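(* The expected total fringe size of a uniformly random simple two-dimensional lattice path of length $n$ satisfies, as $n\to\infty$, \[ \mathbb{E} X_{n}^{L} = \frac{4}{3} n + \frac{1}{3} \log_{4}n + \frac{5 + 3\gamma - 11\log 2}{18 \log 2} + \delta(\log_{4} n) + O\Big(\frac{\log n}{n}\Big), \] where $\delta$ is a $1$-periodic function of mean zero with Fourier series \[ \delta(x) = \frac{2}{3\sqrt{\pi} \log 2} \sum_{k\neq 0} \Gamma\Big(\frac{3 + \chi_{k}}{2}\Big) \bigl(2\zeta(\chi_{k} - 1) + \zeta(\chi_{k} + 1)\bigr) e^{2k\pi i x},\qquad \chi_k=\frac{2\pi i k}{\log 2}. \]
   Context: A simple two-dimensional lattice path of length $n\ge1$ is a word of length $n$ over $\{\uparrow,\rightarrow,\downarrow,\leftarrow\}$; all $4^n$ paths of length $n$ are equally likely. Horizontal steps are $\rightarrow,\leftarrow$, vertical steps $\uparrow,\downarrow$. The reduction $\Phi_L$ on paths of length $\ge2$: (1) if the path starts with a vertical step, rotate the whole path by $90^\circ$ clockwise; (2) if the resulting path ends with a horizontal step, rotate that last step by $90^\circ$ clockwise; the path then decomposes uniquely into segments, each a nonempty run of horizontal steps followed by a nonempty run of vertical steps; (3) replace each segment by $\nearrow$ (starts with $\rightarrow$, first vertical step $\uparrow$), $\searrow$ ($\rightarrow$, $\downarrow$), $\swarrow$ ($\leftarrow$, $\downarrow$), or $\nwarrow$ ($\leftarrow$, $\uparrow$); (4) rotate by $45^\circ$ clockwise: $\nearrow\mapsto\rightarrow$, $\searrow\mapsto\downarrow$,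 $\swarrow\mapsto\leftarrow$, $\nwarrow\mapsto\uparrow$. $\Phi_L$ is undefined on single steps. The $r$th fringe size of a path $\ell$ is the length of $\Phi_L^r(\ell)$ if $\Phi_L$ can be applied $r$ times, and $0$ otherwise; $X^L_n$ is the sum over $r\ge0$ of the $r$th fringe sizes of a random path of length $n$. $\gamma$ is the Euler–Mascheroni constant, $\zeta$ the Riemann zeta function, $\Gamma$ the gamma function. *)

(* Defs.v *)
From Stdlib Require Import Reals List ZArith ClassicalEpsilon.
From Coquelicot Require Import Coquelicot.
Import ListNotations.

Set Implicit Arguments.
Open Scope R_scope.

Inductive step := Up | Rt | Dn | Lt.

Definition path := list step.

Definition horizontal (s : step) : bool :=
  match s with Rt | Lt => true | Up | Dn => false end.

Definition vertical (s : step) : bool := negb (horizontal s).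

(* The 4^n words of length n, each listed exactly once. *)
Fixpoint paths (n : nat) : list path :=
  match n with
  | O => [[]]
  | S m => flat_map (fun s => map (cons s) (paths m)) [Up; Rt; Dn; Lt]
  end.

Definition rot90 (s : step) : step :=
  match s with Up => Rt | Rt => Dn | Dn => Lt | Lt => Up end.

Definition normalize_first (l : path) : path :=
  match l with
  | s :: _ => if vertical s then map rot90 l else l
  | [] => []
  end.

Fixpoint normalize_last (l : path) : path :=
  match l with
  | [] => []
  | [s] => [if horizontal s then rot90 s else s]
  | s :: l' => s :: normalize_last l'
  end.

(* Cuts a path exactly where a vertical step is followed by a horizontal one.
   For a path that starts horizontally and ends vertically, these pieces are
   the segments (nonempty horizontal run, then nonempty vertical run). *)
Fixpoint segments (l : path) : list path :=
  match l with
  | [] => []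
  | s :: l' =>
      match segments l' with
      | (t :: seg) :: segs =>
          if (vertical s && horizontal t)%bool
          then [s] :: (t :: seg) :: segs
          else (s :: t :: seg) :: segs
      | _ => [[s]]
      end
  end.

Inductive diag := NE | SE | SW | NW.

Definition starts_right (seg : path) : bool :=
  match seg with Rt :: _ => true | _ => false end.

Definition first_vertical_up (seg : path) : bool :=
  match find vertical seg with Some Up => true | _ => false end.

Definition segment_diag (seg : path) : diag :=
  match starts_right seg, first_vertical_up seg with
  | true, true => NE
  | true, false => SE
  | false, false => SW
  | false, true => NW
  end.

Definition rot45 (d : diag) : step :=
  match d with NE => Rt | SE => Dn | SW => Lt | NW => Up end.

(* [None] means that the reduction is undefined. *)
Definition Phi_L (l : path) : option path :=
  if Nat.leb 2 (length l)
  then Some (map (fun seg => rot45 (segment_diag seg))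
                 (segments (normalize_last (normalize_first l))))
  else None.

Fixpoint Phi_L_iter (r : nat) (l : path) : option path :=
  match r with
  | O => Some l
  | S r' => match Phi_L l with
            | Some l' => Phi_L_iter r' l'
            | None => None
            end
  end.

Definition fringe_size (r : nat) (l : path) : nat :=
  match Phi_L_iter r l with Some l' => length l' | None => O end.

(* Only finitely many terms are nonzero, since Phi_L shortens paths. *)
Definition total_fringe_size (l : path) : R :=
  Series (fun r => INR (fringe_size r l)).

Definition expected_total_fringe_size (n : nat) : R :=
  fold_right Rplus 0 (map total_fringe_size (paths n)) / 4 ^ n.

Definition euler_gamma : R :=
  real (Lim_seq (fun n => sum_n_m (fun k => / INR k) 1 n - ln (INR n))).

Definition Cexp (z : C) : C :=
  (RtoC (exp (Re z)) * (RtoC (cos (Im z)) + Ci * RtoC (sin (Im z))))%C.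

(* x ^ s for x > 0. *)
Definition cpow (x : R) (s : C) : C := Cexp (s * RtoC (ln x))%C.

(* Euler's integral, which is the gamma function on the half-plane Re s > 0;
   the value is meaningless elsewhere. *)
Definition CGamma (s : C) : C :=
  RInt_gen (V := C_R_CompleteNormedModule)
    (fun t : R => (cpow t (s - 1) * RtoC (exp (- t)))%C)
    (at_right 0) (Rbar_locally p_infty).

Definition analytic_at (f : C -> C) (s : C) : Prop :=
  exists (a : nat -> C) (r : R), 0 < r /\
    forall z : C, Cmod (z - s) < r ->
      is_pseries (K := C_AbsRing) (V := C_NormedModule) a (z - s)%C (f z).

(* [f] continues the Dirichlet series of zeta analytically to the half-plane
   Re s > a, except for the point 1. *)
Definition is_zeta_continuation (a : R) (f : C -> C) : Prop :=
  (forall s : C, a < Re s -> s <> RtoC 1 -> analytic_at f s) /\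
  (forall s : C, 1 < Re s ->
     is_series (K := C_AbsRing) (V := C_NormedModule)
       (fun n => cpow (INR (S n)) (- s)%C) (f s)).

(* The Riemann zeta function by analytic continuation. The set of s <> 1 with
   Re s > a is connected, so by the identity theorem the value does not depend
   on [a] and [f]. At the pole s = 1 the value is meaningless. *)
Definition CZeta (s : C) : C :=
  epsilon (inhabits (RtoC 0))
    (fun v => exists (a : R) (f : C -> C),
       a < Re s /\ is_zeta_continuation a f /\ f s = v).

(* The sum of [f k] over the nonzero integers k; both halves must converge. *)
Definition is_sum_nonzero (f : Z -> C) (l : C) : Prop :=
  exists lp lm : C,
    is_series (K := C_AbsRing) (V := C_NormedModule)
      (fun j => f (Z.of_nat (S j))) lp /\
    is_series (K := C_AbsRing) (V := C_NormedModule)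
      (fun j => f (- Z.of_nat (S j))%Z) lm /\
    l = (lp + lm)%C.

Definition fourier_mode (k : Z) (x : R) : C :=
  Cexp (RtoC (2 * IZR k * PI * x) * Ci)%C.

Definition chi (k : Z) : C := (RtoC (2 * PI * IZR k / ln 2) * Ci)%C.

Definition delta_coeff (k : Z) : C :=
  (RtoC (2 / (3 * sqrt PI * ln 2)) *
   (CGamma ((RtoC 3 + chi k) / RtoC 2) *
    (RtoC 2 * CZeta (chi k - RtoC 1) + CZeta (chi k + RtoC 1))))%C.

(* Main.v *)
Require Import Defs.
From Stdlib Require Import Reals ZArith List Lia Lra ClassicalEpsilon FunctionalExtensionality.
From Coquelicot Require Import Coquelicot.
Import ListNotations.
Open Scope R_scope.

(** The expected r-th fringe size is, with m = 2^r, an expectation for the lazy simple random walk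
    on Z after n steps of a function supported on the multiples of m. Detecting these multiples with
    m-th roots of unity turns it into a sum of polynomial multiples of cos(pi j / m)^(2n), for which
    replacing the cosine power by a Gaussian costs O((1 + 4^r / n) / n). Up to a summable 4^(-r) / 3
    the limit is a function [kern] of log(n / 4^r), a theta-like series with two expansions: [kern
    t] = O(e^(3t/2)) as t -> -oo, and by Poisson summation [kern t] = e^t + 1/3 + [psi t] with [psi
    t] = O(e^(-t)) as t -> +oo. Summing over r >= 0 and completing the sum to all integers r leaves
    the linear and logarithmic terms, a constant and a log 4-periodic function of log n. The Fourier
    coefficients of the latter are values of the Mellin transform of [kern] on the imaginary axis,
    which is Gamma(w + 3/2) (2 zeta(2w - 1) + zeta(2w + 1)) up to a factor: for Re w > 3 by termwise
    integration, then by the identity theorem. The constant comes from the same identity at w = 0,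
    to first order, where the digamma value at 3/2 enters. *)

(** Given its length, the reduction of a uniform path is again uniform, so only lengths matter; the
    generating function of the reduced length is z / ((1 - 2 z)^2 - x z^2) up to elementary factors.
    For x = q + 2 + 1/q, the symbol of the walk, and q = p^2, the denominator splits into 1 - z (p +
    2 + 1/p) and the same factor at - p. Undoing one reduction therefore refines the lattice of the
    walk by a factor 2.

    The Gaussian approximation deteriorates as 4^r / n grows; a Chernoff bound takes over near 4^r =
    32 n log n. The O(log n) levels before that point, with errors of order 1/n, produce the final
    error log n / n.

    Mellin integrals are written in t = log x as two Laplace integrals over half-lines, so that
    every integrand is continuous with exponential decay. Zeta is needed on the line of real part -
    1, which is why Euler-Maclaurin summation is carried to the third Bernoulli polynomial. The
    identity theorem is only used from right to left along horizontal lines, on real and imaginary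
    parts separately, so that no contour integral occurs. *)

(** * Sums over all words of a given length, and the distribution of the reduced word *)

Definition psum (n : nat) (f : path -> R) : R :=
  fold_right Rplus 0 (map f (paths n)).

Lemma fold_right_Rplus_app (l1 l2 : list R) :
  fold_right Rplus 0 (l1 ++ l2) = fold_right Rplus 0 l1 + fold_right Rplus 0 l2.
Proof. induction l1; simpl; lra. Qed.

Lemma psum_0 (f : path -> R) : psum 0 f = f [].
Proof. unfold psum; simpl; lra. Qed.

Lemma psum_S (n : nat) (f : path -> R) :
  psum (S n) f = psum n (fun l => f (Up :: l)) + psum n (fun l => f (Rt :: l))
    + psum n (fun l => f (Dn :: l)) + psum n (fun l => f (Lt :: l)).
Proof.
  unfold psum; simpl.
  rewrite !map_app, !fold_right_Rplus_app, !map_map; simpl.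
  change (list step) with path; ring.
Qed.

Lemma psum_ext (n : nat) (f g : path -> R) :
  (forall l, length l = n -> f l = g l) -> psum n f = psum n g.
Proof.
  revert f g; induction n as [|n IH]; intros f g H.
  - rewrite !psum_0; apply H; reflexivity.
  - rewrite !psum_S.
    rewrite (IH (fun l => f (Up :: l)) (fun l => g (Up :: l))),
      (IH (fun l => f (Rt :: l)) (fun l => g (Rt :: l))),
      (IH (fun l => f (Dn :: l)) (fun l => g (Dn :: l))),
      (IH (fun l => f (Lt :: l)) (fun l => g (Lt :: l)));
      try reflexivity; intros l Hl; apply H; simpl; congruence.
Qed.

Lemma psum_plus (n : nat) (f g : path -> R) :
  psum n (fun l => f l + g l) = psum n f + psum n g.
Proof.
  unfold psum; induction (paths n); simpl; lra.
Qed.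

Lemma psum_const (n : nat) (c : R) : psum n (fun _ => c) = c * 4 ^ n.
Proof.
  induction n as [|n IH]; [rewrite psum_0; simpl; lra|].
  rewrite psum_S, IH; simpl; lra.
Qed.

Lemma psum_rot90 (n : nat) (f : path -> R) :
  psum n (fun l => f (map rot90 l)) = psum n f.
Proof.
  revert f; induction n as [|n IH]; intros f; [rewrite !psum_0; reflexivity|].
  rewrite !psum_S; simpl.
  rewrite (IH (fun l => f (Rt :: l))), (IH (fun l => f (Dn :: l))),
    (IH (fun l => f (Lt :: l))), (IH (fun l => f (Up :: l))); lra.
Qed.

Definition reduced (l : path) : path :=
  map (fun seg => rot45 (segment_diag seg)) (segments l).

Definition head_vertical (l : path) : bool :=
  match l with s :: _ => vertical s | [] => false end.

(** When a word is built by prepending letters, its first segment stays open: a further horizontal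
    letter changes the horizontal direction but not the vertical one. The pair of [first_dir] and
    [reduced_rest] is the state that survives such a letter. *)
Definition first_dir (l : path) : bool :=
  match segments l with seg :: _ => first_vertical_up seg | [] => false end.

Definition reduced_rest (l : path) : path :=
  map (fun seg => rot45 (segment_diag seg)) (tl (segments l)).

Definition quadrant (right up : bool) : step :=
  match right, up with
  | true, true => Rt | true, false => Dn | false, false => Lt | false, true => Up
  end.

Lemma segments_cons (s : step) (l : path) :
  exists seg segs, segments (s :: l) = (s :: seg) :: segs.
Proof.
  simpl; destruct (segments l) as [|[|t seg] segs]; eauto.
  destruct (vertical s && horizontal t)%bool; eauto.
Qed.

Lemma reduced_horizontal (s : step) (l : path) :
  l <> [] -> vertical s = false ->
  reduced (s :: l) =
    quadrant (match s with Rt => true | _ => false end) (first_dir l) :: reduced_rest l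
  /\ first_dir (s :: l) = first_dir l /\ reduced_rest (s :: l) = reduced_rest l.
Proof.
  intros Hl Hs; destruct l as [|t l]; [congruence|].
  destruct (segments_cons t l) as (seg & segs & E).
  unfold reduced, first_dir, reduced_rest.
  change (segments (s :: t :: l)) with
    (match segments (t :: l) with
     | (t :: seg) :: segs =>
          if (vertical s && horizontal t)%bool
          then [s] :: (t :: seg) :: segs
          else (s :: t :: seg) :: segs
      | _ => [[s]] end).
  rewrite E, Hs; simpl.
  unfold segment_diag, first_vertical_up; simpl find; rewrite Hs.
  repeat split.
  destruct s; try discriminate; simpl;
    destruct (if vertical t then Some t else find vertical seg) as [[]|]; reflexivity.
Qed.

Lemma reduced_vertical (s : step) (l : path) :
  l <> [] -> vertical s = true ->
  first_dir (s :: l) = (match s with Up => true | _ => false end) /\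
  reduced_rest (s :: l) = if head_vertical l then reduced_rest l else reduced l.
Proof.
  intros Hl Hs; destruct l as [|t l]; [congruence|].
  destruct (segments_cons t l) as (seg & segs & E).
  unfold reduced, first_dir, reduced_rest.
  change (segments (s :: t :: l)) with
    (match segments (t :: l) with
     | (t :: seg) :: segs =>
          if (vertical s && horizontal t)%bool
          then [s] :: (t :: seg) :: segs
          else (s :: t :: seg) :: segs
      | _ => [[s]] end).
  rewrite E, Hs; change (head_vertical (t :: l)) with (negb (horizontal t)).
  destruct (horizontal t); simpl;
    unfold first_vertical_up; simpl; rewrite Hs; destruct s; try discriminate; auto.
Qed.

(* Sum over all words of length n after the last step has been made vertical,
   so each word ending vertically is counted twice. *)
Definition vsum (n : nat) (g : path -> R) : R := psum n (fun l => g (normalize_last l)).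

Lemma normalize_last_nonempty (l : path) : l <> [] -> normalize_last l <> [].
Proof. destruct l as [|s [|t l]]; simpl; congruence. Qed.

Lemma vsum_SS (n : nat) (g : path -> R) :
  vsum (S (S n)) g = vsum (S n) (fun l => g (Up :: l)) + vsum (S n) (fun l => g (Rt :: l))
    + vsum (S n) (fun l => g (Dn :: l)) + vsum (S n) (fun l => g (Lt :: l)).
Proof. unfold vsum; rewrite !psum_S; simpl; ring. Qed.

Lemma vsum_ext (n : nat) (f g : path -> R) :
  (forall l, l <> [] -> f l = g l) -> vsum (S n) f = vsum (S n) g.
Proof.
  intros H; apply psum_ext; intros l Hl; apply H, normalize_last_nonempty.
  intros ->; discriminate.
Qed.

Lemma vsum_plus (n : nat) (f g : path -> R) :
  vsum n (fun l => f l + g l) = vsum n f + vsum n g.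
Proof. apply (psum_plus n (fun l => f (normalize_last l))). Qed.

Definition sum_tot (n : nat) (F : bool -> path -> R) : R :=
  vsum n (fun l => F (first_dir l) (reduced_rest l)).
Definition sum_ver (n : nat) (F : bool -> path -> R) : R :=
  vsum n (fun l => if head_vertical l then F (first_dir l) (reduced_rest l) else 0).
Definition sum_hor (n : nat) (f : path -> R) : R :=
  vsum n (fun l => if head_vertical l then 0 else f (reduced l)).

(* The weight of [g k] in [conv n g] is the number of ways to spread n steps over
   k + 1 segments, the first horizontal step being already placed; the recursion
   comes from the generating function z / ((1 - 2z)^2 - x z^2). *)
Fixpoint conv (n : nat) (g : nat -> R) : R :=
  match n with
  | O => 0
  | S n' => match n' with
            | O => g O
            | S n'' => 4 * conv n' g - 4 * conv n'' g + conv n'' (fun k => g (S k))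
            end
  end.

Lemma conv_SS (n : nat) (g : nat -> R) :
  conv (S (S n)) g = 4 * conv (S n) g - 4 * conv n g + conv n (fun k => g (S k)).
Proof. reflexivity. Qed.

Lemma conv_lin (n : nat) (a : R) (g h : nat -> R) :
  conv n (fun k => a * g k + h k) = a * conv n g + conv n h /\
  conv (S n) (fun k => a * g k + h k) = a * conv (S n) g + conv (S n) h.
Proof.
  revert g h; induction n as [|n IH]; intros g h; [simpl; split; ring|].
  split; [apply IH|].
  rewrite !conv_SS.
  destruct (IH g h) as [-> ->], (IH (fun k => g (S k)) (fun k => h (S k))) as [-> _].
  ring.
Qed.

Lemma conv_plus (n : nat) (g h : nat -> R) :
  conv n (fun k => g k + h k) = conv n g + conv n h.
Proof.
  rewrite <- (Rmult_1_l (conv n g)).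
  rewrite <- (proj1 (conv_lin n 1 g h)); f_equal.
  apply functional_extensionality; intros; ring.
Qed.

Lemma conv_scal (n : nat) (a : R) (g : nat -> R) :
  conv n (fun k => a * g k) = a * conv n g.
Proof.
  assert (Z : conv n (fun _ => 0) = 0).
  { pose proof (conv_plus n (fun _ => 0) (fun _ => 0)) as H; cbv beta in H.
    replace (fun _ : nat => 0 + 0) with (fun _ : nat => 0) in H; [lra|].
    apply functional_extensionality; intros; ring. }
  rewrite <- (Rplus_0_r (a * _)), <- Z, <- (proj1 (conv_lin n a g _)); f_equal.
  apply functional_extensionality; intros; ring.
Qed.

Definition both (F : bool -> path -> R) (k : nat) : R :=
  psum k (F true) + psum k (F false).

(** Case distinction on the first letter: a vertical letter in front of a horizontal one closes a
    segment, a horizontal letter keeps the state, and both choices of either kind occur. *)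
Lemma sum_SS (n : nat) (F : bool -> path -> R) (f : path -> R) :
  sum_tot (S (S n)) F = sum_ver (S (S n)) F + 2 * sum_tot (S n) F /\
  sum_ver (S (S n)) F = sum_ver (S n) (fun _ => F true) + sum_ver (S n) (fun _ => F false)
     + sum_hor (S n) (F true) + sum_hor (S n) (F false) /\
  sum_hor (S (S n)) f = sum_tot (S n) (fun v r => f (quadrant true v :: r))
     + sum_tot (S n) (fun v r => f (quadrant false v :: r)).
Proof.
  unfold sum_tot, sum_ver, sum_hor; rewrite !vsum_SS.
  assert (V : forall s b, vertical s = true -> (match s with Up => true | _ => false end) = b ->
    vsum (S n) (fun l => F (first_dir (s :: l)) (reduced_rest (s :: l))) =
    vsum (S n) (fun l => if head_vertical l then F b (reduced_rest l) else 0) +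
    vsum (S n) (fun l => if head_vertical l then 0 else F b (reduced l))).
  { intros s b Hs Hb; rewrite <- vsum_plus; apply vsum_ext; intros l Hl.
    destruct (reduced_vertical s l Hl Hs) as [-> ->]; rewrite Hb.
    destruct (head_vertical l); ring. }
  assert (H : forall s, vertical s = false ->
    vsum (S n) (fun l => F (first_dir (s :: l)) (reduced_rest (s :: l))) =
    vsum (S n) (fun l => F (first_dir l) (reduced_rest l))).
  { intros s Hs; apply vsum_ext; intros l Hl.
    destruct (reduced_horizontal s l Hl Hs) as (_ & -> & ->); reflexivity. }
  assert (O : forall s, vertical s = false ->
    vsum (S n) (fun l => f (reduced (s :: l))) =
    vsum (S n) (fun l => f (quadrant (match s with Rt => true | _ => false end)
        (first_dir l) :: reduced_rest l))).
  { intros s Hs; apply vsum_ext; intros l Hl.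
    destruct (reduced_horizontal s l Hl Hs) as (-> & _ & _); reflexivity. }
  assert (Z : vsum (S n) (fun _ => 0) = 0) by (unfold vsum; rewrite psum_const; ring).
  simpl head_vertical; cbn [vertical horizontal negb].
  rewrite (V Up true), (V Dn false), (H Rt), (H Lt), (O Rt), (O Lt), Z by reflexivity.
  repeat split; ring.
Qed.

(** The three sums obey the recursion of [conv], and the rest enters only through unrestricted sums
    [psum k]: all words of a given length are equally frequent as a rest. This uniformity is what
    lets the reduction be iterated. *)
Lemma sum_conv (n : nat) :
  (forall F, sum_tot (S n) F = 2 * conv (S n) (both F)) /\
  (forall F, sum_ver (S n) F = 2 * (conv (S n) (both F) - 2 * conv n (both F))) /\
  (forall f, sum_hor (S n) f = 2 * conv n (fun k => psum (S k) f)).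
Proof.
  induction n as [|n (IT & IV & IH)].
  - unfold sum_tot, sum_ver, sum_hor, vsum, both.
    repeat split; intros F; rewrite psum_S, !psum_0; simpl; rewrite ?psum_0;
    unfold first_dir, reduced_rest; simpl; unfold first_vertical_up; simpl; ring.
  - assert (E : forall F, sum_ver (S (S n)) F =
        2 * (conv (S (S n)) (both F) - 2 * conv (S n) (both F))).
    { intros F; rewrite (proj1 (proj2 (sum_SS n F (fun _ => 0)))), !IV, !IH, conv_SS.
      assert (B : conv n (fun k => both F (S k)) =
         conv n (fun k => psum (S k) (F true)) + conv n (fun k => psum (S k) (F false)))
        by (rewrite <- conv_plus; reflexivity).
      assert (B' : forall m, conv m (both (fun _ => F true)) + conv m (both (fun _ => F false))
         = 2 * conv m (both F)).
      { intros m; rewrite <- conv_plus, <- conv_scal; f_equal.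
        apply functional_extensionality; intros k; unfold both; ring. }
      rewrite B; pose proof (B' n); pose proof (B' (S n)); lra. }
    repeat split.
    + intros F; rewrite (proj1 (sum_SS n F (fun _ => 0))), E, IT; ring.
    + exact E.
    + intros f; rewrite (proj2 (proj2 (sum_SS n (fun _ _ => 0) f))), !IT.
      rewrite <- Rmult_plus_distr_l, <- conv_plus; do 2 f_equal.
      apply functional_extensionality; intros k; unfold both.
      rewrite psum_S; simpl; ring.
Qed.

Lemma psum_reduction (n : nat) (f : path -> R) :
  psum (S (S n)) (fun l => f (reduced (normalize_last (normalize_first l)))) =
  4 * conv (S n) (fun k => psum (S k) f).
Proof.
  (* Rotation maps the words that start vertically onto those that start horizontally, so the latter
     are counted twice. *)
  assert (E : psum (S (S n)) (fun l => f (reduced (normalize_last (normalize_first l)))) =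
     2 * sum_hor (S (S n)) f).
  { rewrite psum_S; cbn [normalize_first vertical horizontal negb map rot90].
    rewrite (psum_rot90 (S n) (fun l => f (reduced (normalize_last (Rt :: l))))).
    rewrite (psum_rot90 (S n) (fun l => f (reduced (normalize_last (Lt :: l))))).
    unfold sum_hor, vsum.
    rewrite (psum_S (S n)).
    assert (V : forall s, vertical s = true -> psum (S n)
       (fun l => if head_vertical (normalize_last (s :: l)) then 0
                 else f (reduced (normalize_last (s :: l)))) = 0).
    { intros s Hs; transitivity (psum (S n) (fun _ => 0)); [|rewrite psum_const; ring].
      apply psum_ext; intros [|t l]; [discriminate|]; intros _; simpl; rewrite Hs; reflexivity. }
    assert (H : forall s, vertical s = false -> psum (S n)
       (fun l => if head_vertical (normalize_last (s :: l)) then 0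
                 else f (reduced (normalize_last (s :: l)))) =
       psum (S n) (fun l => f (reduced (normalize_last (s :: l))))).
    { intros s Hs; apply psum_ext.
      intros [|t l]; [discriminate|]; intros _; simpl; rewrite Hs; reflexivity. }
    rewrite (V Up), (V Dn), (H Rt), (H Lt) by reflexivity; ring. }
  rewrite E, (proj2 (proj2 (sum_conv (S n)))); ring.
Qed.

Definition fringe_sum (r n : nat) : R := psum n (fun l => INR (fringe_size r l)).

Lemma fringe_sum_0 (n : nat) : fringe_sum 0 n = INR n * 4 ^ n.
Proof.
  unfold fringe_sum; rewrite <- psum_const; apply psum_ext; intros l Hl.
  unfold fringe_size; simpl; congruence.
Qed.

Lemma fringe_sum_S (r n : nat) :
  fringe_sum (S r) (S n) = 4 * conv n (fun k => fringe_sum r (S k)).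
Proof.
  destruct n as [|n].
  (* Words of length 1: the reduction is undefined there, which matches the value 0 of [conv] at
     0. *)
  - unfold fringe_sum; rewrite psum_S, !psum_0; simpl; unfold fringe_size; simpl; ring.
  - unfold fringe_sum at 1.
    rewrite (psum_ext _ _ (fun l =>
      INR (fringe_size r (reduced (normalize_last (normalize_first l)))))).
    + apply (psum_reduction n (fun l => INR (fringe_size r l))).
    + intros l Hl; unfold fringe_size; simpl; unfold Phi_L; rewrite Hl; reflexivity.
Qed.

(** * The lazy random walk on Z *)

Fixpoint walk (n : nat) (f : Z -> R) (k : Z) : R :=
  match n with
  | O => f k
  | S n' => (walk n' f (k - 1) + 2 * walk n' f k + walk n' f (k + 1)) / 4
  end.

Definition diff (f : Z -> R) (k : Z) : R := f (k + 1)%Z - f (k - 1)%Z.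

Definition dilate (f : Z -> R) (k : Z) : R := if Z.even k then f (k / 2)%Z else 0.

Lemma walk_ext (n : nat) (f g : Z -> R) (k : Z) :
  (forall k, f k = g k) -> walk n f k = walk n g k.
Proof. intros H; revert k; induction n; intros k; simpl; rewrite ?IHn; auto. Qed.

Lemma walk_lin (n : nat) (a : R) (f g : Z -> R) (k : Z) :
  walk n (fun k => a * f k + g k) k = a * walk n f k + walk n g k.
Proof. revert k; induction n; intros k; simpl; rewrite ?IHn; lra. Qed.

Lemma walk_scal (n : nat) (a : R) (f : Z -> R) (k : Z) :
  walk n (fun k => a * f k) k = a * walk n f k.
Proof. revert k; induction n; intros k; simpl; rewrite ?IHn; lra. Qed.

Lemma walk_le (n : nat) (f g : Z -> R) (k : Z) :
  (forall k, f k <= g k) -> walk n f k <= walk n g k.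
Proof.
  intros H; revert k; induction n; intros k; simpl; auto.
  pose proof (IHn (k - 1)%Z); pose proof (IHn k); pose proof (IHn (k + 1)%Z); lra.
Qed.

Lemma walk_swap (n : nat) (f : Z -> R) (k : Z) :
  walk (S n) f k = (walk n f (k - 1) + 2 * walk n f k + walk n f (k + 1)) / 4.
Proof. reflexivity. Qed.

Lemma walk_diff (n : nat) (f : Z -> R) (k : Z) :
  walk n (diff f) k = diff (walk n f) k.
Proof.
  revert k; induction n; intros k; simpl; [reflexivity|].
  rewrite !IHn; unfold diff; simpl.
  replace (k - 1 + 1)%Z with k by lia; replace (k + 1 - 1)%Z with k by lia.
  replace (k + 1 + 1)%Z with (k + 2)%Z by lia; replace (k - 1 - 1)%Z with (k - 2)%Z by lia.
  lra.
Qed.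

(** With T the sum of the two unit shifts, four times a step is T + 2, and T^2 is 2 plus the two
    shifts by 2. The identity expands (4 W - 2)^2 = T^2 for the step operator W. *)
Lemma walk_SS (n : nat) (f : Z -> R) (k : Z) :
  16 * walk (S (S n)) f k = 16 * walk (S n) f k - 4 * walk n f k
    + (walk n f (k - 2) + 2 * walk n f k + walk n f (k + 2)).
Proof.
  simpl.
  replace (k - 1 + 1)%Z with k by lia; replace (k + 1 - 1)%Z with k by lia.
  replace (k + 1 + 1)%Z with (k + 2)%Z by lia; replace (k - 1 - 1)%Z with (k - 2)%Z by lia.
  lra.
Qed.

(** On even sites the bracket of [walk_SS] is one step of the walk on the coarse lattice, so
    [walk_SS] becomes the recursion [conv_SS]. The difference operator makes the initial values
    agree: for n = 0 both sides vanish, since a dilated function is 0 on odd sites, and for n = 1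
    both are [diff f k]. *)
Lemma walk_dilate (n : nat) (f : Z -> R) (k : Z) :
  conv n (fun i => 4 ^ i * walk i (diff f) k) = 4 ^ n * walk n (diff (dilate f)) (2 * k) /\
  conv (S n) (fun i => 4 ^ i * walk i (diff f) k)
    = 4 ^ S n * walk (S n) (diff (dilate f)) (2 * k).
Proof.
  assert (Ev : forall j, dilate f (2 * j) = f j).
  { intros j; unfold dilate; rewrite Z.even_even, Z.mul_comm, Z.div_mul by lia; reflexivity. }
  assert (Od : forall j, dilate f (2 * j + 1) = 0).
  { intros j; unfold dilate; rewrite Z.even_odd; reflexivity. }
  revert k; induction n as [|n IH]; intros k.
  - cbn [conv walk pow]; unfold diff.
    replace (2 * k - 1 + 1)%Z with (2 * k)%Z by lia.
    replace (2 * k + 1 - 1)%Z with (2 * k)%Z by lia.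
    replace (2 * k - 1 - 1)%Z with (2 * (k - 1))%Z by lia.
    replace (2 * k + 1 + 1)%Z with (2 * (k + 1))%Z by lia.
    replace (2 * k - 1)%Z with (2 * (k - 1) + 1)%Z by lia.
    rewrite !Ev, !Od; split; field.
  - split; [apply IH|].
    rewrite conv_SS.
    destruct (IH k) as [-> ->].
    assert (E : conv n (fun i => 4 ^ S i * walk (S i) (diff f) k) =
      conv n (fun i => 4 ^ i * walk i (diff f) (k - 1)) +
      2 * conv n (fun i => 4 ^ i * walk i (diff f) k) +
      conv n (fun i => 4 ^ i * walk i (diff f) (k + 1))).
    { rewrite <- conv_scal, <- !conv_plus; f_equal.
      apply functional_extensionality; intros i; simpl; field. }
    rewrite E, (proj1 (IH k)), (proj1 (IH (k - 1)%Z)), (proj1 (IH (k + 1)%Z)).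
    replace (2 * (k - 1))%Z with (2 * k - 2)%Z by lia.
    replace (2 * (k + 1))%Z with (2 * k + 2)%Z by lia.
    pose proof (walk_SS n (diff (dilate f)) (2 * k)) as W.
    replace (4 ^ S (S n)) with (4 ^ n * 16) by (simpl; ring).
    rewrite (Rmult_assoc _ 16), W; simpl pow; ring.
Qed.

(** Chosen so that its difference 12 k^2 + 6 has mean 6 (n + 1) after n steps from the origin, six
    times the length of a path with n + 1 steps. *)
Definition cubic (k : Z) : R := 2 * IZR k ^ 3 + IZR k.

Fixpoint weight (r : nat) (k : Z) : R :=
  match r with O => cubic k | S r' => 4 * dilate (weight r') k end.

Lemma walk_const (n : nat) (c : R) (k : Z) : walk n (fun _ => c) k = c.
Proof. revert k; induction n; intros k; simpl; rewrite ?IHn; lra. Qed.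

Lemma walk_sq (n : nat) (k : Z) :
  walk n (fun k => IZR k ^ 2) k = IZR k ^ 2 + INR n / 2.
Proof.
  revert k; induction n; intros k; [simpl; lra|].
  rewrite walk_swap, !IHn, S_INR, minus_IZR, plus_IZR; field.
Qed.

(** Each reduction is one application of [conv], which [walk_dilate] absorbs by dilating the weight;
    the factor 4 of [weight] is the one in [fringe_sum_S]. *)
Lemma fringe_sum_walk (r n : nat) :
  fringe_sum r (S n) = 4 ^ S n / 6 * walk n (diff (weight r)) 0.
Proof.
  revert n; induction r as [|r IH]; intros n.
  - rewrite fringe_sum_0.
    rewrite (walk_ext _ (diff (weight 0)) (fun k => 12 * IZR k ^ 2 + 6)).
    + rewrite walk_lin, walk_sq, walk_const, S_INR; simpl; field.
    + intros k; unfold diff, weight, cubic; rewrite minus_IZR, plus_IZR; ring.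
  - rewrite fringe_sum_S.
    replace (fun k => fringe_sum r (S k)) with
      (fun k => 4 / 6 * (4 ^ k * walk k (diff (weight r)) 0)).
    2:{ apply functional_extensionality; intros k; rewrite IH; simpl; field. }
    rewrite conv_scal, (proj1 (walk_dilate n (weight r) 0)); simpl Z.mul.
    rewrite (walk_ext _ (diff (weight (S r))) (fun k => 4 * diff (dilate (weight r)) k)).
    + rewrite walk_scal; simpl; field.
    + intros k; unfold diff; simpl; ring.
Qed.

Definition multiple (r : nat) (k : Z) : R := if (k mod 2 ^ Z.of_nat r =? 0)%Z then 1 else 0.

Lemma dilate_multiple (r : nat) (f : Z -> R) (k : Z) :
  dilate (fun k => multiple r k * f k) k = multiple (S r) k * f (k / 2)%Z.
Proof.
  assert (P : (0 < 2 ^ Z.of_nat r)%Z) by (apply Z.pow_pos_nonneg; lia).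
  unfold dilate, multiple.
  replace (2 ^ Z.of_nat (S r))%Z with (2 * 2 ^ Z.of_nat r)%Z
    by (rewrite Nat2Z.inj_succ, Z.pow_succ_r; lia).
  destruct (Z.even k) eqn:Ek.
  - apply Z.even_spec in Ek; destruct Ek as [j ->].
    rewrite (Z.mul_comm 2 j), Z.div_mul, (Z.mul_comm j 2), Z.mul_mod_distr_l by lia.
    destruct (Z.eqb_spec (j mod 2 ^ Z.of_nat r) 0) as [->|N]; [reflexivity|].
    destruct (Z.eqb_spec (2 * (j mod 2 ^ Z.of_nat r)) 0); [lia|reflexivity].
  - destruct (Z.eqb_spec (k mod (2 * 2 ^ Z.of_nat r)) 0) as [E|]; [|ring].
    exfalso; apply Z.mod_divide in E; [|lia]; destruct E as [j ->].
    replace (j * (2 * 2 ^ Z.of_nat r))%Z with (2 * (j * 2 ^ Z.of_nat r))%Z in Ek by ring.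
    rewrite Z.even_even in Ek; discriminate.
Qed.

Lemma multiple_S_even (r : nat) (k : Z) : multiple (S r) k <> 0 -> exists j, k = (2 * j)%Z.
Proof.
  unfold multiple; destruct (Z.eqb_spec (k mod 2 ^ Z.of_nat (S r)) 0) as [E|]; [|lra].
  intros _; apply Z.mod_divide in E; [|apply Z.pow_nonzero; lia].
  rewrite Nat2Z.inj_succ, Z.pow_succ_r in E by lia.
  destruct E as [j ->]; exists (j * 2 ^ Z.of_nat r)%Z; ring.
Qed.

Lemma weight_eq (r : nat) (k : Z) :
  weight r k = multiple r k * (2 * IZR k ^ 3 / 2 ^ r + 2 ^ r * IZR k).
Proof.
  revert k; induction r as [|r IH]; intros k.
  - unfold multiple; simpl; rewrite Z.mod_1_r; simpl; unfold cubic; field.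
  - simpl weight.
    replace (dilate (weight r) k) with
      (dilate (fun k => multiple r k * (2 * IZR k ^ 3 / 2 ^ r + 2 ^ r * IZR k)) k)
      by (unfold dilate; rewrite IH; reflexivity).
    rewrite (dilate_multiple r (fun k => 2 * IZR k ^ 3 / 2 ^ r + 2 ^ r * IZR k)).
    destruct (Req_dec (multiple (S r) k) 0) as [->|N]; [ring|].
    destruct (multiple_S_even r k N) as [j ->].
    rewrite (Z.mul_comm 2 j), Z.div_mul, mult_IZR by lia.
    simpl (2 ^ S r); field; apply pow_nonzero; lra.
Qed.

(** The commutator of one step with multiplication by k is a quarter of [diff], which itself
    commutes with the walk; n + 1 steps give n + 1 such commutators. *)
Lemma walk_mul (n : nat) (f : Z -> R) (k : Z) :
  walk (S n) (fun k => IZR k * f k) k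
  = IZR k * walk (S n) f k + INR (S n) / 4 * diff (walk n f) k.
Proof.
  revert k; induction n as [|n IH]; intros k.
  - simpl; unfold diff; simpl; rewrite minus_IZR, plus_IZR; field.
  - rewrite (walk_swap (S n)), !IH, !(walk_swap (S n)).
    unfold diff; rewrite !walk_swap, (S_INR (S n)).
    replace (k - 1 + 1)%Z with k by lia; replace (k + 1 - 1)%Z with k by lia.
    rewrite minus_IZR, plus_IZR; field.
Qed.

(** Two uses of [walk_mul] at the origin produce the square of [diff], which equals 16 (W^2 - W) for
    the step operator W and is thus expressed by the walk again. *)
Lemma walk_mul_sq (n : nat) (f : Z -> R) :
  walk (S n) (fun k => IZR k ^ 2 * f k) 0
  = INR (S n) ^ 2 * walk (S n) f 0
    - INR (S n) * (2 * INR (S n) - 1) / 2 * walk n f 0.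
Proof.
  rewrite (walk_ext _ _ (fun k => IZR k * (IZR k * f k))) by (intros; ring).
  rewrite walk_mul.
  destruct n as [|n].
  - simpl; unfold diff; simpl; field.
  - unfold diff; rewrite !walk_mul; simpl Z.add; simpl Z.sub.
    unfold diff; rewrite !walk_swap, !(S_INR (S n)), !S_INR; simpl.
    field.
Qed.

(** * Expected fringe sizes *)

Definition mean_fringe (r n : nat) : R := fringe_sum r n / 4 ^ n.

(** At the origin [walk_mul] trades the outer difference for a factor k and one more step. The
    function under the walk becomes nonnegative and vanishes at 0, which the tail estimate
    exploits. *)
Lemma mean_fringe_walk (r n : nat) :
  mean_fringe r (S n) = 2 / (3 * INR (S n)) *
    walk (S n) (fun k => multiple r k * (2 * IZR k ^ 4 / 2 ^ r + 2 ^ r * IZR k ^ 2)) 0.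
Proof.
  rewrite (walk_ext _ _ (fun k => IZR k * weight r k)).
  2:{ intros k; rewrite weight_eq; field; apply pow_nonzero; lra. }
  unfold mean_fringe; rewrite fringe_sum_walk, walk_mul, <- walk_diff.
  field; split; [apply not_0_INR; lia | apply pow_nonzero; lra].
Qed.

Definition return_mass (r n : nat) : R := walk n (multiple r) 0.

(* Removing the factors k^2 by [walk_mul_sq] leaves return probabilities of shorter walks. *)
Lemma mean_fringe_return (r n : nat) :
  let N := INR (S (S n)) in
  let B := return_mass r in
  mean_fringe r (S (S n)) = 2 / (3 * N) *
   (2 / 2 ^ r * (N ^ 4 * B (S (S n))
       - N * (2 * N - 1) / 2 * (N ^ 2 + (N - 1) ^ 2) * B (S n)
       + N * (N - 1) * (2 * N - 1) * (2 * N - 3) / 4 * B n)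
    + 2 ^ r * (N ^ 2 * B (S (S n)) - N * (2 * N - 1) / 2 * B (S n))).
Proof.
  intros N B; rewrite mean_fringe_walk; fold N.
  assert (P : 2 ^ r <> 0) by (apply pow_nonzero; lra).
  rewrite (walk_ext _ _ (fun k => 2 / 2 ^ r * (IZR k ^ 2 * (IZR k ^ 2 * multiple r k)) +
     2 ^ r * (IZR k ^ 2 * multiple r k))) by (intros; field; exact P).
  rewrite walk_lin, walk_scal, !walk_mul_sq.
  unfold B, return_mass, N; rewrite !S_INR; field.
  split; [exact P|]; pose proof (pos_INR n); lra.
Qed.

(** * Detection of multiples by roots of unity *)

Fixpoint rsum (n : nat) (f : nat -> R) : R :=
  match n with O => 0 | S n' => rsum n' f + f n' end.

Lemma rsum_ext (n : nat) (f g : nat -> R) :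
  (forall i, (i < n)%nat -> f i = g i) -> rsum n f = rsum n g.
Proof. induction n; simpl; intros H; [reflexivity|]; rewrite IHn, H; auto with arith. Qed.

Lemma rsum_scal (n : nat) (a : R) (f : nat -> R) :
  rsum n (fun i => a * f i) = a * rsum n f.
Proof. induction n; simpl; rewrite ?IHn; ring. Qed.

Lemma rsum_plus (n : nat) (f g : nat -> R) :
  rsum n (fun i => f i + g i) = rsum n f + rsum n g.
Proof. induction n; simpl; rewrite ?IHn; ring. Qed.

Lemma rsum_const (n : nat) (c : R) : rsum n (fun _ => c) = INR n * c.
Proof. induction n; [simpl; ring|]; rewrite S_INR; simpl; rewrite IHn; ring. Qed.

Lemma rsum_app (n m : nat) (f : nat -> R) :
  rsum (n + m) f = rsum n f + rsum m (fun i => f (n + i)%nat).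
Proof.
  induction m; simpl; [rewrite Nat.add_0_r; ring|].
  rewrite Nat.add_succ_r; simpl; rewrite IHm; ring.
Qed.

Lemma rsum_S_l (n : nat) (f : nat -> R) : rsum (S n) f = f O + rsum n (fun i => f (S i)).
Proof. rewrite (rsum_app 1 n); simpl; ring. Qed.

Lemma rsum_rev (n : nat) (f : nat -> R) : rsum n (fun i => f (n - i)%nat) = rsum n (fun i => f (S i)).
Proof.
  induction n; [reflexivity|].
  rewrite rsum_S_l.
  rewrite (rsum_ext n _ (fun i => f (n - i)%nat)) by reflexivity.
  rewrite IHn; simpl; ring.
Qed.

Lemma rsum_walk (m n : nat) (f : nat -> Z -> R) (k : Z) :
  walk n (fun k => rsum m (fun j => f j k)) k = rsum m (fun j => walk n (f j) k).
Proof.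
  induction m; simpl; [apply walk_const|].
  rewrite (walk_ext _ _ (fun k => 1 * rsum m (fun j => f j k) + f m k)) by (intros; ring).
  rewrite walk_lin, IHm; ring.
Qed.

Lemma cos_sum (n : nat) (a : R) :
  2 * sin (a / 2) * rsum n (fun j => cos (INR j * a)) = sin ((INR n - / 2) * a) + sin (a / 2).
Proof.
  induction n.
  - simpl; replace ((0 - / 2) * a) with (- (a / 2)) by field; rewrite sin_neg; ring.
  - simpl rsum; rewrite Rmult_plus_distr_l, IHn, S_INR.
    replace ((INR n + 1 - / 2) * a) with (INR n * a + a / 2) by field.
    replace ((INR n - / 2) * a) with (INR n * a - a / 2) by field.
    rewrite sin_plus, sin_minus; ring.
Qed.

Lemma cos_2PI_IZR (k : Z) : cos (2 * PI * IZR k) = 1.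
Proof.
  replace (2 * PI * IZR k) with (2 * (IZR k * PI)) by ring.
  rewrite cos_2a_sin, (sin_eq_0_1 (IZR k * PI)) by eauto; ring.
Qed.

Lemma sin_2PI_IZR (k : Z) : sin (2 * PI * IZR k) = 0.
Proof. apply sin_eq_0_1; exists (2 * k)%Z; rewrite mult_IZR; ring. Qed.

Lemma pow2_IZR (r : nat) : IZR (2 ^ Z.of_nat r) = 2 ^ r.
Proof. rewrite <- pow_IZR; reflexivity. Qed.

Lemma INR_pow2 (r : nat) : INR (2 ^ r) = 2 ^ r.
Proof. rewrite pow_INR; reflexivity. Qed.

Lemma multiple_filter (r : nat) (k : Z) :
  multiple r k = / 2 ^ r * rsum (2 ^ r) (fun j => cos (2 * (PI * INR j / 2 ^ r) * IZR k)).
Proof.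
  assert (P : 2 ^ r <> 0) by (apply pow_nonzero; lra).
  assert (PZ : (2 ^ Z.of_nat r <> 0)%Z) by (apply Z.pow_nonzero; lia).
  unfold multiple; destruct (Z.eqb_spec (k mod 2 ^ Z.of_nat r) 0) as [E|N].
  - apply Z.mod_divide in E; [|exact PZ]; destruct E as [q ->].
    rewrite (rsum_ext _ _ (fun _ => 1)), rsum_const, INR_pow2; [field; exact P|].
    intros j _; rewrite mult_IZR, pow2_IZR, <- (cos_2PI_IZR (Z.of_nat j * q)).
    f_equal; rewrite mult_IZR, <- INR_IZR_INZ; field; exact P.
  - set (a := 2 * PI * IZR k / 2 ^ r).
    assert (S0 : sin (a / 2) <> 0).
    { intros H; apply sin_eq_0_0 in H; destruct H as [q Hq]; apply N.
      replace k with (q * 2 ^ Z.of_nat r)%Z; [apply Z.mod_mul; exact PZ|].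
      apply eq_IZR; rewrite mult_IZR, pow2_IZR.
      apply (Rmult_eq_reg_r (PI / 2 ^ r)).
      - transitivity (IZR q * PI); [field; exact P|]; rewrite <- Hq; unfold a; field; exact P.
      - pose proof PI_RGT_0; apply Rmult_integral_contrapositive; split;
          [lra|apply Rinv_neq_0_compat, P]. }
    pose proof (cos_sum (2 ^ r) a) as C.
    (* Since 2^r a is a multiple of 2 PI, the two sines of [cos_sum] cancel. *)
    replace ((INR (2 ^ r) - / 2) * a) with (2 * PI * IZR k - a / 2) in C.
    2:{ rewrite INR_pow2; unfold a; field; exact P. }
    rewrite sin_minus, cos_2PI_IZR, sin_2PI_IZR in C.
    rewrite (rsum_ext _ _ (fun j => cos (INR j * a))).
    2:{ intros j _; f_equal; unfold a; field; exact P. }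
    assert (rsum (2 ^ r) (fun j => cos (INR j * a)) = 0) as ->; [|ring].
    apply (Rmult_eq_reg_l (2 * sin (a / 2))); lra.
Qed.

Lemma walk_cos (n : nat) (t : R) (k : Z) :
  walk n (fun k => cos (2 * t * IZR k)) k = (cos t ^ 2) ^ n * cos (2 * t * IZR k).
Proof.
  revert k; induction n; intros k; [simpl; ring|].
  rewrite walk_swap, !IHn, minus_IZR, plus_IZR.
  replace (2 * t * (IZR k - 1)) with (2 * t * IZR k - 2 * t) by ring.
  replace (2 * t * (IZR k + 1)) with (2 * t * IZR k + 2 * t) by ring.
  rewrite cos_minus, cos_plus, (cos_2a_cos t); simpl; field.
Qed.

Lemma return_mass_cos (r n : nat) :
  return_mass r n = / 2 ^ r * rsum (2 ^ r) (fun j => (cos (PI * INR j / 2 ^ r) ^ 2) ^ n).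
Proof.
  unfold return_mass.
  rewrite (walk_ext _ _ (fun k => / 2 ^ r * rsum (2 ^ r)
     (fun j => cos (2 * (PI * INR j / 2 ^ r) * IZR k)))) by (intros; apply multiple_filter).
  rewrite walk_scal, (rsum_walk _ _ (fun j k => cos (2 * (PI * INR j / 2 ^ r) * IZR k))).
  f_equal; apply rsum_ext; intros j _.
  rewrite walk_cos, Rmult_0_r, cos_0; ring.
Qed.

(** [V2] and [V4] are the walk after n steps applied to k^2 cos (2 t k) and k^4 cos (2 t k), at the
    origin. Equivalently, they are - 1/4 of the second and 1/16 of the fourth derivative of cos t ^
    (2 n). *)
Definition V2 (n : nat) (t : R) : R :=
  (cos t ^ 2) ^ (n - 1) * (INR n / 2 - INR n ^ 2 * sin t ^ 2).
Definition V4 (n : nat) (t : R) : R :=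
  (cos t ^ 2) ^ (n - 2) * (3 / 4 * INR n ^ 2 - INR n / 4
    - (3 * INR n ^ 3 - 2 * INR n ^ 2 + INR n / 2) * sin t ^ 2 + INR n ^ 4 * (sin t ^ 2) ^ 2).
Definition spectral (r n : nat) (j : nat) : R :=
  let t := PI * INR j / 2 ^ r in 2 / 2 ^ r * V4 n t + 2 ^ r * V2 n t.

Lemma mean_fringe_spectral (r n : nat) : (2 <= n)%nat ->
  mean_fringe r n = 2 / (3 * INR n * 2 ^ r) * rsum (2 ^ r) (spectral r n).
Proof.
  intros Hn; destruct n as [|[|n]]; try lia.
  assert (P : 2 ^ r <> 0) by (apply pow_nonzero; lra).
  rewrite mean_fringe_return, !return_mass_cos.
  set (N := INR (S (S n))).
  assert (HN : N <> 0) by (apply not_0_INR; lia).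
  set (c := fun i => rsum (2 ^ r) (fun j => (cos (PI * INR j / 2 ^ r) ^ 2) ^ i)).
  transitivity (2 / (3 * N * 2 ^ r) *
     (2 / 2 ^ r * N ^ 4 * c (S (S n)) + 2 ^ r * N ^ 2 * c (S (S n))
      + (- (2 / 2 ^ r * (N * (2 * N - 1) / 2) * (N ^ 2 + (N - 1) ^ 2))
         - 2 ^ r * N * (2 * N - 1) / 2) * c (S n)
      + 2 / 2 ^ r * (N * (N - 1) * (2 * N - 1) * (2 * N - 3) / 4) * c n)).
  { unfold c; field; split; assumption. }
  unfold c; rewrite <- !rsum_scal, <- !rsum_plus, <- rsum_scal.
  apply rsum_ext; intros j _; unfold spectral, V4, V2; fold N.
  replace (S (S n) - 1)%nat with (S n) by lia; replace (S (S n) - 2)%nat with n by lia.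
  set (t := PI * INR j / 2 ^ r).
  replace (cos t ^ 2) with (1 - sin t ^ 2) by (pose proof (sin2_cos2 t); unfold Rsqr in *; simpl; lra).
  set (s := sin t ^ 2); simpl pow; field; split; assumption.
Qed.

Lemma spectral_sym (r n j : nat) : (j <= 2 ^ r)%nat -> spectral r n (2 ^ r - j) = spectral r n j.
Proof.
  intros Hj; unfold spectral.
  assert (P : 2 ^ r <> 0) by (apply pow_nonzero; lra).
  rewrite minus_INR, INR_pow2 by exact Hj.
  replace (PI * (2 ^ r - INR j) / 2 ^ r) with (PI - PI * INR j / 2 ^ r)
    by (field; exact P).
  unfold V2, V4; rewrite cos_minus, sin_minus, cos_PI, sin_PI.
  set (t := PI * INR j / 2 ^ r).
  replace ((-1 * cos t + 0 * sin t) ^ 2) with (cos t ^ 2) by ring.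
  replace ((0 * cos t - -1 * sin t) ^ 2) with (sin t ^ 2) by ring.
  reflexivity.
Qed.

(** The number of frequencies j with 0 < j <= 2^r / 2. *)
Definition half_pow (r : nat) : nat := match r with O => O | S r' => 2 ^ r' end.

(** Frequency 0 gives the elementary terms, and the symmetry j -> 2^r - j folds the other
    frequencies onto the first half. *)
Lemma mean_fringe_half (r n : nat) : (3 <= n)%nat ->
  mean_fringe r n = INR n / 4 ^ r + 1 / 3 - 1 / (3 * 4 ^ r) +
    4 / (3 * INR n * 2 ^ r) * rsum (half_pow r) (fun j => spectral r n (S j)).
Proof.
  intros Hn; rewrite mean_fringe_spectral by lia.
  assert (HN : INR n <> 0) by (apply not_0_INR; lia).
  assert (P : 2 ^ r <> 0) by (apply pow_nonzero; lra).
  assert (P4 : 4 ^ r = 2 ^ r * 2 ^ r) by (rewrite <- Rpow_mult_distr; f_equal; lra).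
  assert (Z0 : spectral r n 0 = 2 / 2 ^ r * (3 / 4 * INR n ^ 2 - INR n / 4) + 2 ^ r * (INR n / 2)).
  { unfold spectral, V4, V2; simpl (INR 0).
    replace (PI * 0 / 2 ^ r) with 0 by (field; exact P).
    rewrite cos_0, sin_0, !pow1; ring. }
  assert (E : rsum (2 ^ r) (spectral r n) =
     spectral r n 0 + 2 * rsum (half_pow r) (fun j => spectral r n (S j))).
  { destruct r as [|r]; [simpl; ring|].
    assert (Pr : 2 ^ r <> 0) by (apply pow_nonzero; lra).
    simpl half_pow.
    assert (Em : (2 ^ S r = 2 ^ r + 2 ^ r)%nat) by (simpl; lia).
    (* The folding counts the middle frequency twice, which is harmless: there the cosine is cos (PI
       / 2) = 0, and n >= 3 keeps both exponents positive. *)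
    assert (Hm : spectral (S r) n (2 ^ r) = 0).
    { unfold spectral, V4, V2; rewrite INR_pow2.
      replace (PI * 2 ^ r / 2 ^ S r) with (PI / 2) by (simpl; field; exact Pr).
      rewrite cos_PI2, !(pow_ne_zero 2), !(pow_ne_zero (n - _)) by lia; ring. }
    rewrite Em at 1; rewrite rsum_app.
    rewrite (rsum_ext (2 ^ r) (fun i => spectral (S r) n (2 ^ r + i))
       (fun i => spectral (S r) n (2 ^ r - i)%nat)).
    2:{ intros i Hi; rewrite <- (spectral_sym (S r) n (2 ^ r - i)) by lia; f_equal; lia. }
    rewrite rsum_rev.
    pose proof (rsum_S_l (2 ^ r) (spectral (S r) n)) as Q; simpl rsum in Q; lra. }
  rewrite E, Z0, P4; field; split; assumption.
Qed.

(** * Gaussian approximation of cosine powers *)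

Lemma increasing_from (f df : R -> R) (a b : R) :
  a <= b -> (forall t, a <= t <= b -> is_derive f t (df t)) ->
  (forall t, a <= t <= b -> 0 <= df t) -> f a <= f b.
Proof.
  intros Hab D P.
  destruct (MVT_gen f a b df) as (c & Hc & E).
  - intros x Hx; apply D; rewrite Rmin_left, Rmax_right in Hx; lra.
  - intros x Hx; apply continuity_pt_filterlim, @ex_derive_continuous.
    exists (df x); apply D; rewrite Rmin_left, Rmax_right in Hx; lra.
  - rewrite Rmin_left, Rmax_right in Hc by lra.
    pose proof (P c Hc); nra.
Qed.

Lemma exp_INR (n : nat) (x : R) : exp (INR n * x) = exp x ^ n.
Proof.
  induction n; [simpl; rewrite Rmult_0_l; apply exp_0|].
  rewrite S_INR; simpl; rewrite <- IHn, <- exp_plus; f_equal; ring.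
Qed.

Lemma exp_ge_1p (x : R) : 1 + x <= exp x.
Proof.
  destruct (Req_dec x 0) as [->|H]; [rewrite exp_0; lra|].
  left; apply exp_ineq1, H.
Qed.

Lemma exp_le (x y : R) : x <= y -> exp x <= exp y.
Proof. intros [H| ->]; [left; apply exp_increasing, H|right; reflexivity]. Qed.

(** The inequality v / k <= exp (v / k), raised to the power k. *)
Lemma pow_exp_le (k : nat) (v : R) : 0 <= v -> v ^ k * exp (- v) <= INR k ^ k.
Proof.
  intros Hv; destruct k as [|k].
  - simpl; rewrite Rmult_1_l, <- exp_0; apply exp_le; lra.
  - set (K := INR (S k)).
    assert (HK : 0 < K) by (apply lt_0_INR; lia).
    assert (E : v ^ S k <= K ^ S k * exp v).
    { replace (exp v) with (exp (v / K) ^ S k)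
        by (rewrite <- exp_INR; fold K; f_equal; field; lra).
      rewrite <- Rpow_mult_distr; apply pow_incr; split; [exact Hv|].
      pose proof (exp_ge_1p (v / K)).
      apply Rle_trans with (K * (v / K)); [right; field; lra|].
      apply Rmult_le_compat_l; lra. }
    apply Rle_trans with (K ^ S k * exp v * exp (- v)).
    + apply Rmult_le_compat_r; [left; apply exp_pos | exact E].
    + rewrite Rmult_assoc, <- exp_plus, Rplus_opp_r, exp_0; lra.
Qed.

Lemma pow_exp_half (k : nat) (u : R) :
  0 <= u -> u ^ k * exp (- (u / 2)) <= (2 * INR k) ^ k.
Proof.
  intros Hu; pose proof (pow_exp_le k (u / 2) ltac:(lra)) as H.
  replace (u ^ k) with (2 ^ k * (u / 2) ^ k) by (rewrite <- Rpow_mult_distr; f_equal; field).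
  rewrite Rpow_mult_distr, Rmult_assoc; apply Rmult_le_compat_l; [apply pow_le; lra|exact H].
Qed.

Lemma exp_neg_le_quadratic (s : R) : 0 <= s -> exp (- s) <= 1 - s + s ^ 2 / 2.
Proof.
  intros Hs.
  pose proof (increasing_from (fun s => 1 - s + s ^ 2 / 2 - exp (- s))
    (fun s => - 1 + s + exp (- s)) 0 s Hs) as H; cbv beta in H.
  rewrite Ropp_0, exp_0 in H.
  assert (0 <= 1 - s + s ^ 2 / 2 - exp (- s)); [|lra].
  apply Rle_trans with (1 - 0 + 0 ^ 2 / 2 - 1); [lra|]; apply H.
  - intros t _; auto_derive; [exact I|field].
  - intros t _; pose proof (exp_ge_1p (- t)); lra.
Qed.

(** The product cos y exp (y^2 / 2) decreases from the value 1, because y cos y <= sin y on this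
    interval. *)
Lemma cos_sq_le_exp (t : R) : 0 <= t <= PI / 2 -> cos t ^ 2 <= exp (- t ^ 2).
Proof.
  intros Ht.
  assert (A : forall y, 0 <= y <= PI / 2 -> y * cos y <= sin y).
  { intros y Hy.
    pose proof (increasing_from (fun y => sin y - y * cos y) (fun y => y * sin y) 0 y) as H.
    cbv beta in H; rewrite sin_0 in H.
    assert (0 - 0 * cos 0 <= sin y - y * cos y); [|lra].
    apply H; [lra| |].
    - intros z _; auto_derive; [exact I|ring].
    - intros z Hz; apply Rmult_le_pos; [lra|]; apply sin_ge_0; pose proof PI_RGT_0; lra. }
  pose proof (increasing_from (fun y => - (cos y * exp (y ^ 2 / 2)))
     (fun y => (sin y - y * cos y) * exp (y ^ 2 / 2)) 0 t) as H; cbv beta in H.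
  assert (B : cos t * exp (t ^ 2 / 2) <= 1).
  { rewrite cos_0 in H; replace (0 ^ 2 / 2) with 0 in H by field; rewrite exp_0 in H.
    apply Ropp_le_cancel; replace (- (1)) with (- (1 * 1)) by ring; apply H; [lra| |].
    - intros z _; auto_derive; [exact I|].
      replace (z * (z * 1) * / 2) with (z ^ 2 / 2) by field; field.
    - intros z Hz; apply Rmult_le_pos; [|left; apply exp_pos].
      pose proof (A z ltac:(lra)); lra. }
  pose proof (cos_ge_0 t ltac:(lra) ltac:(lra)) as C0.
  pose proof (exp_pos (t ^ 2 / 2)) as P.
  assert (C1 : cos t <= exp (- (t ^ 2 / 2))).
  { apply (Rmult_le_reg_r (exp (t ^ 2 / 2))); [exact P|].
    rewrite <- exp_plus, Rplus_opp_l, exp_0; exact B. }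
  replace (exp (- t ^ 2)) with (exp (- (t ^ 2 / 2)) ^ 2)
    by (rewrite <- exp_INR; f_equal; simpl; field).
  apply pow_incr; lra.
Qed.

Lemma pow_diff_le (a b : R) (k : nat) :
  0 <= b <= a -> 0 <= a ^ S k - b ^ S k <= INR (S k) * a ^ k * (a - b).
Proof.
  intros H; split.
  - pose proof (pow_incr b a (S k) H); lra.
  - induction k as [|k IH]; [simpl; lra|].
    replace (a ^ S (S k) - b ^ S (S k)) with
      (a * (a ^ S k - b ^ S k) + b ^ S k * (a - b)) by (simpl; ring).
    pose proof (pow_incr b a (S k) H) as P.
    apply Rle_trans with (a * (INR (S k) * a ^ k * (a - b)) + a ^ S k * (a - b)).
    + apply Rplus_le_compat; [apply Rmult_le_compat_l|apply Rmult_le_compat_r]; lra.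
    + rewrite (S_INR (S k)); right; simpl; ring.
Qed.

(** Two errors are separated by the intermediate value exp (- s) ^ k with s = t^2: each factor cos^2
    t differs from exp (- s) by at most s^2 / 2, and the exponent k differs from n by at most 2.
    Only half of the exponent is spent on smallness; exp (- (u / 2)) remains to absorb polynomial
    factors. *)
Lemma cos_pow_exp (n k : nat) (t : R) :
  (6 <= n)%nat -> (n <= k + 2)%nat -> (k < n)%nat -> 0 < t <= PI / 2 ->
  let u := INR n * t ^ 2 in
  0 <= (cos t ^ 2) ^ k <= exp (- (u / 2)) /\
  Rabs ((cos t ^ 2) ^ k - exp (- u)) <= exp (- (u / 2)) * (u ^ 2 / 2 + 2 * u) / INR n.
Proof.
  intros Hn Hk Hk' Ht u.
  set (s := t ^ 2) in *; set (C := cos t ^ 2); set (q := exp (- (u / 2))).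
  assert (Hs : 0 < s) by (apply pow_lt; lra).
  assert (HN : 6 <= INR n) by (apply le_INR in Hn; simpl in Hn; lra).
  assert (HkN : INR n - 2 <= INR k < INR n).
  { split; [|apply lt_INR, Hk'].
    apply le_INR in Hk; rewrite plus_INR in Hk; simpl in Hk; lra. }
  assert (Cs : 0 <= C <= exp (- s)) by (split; [apply pow2_ge_0|apply cos_sq_le_exp; lra]).
  assert (C1 : 1 - s <= C).
  { unfold C, s; pose proof (sin2_cos2 t) as Q; unfold Rsqr in Q.
    pose proof (sin_lt_x t ltac:(lra)); pose proof PI2_1.
    pose proof (sin_ge_0 t ltac:(lra) ltac:(lra)).
    assert (sin t ^ 2 <= t ^ 2) by (apply pow_incr; lra); simpl in *; lra. }
  pose proof (exp_neg_le_quadratic s ltac:(lra)) as E2.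
  destruct k as [|k']; [lia|].
  destruct (pow_diff_le (exp (- s)) C k' Cs) as [D0 D1].
  assert (Q : forall j, INR n / 2 <= INR j -> exp (- s) ^ j <= q).
  { intros j Hj; rewrite <- exp_INR; apply exp_le; unfold u; nra. }
  (* Here k' >= n - 3, and n >= 6 makes this at least n / 2. *)
  assert (Q1 : exp (- s) ^ k' <= q) by (apply Q; rewrite S_INR in HkN; lra).
  assert (Q2 : exp (- s) ^ S k' <= q) by (apply Q; lra).
  assert (qp : 0 < q) by apply exp_pos.
  split; [split; [apply pow_le; lra|]; lra|].
  assert (A1 : exp (- s) ^ S k' - C ^ S k' <= q * (u ^ 2 / 2) / INR n).
  { eapply Rle_trans; [exact D1|].
    replace (q * (u ^ 2 / 2) / INR n) with (INR n * q * (s ^ 2 / 2))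
      by (unfold u; field; lra).
    apply Rmult_le_compat; [|lra| |lra].
    - apply Rmult_le_pos; [apply pos_INR|apply pow_le; left; apply exp_pos].
    - apply Rmult_le_compat; [apply pos_INR|apply pow_le; left; apply exp_pos|lra|exact Q1]. }
  assert (A2 : 0 <= exp (- s) ^ S k' - exp (- u) <= q * (2 * u) / INR n).
  { replace (exp (- u)) with (exp (- s) ^ S k' * exp (- ((INR n - INR (S k')) * s)))
      by (rewrite <- exp_INR, <- exp_plus; f_equal; unfold u; ring).
    set (d := (INR n - INR (S k')) * s).
    assert (Hd : 0 <= d <= 2 * s) by (unfold d; split; nra).
    pose proof (exp_ge_1p (- d)).
    assert (exp (- d) <= 1) by (rewrite <- exp_0; apply exp_le; lra).
    pose proof (pow_le (exp (- s)) (S k') (Rlt_le _ _ (exp_pos _))) as P.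
    replace (q * (2 * u) / INR n) with (q * (2 * s)) by (unfold u; field; lra).
    replace (exp (- s) ^ S k' - exp (- s) ^ S k' * exp (- d)) with
      (exp (- s) ^ S k' * (1 - exp (- d))) by ring.
    split; [apply Rmult_le_pos; lra|apply Rmult_le_compat; lra]. }
  replace (q * (u ^ 2 / 2 + 2 * u) / INR n) with
    (q * (u ^ 2 / 2) / INR n + q * (2 * u) / INR n) by (field; lra).
  apply Rabs_le; split; lra.
Qed.

Lemma Rabs_mult_le (a b A B : R) : Rabs a <= A -> Rabs b <= B -> Rabs (a * b) <= A * B.
Proof.
  intros H1 H2; rewrite Rabs_mult.
  apply Rmult_le_compat; auto using Rabs_pos.
Qed.

(** Besides the cosine power, sin^2 t is replaced by t^2, through y = n sin^2 t. The factor exp (-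
    (u / 2)) absorbs polynomials up to degree 5, where [pow_exp_half] costs 10^5; this sets the size
    of the constant. The division by u makes the errors summable over the frequencies. *)
Lemma V2_V4_gauss (n : nat) (t : R) :
  (6 <= n)%nat -> 0 < t <= PI / 2 ->
  let u := INR n * t ^ 2 in
  Rabs (V2 n t - INR n * (/ 2 - u) * exp (- u)) <= 1000000 / u /\
  Rabs (V4 n t - INR n ^ 2 * (3 / 4 - 3 * u + u ^ 2) * exp (- u)) <= 1000000 * INR n / u.
Proof.
  intros Hn Ht u.
  destruct (cos_pow_exp n (n - 1) t Hn ltac:(lia) ltac:(lia) Ht) as [P1 D1].
  destruct (cos_pow_exp n (n - 2) t Hn ltac:(lia) ltac:(lia) Ht) as [P2 D2].
  fold u in P1, D1, P2, D2.
  unfold V2, V4.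
  set (p1 := (cos t ^ 2) ^ (n - 1)) in *; set (p2 := (cos t ^ 2) ^ (n - 2)) in *.
  set (q := exp (- (u / 2))) in *; set (E := exp (- u)) in *.
  set (N := INR n) in *.
  assert (HN : 6 <= N) by (unfold N; apply le_INR in Hn; simpl in Hn; lra).
  assert (Hs : 0 < t ^ 2) by (apply pow_lt; lra).
  assert (Hu : 0 < u) by (unfold u; nra).
  set (y := N * sin t ^ 2).
  assert (Hy : 0 <= y <= u /\ u - y <= u ^ 2 / (2 * N)).
  { pose proof (sin2_cos2 t) as Q; unfold Rsqr in Q.
    pose proof (sin_lt_x t ltac:(lra)); pose proof PI2_1.
    pose proof (sin_ge_0 t ltac:(lra) ltac:(lra)).
    assert (S1 : sin t ^ 2 <= t ^ 2) by (apply pow_incr; lra).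
    pose proof (cos_sq_le_exp t ltac:(lra)).
    pose proof (exp_neg_le_quadratic (t ^ 2) ltac:(lra)).
    assert (S2 : t ^ 2 - (t ^ 2) ^ 2 / 2 <= sin t ^ 2) by (simpl in *; lra).
    unfold y, u; repeat split.
    - apply Rmult_le_pos; [lra|apply pow2_ge_0].
    - apply Rmult_le_compat_l; lra.
    - replace ((N * t ^ 2) ^ 2 / (2 * N)) with (N * ((t ^ 2) ^ 2 / 2)) by (field; lra).
      rewrite <- Rmult_minus_distr_l; apply Rmult_le_compat_l; lra. }
  destruct Hy as [[Hy0 Hy1] Hy2].
  assert (q0 : 0 < q) by apply exp_pos.
  pose proof (pow_exp_half 1 u ltac:(lra)) as B1; pose proof (pow_exp_half 2 u ltac:(lra)) as B2.
  pose proof (pow_exp_half 3 u ltac:(lra)) as B3; pose proof (pow_exp_half 4 u ltac:(lra)) as B4.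
  pose proof (pow_exp_half 5 u ltac:(lra)) as B5.
  fold q in B1, B2, B3, B4, B5; simpl INR in B1, B2, B3, B4, B5.
  ring_simplify in B1; ring_simplify in B2; ring_simplify in B3;
    ring_simplify in B4; ring_simplify in B5.
  split.
  - replace (p1 * (N / 2 - N ^ 2 * sin t ^ 2) - N * (/ 2 - u) * E) with
      (N * ((p1 - E) * (/ 2 - u)) + N * (p1 * (u - y))) by (unfold y; field).
    assert (X1 : Rabs (N * ((p1 - E) * (/ 2 - u))) <= q * (u ^ 2 / 2 + 2 * u) * (/ 2 + u)).
    { rewrite Rabs_mult, (Rabs_pos_eq N) by lra.
      apply Rle_trans with (N * ((q * (u ^ 2 / 2 + 2 * u) / N) * (/ 2 + u)));
        [|right; field; lra].
      apply Rmult_le_compat_l; [lra|]; apply Rabs_mult_le; [exact D1|apply Rabs_le; lra]. }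
    assert (X2 : Rabs (N * (p1 * (u - y))) <= q * (u ^ 2 / 2)).
    { rewrite Rabs_mult, (Rabs_pos_eq N) by lra.
      apply Rle_trans with (N * (q * (u ^ 2 / (2 * N)))); [|right; field; lra].
      apply Rmult_le_compat_l; [lra|]; apply Rabs_mult_le; apply Rabs_le; lra. }
    eapply Rle_trans; [apply Rabs_triang|].
    eapply Rle_trans; [apply Rplus_le_compat; [exact X1|exact X2]|].
    apply (Rmult_le_reg_r u); [exact Hu|].
    replace (1000000 / u * u) with 1000000 by (field; lra).
    nra.
  - replace (p2 * (3 / 4 * N ^ 2 - N / 4 - (3 * N ^ 3 - 2 * N ^ 2 + N / 2) * sin t ^ 2 +
       N ^ 4 * (sin t ^ 2) ^ 2) - N ^ 2 * (3 / 4 - 3 * u + u ^ 2) * E) with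
      (N ^ 2 * ((p2 - E) * (3 / 4 - 3 * u + u ^ 2)) +
       N * (p2 * (- / 4 + 3 * (N * (u - y)) + (2 - / (2 * N)) * y - (N * (u - y)) * (u + y))))
      by (unfold y; field; lra).
    assert (Hd : 0 <= N * (u - y) <= u ^ 2 / 2).
    { split; [apply Rmult_le_pos; lra|].
      apply Rle_trans with (N * (u ^ 2 / (2 * N))); [apply Rmult_le_compat_l; lra|].
      right; field; lra. }
    assert (Hi : 0 < / (2 * N) < 1).
    { split; [apply Rinv_0_lt_compat; lra|].
      rewrite <- Rinv_1; apply Rinv_lt_contravar; lra. }
    set (d := N * (u - y)) in *; set (i := / (2 * N)) in *.
    assert (X1 : Rabs (N ^ 2 * ((p2 - E) * (3 / 4 - 3 * u + u ^ 2))) <=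
       N * (q * (u ^ 2 / 2 + 2 * u) * (3 / 4 + 3 * u + u ^ 2))).
    { rewrite Rabs_mult, (Rabs_pos_eq (N ^ 2)) by (apply pow2_ge_0).
      apply Rle_trans with (N ^ 2 * ((q * (u ^ 2 / 2 + 2 * u) / N) * (3 / 4 + 3 * u + u ^ 2)));
        [|right; field; lra].
      apply Rmult_le_compat_l; [apply pow2_ge_0|].
      apply Rabs_mult_le; [exact D2|apply Rabs_le; nra]. }
    assert (X2 : Rabs (N * (p2 * (- / 4 + 3 * d + (2 - i) * y - d * (u + y)))) <=
       N * (q * (/ 4 + 3 / 2 * u ^ 2 + 2 * u + u ^ 3))).
    { rewrite Rabs_mult, (Rabs_pos_eq N) by lra.
      apply Rmult_le_compat_l; [lra|]; apply Rabs_mult_le; [apply Rabs_le; lra|].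
      assert (0 <= d * (u + y) <= u ^ 3).
      { split; [apply Rmult_le_pos; lra|].
        apply Rle_trans with (u ^ 2 / 2 * (2 * u)); [apply Rmult_le_compat; lra|right; field]. }
      assert (0 <= (2 - i) * y <= 2 * u) by (split; [apply Rmult_le_pos; lra|apply Rmult_le_compat; lra]).
      apply Rabs_le; lra. }
    eapply Rle_trans; [apply Rabs_triang|].
    eapply Rle_trans; [apply Rplus_le_compat; [exact X1|exact X2]|].
    rewrite <- Rmult_plus_distr_l.
    replace (1000000 * N / u) with (N * (1000000 / u)) by (field; lra).
    apply Rmult_le_compat_l; [lra|].
    apply (Rmult_le_reg_r u); [exact Hu|].
    replace (1000000 / u * u) with 1000000 by (field; lra).
    nra.
Qed.

(** * Summation of the Gaussian approximation over the frequencies *)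

Lemma rsum_sum_n (f : nat -> R) (n : nat) : rsum (S n) f = sum_n f n.
Proof.
  induction n; [rewrite sum_O; simpl; ring|].
  rewrite sum_Sn, <- IHn; reflexivity.
Qed.

Lemma is_series_rsum (a : nat -> R) (l : R) :
  is_series a l <-> is_lim_seq (fun n => rsum n a) l.
Proof.
  rewrite (is_lim_seq_incr_1 (fun n => rsum n a)).
  change (is_series a l) with (is_lim_seq (sum_n a) l).
  split; intros H.
  - apply (is_lim_seq_ext (sum_n a)); [intros n; symmetry; apply rsum_sum_n|exact H].
  - apply (is_lim_seq_ext (fun n => rsum (S n) a)); [intros n; apply rsum_sum_n|exact H].
Qed.

Lemma Series_abs_le (a b : nat -> R) :
  (forall n, Rabs (a n) <= b n) -> ex_series b ->
  ex_series a /\ Rabs (Series a) <= Series b.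
Proof.
  intros H Hb.
  assert (A : ex_series (fun n => Rabs (a n))).
  { apply (@ex_series_le R_AbsRing R_CompleteNormedModule _ b); [|exact Hb].
    intros n; unfold norm; simpl; unfold abs; simpl; rewrite Rabs_Rabsolu; apply H. }
  split; [apply ex_series_Rabs, A|].
  eapply Rle_trans; [apply Series_Rabs, A|].
  apply Series_le; [|exact Hb].
  intros n; split; [apply Rabs_pos|apply H].
Qed.

Lemma is_series_telescope : is_series (fun j => / (INR (S j) * INR (S (S j)))) 1.
Proof.
  apply is_series_rsum.
  apply (is_lim_seq_ext (fun n => 1 - / INR (S n))).
  - intros n; induction n as [|n IH]; [simpl; field|].
    cbn [rsum]; rewrite <- IH, !S_INR; field; pose proof (pos_INR n); lra.
  - replace (Finite 1) with (Rbar_plus 1 (Rbar_opp 0)) by (simpl; f_equal; ring).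
    apply is_lim_seq_minus'; [apply is_lim_seq_const|].
    apply (is_lim_seq_incr_1 (fun n => / INR n)).
    replace (Finite 0) with (Rbar_inv p_infty) by reflexivity.
    apply is_lim_seq_inv; [apply is_lim_seq_INR|discriminate].
Qed.

Lemma series_inv_sq :
  ex_series (fun j => / INR (S j) ^ 2) /\ Series (fun j => / INR (S j) ^ 2) <= 2.
Proof.
  set (b := fun j => 2 * / (INR (S j) * INR (S (S j)))).
  assert (Hb : is_series b 2).
  { replace 2 with (scal 2 1) by apply Rmult_1_r.
    apply (is_series_scal 2 _ _ is_series_telescope). }
  assert (H : forall j, Rabs (/ INR (S j) ^ 2) <= b j).
  { intros j; unfold b; rewrite (S_INR (S j)); set (x := INR (S j)).
    assert (1 <= x) by (unfold x; rewrite S_INR; pose proof (pos_INR j); lra).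
    rewrite Rabs_pos_eq by (left; apply Rinv_0_lt_compat, pow_lt; lra).
    apply (Rmult_le_reg_r (x ^ 2 * (x + 1))); [apply Rmult_lt_0_compat; [apply pow_lt|]; lra|].
    replace (/ x ^ 2 * (x ^ 2 * (x + 1))) with (x + 1) by (field; lra).
    replace (2 * / (x * (x + 1)) * (x ^ 2 * (x + 1))) with (2 * x) by (field; lra); lra. }
  destruct (Series_abs_le _ _ H (ex_intro _ _ Hb)) as [A B]; split; [exact A|].
  rewrite (is_series_unique _ _ Hb) in B; eapply Rle_trans; [apply Rle_abs|exact B].
Qed.

Lemma series_finite (a : nat -> R) (n : nat) :
  is_series (fun j => if (j <? n)%nat then a j else 0) (rsum n a).
Proof.
  apply is_series_rsum, is_lim_seq_incr_n with n.
  apply (is_lim_seq_ext (fun _ => rsum n a)); [|apply is_lim_seq_const].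
  intros k; induction k as [|k IH].
  - simpl; apply rsum_ext; intros i Hi; apply Nat.ltb_lt in Hi; rewrite Hi; reflexivity.
  - change (S k + n)%nat with (S (k + n)); cbn [rsum]; rewrite <- IH.
    destruct (Nat.ltb_spec (k + n) n); [lia|ring].
Qed.

(** What [V2] and [V4] contribute at frequency j after the Gaussian replacement, normalized as in
    [discrete_term], with x = n / 4^r and u = n t^2 for t = PI j / 2^r. *)
Definition gterm (x : R) (j : nat) : R :=
  let u := PI ^ 2 * INR j ^ 2 * x in
  (x * (3 / 2 - 6 * u + 2 * u ^ 2) + 1 / 2 - u) * exp (- u).

Lemma gterm_bound (x : R) (j : nat) : 0 < x -> (1 <= j)%nat ->
  let u := PI ^ 2 * INR j ^ 2 * x in
  Rabs (gterm x j) <= 1000 * (x + 1) / u ^ 2.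
Proof.
  intros Hx Hj u; unfold gterm; fold u.
  apply le_INR in Hj; simpl in Hj.
  assert (Hu : 0 < u).
  { pose proof PI_RGT_0; unfold u; apply Rmult_lt_0_compat; [apply Rmult_lt_0_compat; apply pow_lt|]; lra. }
  assert (E := exp_pos (- u)).
  pose proof (pow_exp_le 2 u ltac:(lra)) as B2; pose proof (pow_exp_le 3 u ltac:(lra)) as B3.
  pose proof (pow_exp_le 4 u ltac:(lra)) as B4; simpl INR in B2, B3, B4.
  ring_simplify in B2; ring_simplify in B3; ring_simplify in B4.
  set (e := exp (- u)) in *.
  assert (A : Rabs (x * (3 / 2 - 6 * u + 2 * u ^ 2) + 1 / 2 - u) <=
    (x + 1) * (2 + 7 * u + 2 * u ^ 2)) by (apply Rabs_le; nra).
  rewrite Rabs_mult, (Rabs_pos_eq e) by lra.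
  apply Rle_trans with ((x + 1) * (2 + 7 * u + 2 * u ^ 2) * e);
    [apply Rmult_le_compat_r; lra|].
  apply (Rmult_le_reg_r (u ^ 2)); [apply pow_lt, Hu|].
  replace (1000 * (x + 1) / u ^ 2 * u ^ 2) with ((x + 1) * 1000) by (field; lra).
  replace ((x + 1) * (2 + 7 * u + 2 * u ^ 2) * e * u ^ 2) with
    ((x + 1) * (2 * (u ^ 2 * e) + 7 * (u ^ 3 * e) + 2 * (u ^ 4 * e))) by ring.
  apply Rmult_le_compat_l; lra.
Qed.

Lemma pow4_sq (r : nat) : 4 ^ r = 2 ^ r * 2 ^ r.
Proof. rewrite <- Rpow_mult_distr; f_equal; lra. Qed.

Lemma half_pow_le (r : nat) (j : nat) :
  ((j < half_pow r)%nat -> INR (S j) <= 2 ^ r / 2) /\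
  ((half_pow r <= j)%nat -> 2 ^ r / 2 <= INR (S j)).
Proof.
  destruct r as [|r]; simpl half_pow.
  - split; [lia|]; intros _; rewrite S_INR; simpl; pose proof (pos_INR j); lra.
  - replace (2 ^ S r / 2) with (2 ^ r) by (simpl; field).
    rewrite <- INR_pow2; split; intros H; apply le_INR; lia.
Qed.

Definition discrete_term (r n j : nat) : R :=
  if (j <? half_pow r)%nat then / (INR n * 2 ^ r) * spectral r n (S j) else 0.

(** Below the cutoff this is [V2_V4_gauss]. Beyond it only the Gaussian term is left; there u >= n,
    so that the second factor 1 / u in [gterm_bound] supplies the missing 1 / n. *)
Lemma discrete_gterm (r n j : nat) : (6 <= n)%nat ->
  Rabs (discrete_term r n j - gterm (INR n / 4 ^ r) (S j)) <=
  2000000 / INR n * (2 + 4 ^ r / INR n) * / INR (S j) ^ 2.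
Proof.
  intros Hn.
  set (m := 2 ^ r); set (N := INR n); set (J := INR (S j)).
  assert (Hm : 1 <= m) by (apply pow_R1_Rle; lra).
  assert (HN : 6 <= N) by (unfold N; apply le_INR in Hn; simpl in Hn; lra).
  assert (HJ : 1 <= J) by (unfold J; rewrite S_INR; pose proof (pos_INR j); lra).
  rewrite pow4_sq; fold m.
  set (x := N / (m * m)).
  assert (Hx : 0 < x) by (unfold x; apply Rdiv_lt_0_compat; nra).
  set (u := PI ^ 2 * J ^ 2 * x).
  assert (HP : 4 <= PI ^ 2) by (pose proof PI2_1; simpl; nra).
  assert (Hu : 0 < u) by (unfold u; apply Rmult_lt_0_compat; [apply Rmult_lt_0_compat; apply pow_lt|]; pose proof PI_RGT_0; lra).
  assert (Fin : 1000000 / N * (2 * x + 1) / u <= 2000000 / N * (2 + m * m / N) * / J ^ 2).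
  { replace (2000000 / N * (2 + m * m / N) * / J ^ 2) with
      (2000000 / N * (2 * x + 1) * PI ^ 2 / u) by (unfold u, x; field; repeat split; nra).
    unfold Rdiv; rewrite !Rmult_assoc; pose proof (Rinv_0_lt_compat N ltac:(lra)).
    pose proof (Rinv_0_lt_compat u Hu).
    assert (0 < (2 * x + 1) * / u) by (apply Rmult_lt_0_compat; lra).
    assert (0 < / N * ((2 * x + 1) * / u)) by (apply Rmult_lt_0_compat; lra).
    nra. }
  eapply Rle_trans; [|exact Fin].
  unfold discrete_term; destruct (Nat.ltb_spec j (half_pow r)) as [Hj|Hj].
  - apply (proj1 (half_pow_le r j)) in Hj; fold m J in Hj.
    set (t := PI * J / m).
    assert (Ht : 0 < t <= PI / 2).
    { pose proof PI_RGT_0; unfold t; split; [apply Rdiv_lt_0_compat; nra|].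
      apply (Rmult_le_reg_r m); [lra|].
      replace (PI * J / m * m) with (PI * J) by (field; lra).
      replace (PI / 2 * m) with (PI * (m / 2)) by field; apply Rmult_le_compat_l; lra. }
    destruct (V2_V4_gauss n t Hn Ht) as [A2 A4].
    replace (INR n * t ^ 2) with u in A2, A4 by (unfold u, x, t, N; field; lra).
    fold N in A2, A4.
    unfold spectral, gterm; fold N J m t u.
    match goal with |- Rabs ?A <= _ => replace A with
      (2 / (N * (m * m)) * (V4 n t - N ^ 2 * (3 / 4 - 3 * u + u ^ 2) * exp (- u)) +
       / N * (V2 n t - N * (/ 2 - u) * exp (- u))) by (unfold x; field; lra) end.
    eapply Rle_trans; [apply Rabs_triang|].
    replace (1000000 / N * (2 * x + 1) / u) with
      (2 / (N * (m * m)) * (1000000 * N / u) + / N * (1000000 / u))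
      by (unfold x; field; lra).
    apply Rplus_le_compat; apply Rabs_mult_le; try assumption;
      rewrite Rabs_pos_eq; try lra.
    + left; apply Rdiv_lt_0_compat; nra.
    + left; apply Rinv_0_lt_compat; lra.
  - apply (proj2 (half_pow_le r j)) in Hj; fold m J in Hj.
    unfold Rminus; rewrite Rplus_0_l, Rabs_Ropp.
    eapply Rle_trans; [apply gterm_bound; [exact Hx|lia]|]; fold J u.
    assert (HuN : N <= u).
    { unfold u, x; replace (PI ^ 2 * J ^ 2 * (N / (m * m))) with
        (N * (PI ^ 2 * (J / m) ^ 2)) by (field; lra).
      assert (/ 2 <= J / m).
      { apply (Rmult_le_reg_r m); [lra|]; replace (J / m * m) with J by (field; lra); lra. }
      assert (1 <= PI ^ 2 * (J / m) ^ 2) by (assert (/ 4 <= (J / m) ^ 2) by nra; nra).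
      nra. }
    apply (Rmult_le_reg_r (N * u ^ 2)); [apply Rmult_lt_0_compat; [lra|apply pow_lt, Hu]|].
    replace (1000 * (x + 1) / u ^ 2 * (N * u ^ 2)) with (1000 * (x + 1) * N) by (field; lra).
    replace (1000000 / N * (2 * x + 1) / u * (N * u ^ 2)) with (1000000 * (2 * x + 1) * u)
      by (field; lra).
    nra.
Qed.

Lemma mean_fringe_gauss : exists c, 0 < c /\ forall r n, (6 <= n)%nat ->
  ex_series (fun j => gterm (INR n / 4 ^ r) (S j)) /\
  Rabs (mean_fringe r n - (INR n / 4 ^ r + 1 / 3 - 1 / (3 * 4 ^ r))
        - 4 / 3 * Series (fun j => gterm (INR n / 4 ^ r) (S j)))
  <= c / INR n * (1 + 4 ^ r / INR n).
Proof.
  exists 20000000; split; [lra|]; intros r n Hn.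
  assert (HN : 6 <= INR n) by (apply le_INR in Hn; simpl in Hn; lra).
  assert (P : 0 < 2 ^ r) by (apply pow_lt; lra).
  assert (P4 : 0 < 4 ^ r) by (apply pow_lt; lra).
  set (K := 2000000 / INR n * (2 + 4 ^ r / INR n)).
  destruct series_inv_sq as [S1 S2].
  assert (SK : ex_series (fun j => K * / INR (S j) ^ 2)).
  { apply (@ex_series_scal R_AbsRing R_NormedModule K _ S1). }
  destruct (Series_abs_le _ _ (fun j => discrete_gterm r n j Hn) SK) as [E B].
  assert (HD : is_series (discrete_term r n)
     (rsum (half_pow r) (fun j => / (INR n * 2 ^ r) * spectral r n (S j)))).
  { apply series_finite. }
  assert (EG : ex_series (fun j => gterm (INR n / 4 ^ r) (S j))).
  { destruct E as [l Hl].
    exists (minus (rsum (half_pow r) (fun j => / (INR n * 2 ^ r) * spectral r n (S j))) l).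
    eapply is_series_ext; [|apply (is_series_minus _ _ _ _ HD Hl)].
    intros j; unfold minus, plus, opp; simpl; ring. }
  split; [exact EG|].
  rewrite Series_minus in B by (try exact EG; eexists; exact HD).
  rewrite (is_series_unique _ _ HD), rsum_scal, Series_scal_l in B.
  rewrite mean_fringe_half by lia.
  match goal with |- Rabs ?A <= _ => replace A with (4 / 3 * (/ (INR n * 2 ^ r) *
     rsum (half_pow r) (fun j => spectral r n (S j)) -
     Series (fun j => gterm (INR n / 4 ^ r) (S j)))) by (field; repeat split; nra) end.
  rewrite Rabs_mult, (Rabs_pos_eq (4 / 3)) by lra.
  assert (HK : 0 < / INR n /\ 0 < 4 ^ r / INR n).
  { split; [apply Rinv_0_lt_compat|apply Rdiv_lt_0_compat]; lra. }
  destruct HK as [I1 I2].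
  set (y := 4 ^ r / INR n) in *.
  assert (K0 : 0 < K) by (apply Rmult_lt_0_compat; [apply Rdiv_lt_0_compat|]; lra).
  apply Rle_trans with (4 / 3 * (K * 2)).
  - apply Rmult_le_compat_l; [lra|]; eapply Rle_trans; [exact B|].
    apply Rmult_le_compat_l; lra.
  - unfold K, Rdiv; set (i := / INR n) in *; nra.
Qed.

(** * Tails *)

(** The quotient of the two sides is nonincreasing in y, because y cosh y >= sinh y. *)
Lemma cosh_le (y : R) : 0 <= y -> (exp y + exp (- y)) / 2 <= exp (y ^ 2 / 2).
Proof.
  intros Hy.
  assert (A : forall y, 0 <= y -> 0 <= y * (exp y + exp (- y)) - (exp y - exp (- y))).
  { intros z Hz.
    pose proof (increasing_from (fun y => y * (exp y + exp (- y)) - (exp y - exp (- y)))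
      (fun y => y * (exp y - exp (- y))) 0 z Hz) as H; cbv beta in H.
    rewrite Ropp_0, exp_0 in H.
    eapply Rle_trans; [|apply H]; [lra| |].
    - intros t _; auto_derive; [exact I|ring].
    - intros t Ht; apply Rmult_le_pos; [lra|].
      pose proof (exp_le (- t) t ltac:(lra)); lra. }
  pose proof (increasing_from (fun y => - ((exp y + exp (- y)) / 2 * exp (- (y * y / 2))))
    (fun y => (y * (exp y + exp (- y)) - (exp y - exp (- y))) / 2 * exp (- (y * y / 2)))
    0 y Hy) as H; cbv beta in H.
  assert (B : (exp y + exp (- y)) / 2 * exp (- (y * y / 2)) <= 1).
  { apply Ropp_le_cancel; eapply Rle_trans; [|apply H].
    - rewrite Ropp_0, exp_0; replace (- (0 * 0 / 2)) with 0 by field; rewrite exp_0; lra.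
    - intros t _; auto_derive; [exact I|].
      replace (- (t * t * / 2)) with (- (t * t / 2)) by field; field.
    - intros t Ht; apply Rmult_le_pos; [|left; apply exp_pos].
      pose proof (A t ltac:(lra)); lra. }
  apply (Rmult_le_reg_r (exp (- (y * y / 2)))); [apply exp_pos|].
  rewrite <- exp_plus; replace (y ^ 2 / 2 + - (y * y / 2)) with 0 by field.
  rewrite exp_0; exact B.
Qed.

Lemma walk_cosh (n : nat) (a : R) (k : Z) :
  walk n (fun k => exp (a * IZR k) + exp (- (a * IZR k))) k =
  ((exp (a / 2) + exp (- (a / 2))) / 2) ^ (2 * n) * (exp (a * IZR k) + exp (- (a * IZR k))).
Proof.
  revert k; induction n as [|n IH]; intros k; [simpl; ring|].
  rewrite walk_swap, !IH, minus_IZR, plus_IZR.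
  replace (2 * S n)%nat with (S (S (2 * n))) by lia.
  set (c := ((exp (a / 2) + exp (- (a / 2))) / 2)).
  replace (c ^ S (S (2 * n))) with (c ^ 2 * c ^ (2 * n)) by (simpl; ring).
  replace (c ^ 2) with ((2 + exp a + exp (- a)) / 4).
  2:{ unfold c.
      replace (exp a) with (exp (a / 2) * exp (a / 2)) by (rewrite <- exp_plus; f_equal; field).
      replace (exp (- a)) with (exp (- (a / 2)) * exp (- (a / 2)))
        by (rewrite <- exp_plus; f_equal; field).
      assert (E : exp (a / 2) * exp (- (a / 2)) = 1) by (rewrite <- exp_plus, Rplus_opp_r; apply exp_0).
      simpl; nra. }
  replace (a * (IZR k - 1)) with (a * IZR k + - a) by ring.
  replace (a * (IZR k + 1)) with (a * IZR k + a) by ring.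
  rewrite !Ropp_plus_distr, !exp_plus, Ropp_involutive; field.
Qed.

(** A Chernoff bound. The multiple 0 has weight 0, and all others lie at distance at least m = 2^r.
    Of the exponential exp (2 s |k|), one half absorbs the fourth power and the other half yields
    exp (- (s m)). *)
Lemma mean_fringe_tail (r n : nat) : (1 <= n)%nat ->
  0 <= mean_fringe r n <= 100000 * INR n ^ 3 * exp (- (4 ^ r / (4 * INR n))).
Proof.
  intros Hn; destruct n as [|n]; [lia|].
  rewrite mean_fringe_walk; set (N := INR (S n)).
  assert (HN : 1 <= N) by (unfold N; rewrite S_INR; pose proof (pos_INR n); lra).
  set (m := 2 ^ r).
  assert (Hm : 1 <= m) by (apply pow_R1_Rle; lra).
  assert (HM : forall k, 0 <= multiple r k <= 1)
    by (intros k; unfold multiple; destruct (_ =? _)%Z; lra).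
  assert (F0 : 0 <= 2 / (3 * N)) by (left; apply Rdiv_lt_0_compat; lra).
  split.
  - apply Rmult_le_pos; [exact F0|].
    rewrite <- (walk_const (S n) 0 0); apply walk_le; intros k.
    apply Rmult_le_pos; [apply HM|]; apply Rplus_le_le_0_compat.
    + apply Rmult_le_pos; [|left; apply Rinv_0_lt_compat; lra].
      replace (IZR k ^ 4) with ((IZR k ^ 2) ^ 2) by ring; pose proof (pow2_ge_0 (IZR k ^ 2)); lra.
    + apply Rmult_le_pos; [lra|apply pow2_ge_0].
  (* The minimizer of N s^2 - s m, with minimum - 4^r / (4 N). *)
  - set (s := m / (2 * N)).
    assert (Hs : 0 < s) by (apply Rdiv_lt_0_compat; lra).
    set (a := 2 * s).
    (* 768 is 3 * 4^4: for y >= m the polynomial is at most 3 y^4 / m, and (s y)^4 <= 4^4 exp (s y)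
       by [pow_exp_le]. *)
    set (K := 768 / (m * s ^ 4) * exp (- (s * m))).
    assert (Pt : forall k, multiple r k * (2 * IZR k ^ 4 / m + m * IZR k ^ 2) <=
       K * (exp (a * IZR k) + exp (- (a * IZR k)))).
    { intros k.
      assert (K0 : 0 < K).
      { unfold K; apply Rmult_lt_0_compat; [|apply exp_pos].
        apply Rdiv_lt_0_compat; [lra|]; apply Rmult_lt_0_compat; [lra|apply pow_lt, Hs]. }
      assert (R0 : 0 <= K * (exp (a * IZR k) + exp (- (a * IZR k)))).
      { apply Rmult_le_pos; [lra|].
        pose proof (exp_pos (a * IZR k)); pose proof (exp_pos (- (a * IZR k))); lra. }
      unfold multiple; destruct (Z.eqb_spec (k mod 2 ^ Z.of_nat r) 0) as [E|]; [|lra].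
      destruct (Z.eq_dec k 0) as [->|Hk]; [simpl; lra|].
      rewrite Rmult_1_l; set (y := Rabs (IZR k)).
      assert (Hy : m <= y).
      { apply Z.mod_divide in E; [|apply Z.pow_nonzero; lia].
        apply Z.divide_abs_r in E; apply Z.divide_pos_le in E; [|lia].
        unfold y; rewrite <- abs_IZR; unfold m; rewrite <- pow2_IZR; apply IZR_le, E. }
      replace (IZR k ^ 4) with (y ^ 4) by
        (unfold y; replace (Rabs (IZR k) ^ 4) with ((Rabs (IZR k) ^ 2) ^ 2) by ring;
         rewrite RPow_abs, Rabs_pos_eq by apply pow2_ge_0; ring).
      replace (IZR k ^ 2) with (y ^ 2) by
        (unfold y; rewrite RPow_abs, Rabs_pos_eq by apply pow2_ge_0; ring).
      assert (Ex : exp (a * y) <= exp (a * IZR k) + exp (- (a * IZR k))).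
      { pose proof (exp_pos (a * IZR k)); pose proof (exp_pos (- (a * IZR k))).
        unfold y, Rabs; destruct (Rcase_abs (IZR k)); [rewrite Ropp_mult_distr_r in *|]; lra. }
      apply Rle_trans with (K * exp (a * y)); [|apply Rmult_le_compat_l; lra].
      pose proof (pow_exp_le 4 (s * y) ltac:(nra)) as B; simpl INR in B.
      assert (B' : (s * y) ^ 4 <= 256 * exp (s * y)).
      { apply (Rmult_le_reg_r (exp (- (s * y)))); [apply exp_pos|].
        rewrite Rmult_assoc, <- exp_plus, Rplus_opp_r, exp_0; simpl in *; lra. }
      unfold K; rewrite Rmult_assoc, <- exp_plus.
      apply Rle_trans with (768 / (m * s ^ 4) * exp (s * y)).
      - apply Rle_trans with (3 / (m * s ^ 4) * (s * y) ^ 4).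
        + replace (3 / (m * s ^ 4) * (s * y) ^ 4) with (3 * y ^ 4 / m) by (field; lra).
          apply (Rmult_le_reg_r m); [lra|].
          replace ((2 * y ^ 4 / m + m * y ^ 2) * m) with (2 * y ^ 4 + m ^ 2 * y ^ 2) by (field; lra).
          replace (3 * y ^ 4 / m * m) with (2 * y ^ 4 + y ^ 2 * y ^ 2) by (field; lra).
          apply Rplus_le_compat_l, Rmult_le_compat_r; [apply pow2_ge_0|].
          apply pow_incr; lra.
        + replace (768 / (m * s ^ 4) * exp (s * y)) with (3 / (m * s ^ 4) * (256 * exp (s * y)))
            by (field; lra).
          apply Rmult_le_compat_l; [|exact B'].
          left; apply Rdiv_lt_0_compat; [lra|apply Rmult_lt_0_compat; [lra|apply pow_lt, Hs]].
      - apply Rmult_le_compat_l.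
        + left; apply Rdiv_lt_0_compat; [lra|apply Rmult_lt_0_compat; [lra|apply pow_lt, Hs]].
        + apply exp_le; unfold a; nra. }
    assert (W : walk (S n) (fun k => multiple r k * (2 * IZR k ^ 4 / m + m * IZR k ^ 2)) 0 <=
       K * (exp (N * s ^ 2) * 2)).
    { eapply Rle_trans; [apply walk_le, Pt|].
      rewrite walk_scal, walk_cosh.
      replace (a / 2) with s by (unfold a; field).
      rewrite Rmult_0_r, Ropp_0, exp_0.
      apply Rmult_le_compat_l.
      - unfold K; apply Rmult_le_pos; [|left; apply exp_pos].
        left; apply Rdiv_lt_0_compat; [lra|apply Rmult_lt_0_compat; [lra|apply pow_lt, Hs]].
      - replace (1 + 1) with 2 by ring; apply Rmult_le_compat_r; [lra|].
        rewrite pow_mult.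
        replace (exp (N * s ^ 2)) with ((exp (s ^ 2 / 2) ^ 2) ^ S n).
        + apply pow_incr; split; [apply pow2_ge_0|]; apply pow_incr.
          pose proof (exp_pos s); pose proof (exp_pos (- s)); split; [lra|].
          apply cosh_le; lra.
        + rewrite <- !exp_INR; f_equal; unfold N; simpl (INR 2); field. }
    eapply Rle_trans; [apply Rmult_le_compat_l; [exact F0|exact W]|].
    unfold K; rewrite pow4_sq; fold m.
    replace (exp (- (m * m / (4 * N)))) with (exp (- (s * m)) * exp (N * s ^ 2))
      by (rewrite <- exp_plus; f_equal; unfold s; field; lra).
    set (e := exp (- (s * m)) * exp (N * s ^ 2)).
    replace (2 / (3 * N) * (768 / (m * s ^ 4) * exp (- (s * m)) * (exp (N * s ^ 2) * 2))) with
      (16384 * N ^ 3 / m ^ 5 * e) by (unfold e, s; field; lra).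
    apply Rmult_le_compat_r; [left; apply Rmult_lt_0_compat; apply exp_pos|].
    assert (M5 : 1 <= m ^ 5) by (apply pow_R1_Rle, Hm).
    assert (N3 : 0 < N ^ 3) by (apply pow_lt; lra).
    apply (Rmult_le_reg_r (m ^ 5)); [lra|].
    replace (16384 * N ^ 3 / m ^ 5 * m ^ 5) with (16384 * N ^ 3) by (field; lra).
    nra.
Qed.

(** * The expectation as a series *)

Lemma fold_Series (L : list path) (F : nat -> path -> R) :
  (forall r l, 0 <= F r l) ->
  ex_series (fun r => fold_right Rplus 0 (map (F r) L)) ->
  fold_right Rplus 0 (map (fun l => Series (fun r => F r l)) L) =
  Series (fun r => fold_right Rplus 0 (map (F r) L)).
Proof.
  intros F0; induction L as [|l L IH]; simpl; intros Ex.
  - symmetry; apply (is_series_unique (fun _ : nat => 0)), is_series_rsum.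
    apply (is_lim_seq_ext (fun _ => 0)); [|apply is_lim_seq_const].
    intros n; rewrite rsum_const; ring.
  - assert (P : forall r, 0 <= fold_right Rplus 0 (map (F r) L)).
    { intros r; clear - F0; induction L; simpl; [lra|]; pose proof (F0 r a); lra. }
    assert (E1 : ex_series (fun r => F r l)).
    { eapply Series_abs_le; [|exact Ex]; intros r; pose proof (F0 r l); pose proof (P r).
      rewrite Rabs_pos_eq; lra. }
    assert (E2 : ex_series (fun r => fold_right Rplus 0 (map (F r) L))).
    { eapply Series_abs_le; [|exact Ex]; intros r; pose proof (F0 r l); pose proof (P r).
      rewrite Rabs_pos_eq; lra. }
    rewrite Series_plus, IH; auto.
Qed.

Lemma ex_series_geom4 : is_series (fun r => / 4 ^ r) (4 / 3).
Proof.
  apply (is_series_ext (fun r => (/ 4) ^ r)); [intros r; apply pow_inv|].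
  replace (4 / 3) with (/ (1 - / 4)) by field.
  apply is_series_geom; rewrite Rabs_pos_eq; lra.
Qed.

Lemma mean_fringe_summable (n : nat) : (1 <= n)%nat -> ex_series (fun r => mean_fringe r n).
Proof.
  intros Hn; pose proof (le_INR _ _ Hn) as HN; simpl in HN.
  apply (Series_abs_le _ (fun r => 400000 * INR n ^ 4 * / 4 ^ r)).
  - intros r; destruct (mean_fringe_tail r n Hn) as [A B].
    rewrite Rabs_pos_eq by exact A; eapply Rle_trans; [exact B|].
    assert (P4 : 0 < 4 ^ r) by (apply pow_lt; lra).
    set (v := 4 ^ r / (4 * INR n)).
    assert (Hv : 0 < v) by (apply Rdiv_lt_0_compat; lra).
    pose proof (pow_exp_le 1 v ltac:(lra)) as E; simpl in E; rewrite !Rmult_1_r in E.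
    replace (400000 * INR n ^ 4 * / 4 ^ r) with (100000 * INR n ^ 3 * (1 / v))
      by (unfold v; field; lra).
    apply Rmult_le_compat_l; [pose proof (pow_le (INR n) 3 ltac:(lra)); lra|].
    apply (Rmult_le_reg_l v); [exact Hv|].
    replace (v * (1 / v)) with 1 by (field; lra); exact E.
  - apply (@ex_series_scal R_AbsRing R_NormedModule); eexists; apply ex_series_geom4.
Qed.

Lemma expected_total_fringe_size_series (n : nat) : (1 <= n)%nat ->
  expected_total_fringe_size n = Series (fun r => mean_fringe r n).
Proof.
  intros Hn; unfold expected_total_fringe_size, total_fringe_size.
  assert (P4 : 0 < 4 ^ n) by (apply pow_lt; lra).
  rewrite (fold_Series (paths n) (fun r l => INR (fringe_size r l))).
  - unfold Rdiv; rewrite Rmult_comm, <- Series_scal_l; apply Series_ext; intros r.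
    unfold mean_fringe, fringe_sum, psum, Rdiv; apply Rmult_comm.
  - intros; apply pos_INR.
  - destruct (mean_fringe_summable n Hn) as [l Hl]; exists (4 ^ n * l).
    eapply is_series_ext; [|apply (is_series_scal (4 ^ n) _ _ Hl)].
    intros r; unfold mean_fringe, fringe_sum, psum, scal; simpl; unfold mult; simpl; field; lra.
Qed.

(** * Improper integrals on the half-line *)

Definition cont (f : R -> R) := forall t, continuous f t.

Definition is_J (f : R -> R) (l : R) := is_lim (fun b => RInt f 0 b) p_infty l.
(** A total function; it is the integral as soon as [is_J] holds for some value, which [J_correct]
    provides under [cont] and [dom]. *)
Definition J (f : R -> R) : R := real (Lim (fun b => RInt f 0 b) p_infty).
Definition dom (C c : R) (f : R -> R) :=
  0 < c /\ forall t, 0 <= t -> Rabs (f t) <= C * exp (- (c * t)).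

Lemma is_J_unique (f : R -> R) (l : R) : is_J f l -> J f = l.
Proof. intros H; unfold J; rewrite (is_lim_unique _ _ _ H); reflexivity. Qed.

Lemma cont_ex_RInt (f : R -> R) (a b : R) : cont f -> ex_RInt f a b.
Proof. intros H; apply (@ex_RInt_continuous R_CompleteNormedModule); intros; apply H. Qed.

Lemma is_derive_cont (f df : R -> R) : (forall t, is_derive f t (df t)) -> cont f.
Proof. intros H t; apply @ex_derive_continuous; eexists; apply H. Qed.

Lemma RInt_exp_dom (f : R -> R) (C c a b : R) : cont f -> dom C c f -> 0 <= a <= b ->
  Rabs (RInt f a b) <= C / c * exp (- (c * a)).
Proof.
  intros Hf [Hc Hd] Hab.
  assert (C0 : 0 <= C).
  { pose proof (Hd 0 ltac:(lra)) as H; rewrite Rmult_0_r, Ropp_0, exp_0 in H.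
    pose proof (Rabs_pos (f 0)); lra. }
  set (G := fun t => - (C / c * exp (- (c * t)))).
  assert (HG : is_RInt (fun t => C * exp (- (c * t))) a b (G b - G a)).
  { apply (is_RInt_derive G).
    - intros t _; unfold G; auto_derive; [exact I|field; lra].
    - intros t _; apply @ex_derive_continuous; auto_derive; exact I. }
  pose proof (norm_RInt_le f (fun t => C * exp (- (c * t))) a b (RInt f a b) (G b - G a)) as N.
  eapply Rle_trans; [apply N|].
  - lra.
  - intros t Ht; apply Hd; lra.
  - apply (@RInt_correct R_CompleteNormedModule), cont_ex_RInt, Hf.
  - exact HG.
  - unfold G.
    assert (0 <= C / c * exp (- (c * b))).
    { apply Rmult_le_pos; [apply Rmult_le_pos; [lra|left; apply Rinv_0_lt_compat; lra]|].
      left; apply exp_pos. }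
    lra.
Qed.

Lemma RInt_Chasles_cont (f : R -> R) (a b c : R) : cont f -> RInt f a b + RInt f b c = RInt f a c.
Proof. intros H; apply (@RInt_Chasles R_CompleteNormedModule); apply cont_ex_RInt, H. Qed.

Lemma exp_neg_lim (c : R) : 0 < c -> is_lim (fun b => exp (- (c * b))) p_infty 0.
Proof.
  intros Hc.
  apply is_lim_comp with m_infty.
  - apply is_lim_exp_m.
  - replace m_infty with (Rbar_opp (Rbar_mult c p_infty)).
    + apply is_lim_opp.
      apply (is_lim_scal_l (fun b => b) c p_infty p_infty), is_lim_id.
    + simpl; destruct (Rle_dec 0 c); [|lra].
      destruct (Rle_lt_or_eq_dec 0 c r); [reflexivity|lra].
  - exists 0; intros; discriminate.
Qed.

Lemma RInt_diff_dom (f : R -> R) (C c u v : R) : cont f -> dom C c f -> 0 <= u <= v ->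
  Rabs (RInt f 0 v - RInt f 0 u) <= C / c * exp (- (c * u)).
Proof.
  intros Hf Hd H; rewrite <- (RInt_Chasles_cont f 0 u v Hf).
  rewrite Rplus_minus_l; apply RInt_exp_dom; assumption.
Qed.

Lemma J_correct (f : R -> R) (C c : R) : cont f -> dom C c f -> is_J f (J f).
Proof.
  intros Hf Hd.
  assert (E : exists l : R, filterlim (fun b => RInt f 0 b) (Rbar_locally p_infty) (locally l)).
  { apply (filterlim_locally_cauchy (U := R_CompleteSpace)).
    intros eps.
    pose proof (is_lim_scal_l _ (C / c) _ _ (exp_neg_lim c (proj1 Hd))) as L.
    simpl in L; rewrite Rmult_0_r in L.
    apply is_lim_spec in L; specialize (L (pos_div_2 eps)); simpl in L.
    destruct L as [M HM].
    exists (fun b => Rmax 0 M < b); split; [exists (Rmax 0 M); auto|].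
    assert (K : forall u v, Rmax 0 M < u -> u <= v -> Rabs (RInt f 0 v - RInt f 0 u) < eps).
    { intros u v Hu Huv; pose proof (Rmax_l 0 M); pose proof (Rmax_r 0 M).
      eapply Rle_lt_trans; [apply (RInt_diff_dom f C c); [exact Hf|exact Hd|lra]|].
      pose proof (HM u ltac:(lra)) as Q; rewrite Rminus_0_r in Q.
      pose proof (cond_pos eps).
      eapply Rle_lt_trans; [apply Rle_abs|]; lra. }
    intros u v Hu Hv; unfold ball; simpl; unfold AbsRing_ball, abs, minus, plus, opp; simpl.
    destruct (Rle_dec u v).
    - apply K; lra.
    - rewrite <- Rabs_Ropp, Ropp_plus_distr, Ropp_involutive, Rplus_comm; apply K; lra. }
  destruct E as [l Hl].
  assert (H : is_J f l) by exact Hl.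
  rewrite (is_J_unique _ _ H); exact H.
Qed.

Lemma is_J_ext (f g : R -> R) (l : R) :
  (forall t, 0 < t -> f t = g t) -> is_J f l -> is_J g l.
Proof.
  intros H; apply is_lim_ext_loc; exists 0; intros b Hb; apply RInt_ext.
  intros t; rewrite Rmin_left, Rmax_right by lra; intros Ht; apply H; lra.
Qed.

Lemma is_J_lin (f g : R -> R) (a lf lg : R) : cont f -> cont g ->
  is_J f lf -> is_J g lg -> is_J (fun t => a * f t + g t) (a * lf + lg).
Proof.
  intros Cf Cg Hf Hg; unfold is_J.
  apply (is_lim_ext (fun b => a * RInt f 0 b + RInt g 0 b)).
  - intros b; symmetry; apply is_RInt_unique.
    apply (is_RInt_plus (fun t => scal a (f t)) g);
      [apply (is_RInt_scal f)|]; apply (@RInt_correct R_CompleteNormedModule);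
      apply cont_ex_RInt; assumption.
  - apply (is_lim_plus' (fun b => a * RInt f 0 b)); [|exact Hg].
    apply (is_lim_scal_l _ a _ _ Hf).
Qed.

Lemma cont_lin (f g : R -> R) (a : R) : cont f -> cont g -> cont (fun t => a * f t + g t).
Proof.
  intros Hf Hg t; apply (continuous_plus (fun t => a * f t) g); [|apply Hg].
  apply (continuous_scal_r a f), Hf.
Qed.

Lemma J_lin (f g : R -> R) (a C c D d : R) : cont f -> cont g -> dom C c f -> dom D d g ->
  J (fun t => a * f t + g t) = a * J f + J g.
Proof.
  intros Cf Cg Df Dg; apply is_J_unique, is_J_lin; eauto using J_correct.
Qed.

Lemma J_scal (f : R -> R) (a : R) (l : R) : cont f -> is_J f l -> J (fun t => a * f t) = a * l.
Proof.
  intros Cf H; apply is_J_unique.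
  apply (is_lim_ext (fun b => a * RInt f 0 b)).
  - intros b; symmetry; apply (RInt_scal (V := R_CompleteNormedModule)), cont_ex_RInt, Cf.
  - apply (is_lim_scal_l _ a _ _ H).
Qed.

Lemma J_bound (f : R -> R) (C c : R) : cont f -> dom C c f -> Rabs (J f) <= C / c.
Proof.
  intros Cf Df.
  pose proof (J_correct f C c Cf Df) as L.
  assert (H : Rbar_locally p_infty (fun b => - (C / c) <= RInt f 0 b <= C / c)).
  { exists 0; intros b Hb.
    pose proof (RInt_exp_dom f C c 0 b Cf Df ltac:(lra)) as H.
    rewrite Rmult_0_r, Ropp_0, exp_0, Rmult_1_r in H; apply Rabs_le_between, H. }
  apply Rabs_le; split.
  - apply (is_lim_le_loc (fun _ => - (C / c)) (fun b => RInt f 0 b) p_infty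
      (- (C / c)) (J f)); [|apply is_lim_const|exact L].
    revert H; apply filter_imp; intros b Hb; apply Hb.
  - apply (is_lim_le_loc (fun b => RInt f 0 b) (fun _ => C / c) p_infty
      (J f) (C / c)); [|exact L|apply is_lim_const].
    revert H; apply filter_imp; intros b Hb; apply Hb.
Qed.

Lemma J_close (f g : R -> R) (C c D d e : R) : cont f -> cont g -> dom C c f -> dom D d g ->
  0 < c -> (forall t, 0 <= t -> Rabs (f t - g t) <= e * exp (- (c * t))) ->
  Rabs (J f - J g) <= e / c.
Proof.
  intros Cf Cg Df Dg Hc H.
  replace (J f - J g) with (J (fun t => - 1 * g t + f t)).
  - apply J_bound; [apply cont_lin; assumption|]; split; [exact Hc|].
    intros t Ht; replace (-1 * g t + f t) with (f t - g t) by ring; apply H, Ht.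
  - erewrite J_lin; eauto; ring.
Qed.

Lemma cont_rsum (f : nat -> R -> R) (n : nat) :
  (forall k, cont (f k)) -> cont (fun t => rsum n (fun k => f k t)).
Proof.
  intros H; induction n; intros t; simpl; [apply continuous_const|].
  apply (continuous_plus (fun t => rsum n (fun k => f k t)) (f n)); [apply IHn|apply H].
Qed.

Lemma is_series_tail_le (a M : nat -> R) (l : R) (n : nat) :
  (forall k, Rabs (a k) <= M k) -> ex_series M -> is_series a l ->
  Rabs (l - rsum n a) <= Series M - rsum n M.
Proof.
  intros Ha HM Hl.
  assert (B : forall b : nat -> R, ex_series b -> Series b - rsum n b = Series (fun k => b (n + k)%nat)).
  { intros b Hb; destruct n as [|n]; [simpl; rewrite Rminus_0_r; reflexivity|].
    rewrite (Series_incr_n b (S n)) by (auto with arith).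
    simpl pred; rewrite <- sum_n_Reals, <- rsum_sum_n; ring. }
  rewrite <- (is_series_unique _ _ Hl), !B by (auto; eexists; exact Hl).
  apply Series_abs_le; [intros k; apply Ha|].
  apply ex_series_incr_n, HM.
Qed.

Lemma rsum_abs_le (a M : nat -> R) (n : nat) :
  (forall k, Rabs (a k) <= M k) -> Rabs (rsum n a) <= rsum n M.
Proof.
  intros H; induction n; simpl; [rewrite Rabs_R0; lra|].
  eapply Rle_trans; [apply Rabs_triang|]; pose proof (H n); lra.
Qed.

(** The remainder of the series is bounded by the tail of M times one fixed exponential, so its
    integral tends to 0. *)
Lemma J_series (f : nat -> R -> R) (F : R -> R) (M : nat -> R) (c : R) :
  (forall n, cont (f n)) -> cont F -> 0 < c ->
  (forall n t, 0 <= t -> Rabs (f n t) <= M n * exp (- (c * t))) ->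
  ex_series M -> (forall t, 0 <= t -> is_series (fun n => f n t) (F t)) ->
  is_series (fun n => J (f n)) (J F) /\ dom (Series M) c F.
Proof.
  intros Cf CF Hc Hf HM HF.
  assert (Tail : forall n t, 0 <= t -> Rabs (F t - rsum n (fun k => f k t)) <=
     (Series M - rsum n M) * exp (- (c * t))).
  { intros n t Ht.
    pose proof (is_series_tail_le (fun k => f k t) (fun k => exp (- (c * t)) * M k) (F t) n) as H.
    rewrite Series_scal_l, rsum_scal in H.
    eapply Rle_trans; [apply H|right; ring].
    - intros k; rewrite Rmult_comm; apply Hf, Ht.
    - apply (@ex_series_scal R_AbsRing R_NormedModule), HM.
    - apply HF, Ht. }
  assert (DF : dom (Series M) c F).
  { split; [exact Hc|]; intros t Ht; pose proof (Tail O t Ht) as H; simpl in H.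
    rewrite !Rminus_0_r in H; exact H. }
  assert (Dr : forall n, dom (rsum n M) c (fun t => rsum n (fun k => f k t))).
  { intros n; split; [exact Hc|]; intros t Ht; rewrite (Rmult_comm (rsum n M)), <- rsum_scal.
    apply rsum_abs_le; intros k; rewrite Rmult_comm; apply Hf, Ht. }
  assert (Jr : forall n, J (fun t => rsum n (fun k => f k t)) = rsum n (fun k => J (f k))).
  { induction n as [|n IH]; simpl.
    - apply is_J_unique, (is_lim_ext (fun _ => 0)); [|apply is_lim_const].
      intros b; rewrite RInt_const; unfold scal; simpl; unfold mult; simpl; ring.
    - rewrite <- IH.
      replace (fun t => rsum n (fun k => f k t) + f n t) with
        (fun t => 1 * rsum n (fun k => f k t) + f n t)
        by (apply functional_extensionality; intros; ring).
      rewrite (J_lin (fun t => rsum n (fun k => f k t)) (f n) 1 (rsum n M) c (M n) c); auto.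
      + ring.
      + apply cont_rsum, Cf.
      + split; auto. }
  split; [|exact DF].
  apply is_series_rsum.
  apply (is_lim_seq_ext (fun n => J (fun t => rsum n (fun k => f k t)))); [exact Jr|].
  apply is_lim_seq_spec; intros eps.
  destruct HM as [m Hm]; pose proof (is_series_unique _ _ Hm) as Em.
  apply is_series_rsum in Hm; apply is_lim_seq_spec in Hm.
  assert (He : 0 < c * eps) by (apply Rmult_lt_0_compat; [exact Hc|apply cond_pos]).
  destruct (Hm (mkposreal _ He)) as [N HN]; exists N; intros n Hn; specialize (HN n Hn).
  simpl in HN.
  rewrite Rabs_minus_sym.
  eapply Rle_lt_trans; [apply (J_close F _ (Series M) c (rsum n M) c (Series M - rsum n M))|];
    auto using cont_rsum.
  rewrite Em; apply (Rmult_lt_reg_r c); [exact Hc|].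
  replace ((m - rsum n M) / c * c) with (m - rsum n M) by (field; lra).
  apply Rabs_def2 in HN; lra.
Qed.

Lemma is_J_derive (F f : R -> R) (L : R) :
  (forall t, is_derive F t (f t)) -> cont f -> is_lim F p_infty L -> is_J f (L - F 0).
Proof.
  intros D Cf HL; unfold is_J.
  apply (is_lim_ext (fun b => F b - F 0)).
  - intros b; symmetry; apply is_RInt_unique, (is_RInt_derive F f); intros; [apply D|apply Cf].
  - apply is_lim_minus'; [exact HL|apply is_lim_const].
Qed.

Lemma RInt_comp_affine (f : R -> R) (u v a b : R) : cont f ->
  u * RInt (fun t => f (u * t + v)) a b = RInt f (u * a + v) (u * b + v).
Proof.
  intros Cf.
  rewrite <- (RInt_comp_lin f u v a b) by (apply cont_ex_RInt, Cf).
  symmetry; apply (RInt_scal (V := R_CompleteNormedModule)).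
  apply cont_ex_RInt; intros t; apply continuous_comp; [|apply Cf].
  apply @ex_derive_continuous; auto_derive; exact I.
Qed.

Lemma cont_affine (f : R -> R) (u v : R) : cont f -> cont (fun t => f (u * t + v)).
Proof.
  intros Cf t; apply (continuous_comp (fun t => u * t + v) f); [|apply Cf].
  apply @ex_derive_continuous; auto_derive; exact I.
Qed.

Lemma is_J_affine (f : R -> R) (k h l : R) : 0 < k -> cont f -> is_J f l ->
  is_J (fun t => f (k * t + h)) ((l - RInt f 0 h) / k).
Proof.
  intros Hk Cf H; unfold is_J.
  apply (is_lim_ext (fun b => (RInt f 0 (k * b + h) - RInt f 0 h) * / k)).
  - intros b.
    rewrite <- (RInt_Chasles_cont f 0 h (k * b + h) Cf).
    pose proof (RInt_comp_affine f k h 0 b Cf) as E.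
    rewrite Rmult_0_r, Rplus_0_l in E; rewrite <- E; field; lra.
  - apply (is_lim_scal_r _ (/ k) _ (Finite (l - RInt f 0 h))).
    apply is_lim_minus'; [|apply is_lim_const].
    apply (is_lim_comp (fun b => RInt f 0 b) (fun b => k * b + h) p_infty l p_infty).
    + exact H.
    + apply (is_lim_plus (fun b => k * b) (fun _ => h) p_infty p_infty h); [|apply is_lim_const|reflexivity].
      replace p_infty with (Rbar_mult k p_infty) at 2.
      * apply (is_lim_scal_l (fun b => b) k p_infty p_infty), is_lim_id.
      * simpl; destruct (Rle_dec 0 k); [|lra].
        destruct (Rle_lt_or_eq_dec 0 k r); [reflexivity|lra].
    + exists 0; intros; discriminate.
Qed.

(* [J2] integrates over the whole line, which makes it invariant under translation. *)
Definition J2 (f : R -> R) : R := J f + J (fun t => f (- t)).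

(** The translation by h moves the integral of f over [0, h] from one half-line to the other, and it
    cancels in the sum. *)
Lemma is_J2_affine (f : R -> R) (k h l1 l2 : R) : 0 < k -> cont f ->
  is_J f l1 -> is_J (fun t => f (- t)) l2 ->
  J2 (fun t => f (k * t + h)) = (l1 + l2) / k.
Proof.
  intros Hk Cf H1 H2; unfold J2.
  assert (Co : cont (fun t => f (- t))).
  { intros t; apply (continuous_comp Ropp f); [|apply Cf].
    apply @ex_derive_continuous; auto_derive; exact I. }
  rewrite (is_J_unique _ _ (is_J_affine f k h l1 Hk Cf H1)).
  pose proof (is_J_affine (fun t => f (- t)) k (- h) l2 Hk Co H2) as H3; cbv beta in H3.
  rewrite (is_J_unique (fun t => f (k * - t + h)) ((l2 - RInt (fun t => f (- t)) 0 (- h)) / k)).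
  - assert (E : RInt (fun t => f (- t)) 0 (- h) = - RInt f 0 h :> R).
    { pose proof (RInt_comp_affine f (-1) 0 0 (- h) Cf) as E.
      replace (-1 * 0 + 0) with 0 in E by ring; replace (-1 * - h + 0) with h in E by ring.
      rewrite <- E.
      rewrite (RInt_ext (fun t => f (-1 * t + 0)) (fun t => f (- t))).
      { generalize (RInt (fun t => f (- t)) 0 (- h) : R); intros a; change (a = - (-1 * a)); ring. }
      intros t _; f_equal; ring. }
    rewrite E; field; lra.
  - apply (is_J_ext (fun t => f (- (k * t + - h)))); [intros t _; f_equal; ring|exact H3].
Qed.

(** * Term-by-term differentiation *)

Lemma is_derive_rsum (f df : nat -> R -> R) (n : nat) (x : R) :
  (forall k, is_derive (f k) x (df k x)) ->
  is_derive (fun y => rsum n (fun k => f k y)) x (rsum n (fun k => df k x)).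
Proof.
  intros H; induction n; simpl; [apply @is_derive_const|].
  apply (is_derive_plus (fun y => rsum n (fun k => f k y)) (f n)); auto.
Qed.

(** By the mean value theorem the difference quotients obey the same bound M as the derivatives.
    Both tails are therefore small uniformly in h, and a finite sum decides. *)
Lemma is_derive_Series (f df : nat -> R -> R) (M : nat -> R) (x : R) :
  (forall n y, Rabs (y - x) < 1 -> is_derive (f n) y (df n y) /\ Rabs (df n y) <= M n) ->
  ex_series M -> (forall y, Rabs (y - x) < 1 -> ex_series (fun n => f n y)) ->
  is_derive (fun y => Series (fun n => f n y)) x (Series (fun n => df n x)).
Proof.
  intros Hd HM Hs.
  assert (X0 : Rabs (x - x) < 1) by (rewrite Rminus_diag, Rabs_R0; lra).
  apply is_derive_Reals; intros eps Heps.
  pose proof HM as [m Hm]; pose proof (is_series_unique _ _ Hm) as Em.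
  apply is_series_rsum in Hm; apply is_lim_seq_spec in Hm.
  assert (He : 0 < eps / 8) by lra.
  destruct (Hm (mkposreal _ He)) as [N HN]; specialize (HN N (le_n N)); simpl in HN.
  pose proof (is_derive_rsum f df N x (fun k => proj1 (Hd k x X0))) as DN.
  apply is_derive_Reals in DN; destruct (DN (eps / 2) ltac:(lra)) as [delta HD].
  assert (Hdl : 0 < Rmin delta 1) by (apply Rmin_pos; [apply cond_pos|lra]).
  exists (mkposreal _ Hdl); intros h Hh0 Hh; simpl in Hh.
  assert (Hh1 : Rabs h < 1) by (eapply Rlt_le_trans; [exact Hh|apply Rmin_r]).
  specialize (HD h Hh0 ltac:(eapply Rlt_le_trans; [exact Hh|apply Rmin_l])).
  assert (XH : Rabs (x + h - x) < 1) by (replace (x + h - x) with h by ring; exact Hh1).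
  set (q := fun n => (f n (x + h) - f n x) / h).
  assert (Hq : forall n, Rabs (q n) <= M n).
  { intros n; unfold q.
    destruct (MVT_gen (f n) x (x + h) (df n)) as (z & Hz & E).
    - intros y Hy; apply Hd.
      unfold Rmin, Rmax, Rabs in *; destruct (Rle_dec x (x + h)), (Rcase_abs h), (Rcase_abs (y - x)); lra.
    - intros y Hy; apply continuity_pt_filterlim, @ex_derive_continuous.
      exists (df n y); apply Hd.
      unfold Rmin, Rmax, Rabs in *; destruct (Rle_dec x (x + h)), (Rcase_abs h), (Rcase_abs (y - x)); lra.
    - rewrite E; replace (df n z * (x + h - x) / h) with (df n z) by (field; exact Hh0).
      apply Hd.
      unfold Rmin, Rmax, Rabs in *; destruct (Rle_dec x (x + h)), (Rcase_abs h), (Rcase_abs (z - x)); lra. }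
  assert (Sq : is_series q ((Series (fun n => f n (x + h)) - Series (fun n => f n x)) / h)).
  { replace ((Series (fun n => f n (x + h)) - Series (fun n => f n x)) / h) with
      (scal (/ h) (minus (Series (fun n => f n (x + h))) (Series (fun n => f n x)))).
    2:{ unfold scal, minus, plus, opp; simpl; unfold mult; simpl; field; exact Hh0. }
    refine (is_series_ext _ _ _ _ (is_series_scal (/ h) _ _ (is_series_minus _ _ _ _
      (Series_correct _ (Hs _ XH)) (Series_correct _ (Hs _ X0))))).
    intros n; unfold scal, q, minus, plus, opp; simpl; unfold mult; simpl; field; exact Hh0. }
  assert (T1 := is_series_tail_le q M _ N Hq HM Sq).
  destruct (Series_abs_le (fun n => df n x) M (fun n => proj2 (Hd n x X0)) HM) as [Ed _].
  assert (T2 := is_series_tail_le (fun n => df n x) M _ N (fun n => proj2 (Hd n x X0)) HM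
    (Series_correct _ Ed)).
  assert (Rq : rsum N q = (rsum N (fun n => f n (x + h)) - rsum N (fun n => f n x)) / h).
  { unfold q, Rdiv; rewrite Rmult_comm.
    rewrite (rsum_ext N _ (fun n => / h * (f n (x + h) + -1 * f n x))) by (intros; ring).
    rewrite rsum_scal, rsum_plus, rsum_scal; ring. }
  rewrite <- Rq in HD.
  apply Rabs_def2 in HN; rewrite Em in *.
  set (L := (Series (fun n => f n (x + h)) - Series (fun n => f n x)) / h) in *.
  unfold Rabs in *; repeat destruct Rcase_abs; lra.
Qed.

(** * Pointwise convergence of Fourier series *)

Lemma cont_mult (f g : R -> R) : cont f -> cont g -> cont (fun t => f t * g t).
Proof. intros Hf Hg t; apply (continuous_mult f g); auto. Qed.

Lemma cont_const (c : R) : cont (fun _ => c).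
Proof. intros t; apply continuous_const. Qed.

Lemma cont_plus (f g : R -> R) : cont f -> cont g -> cont (fun t => f t + g t).
Proof. intros Hf Hg t; apply (continuous_plus f g); auto. Qed.

Lemma cont_minus (f g : R -> R) : cont f -> cont g -> cont (fun t => f t - g t).
Proof. intros Hf Hg t; apply (continuous_minus f g); auto. Qed.

Ltac solve_cont :=
  first [assumption | lazymatch goal with
    | |- cont (fun _ => ?c) => apply (cont_const c)
    | |- cont (fun t => @?f t + @?g t) => apply (cont_plus f g); solve_cont
    | |- cont (fun t => @?f t - @?g t) => apply (cont_minus f g); solve_cont
    | |- cont (fun t => @?f t * @?g t) => apply (cont_mult f g); solve_cont
    | |- _ => first [solve [auto] | intros ?; apply @ex_derive_continuous; auto_derive; exact I]
    end].

Lemma cont_cos (w p : R) : cont (fun t => cos (w * t + p)).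
Proof. intros t; apply @ex_derive_continuous; auto_derive; exact I. Qed.

Lemma cont_bounded (g : R -> R) (a b : R) : a <= b -> cont g ->
  exists M, 0 <= M /\ forall t, a <= t <= b -> Rabs (g t) <= M.
Proof.
  intros Hab Cg.
  assert (C : forall t, a <= t <= b -> continuity_pt (fun t => Rabs (g t)) t).
  { intros t _; apply continuity_pt_filterlim.
    apply (continuous_comp g Rabs); [apply Cg|apply continuous_Rabs]. }
  destruct (continuity_ab_maj _ a b Hab C) as (m & Hm & _).
  exists (Rabs (g m)); split; [apply Rabs_pos|exact Hm].
Qed.

Lemma RInt_abs_le_const (f : R -> R) (a b M : R) : a <= b -> cont f ->
  (forall t, a <= t <= b -> Rabs (f t) <= M) -> Rabs (RInt f a b) <= (b - a) * M.
Proof.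
  intros Hab Cf H; apply abs_RInt_le_const; [exact Hab|apply cont_ex_RInt, Cf|exact H].
Qed.

Lemma RInt_ext_le (f g : R -> R) (a b : R) : a <= b ->
  (forall t, a <= t <= b -> f t = g t) -> RInt f a b = RInt g a b.
Proof.
  intros H E; apply RInt_ext; rewrite Rmin_left, Rmax_right by exact H; intros t Ht; apply E; lra.
Qed.

Lemma RInt_minus_cont (f g : R -> R) (a b : R) : cont f -> cont g ->
  RInt (fun t => f t - g t) a b = RInt f a b - RInt g a b.
Proof.
  intros Cf Cg; apply (RInt_minus (V := R_CompleteNormedModule)); apply cont_ex_RInt; assumption.
Qed.

Lemma RInt_plus_cont (f g : R -> R) (a b : R) : cont f -> cont g ->
  RInt (fun t => f t + g t) a b = RInt f a b + RInt g a b.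
Proof.
  intros Cf Cg; apply (RInt_plus (V := R_CompleteNormedModule)); apply cont_ex_RInt; assumption.
Qed.

Lemma RInt_scal_cont (f : R -> R) (c a b : R) : cont f ->
  RInt (fun t => c * f t) a b = c * RInt f a b.
Proof.
  intros Cf; apply (RInt_scal (V := R_CompleteNormedModule)); apply cont_ex_RInt; assumption.
Qed.

Lemma RInt_shift (f : R -> R) (h a b : R) : cont f ->
  RInt (fun t => f (t + h)) a b = RInt f (a + h) (b + h).
Proof.
  intros Cf; pose proof (RInt_comp_affine f 1 h a b Cf) as H.
  rewrite !Rmult_1_l in H; rewrite <- H; apply RInt_ext; intros; f_equal; ring.
Qed.

Lemma cont_shift (f : R -> R) (h : R) : cont f -> cont (fun t => f (t + h)).
Proof.
  intros Cf t; apply (continuous_comp (fun t => t + h) f); [|apply Cf].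
  apply @ex_derive_continuous; auto_derive; exact I.
Qed.

(* Shifting by half a period changes the sign of the oscillating factor. *)
Lemma riemann_lebesgue (g : R -> R) (p : R) : cont g ->
  is_lim_seq (fun K => RInt (fun t => g t * cos ((2 * INR K + 1) * PI * t + p)) (- / 2) (/ 2)) 0.
Proof.
  intros Cg.
  destruct (cont_bounded g (-1) 1 ltac:(lra) Cg) as (M & M0 & HM).
  apply is_lim_seq_spec; intros eps; pose proof (cond_pos eps) as He.
  assert (He2 : 0 < eps / 2) by lra.
  destruct (@Heine_cor2 g (-1) 1 (fun x _ => proj2 (continuity_pt_filterlim g x) (Cg x))
    (mkposreal _ He2)) as [delta Hd]; simpl in Hd.
  (* The bound [rho] on the shift h collects three demands: g varies by less than eps / 2 over h,
     the shifted interval stays within [-1, 1], and each of the two boundary strips of width h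
     contributes at most eps / 4. *)
  assert (HR : 0 < Rmin (Rmin delta (/ 2)) (eps / (4 * (M + 1)))).
  { repeat apply Rmin_pos; [apply cond_pos|lra|apply Rdiv_lt_0_compat; lra]. }
  set (rho := Rmin (Rmin delta (/ 2)) (eps / (4 * (M + 1)))) in *.
  destruct (nfloor_ex (/ rho)) as [N HN]; [left; apply Rinv_0_lt_compat, HR|].
  exists (S N); intros K HK; rewrite Rminus_0_r.
  apply le_INR in HK; rewrite S_INR in HK.
  set (h := / (2 * INR K + 1)).
  assert (HKp : 0 < INR K) by (pose proof (pos_INR N); lra).
  assert (Hh : 0 < h) by (apply Rinv_0_lt_compat; lra).
  assert (Hr : h < rho).
  { unfold h; rewrite <- (Rinv_inv rho); apply Rinv_lt_contravar; [|lra].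
    apply Rmult_lt_0_compat; [apply Rinv_0_lt_compat, HR|lra]. }
  assert (Hr1 : h < delta) by (pose proof (Rmin_l (Rmin delta (/ 2)) (eps / (4 * (M + 1))));
    pose proof (Rmin_l delta (/ 2)); unfold rho in Hr; lra).
  assert (Hr2 : h < / 2) by (pose proof (Rmin_l (Rmin delta (/ 2)) (eps / (4 * (M + 1))));
    pose proof (Rmin_r delta (/ 2)); unfold rho in Hr; lra).
  assert (Hr3 : h * M <= eps / 4).
  { pose proof (Rmin_r (Rmin delta (/ 2)) (eps / (4 * (M + 1)))).
    apply Rle_trans with (eps / (4 * (M + 1)) * M);
      [apply Rmult_le_compat_r; unfold rho in Hr; lra|].
    apply (Rmult_le_reg_r (4 * (M + 1))); [lra|].
    replace (eps / (4 * (M + 1)) * M * (4 * (M + 1))) with (eps * M) by (field; lra).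
    replace (eps / 4 * (4 * (M + 1))) with (eps * M + eps) by field; lra. }
  set (w := (2 * INR K + 1) * PI).
  assert (Cs : cont (fun t => cos (w * t + p))) by apply cont_cos.
  set (F := fun t => g t * cos (w * t + p)).
  assert (CF : cont F) by (apply cont_mult; assumption).
  set (D := fun t => (g t - g (t + h)) * cos (w * t + p)).
  assert (CD : cont D).
  { apply (cont_mult (fun t => g t - g (t + h))); [|exact Cs].
    intros t; apply (continuous_minus g (fun t => g (t + h))); [apply Cg|apply cont_shift, Cg]. }
  assert (E : forall t, D t = F t + F (t + h)).
  { intros t; unfold D, F.
    replace (w * (t + h) + p) with ((w * t + p) + PI) by (unfold w, h; field; lra).
    rewrite neg_cos; ring. }
  assert (ED : RInt D (- / 2) (/ 2) = RInt F (- / 2) (/ 2) + RInt F (- / 2 + h) (/ 2 + h) :> R).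
  { rewrite <- (RInt_shift F h), <- RInt_plus_cont by auto using cont_shift.
    apply RInt_ext; intros; apply E. }
  pose proof (RInt_Chasles_cont F (- / 2) (- / 2 + h) (/ 2) CF) as C1.
  pose proof (RInt_Chasles_cont F (- / 2 + h) (/ 2) (/ 2 + h) CF) as C2.
  assert (B : forall t, -1 <= t <= 1 -> Rabs (F t) <= M).
  { intros t Ht; unfold F; rewrite Rabs_mult, <- (Rmult_1_r M).
    apply Rmult_le_compat; auto using Rabs_pos.
    apply Rabs_le; apply COS_bound. }
  assert (B1 : Rabs (RInt F (- / 2) (- / 2 + h)) <= (- / 2 + h - - / 2) * M).
  { apply RInt_abs_le_const; [lra|exact CF|intros; apply B; lra]. }
  assert (B2 : Rabs (RInt F (/ 2) (/ 2 + h)) <= (/ 2 + h - / 2) * M).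
  { apply RInt_abs_le_const; [lra|exact CF|intros; apply B; lra]. }
  assert (B3 : Rabs (RInt D (- / 2) (/ 2)) <= (/ 2 - - / 2) * (eps / 2)).
  { apply RInt_abs_le_const; [lra|exact CD|].
    intros t Ht; unfold D; rewrite Rabs_mult, <- (Rmult_1_r (eps / 2)).
    apply Rmult_le_compat; auto using Rabs_pos.
    - left; apply Hd; try lra.
      replace (t - (t + h)) with (- h) by ring; rewrite Rabs_Ropp, Rabs_pos_eq; lra.
    - apply Rabs_le; apply COS_bound. }
  fold w; fold F.
  replace (- / 2 + h - - / 2) with h in B1 by ring; replace (/ 2 + h - / 2) with h in B2 by ring.
  set (i0 := RInt F (- / 2) (/ 2) : R) in *.
  set (i1 := RInt F (- / 2) (- / 2 + h) : R) in *.
  set (i2 := RInt F (/ 2) (/ 2 + h) : R) in *.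
  set (i3 := RInt F (- / 2 + h) (/ 2) : R) in *.
  set (i4 := RInt F (- / 2 + h) (/ 2 + h) : R) in *.
  set (i5 := RInt D (- / 2) (/ 2) : R) in *.
  assert (X : 2 * i0 = i5 + i1 - i2).
  { change (i1 + i3 = i0) in C1; change (i3 + i2 = i4) in C2; lra. }
  change (Rabs i0 < eps).
  apply Rabs_le_between in B1; apply Rabs_le_between in B2; apply Rabs_le_between in B3.
  apply Rabs_def1; lra.
Qed.

Lemma sin_kernel (K : nat) (t : R) :
  2 * sin (PI * t) * rsum K (fun k => cos (2 * PI * INR (S k) * t)) =
    sin ((2 * INR K + 1) * PI * t) - sin (PI * t) /\
  2 * sin (PI * t) * rsum K (fun k => sin (2 * PI * INR (S k) * t)) =
    cos (PI * t) - cos ((2 * INR K + 1) * PI * t).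
Proof.
  induction K as [|K [IH1 IH2]].
  - simpl; replace ((2 * 0 + 1) * PI * t) with (PI * t) by ring; split; ring.
  - cbn [rsum]; rewrite !Rmult_plus_distr_l, IH1, IH2, S_INR.
    replace ((2 * (INR K + 1) + 1) * PI * t) with (2 * PI * (INR K + 1) * t + PI * t) by ring.
    replace ((2 * INR K + 1) * PI * t) with (2 * PI * (INR K + 1) * t - PI * t) by ring.
    rewrite sin_plus, sin_minus, cos_plus, cos_minus; split; ring.
Qed.

Lemma sin_PI_neq_0 (t : R) : Rabs t < 1 -> t <> 0 -> sin (PI * t) <> 0.
Proof.
  intros Ht T0; pose proof PI_RGT_0.
  apply Rabs_def2 in Ht; destruct (Rdichotomy _ _ T0).
  - replace (PI * t) with (- (PI * - t)) by ring; rewrite sin_neg.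
    pose proof (sin_gt_0 (PI * - t) ltac:(nra) ltac:(nra)); lra.
  - pose proof (sin_gt_0 (PI * t) ltac:(nra) ltac:(nra)); lra.
Qed.

Lemma RInt_cos_period (k : nat) : RInt (fun t => cos (2 * PI * INR (S k) * t)) (- / 2) (/ 2) = 0.
Proof.
  assert (K : 0 < INR (S k)) by (apply lt_0_INR; lia).
  pose proof PI_RGT_0.
  set (w := 2 * PI * INR (S k)); assert (W : w <> 0) by (unfold w; nra).
  apply is_RInt_unique.
  replace 0 with (sin (w * / 2) / w - sin (w * - / 2) / w).
  - apply (is_RInt_derive (fun t => sin (w * t) / w)).
    + intros t _; auto_derive; [exact I|field; exact W].
    + intros t _; apply @ex_derive_continuous; auto_derive; exact I.
  - replace (w * - / 2) with (- (w * / 2)) by ring; rewrite sin_neg.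
    replace (sin (w * / 2)) with 0; [field; exact W|].
    symmetry; apply sin_eq_0_1; exists (Z.of_nat (S k)); rewrite <- INR_IZR_INZ; unfold w; field.
Qed.

Lemma RInt_sin_period (k : nat) : RInt (fun t => sin (2 * PI * INR (S k) * t)) (- / 2) (/ 2) = 0.
Proof.
  assert (K : 0 < INR (S k)) by (apply lt_0_INR; lia).
  pose proof PI_RGT_0.
  set (w := 2 * PI * INR (S k)); assert (W : w <> 0) by (unfold w; nra).
  apply is_RInt_unique.
  replace 0 with (- cos (w * / 2) / w - - cos (w * - / 2) / w).
  - apply (is_RInt_derive (fun t => - cos (w * t) / w)).
    + intros t _; auto_derive; [exact I|field; exact W].
    + intros t _; apply @ex_derive_continuous; auto_derive; exact I.
  - replace (w * - / 2) with (- (w * / 2)) by ring; rewrite cos_neg; field; exact W.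
Qed.

Lemma RInt_rsum (f : nat -> R -> R) (n : nat) (a b : R) : (forall k, cont (f k)) ->
  RInt (fun t => rsum n (fun k => f k t)) a b = rsum n (fun k => RInt (f k) a b).
Proof.
  intros Cf; induction n; cbn [rsum].
  - rewrite RInt_const; unfold scal; simpl; unfold mult; simpl; apply Rmult_0_r.
  - rewrite <- IHn; apply (RInt_plus_cont (fun t => rsum n (fun k => f k t)) (f n)); auto using cont_rsum.
Qed.

(* Dividing by the sine, which vanishes only at 0 where f - f(0) does too, turns the
   partial sums into integrals of a continuous function against a single oscillation. *)
Lemma fourier_pointwise (f : R -> R) (d : R) : cont f -> is_derive f 0 d ->
  is_series (fun k => RInt (fun t => f t * cos (2 * PI * INR (S k) * t)) (- / 2) (/ 2))
    ((f 0 - RInt f (- / 2) (/ 2)) / 2) /\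
  exists l : R, is_series (fun k => RInt (fun t => f t * sin (2 * PI * INR (S k) * t)) (- / 2) (/ 2)) l.
Proof.
  intros Cf Df; pose proof PI_RGT_0 as P0.
  set (F := fun t => f t - f 0).
  assert (CF : cont F).
  { intros t; apply (continuous_minus f (fun _ => f 0)); [apply Cf|apply continuous_const]. }
  (* The value at 0 is the limit of the quotient, which exists because f is differentiable there. *)
  set (g0 := fun t => if Req_EM_T t 0 then d / (2 * PI) else F t / (2 * sin (PI * t))).
  assert (Cg0 : forall t, Rabs t < 1 -> continuous g0 t).
  { intros t Ht; destruct (Req_dec t 0) as [->|T0].
    - apply continuity_pt_filterlim; intros eps Heps.
      assert (L : is_lim (fun t => F t / t / (2 * (sin (PI * t) / t))) 0 (d / (2 * PI))).
      { apply (is_lim_div (fun t => F t / t) (fun t => 2 * (sin (PI * t) / t)) 0 d (2 * PI));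
          [|apply (is_lim_scal_l (fun t => sin (PI * t) / t) 2 0 PI)|intros Q; injection Q; lra|exact I].
        - apply is_derive_Reals in Df; apply is_lim_spec; intros e.
          destruct (Df e (cond_pos e)) as [del Hdel]; exists del; intros y Hy Hy0.
          specialize (Hdel y Hy0); rewrite Rplus_0_l in Hdel; apply Hdel.
          unfold ball in Hy; simpl in Hy;
            unfold AbsRing_ball, abs, minus, plus, opp in Hy; simpl in Hy;
            replace y with (y + - 0) by ring; exact Hy.
        - assert (D : is_derive (fun t => sin (PI * t)) 0 PI).
          { auto_derive; [exact I|rewrite Rmult_0_r, cos_0; ring]. }
          apply is_derive_Reals in D; apply is_lim_spec; intros e.
          destruct (D e (cond_pos e)) as [del Hdel]; exists del; intros y Hy Hy0.
          specialize (Hdel y Hy0); rewrite Rplus_0_l, Rmult_0_r, sin_0, Rminus_0_r in Hdel.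
          apply Hdel; unfold ball in Hy; simpl in Hy;
            unfold AbsRing_ball, abs, minus, plus, opp in Hy; simpl in Hy;
            replace y with (y + - 0) by ring; exact Hy. }
      apply is_lim_spec in L; destruct (L (mkposreal _ Heps)) as [del Hdel]; simpl in Hdel.
      exists (Rmin del 1); split; [apply Rmin_pos; [apply cond_pos|lra]|].
      intros y [[_ Hy0] Hy]; simpl in Hy; unfold Rdist in *; simpl.
      unfold Rdist; rewrite Rminus_0_r in Hy.
      unfold g0; destruct (Req_EM_T y 0) as [|_]; [congruence|].
      destruct (Req_EM_T 0 0) as [_|]; [|congruence].
      assert (Y0 : y <> 0) by congruence.
      pose proof (sin_PI_neq_0 y (Rlt_le_trans _ _ _ Hy (Rmin_r _ _)) Y0) as S0.
      replace (F y / (2 * sin (PI * y))) with (F y / y / (2 * (sin (PI * y) / y)))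
        by (field; split; assumption).
      apply Hdel; [|exact Y0].
      unfold ball; simpl; unfold AbsRing_ball, abs, minus, plus, opp; simpl.
      rewrite Ropp_0, Rplus_0_r; eapply Rlt_le_trans; [exact Hy|apply Rmin_l].
    - apply (continuous_ext_loc _ (fun t => F t * / (2 * sin (PI * t)))).
      + assert (Hp : 0 < Rabs t) by (apply Rabs_pos_lt, T0).
        exists (mkposreal _ Hp); intros y Hy; unfold g0; destruct (Req_EM_T y 0) as [->|]; [|reflexivity].
        exfalso; unfold ball in Hy; simpl in Hy;
          unfold AbsRing_ball, abs, minus, plus, opp in Hy; simpl in Hy.
        rewrite Rplus_0_l, Rabs_Ropp in Hy; lra.
      + apply (continuous_mult F (fun t => / (2 * sin (PI * t)))); [apply CF|].
        apply @ex_derive_continuous; auto_derive.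
        pose proof (sin_PI_neq_0 t Ht T0); lra. }
  (* [riemann_lebesgue] asks for continuity on the whole line, whereas the sine vanishes again at 1
     and - 1. Freezing the argument outside [- 3/4, 3/4] leaves the interval of integration
     untouched. *)
  set (clamp := fun t => Rmax (- (3 / 4)) (Rmin (3 / 4) t)).
  set (g := fun t => g0 (clamp t)).
  assert (Hcl : forall t, Rabs (clamp t) < 1).
  { intros t; unfold clamp, Rmax, Rmin; repeat destruct Rle_dec; apply Rabs_def1; lra. }
  assert (Hcl2 : forall t, - / 2 <= t <= / 2 -> clamp t = t).
  { intros t Ht; unfold clamp; rewrite Rmin_right, Rmax_right; lra. }
  assert (Cg : cont g).
  { intros t; apply (continuous_comp clamp g0); [|apply Cg0, Hcl].
    apply continuity_pt_filterlim; intros eps Heps; exists eps; split; [exact Heps|].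
    intros y [_ Hy]; simpl in *; unfold Rdist in *.
    eapply Rle_lt_trans; [|exact Hy].
    unfold clamp, Rmax, Rmin; repeat destruct Rle_dec; unfold Rabs; repeat destruct Rcase_abs; lra. }
  assert (Hg : forall t, - / 2 <= t <= / 2 -> F t = g t * (2 * sin (PI * t))).
  { intros t Ht; unfold g; rewrite Hcl2 by exact Ht; unfold g0; destruct (Req_EM_T t 0) as [->|T0].
    - rewrite Rmult_0_r, sin_0; unfold F; ring.
    - field; apply sin_PI_neq_0; [apply Rabs_def1; lra|exact T0]. }
  assert (Cc : forall k, cont (fun t => cos (2 * PI * INR (S k) * t))).
  { intros k t; apply @ex_derive_continuous; auto_derive; exact I. }
  assert (Cn : forall k, cont (fun t => sin (2 * PI * INR (S k) * t))).
  { intros k t; apply @ex_derive_continuous; auto_derive; exact I. }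
  assert (Csp : cont (fun t => sin (PI * t))).
  { intros t; apply @ex_derive_continuous; auto_derive; exact I. }
  assert (Ccp : cont (fun t => cos (PI * t))).
  { intros t; apply @ex_derive_continuous; auto_derive; exact I. }
  assert (Ck : forall K p, cont (fun t => cos ((2 * INR K + 1) * PI * t + p))).
  { intros K p; apply cont_cos. }
  assert (Hint : - / 2 <= / 2) by lra.
  split.
  - apply is_series_rsum.
    apply (is_lim_seq_ext (fun K => RInt (fun t => g t * cos ((2 * INR K + 1) * PI * t + - (PI / 2))) (- / 2) (/ 2)
       - / 2 * RInt F (- / 2) (/ 2))).
    + intros K.
      rewrite <- RInt_scal_cont, <- RInt_minus_cont by solve_cont.
      transitivity (RInt (fun t => rsum K (fun k => F t * cos (2 * PI * INR (S k) * t))) (- / 2) (/ 2)).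
      * apply RInt_ext_le; [exact Hint|]; intros t Ht.
        rewrite rsum_scal, !Hg by lra.
        replace (cos ((2 * INR K + 1) * PI * t + - (PI / 2))) with (sin ((2 * INR K + 1) * PI * t)).
        2:{ rewrite <- cos_shift, <- cos_neg; f_equal; ring. }
        rewrite (Rmult_assoc (g t)), (proj1 (sin_kernel K t)); field.
      * rewrite (RInt_rsum (fun k t => F t * cos (2 * PI * INR (S k) * t))) by (intros; solve_cont).
        apply rsum_ext; intros k _.
        transitivity (RInt (fun t => f t * cos (2 * PI * INR (S k) * t)) (- / 2) (/ 2)
          - f 0 * RInt (fun t => cos (2 * PI * INR (S k) * t)) (- / 2) (/ 2)).
        -- rewrite <- RInt_scal_cont, <- RInt_minus_cont by solve_cont.
           apply RInt_ext_le; [exact Hint|]; intros; unfold F; ring.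
        -- rewrite RInt_cos_period, Rmult_0_r, Rminus_0_r; reflexivity.
    + replace (Finite ((f 0 - RInt f (- / 2) (/ 2)) / 2)) with (Finite (0 - / 2 * RInt F (- / 2) (/ 2))).
      * apply is_lim_seq_minus'; [apply riemann_lebesgue, Cg|apply is_lim_seq_const].
      * assert (E : RInt F (- / 2) (/ 2) = RInt f (- / 2) (/ 2) - f 0 :> R).
        { unfold F; rewrite RInt_minus_cont by solve_cont.
          rewrite (RInt_const (V := R_CompleteNormedModule)).
          generalize (RInt f (- / 2) (/ 2) : R); intros i.
          change (i - (/ 2 - - / 2) * f 0 = i - f 0); field. }
        rewrite E; apply (f_equal Finite).
        generalize (RInt f (- / 2) (/ 2) : R); intros i; field.
  - exists (RInt (fun t => g t * cos (PI * t)) (- / 2) (/ 2)).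
    apply is_series_rsum.
    apply (is_lim_seq_ext (fun K => RInt (fun t => g t * cos (PI * t)) (- / 2) (/ 2) -
       RInt (fun t => g t * cos ((2 * INR K + 1) * PI * t + 0)) (- / 2) (/ 2))).
    + intros K; rewrite <- RInt_minus_cont by solve_cont.
      transitivity (RInt (fun t => rsum K (fun k => F t * sin (2 * PI * INR (S k) * t))) (- / 2) (/ 2)).
      * apply RInt_ext_le; [exact Hint|]; intros t Ht.
        rewrite rsum_scal, !Hg, Rplus_0_r by lra.
        rewrite (Rmult_assoc (g t)), (proj2 (sin_kernel K t)); field.
      * rewrite (RInt_rsum (fun k t => F t * sin (2 * PI * INR (S k) * t))) by (intros; solve_cont).
        apply rsum_ext; intros k _.
        transitivity (RInt (fun t => f t * sin (2 * PI * INR (S k) * t)) (- / 2) (/ 2)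
          - f 0 * RInt (fun t => sin (2 * PI * INR (S k) * t)) (- / 2) (/ 2)).
        -- rewrite <- RInt_scal_cont, <- RInt_minus_cont by solve_cont.
           apply RInt_ext_le; [exact Hint|]; intros; unfold F; ring.
        -- rewrite RInt_sin_period, Rmult_0_r, Rminus_0_r; reflexivity.
    + replace (Finite (RInt (fun t => g t * cos (PI * t)) (- / 2) (/ 2))) with
        (Finite (RInt (fun t => g t * cos (PI * t)) (- / 2) (/ 2) - 0)).
      * apply is_lim_seq_minus'; [apply is_lim_seq_const|apply riemann_lebesgue, Cg].
      * apply (f_equal Finite), Rminus_0_r.
Qed.

(** * The theta family *)

Definition yval (n : nat) (t : R) : R := INR (S n) ^ 2 * exp (- t).
Definition sterm (p n : nat) (t : R) : R := yval n t ^ p * exp (- yval n t).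
(* With x = exp t: the sum over k >= 1 of y^p exp(-y), y = k^2 / x. *)
Definition ssum (p : nat) (t : R) : R := Series (fun n => sterm p n t).

Lemma yval_pos (n : nat) (t : R) : 0 < yval n t /\ exp (- t) <= yval n t.
Proof.
  assert (H : 1 <= INR (S n) ^ 2).
  { apply pow_R1_Rle; rewrite S_INR; pose proof (pos_INR n); lra. }
  pose proof (exp_pos (- t)); unfold yval; split; nra.
Qed.

Definition sconst (p q : nat) : R := (2 * INR (p + q)) ^ (p + q).

(** Half of exp (- y) absorbs y^(p + q) and leaves y^(- q), that is exp (q t) / k^(2 q); the other
    half gives the doubly exponential factor. The rate q is free, so the decay towards - oo is as
    fast as desired. *)
Lemma sterm_bound (p q n : nat) (t : R) : (1 <= q)%nat ->
  0 <= sterm p n t <= sconst p q * exp (INR q * t) * exp (- (exp (- t) / 2)) * / INR (S n) ^ 2.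
Proof.
  intros Hq; destruct (yval_pos n t) as [Y0 Y1]; unfold sterm.
  set (y := yval n t) in *.
  split; [apply Rmult_le_pos; [apply pow_le; lra|left; apply exp_pos]|].
  pose proof (pow_exp_half (p + q) y ltac:(lra)) as B; fold (sconst p q) in B.
  assert (N1 : 1 <= INR (S n)) by (rewrite S_INR; pose proof (pos_INR n); lra).
  assert (Yq : 0 < y ^ q) by (apply pow_lt, Y0).
  assert (E1 : y ^ p * exp (- y) <= sconst p q * exp (- (exp (- t) / 2)) * / y ^ q).
  { apply (Rmult_le_reg_r (y ^ q)); [exact Yq|].
    replace (sconst p q * exp (- (exp (- t) / 2)) * / y ^ q * y ^ q) with
      (sconst p q * exp (- (exp (- t) / 2))) by (field; lra).
    replace (y ^ p * exp (- y) * y ^ q) with (y ^ (p + q) * exp (- (y / 2)) * exp (- (y / 2))).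
    - apply Rmult_le_compat; try (left; apply exp_pos).
      + apply Rmult_le_pos; [apply pow_le; lra|left; apply exp_pos].
      + exact B.
      + apply exp_le; lra.
    - rewrite pow_add, Rmult_assoc, <- exp_plus.
      replace (- (y / 2) + - (y / 2)) with (- y) by field; ring. }
  eapply Rle_trans; [exact E1|].
  assert (E2 : / y ^ q <= exp (INR q * t) * / INR (S n) ^ 2).
  { unfold y, yval; rewrite Rpow_mult_distr, Rinv_mult, <- exp_INR, <- exp_Ropp, Rmult_comm.
    replace (- (INR q * - t)) with (INR q * t) by ring.
    apply Rmult_le_compat_l; [left; apply exp_pos|].
    apply Rinv_le_contravar; [apply pow_lt; lra|].
    rewrite <- pow_mult; apply Rle_pow; [exact N1|lia]. }
  assert (C0 : 0 <= sconst p q * exp (- (exp (- t) / 2))).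
  { apply Rmult_le_pos; [|left; apply exp_pos].
    apply pow_le; pose proof (pos_INR (p + q)); lra. }
  eapply Rle_trans; [apply Rmult_le_compat_l; [exact C0|exact E2]|right; ring].
Qed.

Lemma sterm_summable (p : nat) (t : R) : ex_series (fun n => sterm p n t).
Proof.
  apply (Series_abs_le _ (fun n => sconst p 1 * exp (INR 1 * t) * exp (- (exp (- t) / 2)) * / INR (S n) ^ 2)).
  - intros n; destruct (sterm_bound p 1 n t (le_n _)); rewrite Rabs_pos_eq; assumption.
  - apply (@ex_series_scal R_AbsRing R_NormedModule), series_inv_sq.
Qed.

Lemma ssum_bound (p q : nat) (t : R) : (1 <= q)%nat ->
  0 <= ssum p t <= 2 * sconst p q * exp (INR q * t) * exp (- (exp (- t) / 2)).
Proof.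
  intros Hq; set (K := sconst p q * exp (INR q * t) * exp (- (exp (- t) / 2))).
  destruct series_inv_sq as [S1 S2].
  assert (B : forall n, 0 <= sterm p n t <= K * / INR (S n) ^ 2)
    by (intros n; apply sterm_bound, Hq).
  assert (K0 : 0 <= K).
  { unfold K; repeat apply Rmult_le_pos; try (left; apply exp_pos).
    apply pow_le; pose proof (pos_INR (p + q)); lra. }
  split.
  - replace 0 with (Series (fun _ : nat => 0)).
    + apply Series_le; [|apply sterm_summable]; intros n; split; [lra|apply B].
    + apply is_series_unique, is_series_rsum, (is_lim_seq_ext (fun _ => 0)).
      * intros n; rewrite rsum_const; ring.
      * apply is_lim_seq_const.
  - apply Rle_trans with (Series (fun n => K * / INR (S n) ^ 2)).
    + apply Series_le; [exact B|].
      apply (@ex_series_scal R_AbsRing R_NormedModule), S1.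
    + rewrite Series_scal_l; replace (2 * _ * _ * _) with (K * 2) by (unfold K; ring).
      apply Rmult_le_compat_l; assumption.
Qed.

Lemma ssum_bound_exp (p q : nat) (t : R) : (1 <= q)%nat ->
  0 <= ssum p t <= 2 * sconst p q * exp (INR q * t).
Proof.
  intros Hq; destruct (ssum_bound p q t Hq) as [A B]; split; [exact A|].
  eapply Rle_trans; [exact B|].
  rewrite <- (Rmult_1_r (2 * sconst p q * exp (INR q * t))) at 2.
  apply Rmult_le_compat_l.
  - repeat apply Rmult_le_pos; [lra|apply pow_le; pose proof (pos_INR (p + q)); lra|left; apply exp_pos].
  - rewrite <- exp_0; apply exp_le; pose proof (exp_pos (- t)); lra.
Qed.

Lemma sterm_derive (p n : nat) (t : R) :
  is_derive (sterm p n) t (sterm (S p) n t - INR p * sterm p n t).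
Proof.
  unfold sterm, yval; auto_derive; [exact I|].
  destruct p as [|p]; [simpl; ring|].
  simpl pred; simpl pow; ring.
Qed.

(** Since dy/dt = - y, differentiation maps the family into itself; this is why all powers p are
    treated together. *)
Lemma ssum_derive (p : nat) (t : R) :
  is_derive (ssum p) t (ssum (S p) t - INR p * ssum p t).
Proof.
  unfold ssum; rewrite <- Series_scal_l, <- Series_minus;
    [|apply sterm_summable|apply (@ex_series_scal R_AbsRing R_NormedModule), sterm_summable].
  set (K := (sconst (S p) 1 + INR p * sconst p 1) * exp (t + 1)).
  apply (is_derive_Series (sterm p) (fun n t => sterm (S p) n t - INR p * sterm p n t)
    (fun n => K * / INR (S n) ^ 2)).
  - intros n y Hy; split; [apply sterm_derive|].
    apply Rabs_def2 in Hy.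
    destruct (sterm_bound (S p) 1 n y (le_n _)) as [A1 B1].
    destruct (sterm_bound p 1 n y (le_n _)) as [A2 B2].
    pose proof (pos_INR p) as Hp.
    set (i := / INR (S n) ^ 2) in *.
    assert (Hi : 0 < i) by (apply Rinv_0_lt_compat, pow_lt, lt_0_INR; lia).
    assert (G : exp (INR 1 * y) * exp (- (exp (- y) / 2)) * i <= exp (t + 1) * i).
    { apply Rmult_le_compat_r; [lra|]; rewrite <- exp_plus; apply exp_le.
      simpl INR; pose proof (exp_pos (- y)); lra. }
    set (g := exp (INR 1 * y) * exp (- (exp (- y) / 2)) * i) in *.
    assert (C1 : 0 <= sconst (S p) 1) by (apply pow_le; pose proof (pos_INR (S p + 1)); lra).
    assert (C2 : 0 <= sconst p 1) by (apply pow_le; pose proof (pos_INR (p + 1)); lra).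
    replace (sconst (S p) 1 * exp (INR 1 * y) * exp (- (exp (- y) / 2)) * i) with
      (sconst (S p) 1 * g) in B1 by (unfold g; ring).
    replace (sconst p 1 * exp (INR 1 * y) * exp (- (exp (- y) / 2)) * i) with
      (sconst p 1 * g) in B2 by (unfold g; ring).
    replace (K * i) with (sconst (S p) 1 * (exp (t + 1) * i) + INR p * (sconst p 1 * (exp (t + 1) * i)))
      by (unfold K; ring).
    pose proof (Rmult_le_compat_l _ _ _ C1 G); pose proof (Rmult_le_compat_l _ _ _ C2 G) as G2.
    assert (H3 : 0 <= INR p * sterm p n y <= INR p * (sconst p 1 * (exp (t + 1) * i))).
    { split; [apply Rmult_le_pos; assumption|apply Rmult_le_compat_l; lra]. }
    apply Rabs_le; lra.
  - apply (@ex_series_scal R_AbsRing R_NormedModule), series_inv_sq.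
  - intros y _; apply sterm_summable.
Qed.

(** * Gaussian integrals and the theta function *)

Definition gauss (k t : R) : R := exp (- (k * t ^ 2)).

Lemma gauss_cont (k : R) : cont (gauss k).
Proof. intros t; apply @ex_derive_continuous; unfold gauss; auto_derive; exact I. Qed.

Lemma gauss_poly_dom (k : R) (n : nat) : 0 < k -> exists C, forall t, 0 <= t ->
  t ^ n * gauss k t <= C * exp (- (1 * t)).
Proof.
  intros Hk.
  set (c := (2 * INR n) ^ n * exp (9 / (4 * k))).
  exists c; intros t Ht; unfold c, gauss.
  pose proof (pow_exp_half n t Ht) as B.
  replace (exp (- (k * t ^ 2))) with
    (exp (- (t / 2)) * exp (- (k * t ^ 2) + 3 / 2 * t) * exp (- (1 * t)))
    by (rewrite <- !exp_plus; f_equal; field).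
  rewrite <- !Rmult_assoc; apply Rmult_le_compat_r; [left; apply exp_pos|].
  apply Rmult_le_compat; try (left; apply exp_pos).
  - apply Rmult_le_pos; [apply pow_le; lra|left; apply exp_pos].
  - exact B.
  - apply exp_le.
    assert (0 <= (2 * k * t - 3 / 2) ^ 2) by apply pow2_ge_0.
    apply (Rmult_le_reg_r (4 * k)); [lra|].
    replace (9 / (4 * k) * (4 * k)) with 9 by (field; lra).
    simpl in *; nra.
Qed.

Lemma gauss_dom (k : R) (n : nat) (f : R -> R) (B : R) : 0 < k ->
  (forall t, 0 <= t -> Rabs (f t) <= B * t ^ n) -> exists C, dom C 1 (fun t => gauss k t * f t).
Proof.
  intros Hk Hf; destruct (gauss_poly_dom k n Hk) as [C HC].
  exists (Rabs B * C); split; [lra|]; intros t Ht.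
  pose proof (exp_pos (- (k * t ^ 2))) as P; fold (gauss k t) in P.
  rewrite Rabs_mult, (Rabs_pos_eq (gauss k t)) by lra.
  apply Rle_trans with (Rabs B * (t ^ n * gauss k t)).
  - replace (Rabs B * (t ^ n * gauss k t)) with (gauss k t * (Rabs B * t ^ n)) by ring.
    apply Rmult_le_compat_l; [lra|].
    eapply Rle_trans; [apply Hf, Ht|]; apply Rmult_le_compat_r; [apply pow_le, Ht|apply Rle_abs].
  - rewrite Rmult_assoc; apply Rmult_le_compat_l; [apply Rabs_pos|apply HC, Ht].
Qed.

Definition gauss_cos (k w : R) : R := J (fun t => gauss k t * cos (w * t)).

Lemma gauss_cos_lim (k w : R) : 0 < k -> is_J (fun t => gauss k t * cos (w * t)) (gauss_cos k w).
Proof.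
  intros Hk; destruct (gauss_dom k 0 (fun t => cos (w * t)) 1 Hk) as [C HC].
  - intros t _; simpl; rewrite Rmult_1_r; apply Rabs_le, COS_bound.
  - apply (J_correct _ C 1); [|exact HC].
    apply cont_mult; [apply gauss_cont|]; intros t; apply @ex_derive_continuous; auto_derive; exact I.
Qed.

(** Expresses the derivative in w of the cosine integral by the integral itself. The resulting
    differential equation is solved in [gauss_cos_eq], up to the value at w = 0, which only
    [gauss_integral] determines. *)
Lemma gauss_sin_by_parts (k w : R) : 0 < k ->
  J (fun t => gauss k t * (t * sin (w * t))) = w / (2 * k) * gauss_cos k w.
Proof.
  intros Hk.
  set (F := fun t => gauss k t * sin (w * t)).
  set (dF := fun t => -2 * k * (gauss k t * (t * sin (w * t))) + w * (gauss k t * cos (w * t))).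
  destruct (gauss_dom k 1 (fun t => t * sin (w * t)) 1 Hk) as [C1 D1].
  { intros t Ht; rewrite Rabs_mult, (Rabs_pos_eq t), pow_1, Rmult_1_l by lra.
    assert (Rabs (sin (w * t)) <= 1) by (apply Rabs_le, SIN_bound); nra. }
  destruct (gauss_dom k 0 (fun t => w * cos (w * t)) (Rabs w) Hk) as [C2 D2].
  { intros t Ht; rewrite Rabs_mult; simpl; apply Rmult_le_compat_l; [apply Rabs_pos|].
    apply Rabs_le, COS_bound. }
  assert (Cs : cont (fun t => gauss k t * (t * sin (w * t)))).
  { apply cont_mult; [apply gauss_cont|]; intros t; apply @ex_derive_continuous; auto_derive; exact I. }
  assert (Cc : cont (fun t => gauss k t * cos (w * t))).
  { apply cont_mult; [apply gauss_cont|]; intros t; apply @ex_derive_continuous; auto_derive; exact I. }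
  assert (LF : is_lim F p_infty 0).
  { apply (is_lim_le_le_loc (fun t => - gauss k t) (gauss k)).
    - exists 0; intros t _; unfold F; pose proof (exp_pos (- (k * t ^ 2))); fold (gauss k t) in *.
      pose proof (SIN_bound (w * t)); split; nra.
    - replace (Finite 0) with (Rbar_opp 0) by (simpl; f_equal; ring); apply is_lim_opp.
      destruct (gauss_dom k 0 (fun _ => 1) 1 Hk) as [C [_ HC]].
      { intros t _; simpl; rewrite Rabs_R1; lra. }
      apply (is_lim_le_le_loc (fun _ => 0) (fun t => C * exp (- (1 * t)))).
      + exists 0; intros t Ht; specialize (HC t ltac:(lra)); rewrite Rmult_1_r in HC.
        pose proof (exp_pos (- (k * t ^ 2))); fold (gauss k t) in *; pose proof (Rle_abs (gauss k t)); lra.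
      + apply is_lim_const.
      + replace (Finite 0) with (Rbar_mult C 0) by (simpl; f_equal; ring).
        apply is_lim_scal_l, exp_neg_lim; lra.
    - destruct (gauss_dom k 0 (fun _ => 1) 1 Hk) as [C [_ HC]].
      { intros t _; simpl; rewrite Rabs_R1; lra. }
      apply (is_lim_le_le_loc (fun _ => 0) (fun t => C * exp (- (1 * t)))).
      + exists 0; intros t Ht; specialize (HC t ltac:(lra)); rewrite Rmult_1_r in HC.
        pose proof (exp_pos (- (k * t ^ 2))); fold (gauss k t) in *; pose proof (Rle_abs (gauss k t)); lra.
      + apply is_lim_const.
      + replace (Finite 0) with (Rbar_mult C 0) by (simpl; f_equal; ring).
        apply is_lim_scal_l, exp_neg_lim; lra. }
  assert (CdF : cont dF).
  { apply (cont_lin (fun t => gauss k t * (t * sin (w * t))) (fun t => w * (gauss k t * cos (w * t)))).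
    - exact Cs.
    - apply (cont_mult (fun _ => w)); [apply cont_const|exact Cc]. }
  assert (H : is_J dF (0 - F 0)).
  { apply is_J_derive; [|exact CdF|exact LF].
    intros t; unfold F, dF, gauss; auto_derive; [exact I|].
    replace (- (k * (t * (t * 1)))) with (- (k * t ^ 2)) by ring; ring. }
  apply is_J_unique in H; unfold F in H; rewrite Rmult_0_r, sin_0 in H.
  unfold dF in H.
  replace (fun t => -2 * k * (gauss k t * (t * sin (w * t))) + w * (gauss k t * cos (w * t))) with
    (fun t => -2 * k * (gauss k t * (t * sin (w * t))) + gauss k t * (w * cos (w * t))) in H
    by (apply functional_extensionality; intros; ring).
  rewrite (J_lin _ _ _ C1 1 C2 1) in H; auto.
  2:{ apply cont_mult; [apply gauss_cont|]; intros t; apply @ex_derive_continuous; auto_derive; exact I. }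
  replace (fun t => gauss k t * (w * cos (w * t))) with (fun t => w * (gauss k t * cos (w * t))) in H
    by (apply functional_extensionality; intros; ring).
  rewrite (J_scal _ w (gauss_cos k w)) in H by (exact Cc || apply gauss_cos_lim, Hk).
  apply (Rmult_eq_reg_l (2 * k)); [|lra].
  replace (2 * k * (w / (2 * k) * gauss_cos k w)) with (w * gauss_cos k w) by (field; lra); lra.
Qed.

Lemma MVT_everywhere (f df : R -> R) (a b : R) : (forall t, is_derive f t (df t)) ->
  exists c, Rmin a b <= c <= Rmax a b /\ f b - f a = df c * (b - a).
Proof.
  intros D; apply MVT_gen; intros x _; [apply D|].
  apply continuity_pt_filterlim, (is_derive_cont f df D).
Qed.

(** A quadratic remainder uniform in a, which justifies differentiation under the Gaussian
    integral. *)
Lemma cos_taylor (a b : R) : Rabs (cos (a + b) - cos a + b * sin a) <= b ^ 2.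
Proof.
  destruct (MVT_everywhere (fun s => cos (a + s * b) + s * b * sin a)
    (fun s => b * (sin a - sin (a + s * b))) 0 1) as (c & Hc & E).
  - intros s; auto_derive; [exact I|ring].
  - rewrite Rmin_left, Rmax_right in Hc by lra.
    destruct (MVT_everywhere (fun s => sin (a + s * b)) (fun s => b * cos (a + s * b)) 0 c)
      as (c' & Hc' & E').
    + intros s; auto_derive; [exact I|ring].
    + rewrite !Rmult_0_l, Rmult_1_l, !Rplus_0_r in *.
      replace (cos (a + b) - cos a + b * sin a) with (- (b ^ 2 * (c * cos (a + c' * b)))).
      * rewrite Rabs_Ropp, Rabs_mult, Rabs_pos_eq by apply pow2_ge_0.
        rewrite <- (Rmult_1_r (b ^ 2)) at 2; apply Rmult_le_compat_l; [apply pow2_ge_0|].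
        pose proof (COS_bound (a + c' * b)); apply Rabs_le; nra.
      * replace (cos (a + b) - cos a + b * sin a) with (cos (a + b) + 1 * b * sin a - cos a) by ring.
        transitivity (b * (sin a - sin (a + c * b)) * (1 - 0)); [|rewrite <- E; ring].
        replace (sin a - sin (a + c * b)) with (- (b * cos (a + c' * b) * (c - 0))) by (rewrite <- E'; ring).
        ring.
Qed.

Lemma gauss_cos_derive (k w : R) : 0 < k ->
  is_derive (gauss_cos k) w (- (w / (2 * k) * gauss_cos k w)).
Proof.
  intros Hk; rewrite <- (gauss_sin_by_parts k w Hk).
  destruct (gauss_poly_dom k 2 Hk) as [C2 H2].
  assert (Cc : forall w, cont (fun t => gauss k t * cos (w * t))).
  { intros v; apply cont_mult; [apply gauss_cont|]; intros t; apply @ex_derive_continuous; auto_derive; exact I. }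
  assert (Cs : cont (fun t => gauss k t * (t * sin (w * t)))).
  { apply cont_mult; [apply gauss_cont|]; intros t; apply @ex_derive_continuous; auto_derive; exact I. }
  destruct (gauss_dom k 1 (fun t => t * sin (w * t)) 1 Hk) as [C1 D1].
  { intros t Ht; rewrite Rabs_mult, (Rabs_pos_eq t), pow_1, Rmult_1_l by lra.
    assert (Rabs (sin (w * t)) <= 1) by (apply Rabs_le, SIN_bound); nra. }
  assert (Dc : forall w, exists C, dom C 1 (fun t => gauss k t * cos (w * t))).
  { intros v; apply (gauss_dom k 0 (fun t => cos (v * t)) 1 Hk).
    intros t _; simpl; rewrite Rmult_1_r; apply Rabs_le, COS_bound. }
  assert (Q : forall h, Rabs (gauss_cos k (w + h) - gauss_cos k w +
     h * J (fun t => gauss k t * (t * sin (w * t)))) <= C2 * h ^ 2).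
  { intros h; destruct (Dc w) as [Ca Da], (Dc (w + h)) as [Cb Db].
    set (f1 := fun t => gauss k t * cos ((w + h) * t)).
    set (f2 := fun t => gauss k t * cos (w * t)).
    set (f3 := fun t => gauss k t * (t * sin (w * t))).
    assert (E1 : J (fun t => -1 * f2 t + f1 t) = -1 * J f2 + J f1) by (eapply J_lin; eauto; apply Cc).
    assert (D12 : dom (Ca + Cb) 1 (fun t => -1 * f2 t + f1 t)).
    { split; [lra|]; intros t Ht; eapply Rle_trans; [apply Rabs_triang|].
      rewrite Rabs_mult; replace (Rabs (-1)) with 1 by (rewrite Rabs_left; lra).
      rewrite Rmult_1_l, Rmult_plus_distr_r.
      apply Rplus_le_compat; [apply Da, Ht|apply Db, Ht]. }
    assert (C12 : cont (fun t => -1 * f2 t + f1 t)) by (apply cont_lin; apply Cc).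
    assert (E2 : J (fun t => h * f3 t + (-1 * f2 t + f1 t)) = h * J f3 + J (fun t => -1 * f2 t + f1 t)).
    { eapply J_lin; eauto. }
    unfold gauss_cos; fold f1 f2 f3.
    replace (J f1 - J f2 + h * J f3) with (J (fun t => h * f3 t + (-1 * f2 t + f1 t)))
      by (rewrite E2, E1; ring).
    rewrite <- (Rdiv_1_r (C2 * h ^ 2)).
    apply J_bound; [apply cont_lin; assumption|]; split; [lra|]; intros t Ht.
    unfold f1, f2, f3.
    replace (h * (gauss k t * (t * sin (w * t))) + (-1 * (gauss k t * cos (w * t)) +
       gauss k t * cos ((w + h) * t))) with
      (gauss k t * (cos (w * t + h * t) - cos (w * t) + h * t * sin (w * t)))
      by (replace ((w + h) * t) with (w * t + h * t) by ring; ring).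
    pose proof (exp_pos (- (k * t ^ 2))) as P; fold (gauss k t) in P.
    rewrite Rabs_mult, (Rabs_pos_eq (gauss k t)) by lra.
    apply Rle_trans with (gauss k t * (h * t) ^ 2);
      [apply Rmult_le_compat_l; [lra|apply cos_taylor]|].
    replace (gauss k t * (h * t) ^ 2) with (h ^ 2 * (t ^ 2 * gauss k t)) by ring.
    replace (C2 * h ^ 2 * exp (- (1 * t))) with (h ^ 2 * (C2 * exp (- (1 * t)))) by ring.
    apply Rmult_le_compat_l; [apply pow2_ge_0|apply H2, Ht]. }
  set (D := J (fun t => gauss k t * (t * sin (w * t)))) in *.
  apply is_derive_Reals; intros eps Heps.
  assert (C20 : 0 <= C2).
  { pose proof (H2 1 ltac:(lra)) as H; rewrite pow1, Rmult_1_l in H.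
    pose proof (exp_pos (- (k * 1 ^ 2))); unfold gauss in H.
    pose proof (exp_pos (- (1 * 1))).
    destruct (Rle_dec 0 C2); [assumption|]; nra. }
  assert (Hd : 0 < eps / (C2 + 1)) by (apply Rdiv_lt_0_compat; lra).
  exists (mkposreal _ Hd); intros h Hh0 Hh; simpl in Hh.
  replace ((gauss_cos k (w + h) - gauss_cos k w) / h - - D) with
    ((gauss_cos k (w + h) - gauss_cos k w + h * D) / h) by (field; exact Hh0).
  unfold Rdiv at 1; rewrite Rabs_mult, Rabs_inv.
  assert (Ha : 0 < Rabs h) by (apply Rabs_pos_lt, Hh0).
  apply (Rmult_lt_reg_r (Rabs h)); [exact Ha|].
  rewrite Rmult_assoc, Rinv_l, Rmult_1_r by lra.
  eapply Rle_lt_trans; [apply Q|].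
  replace (h ^ 2) with (Rabs h * Rabs h) by (rewrite <- Rabs_mult, Rabs_pos_eq; [ring|nra]).
  rewrite <- Rmult_assoc; apply Rmult_lt_compat_r; [exact Ha|].
  apply (Rmult_lt_compat_l (C2 + 1)) in Hh; [|lra].
  replace ((C2 + 1) * (eps / (C2 + 1))) with eps in Hh by (field; lra); nra.
Qed.

Lemma gauss_cos_eq (k w : R) : 0 < k ->
  gauss_cos k w = gauss_cos k 0 * exp (- (w ^ 2 / (4 * k))).
Proof.
  intros Hk.
  set (F := fun w => gauss_cos k w * exp (w ^ 2 / (4 * k))).
  assert (D : forall v, is_derive F v 0).
  { intros v; unfold F.
    assert (G : is_derive (fun w => exp (w ^ 2 / (4 * k))) v (v / (2 * k) * exp (v ^ 2 / (4 * k)))).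
    { auto_derive; [exact I|].
      replace (v * (v * 1) * / (4 * k)) with (v ^ 2 / (4 * k)) by (field; lra); field; lra. }
    evar_last.
    - apply (is_derive_mult (gauss_cos k) (fun w => exp (w ^ 2 / (4 * k)))).
      + apply gauss_cos_derive, Hk.
      + exact G.
      + intros; apply Rmult_comm.
    - unfold plus, mult, scal; simpl; unfold mult; simpl; field; lra. }
  assert (E : F w = F 0).
  { destruct (MVT_everywhere F (fun _ => 0) 0 w D) as (c & _ & E); lra. }
  unfold F in E; replace (0 ^ 2 / (4 * k)) with 0 in E by (field; lra).
  rewrite exp_0, Rmult_1_r in E; rewrite <- E, Rmult_assoc, <- exp_plus, Rplus_opp_r, exp_0; ring.
Qed.

(* Coquelicot's structures display equalities on R at other carriers, which [ring] rejects. *)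
Ltac as_R := match goal with |- @eq _ ?a ?b => change (@eq R a b) end.

Lemma series_scal (c : R) (a : nat -> R) (l : R) :
  is_series a l -> is_series (fun n => c * a n) (c * l).
Proof. apply (is_series_scal c a l). Qed.

Lemma series_plus (a b : nat -> R) (l m : R) :
  is_series a l -> is_series b m -> is_series (fun n => a n + b n) (l + m).
Proof. apply (is_series_plus a b l m). Qed.

Lemma RInt_series (f : nat -> R -> R) (F : R -> R) (M : nat -> R) (a b : R) :
  a <= b -> (forall n, cont (f n)) -> cont F ->
  (forall n t, a <= t <= b -> Rabs (f n t) <= M n) ->
  ex_series M -> (forall t, a <= t <= b -> is_series (fun n => f n t) (F t)) ->
  is_series (fun n => RInt (f n) a b) (RInt F a b).
Proof.
  intros Hab Cf CF Hf HM HF.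
  apply is_series_rsum, is_lim_seq_spec; intros eps.
  destruct HM as [m Hm]; pose proof (is_series_unique _ _ Hm) as Em.
  pose proof Hm as Hm'; apply is_series_rsum in Hm; apply is_lim_seq_spec in Hm.
  assert (He : 0 < eps / (b - a + 1)) by (apply Rdiv_lt_0_compat; [apply cond_pos|lra]).
  destruct (Hm (mkposreal _ He)) as [N HN]; exists N; intros n Hn; specialize (HN n Hn).
  simpl in HN; apply Rabs_def2 in HN.
  rewrite <- RInt_rsum, Rabs_minus_sym, <- RInt_minus_cont by auto using cont_rsum.
  eapply Rle_lt_trans; [apply (RInt_abs_le_const _ a b (m - rsum n M) Hab)|].
  - apply cont_minus; auto using cont_rsum.
  - intros t Ht; rewrite <- Em.
    apply (is_series_tail_le (fun k => f k t)); [intros k; apply Hf, Ht|eexists; exact Hm'|apply HF, Ht].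
  - apply Rle_lt_trans with ((b - a) * (eps / (b - a + 1))); [apply Rmult_le_compat_l; lra|].
    replace (eps : R) with ((b - a + 1) * (eps / (b - a + 1))) at 2 by (field; lra).
    apply Rmult_lt_compat_r; lra.
Qed.

(** * Poisson summation *)

(** The shifts by n + 1 and - (n + 1) are paired, so that the periodization over all integers
    becomes one series over n. *)
Definition wrap (k : R) (n : nat) (t : R) : R := gauss k (INR (S n) + t) + gauss k (INR (S n) - t).
Definition dwrap (k : R) (n : nat) (t : R) : R :=
  -2 * k * (INR (S n) + t) * gauss k (INR (S n) + t) + 2 * k * (INR (S n) - t) * gauss k (INR (S n) - t).

Lemma gauss_decay (k : R) : 0 < k -> exists C, forall z,
  gauss k z * (1 + z ^ 2) <= C /\ Rabs (-2 * k * z * gauss k z) * (1 + z ^ 2) <= C.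
Proof.
  intros Hk; exists (2 + 2 * k + 16 / k + 4 / k); intros z.
  assert (Z : 0 <= k * z ^ 2) by (apply Rmult_le_pos; [lra|apply pow2_ge_0]).
  pose proof (pow_exp_le 1 _ Z) as B1; pose proof (pow_exp_le 2 _ Z) as B2.
  fold (gauss k z) in B1, B2; simpl INR in B1, B2; rewrite pow_1 in B1.
  assert (G : 0 < gauss k z <= 1).
  { unfold gauss; split; [apply exp_pos|]; rewrite <- exp_0; apply exp_le; lra. }
  set (g := gauss k z) in *.
  assert (K1 : 0 < / k) by (apply Rinv_0_lt_compat, Hk).
  assert (X1 : z ^ 2 * g <= / k).
  { apply (Rmult_le_reg_l k); [lra|]; rewrite Rinv_r by lra; simpl in *; lra. }
  assert (X2 : k * (z ^ 2) ^ 2 * g <= 4 / k).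
  { apply (Rmult_le_reg_l k); [lra|]; replace (k * (4 / k)) with 4 by (field; lra).
    replace (k * (k * (z ^ 2) ^ 2 * g)) with ((k * z ^ 2) ^ 2 * g) by ring; simpl in *; lra. }
  unfold Rdiv in *; split; [nra|].
  assert (Rabs (-2 * k * z * g) <= k * (1 + z ^ 2) * g).
  { replace (-2 * k * z * g) with (k * g * (-2 * z)) by ring.
    replace (k * (1 + z ^ 2) * g) with (k * g * (1 + z ^ 2)) by ring.
    rewrite Rabs_mult, Rabs_pos_eq by nra.
    apply Rmult_le_compat_l; [nra|].
    pose proof (pow2_ge_0 (z - 1)); pose proof (pow2_ge_0 (z + 1)); apply Rabs_le; nra. }
  apply Rle_trans with (k * (1 + z ^ 2) * g * (1 + z ^ 2)).
  - apply Rmult_le_compat_r; [pose proof (pow2_ge_0 z); lra|assumption].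
  - replace (k * (1 + z ^ 2) * g * (1 + z ^ 2)) with (k * g + 2 * k * (z ^ 2 * g) + k * (z ^ 2) ^ 2 * g) by ring.
    assert (k * (z ^ 2 * g) <= 1).
    { apply Rle_trans with (k * / k); [apply Rmult_le_compat_l; lra|right; field; lra]. }
    nra.
Qed.

Lemma wrap_bound (k x : R) : 0 < k -> exists M, forall n y, Rabs (y - x) < 1 ->
  Rabs (wrap k n y) <= M * / INR (S n) ^ 2 /\ Rabs (dwrap k n y) <= M * / INR (S n) ^ 2.
Proof.
  intros Hk; destruct (gauss_decay k Hk) as [C HC].
  set (B := (Rabs x + 1) ^ 2).
  exists (4 * (B * C)); intros n y Hy.
  set (N := INR (S n)).
  assert (HN : 0 < N) by (apply lt_0_INR; lia).
  assert (HB : 1 <= B).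
  { unfold B; pose proof (Rabs_pos x); simpl; nra. }
  assert (Hy2 : y ^ 2 <= B).
  { unfold B; rewrite <- (Rabs_pos_eq (y ^ 2)), <- RPow_abs by apply pow2_ge_0.
    apply pow_incr; split; [apply Rabs_pos|].
    replace y with (x + (y - x)) by ring; eapply Rle_trans; [apply Rabs_triang|]; lra. }
  assert (Q : forall z v, N ^ 2 <= 2 * z ^ 2 + 2 * y ^ 2 -> Rabs v * (1 + z ^ 2) <= C ->
     Rabs v <= 2 * (B * C) * / N ^ 2).
  { intros z v Hz Hv.
    apply (Rmult_le_reg_r (N ^ 2)); [apply pow_lt, HN|].
    rewrite Rmult_assoc, Rinv_l, Rmult_1_r by (apply pow_nonzero; lra).
    pose proof (Rabs_pos v); pose proof (pow2_ge_0 z).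
    apply Rle_trans with (Rabs v * (2 * B * (1 + z ^ 2))).
    - apply Rmult_le_compat_l; [assumption|]; nra.
    - replace (Rabs v * (2 * B * (1 + z ^ 2))) with (2 * B * (Rabs v * (1 + z ^ 2))) by ring.
      replace (2 * (B * C)) with (2 * B * C) by ring; apply Rmult_le_compat_l; [lra|exact Hv]. }
  assert (G0 : forall z, Rabs (gauss k z) = gauss k z)
    by (intros; apply Rabs_pos_eq; left; apply exp_pos).
  assert (P1 : N ^ 2 <= 2 * (N + y) ^ 2 + 2 * y ^ 2) by (pose proof (pow2_ge_0 (N + 2 * y)); nra).
  assert (P2 : N ^ 2 <= 2 * (N - y) ^ 2 + 2 * y ^ 2) by (pose proof (pow2_ge_0 (N - 2 * y)); nra).
  replace (4 * (B * C) * / N ^ 2) with (2 * (B * C) * / N ^ 2 + 2 * (B * C) * / N ^ 2) by ring.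
  unfold wrap, dwrap; fold N; split; (eapply Rle_trans; [apply Rabs_triang|]); apply Rplus_le_compat.
  - apply (Q (N + y)); [exact P1|rewrite G0; apply HC].
  - apply (Q (N - y)); [exact P2|rewrite G0; apply HC].
  - apply (Q (N + y)); [exact P1|apply HC].
  - apply (Q (N - y)); [exact P2|].
    replace (2 * k * (N - y) * gauss k (N - y)) with (- (-2 * k * (N - y) * gauss k (N - y))) by ring.
    rewrite Rabs_Ropp; apply HC.
Qed.

Lemma inv_sq_scal (M : R) : ex_series (fun n => M * / INR (S n) ^ 2).
Proof. apply (@ex_series_scal R_AbsRing R_NormedModule), series_inv_sq. Qed.

Lemma wrap_summable (k y : R) : 0 < k -> ex_series (fun n => wrap k n y).
Proof.
  intros Hk; destruct (wrap_bound k y Hk) as [M HM].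
  apply (Series_abs_le _ (fun n => M * / INR (S n) ^ 2)); [|apply inv_sq_scal].
  intros n; apply HM; rewrite Rminus_diag, Rabs_R0; lra.
Qed.

Definition periodized (k t : R) : R := gauss k t + Series (fun n => wrap k n t).

Lemma periodized_derive (k t : R) : 0 < k ->
  is_derive (periodized k) t (-2 * k * t * gauss k t + Series (fun n => dwrap k n t)).
Proof.
  intros Hk; apply (is_derive_plus (gauss k) (fun t => Series (fun n => wrap k n t))).
  - unfold gauss; auto_derive; [exact I|].
    replace (t * (t * 1)) with (t ^ 2) by ring; ring.
  - destruct (wrap_bound k t Hk) as [M HM].
    apply (is_derive_Series (wrap k) (dwrap k) (fun n => M * / INR (S n) ^ 2)).
    + intros n y Hy; split; [|apply HM, Hy].
      unfold wrap, dwrap, gauss; generalize (INR (S n)); intros N; auto_derive; [exact I|].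
      replace ((N + y) * ((N + y) * 1)) with ((N + y) ^ 2) by ring.
      replace ((N + - y) * ((N + - y) * 1)) with ((N - y) ^ 2) by ring.
      ring.
    + apply inv_sq_scal.
    + intros; apply wrap_summable, Hk.
Qed.

Lemma gauss_even (k t : R) : gauss k (- t) = gauss k t.
Proof. unfold gauss; f_equal; ring. Qed.

Lemma cos_shift_period (j n : nat) (t : R) :
  cos (2 * PI * INR j * (t + INR n)) = cos (2 * PI * INR j * t).
Proof.
  replace (2 * PI * INR j * (t + INR n)) with (2 * PI * INR j * t + 2 * PI * IZR (Z.of_nat (j * n)))
    by (rewrite <- INR_IZR_INZ, mult_INR; ring).
  rewrite cos_plus, cos_2PI_IZR, sin_2PI_IZR; ring.
Qed.

(** Unfolding: the cosine has period 1, so the terms of the periodization integrate over consecutive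
    unit cells, which tile the line; evenness accounts for the factor 2. *)
Lemma periodized_coeff (k : R) (j : nat) : 0 < k ->
  RInt (fun t => periodized k t * cos (2 * PI * INR j * t)) (- / 2) (/ 2)
  = 2 * gauss_cos k (2 * PI * INR j) :> R.
Proof.
  intros Hk.
  set (H := fun t => gauss k t * cos (2 * PI * INR j * t)).
  assert (Cc : cont (fun t => cos (2 * PI * INR j * t))).
  { intros t; apply @ex_derive_continuous; auto_derive; exact I. }
  assert (CH : cont H) by (apply cont_mult; [apply gauss_cont|exact Cc]).
  assert (CP : cont (periodized k)) by (apply (is_derive_cont _ _ (fun t => periodized_derive k t Hk))).
  assert (Cw : forall n, cont (fun t => wrap k n t * cos (2 * PI * INR j * t))).
  { intros n t; apply @ex_derive_continuous; unfold wrap, gauss; auto_derive; exact I. }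
  assert (Hev : forall t, H (- t) = H t).
  { intros t; unfold H; rewrite gauss_even; f_equal.
    rewrite <- cos_neg; f_equal; ring. }
  assert (E0 : RInt H (- / 2) (/ 2) = 2 * RInt H 0 (/ 2) :> R).
  { rewrite <- (RInt_Chasles_cont H (- / 2) 0 (/ 2) CH).
    pose proof (RInt_comp_affine H (-1) 0 0 (/ 2) CH) as E.
    replace (-1 * 0 + 0) with 0 in E by ring; replace (-1 * / 2 + 0) with (- / 2) in E by ring.
    rewrite (RInt_ext_le (fun t => H (-1 * t + 0)) H 0 (/ 2)) in E;
      [|lra|intros t _; rewrite <- Hev; f_equal; ring].
    rewrite <- (opp_RInt_swap H 0 (- / 2)) by (apply cont_ex_RInt, CH).
    rewrite <- E; generalize (RInt H 0 (/ 2) : R); intros i; change (- (-1 * i) + i = 2 * i); ring. }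
  assert (En : forall n, RInt (fun t => wrap k n t * cos (2 * PI * INR j * t)) (- / 2) (/ 2)
     = 2 * RInt H (INR n + / 2) (INR (S n) + / 2) :> R).
  { intros n.
    assert (A1 : RInt (fun t => H (t + INR (S n))) (- / 2) (/ 2) = RInt H (INR n + / 2) (INR (S n) + / 2)).
    { rewrite RInt_shift by exact CH; f_equal; rewrite ?S_INR; field. }
    assert (A2 : RInt (fun t => H (-1 * t + INR (S n))) (- / 2) (/ 2) = RInt H (INR n + / 2) (INR (S n) + / 2)).
    { pose proof (RInt_comp_affine H (-1) (INR (S n)) (- / 2) (/ 2) CH) as E.
      rewrite <- (opp_RInt_swap H) by (apply cont_ex_RInt, CH).
      replace (-1 * - / 2 + INR (S n)) with (INR (S n) + / 2) in E by ring.
      replace (-1 * / 2 + INR (S n)) with (INR n + / 2) in E by (rewrite S_INR; field).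
      rewrite <- E; generalize (RInt (fun t => H (-1 * t + INR (S n))) (- / 2) (/ 2) : R).
      intros i; change (i = - (-1 * i)); ring. }
    transitivity (RInt (fun t => H (t + INR (S n))) (- / 2) (/ 2) +
       RInt (fun t => H (-1 * t + INR (S n))) (- / 2) (/ 2)).
    - rewrite <- RInt_plus_cont by (auto using cont_shift, cont_affine).
      apply RInt_ext_le; [lra|]; intros t _; unfold H, wrap.
      rewrite !cos_shift_period.
      replace (cos (2 * PI * INR j * (-1 * t))) with (cos (2 * PI * INR j * t))
        by (rewrite <- cos_neg; f_equal; ring).
      replace (t + INR (S n)) with (INR (S n) + t) by ring.
      replace (-1 * t + INR (S n)) with (INR (S n) - t) by ring; ring.
    - rewrite A1, A2; generalize (RInt H (INR n + / 2) (INR (S n) + / 2) : R); intros; ring. }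
  destruct (wrap_bound k 0 Hk) as [M HM].
  assert (Sr : is_series (fun n => RInt (fun t => wrap k n t * cos (2 * PI * INR j * t)) (- / 2) (/ 2))
     (RInt (fun t => (periodized k t - gauss k t) * cos (2 * PI * INR j * t)) (- / 2) (/ 2))).
  { apply (RInt_series _ _ (fun n => M * / INR (S n) ^ 2)); [lra|exact Cw| | |apply inv_sq_scal|].
    - apply cont_mult; [apply cont_minus; [exact CP|apply gauss_cont]|exact Cc].
    - intros n t Ht; rewrite Rabs_mult.
      rewrite <- (Rmult_1_r (M * _)); apply Rmult_le_compat; try apply Rabs_pos.
      + apply HM; apply Rabs_def1; lra.
      + apply Rabs_le, COS_bound.
    - intros t _; unfold periodized.
      replace ((gauss k t + Series (fun n => wrap k n t) - gauss k t) * cos (2 * PI * INR j * t)) with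
        (cos (2 * PI * INR j * t) * Series (fun n => wrap k n t)) by ring.
      eapply is_series_ext; [|apply series_scal, Series_correct, wrap_summable, Hk].
      intros n; apply Rmult_comm. }
  assert (L2 : is_series (fun n => RInt (fun t => wrap k n t * cos (2 * PI * INR j * t)) (- / 2) (/ 2))
     (2 * (gauss_cos k (2 * PI * INR j) - RInt H 0 (/ 2)))).
  { apply is_series_rsum.
    apply (is_lim_seq_ext (fun N => 2 * (RInt H 0 (INR N + / 2) - RInt H 0 (/ 2)))).
    - intros N; induction N as [|N IH].
      + simpl; rewrite Rplus_0_l, Rminus_diag; ring.
      + cbn [rsum]; rewrite <- IH, En.
        rewrite <- (RInt_Chasles_cont H 0 (INR N + / 2) (INR (S N) + / 2) CH).
        match goal with |- 2 * (?a + ?b - ?c) = _ => change (2 * (a + b - c) = 2 * (a - c) + 2 * b :> R) end.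
        generalize (RInt H 0 (INR N + / 2) : R), (RInt H (INR N + / 2) (INR (S N) + / 2) : R), (RInt H 0 (/ 2) : R).
        intros; ring.
    - apply (is_lim_seq_scal_l _ 2 (Finite (gauss_cos k (2 * PI * INR j) - RInt H 0 (/ 2)))).
      apply is_lim_seq_minus'; [|apply is_lim_seq_const].
      apply (is_lim_comp_seq (fun b => RInt H 0 b) (fun N => INR N + / 2) p_infty).
      + apply (gauss_cos_lim k _ Hk).
      + exists 0%nat; intros; discriminate.
      + apply (is_lim_seq_plus INR (fun _ => / 2) p_infty (/ 2) p_infty);
          [apply is_lim_seq_INR|apply is_lim_seq_const|reflexivity]. }
  apply is_series_unique in Sr; apply is_series_unique in L2; rewrite Sr in L2.
  transitivity (RInt (fun t => (periodized k t - gauss k t) * cos (2 * PI * INR j * t)) (- / 2) (/ 2)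
    + RInt H (- / 2) (/ 2)).
  - rewrite <- RInt_plus_cont;
      [|apply cont_mult; [apply cont_minus; [exact CP|apply gauss_cont]|exact Cc]|exact CH].
    apply RInt_ext_le; [lra|]; intros t _; unfold H; ring.
  - rewrite L2, E0; generalize (RInt H 0 (/ 2) : R); intros; ring.
Qed.

(** The Fourier series of the periodized Gaussian, evaluated at 0, with the coefficients known from
    [gauss_cos_eq]. *)
Lemma theta_poisson (k : R) : 0 < k ->
  1 + 2 * Series (fun n => gauss k (INR (S n))) =
  2 * gauss_cos k 0 * (1 + 2 * Series (fun j => exp (- (PI ^ 2 * INR (S j) ^ 2 / k)))).
Proof.
  intros Hk.
  assert (CP : cont (periodized k)) by (apply (is_derive_cont _ _ (fun t => periodized_derive k t Hk))).
  destruct (fourier_pointwise (periodized k) _ CP (periodized_derive k 0 Hk)) as [F _].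
  pose proof (periodized_coeff k 0 Hk) as C0; simpl INR in C0; rewrite Rmult_0_r in C0.
  rewrite (RInt_ext_le _ (periodized k)) in C0;
    [|lra|intros; rewrite Rmult_0_l, cos_0; ring].
  rewrite C0 in F.
  assert (G : is_series (fun j => 2 * gauss_cos k 0 * exp (- (PI ^ 2 * INR (S j) ^ 2 / k)))
     ((periodized k 0 - 2 * gauss_cos k 0) / 2)).
  { eapply is_series_ext; [|exact F]; intros j; cbv beta.
    rewrite periodized_coeff, gauss_cos_eq by exact Hk.
    rewrite <- Rmult_assoc; apply (f_equal (fun e => 2 * gauss_cos k 0 * exp e)); field; lra. }
  apply is_series_unique in G; rewrite Series_scal_l in G.
  assert (P0 : periodized k 0 = 1 + 2 * Series (fun n => gauss k (INR (S n)))).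
  { unfold periodized; f_equal.
    - unfold gauss; replace (- (k * 0 ^ 2)) with 0 by ring; apply exp_0.
    - rewrite <- Series_scal_l; apply Series_ext; intros n; unfold wrap.
      rewrite Rplus_0_r, Rminus_0_r; ring. }
  rewrite <- P0; lra.
Qed.

(** * The theta relation, its derivatives and the limit kernel *)

(** In the variable x = exp t this is the involution x -> 1 / (PI^2 x), with fixed point 1 / PI. *)
Definition dual (t : R) : R := - t - 2 * ln PI.

Lemma exp_dual (t : R) : exp (- dual t) = PI ^ 2 * exp t.
Proof.
  unfold dual; replace (- (- t - 2 * ln PI)) with (ln PI + ln PI + t) by ring.
  rewrite !exp_plus, exp_ln by apply PI_RGT_0; ring.
Qed.

Lemma theta_raw (t : R) :
  1 + 2 * ssum 0 t = 2 * gauss_cos (exp (- t)) 0 * (1 + 2 * ssum 0 (dual t)).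
Proof.
  pose proof (theta_poisson (exp (- t)) (exp_pos _)) as H.
  assert (E1 : Series (fun n => gauss (exp (- t)) (INR (S n))) = ssum 0 t).
  { apply Series_ext; intros n; unfold gauss, sterm, yval.
    rewrite pow_O, Rmult_1_l; do 2 f_equal; apply Rmult_comm. }
  assert (E2 : Series (fun j => exp (- (PI ^ 2 * INR (S j) ^ 2 / exp (- t)))) = ssum 0 (dual t)).
  { apply Series_ext; intros n; unfold sterm, yval.
    rewrite pow_O, Rmult_1_l, exp_dual, (exp_Ropp t); do 2 f_equal.
    pose proof (exp_pos t) as P; set (N := INR (S n)).
    assert (E : PI ^ 2 * N ^ 2 / / exp t = N ^ 2 * (PI ^ 2 * exp t)) by (field; lra); exact E. }
  rewrite E1, E2 in H; exact H.
Qed.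

(* The self-dual point of the theta relation gives the value of the Gaussian integral. *)
Lemma gauss_integral (t : R) : 2 * gauss_cos (exp (- t)) 0 = sqrt PI * exp (t / 2).
Proof.
  pose proof PI_RGT_0 as P0.
  assert (A1 : 2 * gauss_cos PI 0 = 1).
  { pose proof (theta_raw (- ln PI)) as H.
    replace (dual (- ln PI)) with (- ln PI) in H by (unfold dual; ring).
    rewrite Ropp_involutive, exp_ln in H by exact P0.
    destruct (ssum_bound 0 1 (- ln PI) (le_n _)) as [S0 _].
    apply (Rmult_eq_reg_r (1 + 2 * ssum 0 (- ln PI))); lra. }
  (* Since PI c^2 = exp (- t), rescaling by c turns the Gaussian of parameter PI, whose integral is
     now known, into that of parameter exp (- t). *)
  set (c := exp (- ((t + ln PI) / 2))).
  assert (Hc : 0 < c) by apply exp_pos.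
  pose proof (gauss_cos_lim PI 0 P0) as L.
  assert (Cc : cont (fun u => gauss PI u * cos (0 * u))).
  { apply cont_mult; [apply gauss_cont|]; intros u; apply @ex_derive_continuous; auto_derive; exact I. }
  pose proof (is_J_affine _ c 0 _ Hc Cc L) as L2.
  rewrite RInt_point in L2.
  assert (E : gauss_cos (exp (- t)) 0 = gauss_cos PI 0 / c).
  { unfold gauss_cos at 1; apply is_J_unique.
    replace (gauss_cos PI 0 / c) with ((gauss_cos PI 0 - 0) / c) by (rewrite Rminus_0_r; reflexivity).
    apply (is_J_ext (fun u => gauss PI (c * u + 0) * cos (0 * (c * u + 0)))); [|exact L2].
    intros u _; rewrite !Rmult_0_l; f_equal; unfold gauss; f_equal.
    replace (exp (- t)) with (PI * (c * c)); [ring|].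
    rewrite <- (exp_ln PI P0) at 1; unfold c; rewrite <- !exp_plus; f_equal; field. }
  rewrite E; replace (2 * (gauss_cos PI 0 / c)) with (2 * gauss_cos PI 0 * / c) by (field; lra).
  rewrite A1, Rmult_1_l; unfold c; rewrite <- exp_Ropp.
  rewrite <- (exp_ln (sqrt PI)) by (apply sqrt_lt_R0, P0).
  rewrite <- exp_plus; f_equal.
  assert (ln PI = 2 * ln (sqrt PI)).
  { rewrite <- (sqrt_sqrt PI) at 1 by lra; rewrite ln_mult by (apply sqrt_lt_R0, P0); ring. }
  lra.
Qed.

Lemma ssum_dual_derive (p : nat) (t : R) :
  is_derive (fun t => ssum p (dual t)) t (- (ssum (S p) (dual t) - INR p * ssum p (dual t))).
Proof.
  evar_last.
  - apply (is_derive_comp (ssum p) dual); [apply ssum_derive|].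
    unfold dual; auto_derive; [exact I|reflexivity].
  - unfold scal; simpl; unfold mult; simpl; ring.
Qed.

Lemma is_derive_eq (f g : R -> R) (t a b : R) :
  (forall t, f t = g t) -> is_derive f t a -> is_derive g t b -> a = b.
Proof.
  intros E Hf Hg; apply is_derive_unique in Hg; rewrite <- Hg.
  symmetry; apply is_derive_unique, (is_derive_ext f); assumption.
Qed.

Lemma derive_plus (f g : R -> R) (t a b : R) :
  is_derive f t a -> is_derive g t b -> is_derive (fun t => f t + g t) t (a + b).
Proof. apply (is_derive_plus f g). Qed.

Lemma derive_scal (f : R -> R) (c t a : R) :
  is_derive f t a -> is_derive (fun t => c * f t) t (c * a).
Proof. apply (is_derive_scal f t c a). Qed.

Lemma derive_mult (f g : R -> R) (t a b : R) :
  is_derive f t a -> is_derive g t b -> is_derive (fun t => f t * g t) t (a * g t + f t * b).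
Proof. intros Hf Hg; apply (is_derive_mult f g); auto; intros; apply Rmult_comm. Qed.

Definition e2 (t : R) : R := exp (t / 2).
Lemma e2_derive (t : R) : is_derive e2 t (e2 t / 2).
Proof. unfold e2; auto_derive; [exact I|]; unfold Rdiv; ring. Qed.

(** The theta relation differentiated once and twice in t, using that [ssum] is closed under
    differentiation on both sides. *)
Lemma theta_derivatives (t : R) :
  ssum 1 t = sqrt PI * e2 t * (/ 4 * (1 + 2 * ssum 0 (dual t)) - ssum 1 (dual t)) /\
  ssum 2 t = sqrt PI * e2 t *
    (3 / 8 * (1 + 2 * ssum 0 (dual t)) - 3 * ssum 1 (dual t) + ssum 2 (dual t)).
Proof.
  assert (D0 : forall s, is_derive (fun t => 1 + 2 * ssum 0 (dual t)) s (-2 * ssum 1 (dual s))).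
  { intros s; evar_last.
    - apply derive_plus; [apply @is_derive_const|apply derive_scal, ssum_dual_derive].
    - unfold zero; simpl; ring. }
  assert (T1 : forall t, ssum 1 t =
     sqrt PI * (e2 t * (/ 4 * (1 + 2 * ssum 0 (dual t)) + -1 * ssum 1 (dual t)))).
  { intros s.
    assert (H : 0 + 2 * (ssum 1 s - INR 0 * ssum 0 s) =
      sqrt PI * (e2 s / 2 * (1 + 2 * ssum 0 (dual s)) + e2 s * (-2 * ssum 1 (dual s)))).
    { apply (is_derive_eq (fun t => 1 + 2 * ssum 0 t)
        (fun t => sqrt PI * (e2 t * (1 + 2 * ssum 0 (dual t)))) s).
      - intros u; rewrite theta_raw, gauss_integral; unfold e2; ring.
      - evar_last; [apply derive_plus; [apply @is_derive_const|apply derive_scal, ssum_derive]|reflexivity].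
      - evar_last; [apply derive_scal, derive_mult; [apply e2_derive|apply D0]|reflexivity]. }
    simpl INR in H; lra. }
  split; [rewrite T1; ring|].
  assert (H : ssum 2 t - INR 1 * ssum 1 t =
    sqrt PI * (e2 t / 2 * (/ 4 * (1 + 2 * ssum 0 (dual t)) + -1 * ssum 1 (dual t)) +
      e2 t * (/ 4 * (-2 * ssum 1 (dual t)) + -1 * - (ssum 2 (dual t) - INR 1 * ssum 1 (dual t))))).
  { apply (is_derive_eq (ssum 1) _ t _ _ T1); [apply ssum_derive|].
    evar_last; [apply derive_scal, derive_mult; [apply e2_derive|]|reflexivity].
    apply derive_plus; apply derive_scal; [apply D0|apply ssum_dual_derive]. }
  simpl INR in H; rewrite T1 in H; lra.
Qed.

(* With x = exp t: the Gaussian limit of the r-th fringe size, x = n / 4^r. *)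
Definition kern (t : R) : R := 4 / (3 * sqrt PI) * (2 * exp (t / 2) * ssum 2 t + exp (- (t / 2)) * ssum 1 t).

Definition psi (t : R) : R :=
  4 / 3 * (exp t * (3 / 2 * ssum 0 (dual t) - 6 * ssum 1 (dual t) + 2 * ssum 2 (dual t))
    + / 2 * ssum 0 (dual t) - ssum 1 (dual t)).

(** The constant 1 in the dual theta sum produces exp t + 1/3; all other terms decay as t grows and
    make up [psi]. *)
Lemma kern_psi (t : R) : kern t = exp t + 1 / 3 + psi t.
Proof.
  unfold kern, psi; destruct (theta_derivatives t) as [-> ->].
  assert (P : sqrt PI <> 0) by (apply Rgt_not_eq, sqrt_lt_R0, PI_RGT_0).
  assert (E1 : exp t = exp (t / 2) * exp (t / 2)) by (rewrite <- exp_plus; f_equal; field).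
  assert (E2 : exp (- (t / 2)) = / exp (t / 2)) by apply exp_Ropp.
  pose proof (exp_pos (t / 2)).
  rewrite E1, E2; unfold e2; field; split; [lra|exact P].
Qed.

(** Identifies [psi] with the sum over frequencies in [mean_fringe_gauss], so that [kern] is the
    limit found there, apart from the term 1 / (3 * 4^r). *)
Lemma psi_gterm (t : R) : psi t = 4 / 3 * Series (fun j => gterm (exp t) (S j)).
Proof.
  unfold psi; f_equal; symmetry.
  set (x := exp t); set (s := dual t).
  assert (ex : forall p, is_series (fun n => sterm p n s) (ssum p s))
    by (intros p; apply Series_correct, sterm_summable).
  assert (sc : forall c p, is_series (fun n => c * sterm p n s) (c * ssum p s))
    by (intros c p; apply (is_series_scal c _ _ (ex p))).
  apply is_series_unique.
  replace (x * (3 / 2 * ssum 0 s - 6 * ssum 1 s + 2 * ssum 2 s) + / 2 * ssum 0 s - ssum 1 s) with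
    ((x * (3 / 2) + / 2) * ssum 0 s + ((- 6 * x - 1) * ssum 1 s + (2 * x) * ssum 2 s)) by ring.
  eapply is_series_ext; [|apply (series_plus _ _ _ _ (sc (x * (3 / 2) + / 2) 0%nat)
    (series_plus _ _ _ _ (sc (- 6 * x - 1) 1%nat) (sc (2 * x) 2%nat)))].
  intros j; cbv beta; unfold gterm, sterm.
  replace (PI ^ 2 * INR (S j) ^ 2 * x) with (yval j s) by (unfold yval, s; rewrite exp_dual; unfold x; ring).
  as_R; simpl pow; field.
Qed.

Definition dkern (t : R) : R := 4 / (3 * sqrt PI) *
  (2 * (exp (t / 2) * (/ 2 * ssum 2 t + (ssum 3 t - 2 * ssum 2 t)))
   + exp (- (t / 2)) * (- / 2 * ssum 1 t + (ssum 2 t - ssum 1 t))).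

Lemma kern_derive (t : R) : is_derive kern t (dkern t).
Proof.
  evar_last.
  - unfold kern; apply derive_scal, derive_plus; (apply derive_mult; [|apply ssum_derive]).
    + apply derive_scal; apply (e2_derive t).
    + apply (is_derive_comp exp (fun t => - (t / 2))); [apply is_derive_exp|].
      auto_derive; [exact I|reflexivity].
  - unfold dkern, e2, scal; simpl; unfold mult; simpl.
    generalize (4 / (3 * sqrt PI)); intros c; field.
Qed.

Definition dpsi (t : R) : R := dkern t - exp t.

Lemma psi_derive (t : R) : is_derive psi t (dpsi t).
Proof.
  apply (is_derive_ext (fun t => kern t - (exp t + 1 / 3))).
  - intros u; rewrite kern_psi; as_R; ring.
  - apply (is_derive_minus kern (fun t => exp t + 1 / 3)); [apply kern_derive|].
    auto_derive; [exact I|ring].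
Qed.

(** In [dpsi] a growing exponential cancels. The same derivative computed on the dual side shows the
    decay for large t. *)
Definition dpsi' (t : R) : R :=
  4 / 3 * (exp t * (3 / 2 * ssum 0 (dual t) - 6 * ssum 1 (dual t) + 2 * ssum 2 (dual t))
    + exp t * (3 / 2 * - ssum 1 (dual t) + -6 * - (ssum 2 (dual t) - ssum 1 (dual t))
       + 2 * - (ssum 3 (dual t) - 2 * ssum 2 (dual t)))
    + / 2 * - ssum 1 (dual t) + -1 * - (ssum 2 (dual t) - ssum 1 (dual t))).

Lemma dpsi_eq (t : R) : dpsi t = dpsi' t.
Proof.
  apply (is_derive_eq psi (fun t => 4 / 3 * (exp t *
     (3 / 2 * ssum 0 (dual t) + -6 * ssum 1 (dual t) + 2 * ssum 2 (dual t))
    + / 2 * ssum 0 (dual t) + -1 * ssum 1 (dual t))) t).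
  - intros u; unfold psi; ring.
  - apply psi_derive.
  - evar_last.
    + apply derive_scal, derive_plus; [apply derive_plus|].
      * apply derive_mult; [apply is_derive_exp|].
        apply derive_plus; [apply derive_plus|]; apply derive_scal, ssum_dual_derive.
      * apply derive_scal, ssum_dual_derive.
      * apply derive_scal, ssum_dual_derive.
    + unfold dpsi'; simpl INR; ring.
Qed.

(** The rate is free: q = 2 serves the sums over shifts, and q = 6 gives the rate 11/2, beyond the
    real part 4 that bounds the strip of the Mellin identity. *)
Lemma kern_bound (q : nat) : (2 <= q)%nat -> exists C, 0 < C /\ forall t,
  0 <= kern t <= C * exp ((INR q - / 2) * t) * exp (- (exp (- t) / 2)) /\ Rabs (dkern t) <= C * exp ((INR q - / 2) * t).
Proof.
  intros Hq.
  assert (P : 0 < 4 / (3 * sqrt PI)).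
  { apply Rdiv_lt_0_compat; [lra|]; pose proof (sqrt_lt_R0 _ PI_RGT_0); lra. }
  set (c := 4 / (3 * sqrt PI)) in *.
  set (A := 2 * sconst 2 (q - 1) + 2 * sconst 3 (q - 1) + 2 * sconst 1 q + 2 * sconst 2 q).
  assert (S0 : forall p k, 0 <= sconst p k) by (intros; apply pow_le; pose proof (pos_INR (p + k)); lra).
  assert (A0 : 0 <= A) by (unfold A; pose proof (S0 2 (q-1))%nat; pose proof (S0 3 (q-1))%nat;
    pose proof (S0 1 q)%nat; pose proof (S0 2 q)%nat; lra).
  exists (c * (20 * A + 1)); split; [nra|]; intros t.
  assert (Eq : INR (q - 1) = INR q - 1) by (rewrite minus_INR by lia; reflexivity).
  set (X := exp ((INR q - / 2) * t)).
  assert (X0 : 0 < X) by apply exp_pos.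
  set (Y := exp (- (exp (- t) / 2))).
  assert (Y0 : 0 < Y <= 1).
  { unfold Y; split; [apply exp_pos|]; rewrite <- exp_0; apply exp_le; pose proof (exp_pos (- t)); lra. }
  assert (B1 : forall p, (p = 2 \/ p = 3)%nat -> 0 <= exp (t / 2) * ssum p t <= A * (X * Y)).
  { intros p Hp; destruct (ssum_bound p (q - 1) t ltac:(lia)) as [L U]; fold Y in U.
    pose proof (exp_pos (t / 2)); split; [apply Rmult_le_pos; lra|].
    apply Rle_trans with (2 * sconst p (q - 1) * (X * Y)).
    - replace (2 * sconst p (q - 1) * (X * Y)) with
        (exp (t / 2) * (2 * sconst p (q - 1) * exp (INR (q - 1) * t) * Y)).
      + apply Rmult_le_compat_l; lra.
      + replace X with (exp (t / 2) * exp (INR (q - 1) * t)); [ring|].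
        unfold X; rewrite <- exp_plus, Eq; f_equal; field.
    - apply Rmult_le_compat_r; [nra|]; unfold A; pose proof (S0 2 (q-1))%nat; pose proof (S0 3 (q-1))%nat;
        pose proof (S0 1 q)%nat; pose proof (S0 2 q)%nat; destruct Hp as [->| ->]; lra. }
  assert (B2 : forall p, (p = 1 \/ p = 2)%nat -> 0 <= exp (- (t / 2)) * ssum p t <= A * (X * Y)).
  { intros p Hp; destruct (ssum_bound p q t ltac:(lia)) as [L U]; fold Y in U.
    pose proof (exp_pos (- (t / 2))); split; [apply Rmult_le_pos; lra|].
    apply Rle_trans with (2 * sconst p q * (X * Y)).
    - replace (2 * sconst p q * (X * Y)) with
        (exp (- (t / 2)) * (2 * sconst p q * exp (INR q * t) * Y)).
      + apply Rmult_le_compat_l; lra.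
      + replace X with (exp (- (t / 2)) * exp (INR q * t)); [ring|].
        unfold X; rewrite <- exp_plus; f_equal; field.
    - apply Rmult_le_compat_r; [nra|]; unfold A; pose proof (S0 2 (q-1))%nat; pose proof (S0 3 (q-1))%nat;
        pose proof (S0 1 q)%nat; pose proof (S0 2 q)%nat; destruct Hp as [->| ->]; lra. }
  pose proof (B1 2%nat ltac:(auto)) as B12; pose proof (B1 3%nat ltac:(auto)) as B13.
  pose proof (B2 1%nat ltac:(auto)) as B21; pose proof (B2 2%nat ltac:(auto)) as B22.
  unfold kern, dkern; fold c.
  set (a2 := exp (t / 2) * ssum 2 t) in *; set (a3 := exp (t / 2) * ssum 3 t) in *.
  set (b1 := exp (- (t / 2)) * ssum 1 t) in *; set (b2 := exp (- (t / 2)) * ssum 2 t) in *.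
  assert (AX : 0 <= A * (X * Y) <= A * X).
  { split; [apply Rmult_le_pos; nra|apply Rmult_le_compat_l; nra]. }
  assert (XY : 0 < X * Y) by nra.
  replace (2 * exp (t / 2) * ssum 2 t + b1) with (2 * a2 + b1) by (unfold a2; ring).
  replace (2 * (exp (t / 2) * (/ 2 * ssum 2 t + (ssum 3 t - 2 * ssum 2 t))) +
    exp (- (t / 2)) * (- / 2 * ssum 1 t + (ssum 2 t - ssum 1 t))) with
    (2 * a3 - 3 * a2 - 3 / 2 * b1 + b2) by (unfold a2, a3, b1, b2; field).
  split; [split|].
  - apply Rmult_le_pos; lra.
  - replace (c * (20 * A + 1) * X * Y) with (c * (20 * (A * (X * Y)) + X * Y)) by ring.
    apply Rmult_le_compat_l; lra.
  - rewrite Rabs_mult, (Rabs_pos_eq c) by lra.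
    replace (c * (20 * A + 1) * X) with (c * (20 * (A * X) + X)) by ring.
    apply Rmult_le_compat_l; [lra|]; apply Rabs_le; lra.
Qed.

Lemma psi_bound : exists C, 0 < C /\ forall t,
  Rabs (psi t) <= C * exp (- t) /\ Rabs (dpsi t) <= C * exp (- t).
Proof.
  assert (S0 : forall p k, 0 <= sconst p k) by (intros; apply pow_le; pose proof (pos_INR (p + k)); lra).
  set (A := sconst 0 1 + sconst 1 1 + sconst 2 1 + sconst 3 1 +
    sconst 0 2 + sconst 1 2 + sconst 2 2 + sconst 3 2).
  assert (HA : forall p q, (p < 4)%nat -> (q = 1 \/ q = 2)%nat -> 0 <= sconst p q <= A).
  { intros p q Hp Hq; split; [apply S0|]; unfold A.
    pose proof (S0 0 1)%nat; pose proof (S0 1 1)%nat; pose proof (S0 2 1)%nat; pose proof (S0 3 1)%nat.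
    pose proof (S0 0 2)%nat; pose proof (S0 1 2)%nat; pose proof (S0 2 2)%nat; pose proof (S0 3 2)%nat.
    destruct p as [|[|[|[|]]]]; try lia; destruct Hq as [->| ->]; lra. }
  exists (200 * A + 1); split; [pose proof (HA 0 1)%nat as H; specialize (H ltac:(lia) ltac:(auto)); lra|].
  intros t; rewrite dpsi_eq.
  set (X := exp (- t)); assert (X0 : 0 < X) by apply exp_pos.
  assert (Ed : forall q, exp (INR q * dual t) <= exp (- (INR q * t))).
  { intros q; apply exp_le; unfold dual.
    assert (0 <= ln PI) by (rewrite <- ln_1; apply ln_le; [lra|]; pose proof PI2_1; lra).
    pose proof (pos_INR q); nra. }
  assert (B1 : forall p, (p < 4)%nat -> 0 <= ssum p (dual t) <= 2 * (A * X)).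
  { intros p Hp; destruct (ssum_bound_exp p 1 (dual t) (le_n _)) as [L U]; split; [exact L|].
    eapply Rle_trans; [exact U|]; rewrite Rmult_assoc; apply Rmult_le_compat_l; [lra|].
    destruct (HA p 1%nat Hp ltac:(auto)).
    apply Rmult_le_compat; try assumption; [left; apply exp_pos|].
    eapply Rle_trans; [apply Ed|]; simpl INR; rewrite Rmult_1_l; apply Rle_refl. }
  assert (B2 : forall p, (p < 4)%nat -> 0 <= exp t * ssum p (dual t) <= 2 * (A * X)).
  { intros p Hp; destruct (ssum_bound_exp p 2 (dual t) ltac:(lia)) as [L U].
    split; [apply Rmult_le_pos; [left; apply exp_pos|exact L]|].
    apply Rle_trans with (exp t * (2 * sconst p 2 * exp (INR 2 * dual t)));
      [apply Rmult_le_compat_l; [left; apply exp_pos|exact U]|].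
    destruct (HA p 2%nat Hp ltac:(auto)).
    replace (exp t * (2 * sconst p 2 * exp (INR 2 * dual t))) with
      (2 * (sconst p 2 * (exp t * exp (INR 2 * dual t)))) by ring.
    apply Rmult_le_compat_l; [lra|].
    apply Rmult_le_compat; try assumption; [left; apply Rmult_lt_0_compat; apply exp_pos|].
    replace X with (exp t * exp (- (INR 2 * t))).
    - apply Rmult_le_compat_l; [left; apply exp_pos|apply Ed].
    - unfold X; rewrite <- exp_plus; f_equal; simpl; ring. }
  pose proof (B1 0 ltac:(lia))%nat; pose proof (B1 1 ltac:(lia))%nat; pose proof (B1 2 ltac:(lia))%nat.
  pose proof (B2 0 ltac:(lia))%nat; pose proof (B2 1 ltac:(lia))%nat; pose proof (B2 2 ltac:(lia))%nat.
  pose proof (B2 3 ltac:(lia))%nat.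
  unfold psi, dpsi'.
  replace ((200 * A + 1) * X) with (200 * (A * X) + X) by ring.
  set (s0 := ssum 0 (dual t)) in *; set (s1 := ssum 1 (dual t)) in *; set (s2 := ssum 2 (dual t)) in *.
  set (s3 := ssum 3 (dual t)) in *.
  assert (AX : 0 <= A * X) by (apply Rmult_le_pos; [|lra]; destruct (HA 0 1)%nat; auto; try lia; lra).
  set (E := exp t) in *; set (W := A * X) in *.
  split.
  - replace (4 / 3 * (E * (3 / 2 * s0 - 6 * s1 + 2 * s2) + / 2 * s0 - s1)) with
      (2 * (E * s0) - 8 * (E * s1) + 8 / 3 * (E * s2) + 2 / 3 * s0 - 4 / 3 * s1) by field.
    apply Rabs_le; lra.
  - match goal with |- Rabs ?e <= _ => replace e with
      (2 * (E * s0) - 18 * (E * s1) + 16 * (E * s2) - 8 / 3 * (E * s3) - 2 * s1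
        + 4 / 3 * s2) by field end.
    apply Rabs_le; lra.
Qed.

(** * Complex series and the complex exponential *)

Notation is_Cseries := (is_series (K := C_AbsRing) (V := C_NormedModule)).
Lemma C_eq (z w : C) : fst z = fst w -> snd z = snd w -> z = w.
Proof. destruct z, w; simpl; congruence. Qed.

Lemma sum_n_C (a : nat -> C) (n : nat) :
  sum_n (G := C_NormedModule) a n = (sum_n (fun k => fst (a k)) n, sum_n (fun k => snd (a k)) n).
Proof.
  induction n; [rewrite !sum_O; apply surjective_pairing|].
  rewrite !sum_Sn, IHn; reflexivity.
Qed.

Lemma is_Cseries_parts (a : nat -> C) (l : C) :
  is_Cseries a l <->
  is_series (fun n => fst (a n)) (fst l) /\ is_series (fun n => snd (a n)) (snd l).
Proof.
  unfold is_series; split.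
  - intros H; split; apply filterlim_locally; intros eps.
    + pose proof (proj1 (filterlim_locally _ _) H eps) as Q; revert Q; apply filter_imp.
      intros n; rewrite sum_n_C; intros [A _]; exact A.
    + pose proof (proj1 (filterlim_locally _ _) H eps) as Q; revert Q; apply filter_imp.
      intros n; rewrite sum_n_C; intros [_ A]; exact A.
  - intros [H1 H2]; apply filterlim_locally; intros eps.
    pose proof (proj1 (filterlim_locally _ _) H1 eps) as Q1.
    pose proof (proj1 (filterlim_locally _ _) H2 eps) as Q2.
    generalize (filter_and _ _ Q1 Q2); apply filter_imp.
    intros n [A B]; rewrite sum_n_C; split; assumption.
Qed.

Lemma Cmod_parts (z : C) : Rabs (fst z) <= Cmod z /\ Rabs (snd z) <= Cmod z.
Proof.
  pose proof (Rmax_Cmod z); pose proof (Rmax_l (Rabs (fst z)) (Rabs (snd z)));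
  pose proof (Rmax_r (Rabs (fst z)) (Rabs (snd z))); lra.
Qed.

Lemma Cexp_eq (z : C) : Cexp z = (exp (fst z) * cos (snd z), exp (fst z) * sin (snd z)).
Proof. apply C_eq; unfold Cexp, Ci, Re, Im; simpl; ring. Qed.

Lemma Cexp_plus (z w : C) : Cexp (z + w) = (Cexp z * Cexp w)%C.
Proof.
  rewrite !Cexp_eq; simpl; rewrite exp_plus, cos_plus, sin_plus; apply C_eq; simpl; ring.
Qed.

Lemma Cexp_R (x : R) : Cexp (RtoC x) = RtoC (exp x).
Proof. rewrite Cexp_eq; simpl; rewrite cos_0, sin_0; apply C_eq; simpl; ring. Qed.

Lemma Cmod_Cexp (z : C) : Cmod (Cexp z) = exp (fst z).
Proof.
  rewrite Cexp_eq; unfold Cmod; simpl.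
  transitivity (sqrt (Rsqr (exp (fst z)))); [|apply sqrt_Rsqr; left; apply exp_pos].
  f_equal; unfold Rsqr.
  pose proof (sin2_cos2 (snd z)) as H; unfold Rsqr in H.
  transitivity (exp (fst z) * exp (fst z) * (sin (snd z) * sin (snd z) + cos (snd z) * cos (snd z))).
  - ring.
  - rewrite H; ring.
Qed.

Lemma exp_term_le (x : R) (k : nat) : 0 <= x -> x ^ k / INR (fact k) <= exp x.
Proof.
  intros Hx; pose proof (is_exp_Reals x) as H; apply is_pseries_R in H; apply is_series_rsum in H.
  assert (P : forall n, 0 <= / INR (fact n) * x ^ n).
  { intros n; apply Rmult_le_pos; [left; apply Rinv_0_lt_compat, INR_fact_lt_0|apply pow_le, Hx]. }
  pose proof (is_lim_seq_incr_compare _ _ H) as Q.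
  specialize (Q ltac:(intros n; cbn [rsum]; pose proof (P n); lra) (S k)); cbn [rsum] in Q.
  assert (R0 : 0 <= rsum k (fun n => / INR (fact n) * x ^ n)).
  { clear - P; induction k; cbn [rsum]; [lra|pose proof (P k); lra]. }
  unfold Rdiv; rewrite Rmult_comm; lra.
Qed.

(** F stands for either coordinate; the coefficients are dominated by those of the real exponential
    of the modulus of z. *)
Lemma Cpow_fact_radius (z : C) (F : C -> R) : (forall w, Rabs (F w) <= Cmod w) ->
  CV_radius (fun k => F (Cpow z k) / INR (fact k)) = p_infty.
Proof.
  intros HF.
  destruct (CV_radius_bounded (fun k => F (Cpow z k) / INR (fact k))) as [UB _].
  assert (Q : forall r : R, Rbar_le r (CV_radius (fun k => F (Cpow z k) / INR (fact k)))).
  { intros r; apply UB; exists (exp (Cmod z * Rabs r)); intros n.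
    eapply Rle_trans; [|apply (exp_term_le _ n), Rmult_le_pos; [apply Cmod_ge_0|apply Rabs_pos]].
    unfold Rdiv; rewrite !Rabs_mult, Rpow_mult_distr, <- RPow_abs.
    rewrite (Rabs_pos_eq (/ INR (fact n))) by (left; apply Rinv_0_lt_compat, INR_fact_lt_0).
    replace (Cmod z ^ n * Rabs r ^ n * / INR (fact n)) with (Cmod z ^ n * / INR (fact n) * Rabs r ^ n) by ring.
    apply Rmult_le_compat_r; [apply pow_le, Rabs_pos|].
    apply Rmult_le_compat_r; [left; apply Rinv_0_lt_compat, INR_fact_lt_0|].
    rewrite <- Cmod_pow; apply HF. }
  destruct (CV_radius _) as [c| |]; [|reflexivity|].
  - specialize (Q (c + 1)); simpl in Q; lra.
  - specialize (Q 0); contradiction.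
Qed.

Lemma constant_of_derive_0 (f : R -> R) (t : R) : (forall t, is_derive f t 0) -> f t = f 0.
Proof. intros D; destruct (MVT_everywhere f (fun _ => 0) 0 t D) as (c & _ & E); lra. Qed.

(* Multiplying the two real series by the inverse of [Cexp (t z)] gives constants. *)
Lemma Cexp_series (z : C) : is_Cseries (fun k => (Cpow z k * RtoC (/ INR (fact k)))%C) (Cexp z).
Proof.
  set (a := fun k => fst (Cpow z k) / INR (fact k)).
  set (b := fun k => snd (Cpow z k) / INR (fact k)).
  assert (Ra : CV_radius a = p_infty) by (apply Cpow_fact_radius; intros; apply Cmod_parts).
  assert (Rb : CV_radius b = p_infty) by (apply Cpow_fact_radius; intros; apply Cmod_parts).
  set (x := fst z); set (y := snd z).
  assert (Ea : forall t, ex_pseries a t) by (intros; apply CV_radius_inside; rewrite Ra; exact I).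
  assert (Eb : forall t, ex_pseries b t) by (intros; apply CV_radius_inside; rewrite Rb; exact I).
  assert (Sa : forall c t, ex_pseries (PS_scal c a) t).
  { intros; apply ex_pseries_scal; [apply Rmult_comm|apply Ea]. }
  assert (Sb : forall c t, ex_pseries (PS_scal c b) t).
  { intros; apply ex_pseries_scal; [apply Rmult_comm|apply Eb]. }
  assert (Da : forall t, is_derive (PSeries a) t (x * PSeries a t + - y * PSeries b t)).
  { intros t; rewrite <- !PSeries_scal, <- PSeries_plus by auto.
    rewrite (PSeries_ext _ (PS_derive a)); [apply is_derive_PSeries; rewrite Ra; exact I|].
    intros n; unfold PS_plus, PS_scal, PS_derive, a, b, plus, scal; simpl; unfold mult; simpl.
    change (fact n + n * fact n)%nat with (S n * fact n)%nat.
    rewrite mult_INR; fold x y; change (match n with 0%nat => 1 | S _ => INR n + 1 end) with (INR (S n)).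
    field; split; [apply INR_fact_neq_0|apply not_0_INR; lia]. }
  assert (Db : forall t, is_derive (PSeries b) t (y * PSeries a t + x * PSeries b t)).
  { intros t; rewrite <- !PSeries_scal, <- PSeries_plus by auto.
    rewrite (PSeries_ext _ (PS_derive b)); [apply is_derive_PSeries; rewrite Rb; exact I|].
    intros n; unfold PS_plus, PS_scal, PS_derive, a, b, plus, scal; simpl; unfold mult; simpl.
    change (fact n + n * fact n)%nat with (S n * fact n)%nat.
    rewrite mult_INR; fold x y; change (match n with 0%nat => 1 | S _ => INR n + 1 end) with (INR (S n)).
    field; split; [apply INR_fact_neq_0|apply not_0_INR; lia]. }
  set (c := fun t => exp (- x * t) * cos (y * t)).
  set (s := fun t => exp (- x * t) * sin (y * t)).
  assert (Dc : forall t, is_derive c t (- x * c t - y * s t)).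
  { intros t; unfold c, s; auto_derive; [exact I|ring]. }
  assert (Ds : forall t, is_derive s t (- x * s t + y * c t)).
  { intros t; unfold c, s; auto_derive; [exact I|ring]. }
  assert (A0 : PSeries a 0 = 1) by (rewrite PSeries_0; unfold a; simpl; field).
  assert (B0 : PSeries b 0 = 0) by (rewrite PSeries_0; unfold b; simpl; field).
  assert (c0 : c 0 = 1) by (unfold c; rewrite !Rmult_0_r, exp_0, cos_0; ring).
  assert (s0 : s 0 = 0) by (unfold s; rewrite !Rmult_0_r, exp_0, sin_0; ring).
  assert (Q1 : PSeries a 1 * c 1 + PSeries b 1 * s 1 = 1).
  { rewrite (constant_of_derive_0 (fun t => PSeries a t * c t + PSeries b t * s t) 1).
    - rewrite A0, B0, c0, s0; ring.
    - intros t; evar_last; [apply derive_plus; apply derive_mult; auto|ring]. }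
  assert (Q2 : PSeries b 1 * c 1 + -1 * (PSeries a 1 * s 1) = 0).
  { rewrite (constant_of_derive_0 (fun t => PSeries b t * c t + -1 * (PSeries a t * s t)) 1).
    - rewrite A0, B0, c0, s0; ring.
    - intros t; evar_last; [apply derive_plus; [|apply derive_scal]; apply derive_mult; auto|ring]. }
  assert (E1 : exp x * exp (- x) = 1) by (rewrite <- exp_plus, Rplus_opp_r; apply exp_0).
  pose proof (sin2_cos2 y) as T; unfold Rsqr in T.
  unfold c, s in Q1, Q2; rewrite !Rmult_1_r in Q1, Q2.
  set (A := PSeries a 1) in *; set (B := PSeries b 1) in *.
  assert (VA : A = exp x * cos y).
  { transitivity (exp x * (cos y * (A * (exp (- x) * cos y) + B * (exp (- x) * sin y))
       - sin y * (B * (exp (- x) * cos y) + -1 * (A * (exp (- x) * sin y))))).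
    - transitivity (A * (exp x * exp (- x)) * (sin y * sin y + cos y * cos y)); [rewrite E1, T; ring|ring].
    - rewrite Q1, Q2; ring. }
  assert (VB : B = exp x * sin y).
  { transitivity (exp x * (sin y * (A * (exp (- x) * cos y) + B * (exp (- x) * sin y))
       + cos y * (B * (exp (- x) * cos y) + -1 * (A * (exp (- x) * sin y))))).
    - transitivity (B * (exp x * exp (- x)) * (sin y * sin y + cos y * cos y)); [rewrite E1, T; ring|ring].
    - rewrite Q1, Q2; ring. }
  apply is_Cseries_parts; rewrite Cexp_eq; simpl fst at 3; simpl snd at 3; fold x y.
  rewrite <- VA, <- VB; split.
  - apply (is_series_ext (fun k => a k * 1 ^ k)).
    + intros k; as_R; rewrite pow1; unfold a; simpl; field; apply INR_fact_neq_0.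
    + exact (proj1 (is_pseries_R a 1 A) (PSeries_correct a 1 (Ea 1))).
  - apply (is_series_ext (fun k => b k * 1 ^ k)).
    + intros k; as_R; rewrite pow1; unfold b; simpl; field; apply INR_fact_neq_0.
    + exact (proj1 (is_pseries_R b 1 B) (PSeries_correct b 1 (Eb 1))).
Qed.

(** * Laplace transforms are analytic *)

Definition contC (f : R -> C) := cont (fun t => fst (f t)) /\ cont (fun t => snd (f t)).
Definition domC (M c : R) (f : R -> C) := 0 < c /\ forall t, 0 <= t -> Cmod (f t) <= M * exp (- (c * t)).
Definition JC (f : R -> C) : C := (J (fun t => fst (f t)), J (fun t => snd (f t))).

Lemma domC_parts (M c : R) (f : R -> C) : domC M c f ->
  dom M c (fun t => fst (f t)) /\ dom M c (fun t => snd (f t)).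
Proof.
  intros [Hc H]; repeat split; try exact Hc; intros t Ht; specialize (H t Ht);
    destruct (Cmod_parts (f t)); lra.
Qed.

Lemma JC_ext (f g : R -> C) : (forall t, f t = g t) -> JC f = JC g.
Proof. intros H; replace g with f; [reflexivity|apply functional_extensionality, H]. Qed.

Lemma J_lin2 (f g : R -> R) (a b C c D d : R) : cont f -> cont g -> dom C c f -> dom D d g ->
  J (fun t => a * f t + b * g t) = a * J f + b * J g.
Proof.
  intros Cf Cg Df Dg.
  assert (Db : dom (Rabs b * D) d (fun t => b * g t)).
  { destruct Dg as [Hd Hg]; split; [exact Hd|]; intros t Ht; rewrite Rabs_mult, Rmult_assoc.
    apply Rmult_le_compat_l; [apply Rabs_pos|apply Hg, Ht]. }
  assert (Cb : cont (fun t => b * g t)) by (apply (cont_mult (fun _ => b)); [apply cont_const|exact Cg]).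
  rewrite (J_lin f (fun t => b * g t) a C c (Rabs b * D) d Cf Cb Df Db).
  rewrite (J_scal g b (J g) Cg (J_correct g D d Cg Dg)); reflexivity.
Qed.

Lemma JC_lin (f g : R -> C) (z : C) (M c N d : R) :
  contC f -> contC g -> domC M c f -> domC N d g ->
  JC (fun t => (z * f t + g t)%C) = (z * JC f + JC g)%C.
Proof.
  intros [C1 C2] [C3 C4] Df Dg; destruct (domC_parts _ _ _ Df) as [D1 D2], (domC_parts _ _ _ Dg) as [D3 D4].
  assert (Q : forall (a b : R) (h : R -> R), cont h -> dom N d h ->
    J (fun t => a * fst (f t) + b * snd (f t) + h t) =
    a * J (fun t => fst (f t)) + b * J (fun t => snd (f t)) + J h).
  { intros a b h Ch Dh.
    rewrite <- (J_lin2 _ _ a b M c M c C1 C2 D1 D2).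
    rewrite <- (Rmult_1_l (J (fun t => a * fst (f t) + b * snd (f t)))).
    rewrite <- (J_lin (fun t => a * fst (f t) + b * snd (f t)) h 1 ((Rabs a + Rabs b) * M) c N d); auto.
    - f_equal; apply functional_extensionality; intros t; ring.
    - apply cont_plus; apply (cont_mult (fun _ => _)); auto using cont_const.
    - split; [apply D1|]; intros t Ht; eapply Rle_trans; [apply Rabs_triang|].
      rewrite !Rabs_mult, !Rmult_plus_distr_r, !Rmult_assoc.
      apply Rplus_le_compat; (apply Rmult_le_compat_l; [apply Rabs_pos|]); [apply D1|apply D2]; exact Ht. }
  apply C_eq; unfold JC; simpl.
  - transitivity (fst z * J (fun t => fst (f t)) + - snd z * J (fun t => snd (f t)) + J (fun t => fst (g t)));
      [rewrite <- Q by assumption; f_equal; apply functional_extensionality; intros; ring|ring].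
  - transitivity (snd z * J (fun t => fst (f t)) + fst z * J (fun t => snd (f t)) + J (fun t => snd (g t)));
      [rewrite <- Q by assumption; f_equal; apply functional_extensionality; intros; ring|ring].
Qed.

Lemma contC_const (z : C) : contC (fun _ => z).
Proof. split; apply cont_const. Qed.

Lemma contC_mult (f g : R -> C) : contC f -> contC g -> contC (fun t => (f t * g t)%C).
Proof.
  intros [A B] [A' B']; split; simpl.
  - apply cont_minus; apply cont_mult; assumption.
  - apply cont_plus; apply cont_mult; assumption.
Qed.

Lemma contC_plus (f g : R -> C) : contC f -> contC g -> contC (fun t => (f t + g t)%C).
Proof. intros [A B] [A' B']; split; simpl; apply cont_plus; assumption. Qed.

Lemma contC_R (f : R -> R) : cont f -> contC (fun t => RtoC (f t)).
Proof. intros H; split; simpl; [exact H|apply cont_const]. Qed.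

Lemma contC_Cexp (s : C) : contC (fun t => Cexp (s * RtoC t)).
Proof.
  split.
  - replace (fun t => fst (Cexp (s * RtoC t))) with (fun t => exp (fst s * t) * cos (snd s * t)).
    + intros t; apply @ex_derive_continuous; auto_derive; exact I.
    + apply functional_extensionality; intros t; rewrite Cexp_eq; simpl; f_equal; f_equal; ring.
  - replace (fun t => snd (Cexp (s * RtoC t))) with (fun t => exp (fst s * t) * sin (snd s * t)).
    + intros t; apply @ex_derive_continuous; auto_derive; exact I.
    + apply functional_extensionality; intros t; rewrite Cexp_eq; simpl; f_equal; f_equal; ring.
Qed.

Lemma Cmod_Cexp_line (s : C) (t : R) : Cmod (Cexp (s * RtoC t)) = exp (fst s * t).
Proof. rewrite Cmod_Cexp; f_equal; simpl; ring. Qed.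

Lemma JC_scal (f : R -> C) (z : C) (M c : R) : contC f -> domC M c f ->
  JC (fun t => (z * f t)%C) = (z * JC f)%C.
Proof.
  intros Cf Df.
  assert (D0 : domC 0 c (fun _ : R => RtoC 0)).
  { split; [apply Df|]; intros; rewrite Cmod_0; lra. }
  assert (J0 : JC (fun _ : R => RtoC 0) = RtoC 0).
  { assert (Z : J (fun _ => 0) = 0).
    { apply is_J_unique, (is_lim_ext (fun _ => 0)); [|apply is_lim_const].
      intros b; rewrite RInt_const; unfold scal; simpl; unfold mult; simpl; ring. }
    unfold JC; simpl; rewrite Z; reflexivity. }
  pose proof (JC_lin f (fun _ => RtoC 0) z M c 0 c Cf (contC_const _) Df D0) as H.
  rewrite J0 in H; rewrite Cplus_0_r in H; rewrite <- H.
  apply JC_ext; intros; rewrite Cplus_0_r; reflexivity.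
Qed.

Lemma JC_series (f : nat -> R -> C) (F : R -> C) (M : nat -> R) (c : R) :
  (forall n, contC (f n)) -> contC F -> 0 < c ->
  (forall n t, 0 <= t -> Cmod (f n t) <= M n * exp (- (c * t))) ->
  ex_series M -> (forall t, 0 <= t -> is_Cseries (fun n => f n t) (F t)) ->
  is_Cseries (fun n => JC (f n)) (JC F).
Proof.
  intros Cf [CF1 CF2] Hc Hf HM HF.
  apply is_Cseries_parts; split; simpl.
  - apply (J_series (fun n t => fst (f n t)) (fun t => fst (F t)) M c); auto.
    + intros n; apply Cf.
    + intros n t Ht; eapply Rle_trans; [apply Cmod_parts|apply Hf, Ht].
    + intros t Ht; apply (proj1 (is_Cseries_parts _ _) (HF t Ht)).
  - apply (J_series (fun n t => snd (f n t)) (fun t => snd (F t)) M c); auto.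
    + intros n; apply Cf.
    + intros n t Ht; eapply Rle_trans; [apply Cmod_parts|apply Hf, Ht].
    + intros t Ht; apply (proj1 (is_Cseries_parts _ _) (HF t Ht)).
Qed.

(** A Mellin integral in the variable exp t splits at t = 0 into [lap] of the right half at s and
    [lap] of the reflected left half at - s. *)
Definition lap (f : R -> R) (s : C) : C := JC (fun t => (RtoC (f t) * Cexp (- s * RtoC t))%C).

Lemma lap_cont (f : R -> R) (s : C) : cont f -> contC (fun t => (RtoC (f t) * Cexp (- s * RtoC t))%C).
Proof. intros Cf; apply contC_mult; [apply contC_R, Cf|apply contC_Cexp]. Qed.

Definition ebound (M c : R) (f : R -> R) := forall t, 0 <= t -> Rabs (f t) <= M * exp (- (c * t)).

Lemma lap_dom (f : R -> R) (M c : R) (s : C) : ebound M c f -> - c < fst s ->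
  domC M (c + fst s) (fun t => (RtoC (f t) * Cexp (- s * RtoC t))%C).
Proof.
  intros Hf Hs; split; [lra|]; intros t Ht.
  rewrite Cmod_mult, Cmod_R, Cmod_Cexp_line.
  replace (- ((c + fst s) * t)) with (- (c * t) + fst (- s)%C * t) by (simpl; ring).
  rewrite exp_plus, <- Rmult_assoc; apply Rmult_le_compat_r; [left; apply exp_pos|apply Hf, Ht].
Qed.

Lemma Cpow_scal (z : C) (t : R) (k : nat) : Cpow (z * RtoC t) k = (Cpow z k * RtoC (t ^ k))%C.
Proof. rewrite Cpow_mult_l, <- RtoC_pow; reflexivity. Qed.

Lemma ex_series_half (C0 : R) : ex_series (fun k => C0 * (/ 2) ^ k).
Proof.
  exists (C0 * / (1 - / 2)); apply series_scal, is_series_geom; rewrite Rabs_pos_eq; lra.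
Qed.

(** The factor exp (- (z - s) t) is expanded under the integral. With b the decay rate of the
    integrand at s, the radius b / 4 bounds the k-th term by 2^(- k) exp (b t / 2): a geometric
    series that uses up only half of the decay. *)
Lemma lap_analytic (f : R -> R) (M c : R) (s : C) : cont f -> ebound M c f -> - c < fst s ->
  analytic_at (lap f) s.
Proof.
  intros Cf Hf Hs; set (b := c + fst s); assert (Hb : 0 < b) by (unfold b; lra).
  assert (M0 : 0 <= M).
  { pose proof (Hf 0 (Rle_refl 0)) as H; rewrite Rmult_0_r, Ropp_0, exp_0 in H.
    pose proof (Rabs_pos (f 0)); lra. }
  set (G := fun t => (RtoC (f t) * Cexp (- s * RtoC t))%C).
  pose proof (lap_dom f M c s Hf Hs) as DG; fold G b in DG.
  pose proof (lap_cont f s Cf) as CG; fold G in CG.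
  assert (Ct : forall k, cont (fun t => (- t) ^ k / INR (fact k))).
  { intros k t; apply @ex_derive_continuous; auto_derive; exact I. }
  exists (fun k => JC (fun t => (RtoC ((- t) ^ k / INR (fact k)) * G t)%C)), (b / 4).
  split; [lra|]; intros z Hz; unfold is_pseries.
  set (h := (z - s)%C) in *.
  assert (HM : forall k t, 0 <= t -> Rabs ((- t) ^ k / INR (fact k)) * Cmod h ^ k <= (/ 2) ^ k * exp (b / 2 * t)).
  { intros k t Ht.
    replace (Rabs ((- t) ^ k / INR (fact k))) with (t ^ k / INR (fact k)).
    2:{ unfold Rdiv; rewrite Rabs_mult, <- RPow_abs, Rabs_Ropp, Rabs_pos_eq by exact Ht.
        rewrite Rabs_pos_eq; [reflexivity|left; apply Rinv_0_lt_compat, INR_fact_lt_0]. }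
    pose proof (exp_term_le (b / 2 * t) k ltac:(apply Rmult_le_pos; lra)) as E.
    rewrite Rpow_mult_distr in E.
    assert (Hh : Cmod h ^ k <= (/ 2) ^ k * (b / 2) ^ k).
    { rewrite <- Rpow_mult_distr; apply pow_incr; split; [apply Cmod_ge_0|lra]. }
    assert (T : 0 <= t ^ k / INR (fact k)).
    { apply Rmult_le_pos; [apply pow_le, Ht|left; apply Rinv_0_lt_compat, INR_fact_lt_0]. }
    apply Rle_trans with (t ^ k / INR (fact k) * ((/ 2) ^ k * (b / 2) ^ k)); [apply Rmult_le_compat_l; assumption|].
    replace (t ^ k / INR (fact k) * ((/ 2) ^ k * (b / 2) ^ k)) with
      ((/ 2) ^ k * ((b / 2) ^ k * t ^ k / INR (fact k))) by (unfold Rdiv; ring).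
    apply Rmult_le_compat_l; [apply pow_le; lra|exact E]. }
  assert (DM : forall k t, 0 <= t -> Cmod (Cpow h k * (RtoC ((- t) ^ k / INR (fact k)) * G t)) <=
     M * (/ 2) ^ k * exp (- (b / 2 * t))).
  { intros k t Ht; rewrite !Cmod_mult, Cmod_pow, Cmod_R.
    pose proof (proj2 DG t Ht) as DGt.
    replace (M * (/ 2) ^ k * exp (- (b / 2 * t))) with
      ((/ 2) ^ k * exp (b / 2 * t) * (M * exp (- (b * t)))).
    - rewrite <- Rmult_assoc, (Rmult_comm (Cmod h ^ k)).
      apply Rmult_le_compat; [|apply Cmod_ge_0|apply HM, Ht|exact DGt].
      apply Rmult_le_pos; [apply Rabs_pos|apply pow_le, Cmod_ge_0].
    - replace (- (b / 2 * t)) with (b / 2 * t + - (b * t)) by field; rewrite exp_plus; ring. }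
  apply (is_series_ext (fun k => JC (fun t => (Cpow h k * (RtoC ((- t) ^ k / INR (fact k)) * G t))%C))).
  - intros k.
    assert (Ck : contC (fun t => (RtoC ((- t) ^ k / INR (fact k)) * G t)%C)) by (apply contC_mult; [apply contC_R, Ct|exact CG]).
    apply (JC_scal _ _ ((4 / b) ^ k * exp 0 * M) (b / 2) Ck).
    split; [lra|]; intros t Ht; rewrite Cmod_mult, Cmod_R.
    pose proof (proj2 DG t Ht) as DGt.
    pose proof (exp_term_le (b / 2 * t) k ltac:(apply Rmult_le_pos; lra)) as E.
    replace (Rabs ((- t) ^ k / INR (fact k))) with (t ^ k / INR (fact k)).
    2:{ unfold Rdiv; rewrite Rabs_mult, <- RPow_abs, Rabs_Ropp, Rabs_pos_eq by exact Ht.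
        rewrite Rabs_pos_eq; [reflexivity|left; apply Rinv_0_lt_compat, INR_fact_lt_0]. }
    rewrite exp_0, Rmult_1_r.
    assert (T1 : t ^ k / INR (fact k) <= (4 / b) ^ k * exp (b / 2 * t)).
    { replace (t ^ k / INR (fact k)) with ((2 / b) ^ k * ((b / 2 * t) ^ k / INR (fact k))).
      - apply Rmult_le_compat; [apply pow_le; left; apply Rdiv_lt_0_compat; lra| | |exact E].
        + apply Rmult_le_pos; [apply pow_le, Rmult_le_pos; lra|left; apply Rinv_0_lt_compat, INR_fact_lt_0].
        + apply pow_incr; split; [left; apply Rdiv_lt_0_compat; lra|].
          apply Rmult_le_compat_r; [left; apply Rinv_0_lt_compat, Hb|lra].
      - unfold Rdiv at 2; rewrite <- Rmult_assoc, <- Rpow_mult_distr.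
        replace (2 / b * (b / 2 * t)) with t by (field; lra); reflexivity. }
    replace ((4 / b) ^ k * M * exp (- (b / 2 * t))) with
      ((4 / b) ^ k * exp (b / 2 * t) * (M * exp (- (b * t)))).
    + apply Rmult_le_compat; [|apply Cmod_ge_0|exact T1|exact DGt].
      apply Rmult_le_pos; [apply pow_le, Ht|left; apply Rinv_0_lt_compat, INR_fact_lt_0].
    + replace (- (b / 2 * t)) with (b / 2 * t + - (b * t)) by field; rewrite exp_plus; ring.
  - apply (JC_series _ _ (fun k => M * (/ 2) ^ k) (b / 2)).
    + intros k; apply contC_mult; [apply contC_const|apply contC_mult; [apply contC_R, Ct|exact CG]].
    + apply lap_cont, Cf.
    + lra.
    + exact DM.
    + apply ex_series_half.
    + intros t Ht.
      pose proof (Cexp_series (- h * RtoC t)) as E.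
      assert (EG : (RtoC (f t) * Cexp (- z * RtoC t))%C = (G t * Cexp (- h * RtoC t))%C).
      { unfold G; rewrite <- Cmult_assoc, <- Cexp_plus; f_equal; f_equal; unfold h; ring. }
      rewrite EG.
      eapply is_series_ext; [|apply (is_series_scal (K := C_AbsRing) (V := C_NormedModule) (G t)), E].
      intros k; unfold scal; simpl; unfold mult; simpl.
      replace (- h * RtoC t)%C with (h * RtoC (- t))%C by (rewrite RtoC_opp; ring).
      rewrite Cpow_scal; unfold Rdiv; rewrite RtoC_mult; ring.
Qed.

Lemma analytic_ext (f g : C -> C) (s : C) : (forall z, f z = g z) -> analytic_at f s -> analytic_at g s.
Proof. intros E (a & r & Hr & H); exists a, r; split; [exact Hr|]; intros z Hz; rewrite <- E; auto. Qed.

Lemma analytic_plus (f g : C -> C) (s : C) :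
  analytic_at f s -> analytic_at g s -> analytic_at (fun z => f z + g z)%C s.
Proof.
  intros (a & r & Hr & H) (b & r' & Hr' & H'); exists (PS_plus a b), (Rmin r r').
  split; [apply Rmin_pos; assumption|]; intros z Hz.
  apply (is_pseries_plus (K := C_AbsRing) (V := C_NormedModule)); [apply H|apply H'];
    eapply Rlt_le_trans; eauto; [apply Rmin_l|apply Rmin_r].
Qed.

Lemma analytic_scal (f : C -> C) (c s : C) :
  analytic_at f s -> analytic_at (fun z => c * f z)%C s.
Proof.
  intros (a & r & Hr & H); exists (PS_scal c a), r; split; [exact Hr|]; intros z Hz.
  apply (is_pseries_scal (K := C_AbsRing) (V := C_NormedModule)); [apply Cmult_comm|apply H, Hz].
Qed.

(** Writing z as (z - s) + s makes one part a shift of the coefficients. Repeated use covers the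
    polynomial factors of [zeta_reg], with no product of two power series. *)
Lemma analytic_mul_X (f : C -> C) (s : C) :
  analytic_at f s -> analytic_at (fun z => z * f z)%C s.
Proof.
  intros (a & r & Hr & H).
  apply (analytic_ext (fun z => (z - s) * f z + s * f z)%C); [intros; ring|].
  apply analytic_plus; [|apply analytic_scal; exists a, r; auto].
  exists (PS_incr_1 a), r; split; [exact Hr|]; intros z Hz.
  apply (is_pseries_incr_1 (K := C_AbsRing) (V := C_NormedModule)), H, Hz.
Qed.

Lemma is_Cseries_lim (a : nat -> C) (l : C) (e : nat -> R) :
  (forall n, Cmod (sum_n (G := C_NormedModule) a n - l) <= e n) -> is_lim_seq e 0 -> is_Cseries a l.
Proof.
  intros H L; apply filterlim_locally; intros eps.
  apply is_lim_seq_spec in L; destruct (L eps) as [N HN]; exists N; intros n Hn.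
  specialize (HN n Hn); rewrite Rminus_0_r in HN; apply Rabs_def2 in HN.
  specialize (H n); destruct (Cmod_parts (sum_n (G := C_NormedModule) a n - l)) as [A B].
  split; unfold ball; simpl; unfold AbsRing_ball, abs, minus, plus, opp; simpl.
  - eapply Rle_lt_trans; [exact A|lra].
  - eapply Rle_lt_trans; [exact B|lra].
Qed.

Lemma Cgeom (q : C) : Cmod q < 1 -> is_Cseries (Cpow q) (/ (1 - q))%C.
Proof.
  intros Hq.
  assert (N0 : (1 - q)%C <> RtoC 0).
  { intros E; assert (q = RtoC 1) by (transitivity (1 - (1 - q))%C; [ring|rewrite E; ring]); subst.
    rewrite Cmod_1 in Hq; lra. }
  apply (is_Cseries_lim _ _ (fun n => / Cmod (1 - q) * Cmod q ^ S n)).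
  - intros n.
    assert (E : sum_n (G := C_NormedModule) (Cpow q) n = ((1 - Cpow q (S n)) / (1 - q))%C).
    { induction n as [|n IH].
      - rewrite sum_O; simpl; field; exact N0.
      - rewrite sum_Sn, IH; unfold plus; simpl; field; exact N0. }
    rewrite E.
    replace ((1 - Cpow q (S n)) / (1 - q) - / (1 - q))%C with (- (/ (1 - q) * Cpow q (S n)))%C by (field; exact N0).
    rewrite Cmod_opp, Cmod_mult, Cmod_inv, Cmod_pow by exact N0; lra.
  - replace (Finite 0) with (Rbar_mult (/ Cmod (1 - q)) 0) by (simpl; f_equal; ring).
    apply is_lim_seq_scal_l, (is_lim_seq_incr_1 (fun n => Cmod q ^ n)).
    apply is_lim_seq_geom; rewrite Rabs_pos_eq; [exact Hq|apply Cmod_ge_0].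
Qed.

Lemma analytic_inv (c s : C) : s <> c -> analytic_at (fun z => / (z - c))%C s.
Proof.
  intros Hs.
  assert (N0 : (s - c)%C <> RtoC 0).
  { intros E; apply Hs; transitivity (s - c + c)%C; [ring|rewrite E; ring]. }
  exists (fun k => (/ (s - c) * Cpow (- / (s - c)) k)%C), (Cmod (s - c) / 2).
  assert (P' : 0 < Cmod (s - c)) by (apply (proj1 (Cmod_gt_0 _)), N0).
  split; [lra|]; intros z Hz; unfold is_pseries.
  set (q := (- / (s - c) * (z - s))%C).
  assert (Hq : Cmod q < 1).
  { unfold q; rewrite Cmod_mult, Cmod_opp, Cmod_inv by exact N0.
    apply (Rmult_lt_reg_l (Cmod (s - c))); [exact P'|].
    rewrite <- Rmult_assoc, Rinv_r, Rmult_1_l, Rmult_1_r by lra; lra. }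
  assert (N1 : (1 - q)%C <> RtoC 0).
  { intros E; assert (q = RtoC 1) as E1 by (transitivity (1 - (1 - q))%C; [ring|rewrite E; ring]).
    rewrite E1, Cmod_1 in Hq; lra. }
  assert (Ez : (z - c)%C = ((s - c) * (1 - q))%C) by (unfold q; field; exact N0).
  replace (/ (z - c))%C with (/ (s - c) * / (1 - q))%C.
  - eapply is_series_ext; [|apply (is_series_scal (K := C_AbsRing) (V := C_NormedModule) (/ (s - c))%C), Cgeom, Hq].
    intros k; unfold scal; simpl; unfold mult; simpl; unfold q.
    rewrite Cpow_mult_l; change (pow_n (K := C_AbsRing) (z - s)%C k) with (Cpow (z - s) k); ring.
  - rewrite Ez; field; split; assumption.
Qed.

Lemma analytic_shift (f : C -> C) (c s : C) :
  analytic_at f (s + c) -> analytic_at (fun z => f (z + c)%C) s.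
Proof.
  intros (a & r & Hr & H); exists a, r; split; [exact Hr|]; intros z Hz.
  replace (z - s)%C with (z + c - (s + c))%C in * by ring; apply H, Hz.
Qed.

Lemma analytic_const (c s : C) : analytic_at (fun _ => c) s.
Proof.
  exists (fun k => match k with O => c | _ => RtoC 0 end), 1; split; [lra|]; intros z _.
  apply (is_Cseries_lim _ _ (fun _ => 0)); [|apply is_lim_seq_const].
  intros n.
  match goal with |- Cmod (?S - c) <= 0 => replace S with c end.
  - replace (c - c)%C with (RtoC 0) by ring; rewrite Cmod_0; lra.
  - induction n as [|n IH].
    + rewrite sum_O; unfold scal; simpl; unfold mult, one; simpl; ring.
    + rewrite sum_Sn, <- IH; unfold plus, scal; simpl; unfold mult; simpl; ring.
Qed.

(** * Euler-Maclaurin continuation of zeta *)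

(** The first three Bernoulli polynomials. With the third one the remainder integral converges for
    Re s > - 2, which covers the line Re s = - 1 occurring in the Fourier coefficients. *)
Definition bern1 (v : R) : R := v - / 2.
Definition bern2 (v : R) : R := v ^ 2 - v + / 6.
Definition bern3 (v : R) : R := v ^ 3 - 3 / 2 * v ^ 2 + / 2 * v.

Lemma frac_part_eq (y : R) (k : Z) : IZR k <= y < IZR k + 1 -> frac_part y = y - IZR k.
Proof. intros H; unfold frac_part; rewrite <- (Int_part_spec y k); lra. Qed.

Lemma bern3_bound (v : R) : 0 <= v <= 1 -> Rabs (bern3 v) <= v /\ Rabs (bern3 v) <= 1 - v.
Proof.
  intros Hv; unfold bern3.
  replace (v ^ 3 - 3 / 2 * v ^ 2 + / 2 * v) with (v * (1 - v) * (/ 2 - v)) by field.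
  assert (0 <= v * (1 - v)) by nra.
  rewrite Rabs_mult, (Rabs_pos_eq (v * (1 - v))) by assumption.
  assert (Rabs (/ 2 - v) <= 1) by (apply Rabs_le; lra).
  pose proof (Rabs_pos (/ 2 - v)); split; nra.
Qed.

(** [bern3] vanishes at 0 and at 1, so the periodic extension has no jumps. When an integer
    separates y and z, each value is bounded by the distance to an integer in between. *)
Lemma bern3_frac_lipschitz (y z : R) : y <= z ->
  Rabs (bern3 (frac_part z) - bern3 (frac_part y)) <= z - y.
Proof.
  intros Hyz.
  destruct (base_fp y) as [Y0 Y1], (base_fp z) as [Z0 Z1].
  set (v := frac_part y) in *; set (w := frac_part z) in *.
  assert (Ey : y = IZR (Int_part y) + v) by (unfold v, frac_part; ring).
  assert (Ez : z = IZR (Int_part z) + w) by (unfold w, frac_part; ring).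
  set (j := Int_part y) in *; set (k := Int_part z) in *.
  destruct (Z_lt_le_dec j k) as [L|L].
  - apply (Zlt_le_succ j k), IZR_le in L; rewrite succ_IZR in L.
    destruct (bern3_bound v) as [_ B1]; [lra|]; destruct (bern3_bound w) as [B2 _]; [lra|].
    apply Rabs_le_between in B1; apply Rabs_le_between in B2; apply Rabs_le; lra.
  - assert (k = j).
    { destruct (Z.eq_dec k j); [assumption|].
      assert (L' : (k + 1 <= j)%Z) by lia; apply IZR_le in L'; rewrite plus_IZR in L'; lra. }
    assert (Hvw : z - y = w - v) by (rewrite Ey, Ez, H; ring).
    unfold bern3.
    replace (w ^ 3 - 3 / 2 * w ^ 2 + / 2 * w - (v ^ 3 - 3 / 2 * v ^ 2 + / 2 * v)) with
      ((w - v) * (w ^ 2 + w * v + v ^ 2 - 3 / 2 * (w + v) + / 2)) by field.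
    rewrite Rabs_mult, Rabs_pos_eq, Hvw by lra.
    rewrite <- (Rmult_1_r (w - v)) at 2; apply Rmult_le_compat_l; [lra|].
    apply Rabs_le; split; nra.
Qed.

Definition bernoulli (t : R) : R := bern3 (frac_part (exp t)).

Lemma bernoulli_cont : cont bernoulli.
Proof.
  intros t; apply (continuous_comp exp (fun y => bern3 (frac_part y))).
  - apply @ex_derive_continuous; auto_derive; exact I.
  - apply continuity_pt_filterlim; intros eps Heps; exists eps; split; [exact Heps|].
    intros y [_ Hy]; simpl in *; unfold Rdist in *.
    eapply Rle_lt_trans; [|exact Hy].
    destruct (Rle_dec (exp t) y).
    + rewrite (Rabs_pos_eq (y - exp t)) by lra; apply bern3_frac_lipschitz; assumption.
    + rewrite Rabs_minus_sym, (Rabs_minus_sym y), (Rabs_pos_eq (exp t - y)) by lra.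
      apply bern3_frac_lipschitz; lra.
Qed.

Lemma bernoulli_bound : ebound 1 0 bernoulli.
Proof.
  intros t _; rewrite Rmult_0_l, Ropp_0, exp_0.
  destruct (base_fp (exp t)) as [F0 F1]; destruct (bern3_bound (frac_part (exp t))); unfold bernoulli; lra.
Qed.

Definition derivC (f : R -> C) (t : R) (l : C) :=
  is_derive (fun t => fst (f t)) t (fst l) /\ is_derive (fun t => snd (f t)) t (snd l).

Lemma derivC_plus (f g : R -> C) (t : R) (a b : C) :
  derivC f t a -> derivC g t b -> derivC (fun t => f t + g t)%C t (a + b)%C.
Proof. intros [A B] [A' B']; split; simpl; apply derive_plus; assumption. Qed.

Lemma derivC_scal (f : R -> C) (c : C) (t : R) (a : C) :
  derivC f t a -> derivC (fun t => c * f t)%C t (c * a)%C.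
Proof.
  intros [A B]; split; simpl.
  - apply (is_derive_minus (fun t => fst c * fst (f t)) (fun t => snd c * snd (f t)));
      apply derive_scal; assumption.
  - apply derive_plus; apply derive_scal; assumption.
Qed.

Lemma derivC_mulR (f : R -> C) (r : R -> R) (t : R) (a : C) (b : R) :
  derivC f t a -> is_derive r t b ->
  derivC (fun t => f t * RtoC (r t))%C t (a * RtoC (r t) + f t * RtoC b)%C.
Proof.
  intros [A B] H; split; simpl.
  - apply (is_derive_ext (fun t => fst (f t) * r t)); [intros; as_R; ring|].
    rewrite !Rmult_0_r, !Rminus_0_r; apply derive_mult; assumption.
  - apply (is_derive_ext (fun t => snd (f t) * r t)); [intros; as_R; ring|].
    rewrite !Rmult_0_r, !Rplus_0_l; apply derive_mult; assumption.
Qed.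

Lemma derivC_Cexp (s : C) (t : R) : derivC (fun t => Cexp (s * RtoC t)) t (s * Cexp (s * RtoC t))%C.
Proof.
  split.
  - apply (is_derive_ext (fun t => exp (fst s * t) * cos (snd s * t))).
    + intros u; as_R; rewrite Cexp_eq; simpl; f_equal; f_equal; ring.
    + rewrite Cexp_eq; simpl.
      replace (fst s * t - snd s * 0) with (fst s * t) by ring.
      replace (fst s * 0 + snd s * t) with (snd s * t) by ring.
      auto_derive; [exact I|ring].
  - apply (is_derive_ext (fun t => exp (fst s * t) * sin (snd s * t))).
    + intros u; as_R; rewrite Cexp_eq; simpl; f_equal; f_equal; ring.
    + rewrite Cexp_eq; simpl.
      replace (fst s * t - snd s * 0) with (fst s * t) by ring.
      replace (fst s * 0 + snd s * t) with (snd s * t) by ring.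
      auto_derive; [exact I|ring].
Qed.

Definition RIntC (f : R -> C) (a b : R) : C := (RInt (fun t => fst (f t)) a b, RInt (fun t => snd (f t)) a b).

Lemma RIntC_derive (F f : R -> C) (a b : R) : (forall t, derivC F t (f t)) -> contC f ->
  RIntC f a b = (F b - F a)%C.
Proof.
  intros D [C1 C2]; unfold RIntC; apply C_eq; simpl; apply is_RInt_unique.
  - apply (is_RInt_derive (fun t => fst (F t))); intros; [apply D|apply C1].
  - apply (is_RInt_derive (fun t => snd (F t))); intros; [apply D|apply C2].
Qed.

Lemma RIntC_Chasles (f : R -> C) (a b c : R) : contC f -> (RIntC f a b + RIntC f b c)%C = RIntC f a c.
Proof. intros [C1 C2]; apply C_eq; simpl; apply RInt_Chasles_cont; assumption. Qed.

Lemma RIntC_ext (f g : R -> C) (a b : R) : a <= b -> (forall t, a < t < b -> f t = g t) ->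
  RIntC f a b = RIntC g a b.
Proof.
  intros Hab H; apply C_eq; simpl; apply RInt_ext; rewrite Rmin_left, Rmax_right by exact Hab;
    intros t Ht; rewrite H by exact Ht; reflexivity.
Qed.

Lemma RIntC_lin (f g : R -> C) (c : C) (a b : R) : contC f -> contC g ->
  RIntC (fun t => c * f t - g t)%C a b = (c * RIntC f a b - RIntC g a b)%C.
Proof.
  intros [C1 C2] [C3 C4]; apply C_eq; simpl.
  - transitivity (fst c * RInt (fun t => fst (f t)) a b - snd c * RInt (fun t => snd (f t)) a b
       - RInt (fun t => fst (g t)) a b).
    + rewrite <- !RInt_scal_cont, <- !RInt_minus_cont by solve_cont; reflexivity.
    + unfold Rminus; ring.
  - transitivity (fst c * RInt (fun t => snd (f t)) a b + snd c * RInt (fun t => fst (f t)) a b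
       - RInt (fun t => snd (g t)) a b).
    + rewrite <- !RInt_scal_cont, <- RInt_plus_cont, <- !RInt_minus_cont by solve_cont; reflexivity.
    + unfold Rminus; ring.
Qed.

Definition em_coeff (s : C) : C := (s * (s + 1) * (s + 2) / 6)%C.
Definition em_integrand (s : C) (t : R) : C := (RtoC (bernoulli t) * Cexp (- (s + 2) * RtoC t))%C.

Lemma em_cont (s : C) : contC (em_integrand s).
Proof. apply lap_cont, bernoulli_cont. Qed.

(** One unit interval of Euler-Maclaurin summation, in the variable t = log x. Three integrations by
    parts are replaced by an explicit antiderivative F, verified by differentiation. *)
Lemma em_step (s : C) (n : nat) :
  let X k := Cexp (- s * RtoC (ln (INR k))) in
  let a := ln (INR (S n)) in let b := ln (INR (S (S n))) in
  (em_coeff s * RIntC (em_integrand s) a b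
     - RIntC (fun t => Cexp ((1 - s) * RtoC t)) a b)%C =
  (- (s / 12) * (X (S (S n)) / RtoC (INR (S (S n))) - X (S n) / RtoC (INR (S n)))
     - / 2 * (X (S (S n)) + X (S n)))%C.
Proof.
  intros X a b.
  set (N := INR (S n)).
  assert (HN : 0 < N) by (apply lt_0_INR; lia).
  assert (EN : INR (S (S n)) = N + 1) by (unfold N; apply S_INR).
  assert (ea : exp a = N) by (apply exp_ln, HN).
  assert (eb : exp b = N + 1) by (unfold b; rewrite EN; apply exp_ln; lra).
  assert (Hab : a < b) by (apply ln_increasing; [exact HN|rewrite EN; fold N; lra]).
  (* In x = exp t these are B_3(x - N) / x^2, B_2(x - N) / x and B_1(x - N). With these powers of x,
     each derivative is a combination of the function itself and the next one, since B_k' = k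
     B_(k-1). *)
  set (r3 := fun t => bern3 (exp t - N) * exp (- 2 * t)).
  set (r2 := fun t => bern2 (exp t - N) * exp (- t)).
  set (r1 := fun t => bern1 (exp t - N)).
  assert (D3 : forall t, is_derive r3 t (3 * r2 t - 2 * r3 t)).
  { intros t; unfold r3, r2, bern3, bern2; auto_derive; [exact I|].
    replace (exp (- t)) with (exp t * exp (-2 * t)) by (rewrite <- exp_plus; f_equal; ring); field. }
  assert (D2 : forall t, is_derive r2 t (2 * r1 t - r2 t)).
  { intros t; unfold r2, r1, bern2, bern1; auto_derive; [exact I|].
    assert (E : exp t * exp (- t) = 1) by (rewrite <- exp_plus, Rplus_opp_r; apply exp_0).
    transitivity ((2 * (exp t - N) - 1) * (exp t * exp (- t))
       - ((exp t - N) ^ 2 - (exp t - N) + / 6) * exp (- t)); [field|rewrite E; field]. }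
  assert (D1 : forall t, is_derive r1 t (exp t)).
  { intros t; unfold r1, bern1; auto_derive; [exact I|ring]. }
  set (E := fun t => Cexp (- s * RtoC t)).
  set (F := fun t => (- (s * (s + 1) / 6) * (E t * RtoC (r3 t)) +
     (- (s / 2) * (E t * RtoC (r2 t)) + - (1) * (E t * RtoC (r1 t))))%C).
  set (f := fun t => (em_coeff s * (RtoC (r3 t) * E t) - E t * RtoC (exp t))%C).
  assert (DF : forall t, derivC F t (f t)).
  { intros t; unfold F, f.
    assert (DE := derivC_Cexp (- s) t).
    pose proof (derivC_plus _ _ t _ _
      (derivC_scal _ (- (s * (s + 1) / 6))%C t _ (derivC_mulR _ r3 t _ _ DE (D3 t)))
      (derivC_plus _ _ t _ _ (derivC_scal _ (- (s / 2))%C t _ (derivC_mulR _ r2 t _ _ DE (D2 t)))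
        (derivC_scal _ (- (1))%C t _ (derivC_mulR _ r1 t _ _ DE (D1 t))))) as H.
    match type of H with derivC _ _ ?l => replace (em_coeff s * (RtoC (r3 t) * E t) - E t * RtoC (exp t))%C with l end;
      [exact H|].
    unfold em_coeff, E; rewrite !RtoC_minus, !RtoC_mult; field. }
  assert (Cr : forall r dr, (forall t, is_derive r t (dr t)) -> cont r) by (intros; eapply is_derive_cont; eauto).
  assert (CE : contC E) by apply contC_Cexp.
  assert (C1 : contC (fun t => (RtoC (r3 t) * E t)%C)).
  { apply contC_mult; [apply contC_R, (Cr r3 _ D3)|exact CE]. }
  assert (C2 : contC (fun t => (E t * RtoC (exp t))%C)).
  { apply contC_mult; [exact CE|apply contC_R; apply (Cr exp exp), is_derive_exp]. }
  assert (Cf : contC f).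
  { unfold f; destruct C1 as [A1 A2], C2 as [B1 B2].
    destruct (contC_mult (fun _ => em_coeff s) _ (contC_const _) (conj A1 A2)) as [A1' A2'].
    split; [apply (cont_minus _ _ A1' B1)|apply (cont_minus _ _ A2' B2)]. }
  pose proof (RIntC_derive F f a b DF Cf) as Q.
  unfold f in Q; rewrite RIntC_lin in Q by assumption.
  rewrite (RIntC_ext _ (em_integrand s)) in Q; [|lra|].
  2:{ intros t Ht; unfold em_integrand, r3, bernoulli.
      rewrite (frac_part_eq (exp t) (Z.of_nat (S n))), <- INR_IZR_INZ; fold N.
      - rewrite RtoC_mult, <- Cmult_assoc; f_equal.
        rewrite <- Cexp_R; unfold E; rewrite <- Cexp_plus; f_equal.
        apply C_eq; simpl; ring.
      - pose proof (exp_increasing _ _ (proj1 Ht)); pose proof (exp_increasing _ _ (proj2 Ht)).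
        rewrite <- INR_IZR_INZ; fold N; lra. }
  rewrite (RIntC_ext (fun t => (E t * RtoC (exp t))%C) (fun t => Cexp ((1 - s) * RtoC t))) in Q; [|lra|].
  2:{ intros t _; unfold E; rewrite <- Cexp_R, <- Cexp_plus; f_equal; ring. }
  rewrite Q; unfold F, r3, r2, r1; rewrite ea, eb.
  unfold X; rewrite EN; fold N.
  replace (E b) with (Cexp (- s * RtoC (ln (N + 1)))) by (unfold E, b; rewrite EN; reflexivity).
  replace (E a) with (Cexp (- s * RtoC (ln N))) by reflexivity.
  replace (exp (- b)) with (/ (N + 1)) by (rewrite exp_Ropp, eb; reflexivity).
  replace (exp (- a)) with (/ N) by (rewrite exp_Ropp, ea; reflexivity).
  replace (N + 1 - N) with 1 by ring; replace (N - N) with 0 by ring.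
  assert (V3 : bern3 1 = 0 /\ bern3 0 = 0) by (unfold bern3; split; field).
  assert (V2 : bern2 1 = / 6 /\ bern2 0 = / 6) by (unfold bern2; split; field).
  assert (V1 : bern1 1 = / 2 /\ bern1 0 = - / 2) by (unfold bern1; split; field).
  destruct V3 as [-> ->], V2 as [-> ->], V1 as [-> ->].
  rewrite !Rmult_0_l, !RtoC_mult, RtoC_opp, !RtoC_inv by lra.
  assert (NC : RtoC N <> 0%C) by (intros H; injection H; lra).
  assert (NC' : RtoC (N + 1) <> 0%C) by (intros H; injection H; lra).
  field; split; assumption.
Qed.

(** The zeta function without its polar part 1 / (s - 1), in Euler-Maclaurin form. *)
Definition zeta_reg (s : C) : C := (/ 2 + s / 12 - em_coeff s * lap bernoulli (s + 2))%C.

Lemma zeta_partial (s : C) (n : nat) :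
  let X k := Cexp (- s * RtoC (ln (INR k))) in
  let b := ln (INR (S n)) in
  (sum_n (G := C_NormedModule) (fun k => X (S k)) n - RIntC (fun t => Cexp ((1 - s) * RtoC t)) 0 b)%C =
  (/ 2 + s / 12 - em_coeff s * RIntC (em_integrand s) 0 b
    + (/ 2 - s / 12 * / RtoC (INR (S n))) * X (S n))%C.
Proof.
  intros X b; unfold b; induction n as [|n IH].
  - rewrite sum_O; unfold X; simpl INR; rewrite ln_1.
    assert (Z : forall f, RIntC f 0 0 = RtoC 0) by (intros; unfold RIntC; rewrite !RInt_point; reflexivity).
    rewrite !Z; replace (- s * RtoC 0)%C with (RtoC 0) by ring; rewrite Cexp_R, exp_0; field.
  - pose proof (em_step s n) as E; cbv zeta beta in E, IH.
    rewrite sum_Sn; match goal with |- context [plus ?x ?y] => change (plus x y) with (x + y)%C end.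
    rewrite <- (RIntC_Chasles (em_integrand s) 0 (ln (INR (S n))) (ln (INR (S (S n)))) (em_cont s)).
    rewrite <- (RIntC_Chasles (fun t => Cexp ((1 - s) * RtoC t)) 0 (ln (INR (S n))) (ln (INR (S (S n)))))
      by apply contC_Cexp.
    change (sum_n (fun k => X (S k)) n) with (sum_n (G := C_NormedModule) (fun k => X (S k)) n).
    set (S0 := sum_n (G := C_NormedModule) (fun k => X (S k)) n) in *.
    set (I1 := RIntC (em_integrand s) 0 (ln (INR (S n)))) in *.
    set (I2 := RIntC (em_integrand s) (ln (INR (S n))) (ln (INR (S (S n))))) in *.
    set (E1 := RIntC (fun t => Cexp ((1 - s) * RtoC t)) 0 (ln (INR (S n)))) in *.
    set (E2 := RIntC (fun t => Cexp ((1 - s) * RtoC t)) (ln (INR (S n))) (ln (INR (S (S n))))) in *.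
    assert (A : E2 = (em_coeff s * I2 - (em_coeff s * I2 - E2))%C) by ring.
    rewrite E in A.
    assert (N1 : RtoC (INR (S n)) <> 0%C) by (intros H; apply RtoC_inj in H; revert H; apply not_0_INR; lia).
    assert (N2 : RtoC (INR (S (S n))) <> 0%C) by (intros H; apply RtoC_inj in H; revert H; apply not_0_INR; lia).
    replace (S0 + X (S (S n)) - (E1 + E2))%C with ((S0 - E1) + X (S (S n)) - E2)%C by ring.
    rewrite IH, A; unfold X; field; split; assumption.
Qed.

Definition limC (u : nat -> C) (l : C) :=
  is_lim_seq (fun n => fst (u n)) (fst l) /\ is_lim_seq (fun n => snd (u n)) (snd l).

Lemma limC_plus (u v : nat -> C) (l m : C) : limC u l -> limC v m -> limC (fun n => u n + v n)%C (l + m)%C.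
Proof. intros [A B] [A' B']; split; simpl; apply is_lim_seq_plus'; assumption. Qed.

Lemma limC_scal (u : nat -> C) (c l : C) : limC u l -> limC (fun n => c * u n)%C (c * l)%C.
Proof.
  intros [A B]; split; simpl.
  - apply is_lim_seq_minus'; apply (is_lim_seq_scal_l _ _ (Finite _)); assumption.
  - apply is_lim_seq_plus'; apply (is_lim_seq_scal_l _ _ (Finite _)); assumption.
Qed.

Lemma limC_const (c : C) : limC (fun _ => c) c.
Proof. split; apply is_lim_seq_const. Qed.

Lemma limC_ext (u v : nat -> C) (l : C) : (forall n, u n = v n) -> limC u l -> limC v l.
Proof.
  intros E [A B]; split; [eapply is_lim_seq_ext; [|exact A]|eapply is_lim_seq_ext; [|exact B]];
    intros n; cbv beta; rewrite E; reflexivity.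
Qed.

Lemma limC_zero (u : nat -> C) (e : nat -> R) : (forall n, Cmod (u n) <= e n) -> is_lim_seq e 0 -> limC u 0%C.
Proof.
  intros H L.
  assert (L' : is_lim_seq (fun n => - e n) 0).
  { replace (Finite 0) with (Rbar_opp 0) by (simpl; f_equal; ring); apply is_lim_seq_opp in L; exact L. }
  split; simpl; apply (is_lim_seq_le_le (fun n => - e n) _ e); try assumption;
    intros n; specialize (H n); destruct (Cmod_parts (u n)) as [A B];
    apply Rabs_le_between in A; apply Rabs_le_between in B; lra.
Qed.

Lemma is_Cseries_limC (a : nat -> C) (l : C) :
  is_Cseries a l <-> limC (sum_n (G := C_NormedModule) a) l.
Proof.
  rewrite is_Cseries_parts; unfold limC.
  change (is_series (fun n => fst (a n)) (fst l)) with (is_lim_seq (sum_n (fun n => fst (a n))) (fst l)).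
  change (is_series (fun n => snd (a n)) (snd l)) with (is_lim_seq (sum_n (fun n => snd (a n))) (snd l)).
  assert (E : forall n, sum_n (G := C_NormedModule) a n =
    (sum_n (fun k => fst (a k)) n, sum_n (fun k => snd (a k)) n)) by apply sum_n_C.
  split; intros [A B]; split.
  - eapply is_lim_seq_ext; [|exact A]; intros n; rewrite E; reflexivity.
  - eapply is_lim_seq_ext; [|exact B]; intros n; rewrite E; reflexivity.
  - eapply is_lim_seq_ext; [|exact A]; intros n; cbv beta; rewrite E; reflexivity.
  - eapply is_lim_seq_ext; [|exact B]; intros n; cbv beta; rewrite E; reflexivity.
Qed.

Lemma lap_limC (f : R -> R) (M c : R) (s : C) (b : nat -> R) :
  cont f -> ebound M c f -> - c < fst s -> is_lim_seq b p_infty ->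
  limC (fun n => RIntC (fun t => RtoC (f t) * Cexp (- s * RtoC t))%C 0 (b n)) (lap f s).
Proof.
  intros Cf Hf Hs Hb.
  destruct (lap_cont f s Cf) as [C1 C2], (domC_parts _ _ _ (lap_dom f M c s Hf Hs)) as [D1 D2].
  split; simpl.
  - apply (is_lim_comp_seq (RInt (fun t => fst (RtoC (f t) * Cexp (- s * RtoC t))%C) 0) b p_infty);
      [apply (J_correct _ _ _ C1 D1)|exists 0%nat; intros; discriminate|exact Hb].
  - apply (is_lim_comp_seq (RInt (fun t => snd (RtoC (f t) * Cexp (- s * RtoC t))%C) 0) b p_infty);
      [apply (J_correct _ _ _ C2 D2)|exists 0%nat; intros; discriminate|exact Hb].
Qed.

Lemma ln_INR_lim : is_lim_seq (fun n => ln (INR (S n))) p_infty.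
Proof.
  apply (is_lim_seq_incr_1 (fun n => ln (INR n))).
  apply (is_lim_comp_seq ln INR p_infty); [apply is_lim_ln_p|exists 0%nat; intros; discriminate|apply is_lim_seq_INR].
Qed.

Lemma power_lim (s : R) : 0 < s -> is_lim_seq (fun n => exp (- s * ln (INR (S n)))) 0.
Proof.
  intros Hs.
  apply (is_lim_seq_ext (fun n => exp (- (s * ln (INR (S n)))))); [intros; f_equal; ring|].
  apply (is_lim_comp_seq (fun b => exp (- (s * b))) _ p_infty);
    [apply exp_neg_lim, Hs|exists 0%nat; intros; discriminate|apply ln_INR_lim].
Qed.

Lemma zeta_reg_limit (s : C) : 0 < fst s ->
  limC (fun n => sum_n (G := C_NormedModule) (fun k => Cexp (- s * RtoC (ln (INR (S k))))) n
     - RIntC (fun t => Cexp ((1 - s) * RtoC t)) 0 (ln (INR (S n))))%C (zeta_reg s).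
Proof.
  intros Hs.
  apply (limC_ext _ _ _ (fun n => eq_sym (zeta_partial s n))); cbv zeta.
  replace (zeta_reg s) with (/ 2 + s / 12 + (- em_coeff s * lap bernoulli (s + 2)) + 0)%C
    by (unfold zeta_reg; ring).
  apply limC_plus.
  - apply (limC_ext (fun n => / 2 + s / 12 + (- em_coeff s * RIntC (em_integrand s) 0 (ln (INR (S n)))))%C);
      [intros; ring|].
    apply limC_plus; [apply limC_const|]; apply limC_scal.
    apply (lap_limC bernoulli 1 0); [apply bernoulli_cont|apply bernoulli_bound|simpl; lra|apply ln_INR_lim].
  - set (K := (/ 2 + Cmod (s / 12))%R).
    apply (limC_zero _ (fun n => K * exp (- fst s * ln (INR (S n))))%R).
    + intros n; rewrite Cmod_mult, Cmod_Cexp_line; simpl fst.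
      apply Rmult_le_compat_r; [left; apply exp_pos|]; unfold K.
      eapply Rle_trans; [apply Cmod_triangle|]; rewrite Cmod_opp.
      apply Rplus_le_compat.
      * rewrite <- RtoC_inv, Cmod_R, Rabs_pos_eq by lra; lra.
      * assert (1 <= INR (S n)) by (rewrite S_INR; pose proof (pos_INR n); lra).
        rewrite Cmod_mult, <- RtoC_inv, Cmod_R, Rabs_pos_eq by
          (try lra; left; apply Rinv_0_lt_compat; lra).
        rewrite <- (Rmult_1_r (Cmod (s / 12))) at 2; apply Rmult_le_compat_l; [apply Cmod_ge_0|].
        rewrite <- Rinv_1; apply Rinv_le_contravar; lra.
    + replace (Finite 0) with (Rbar_mult K 0) by (simpl; f_equal; ring).
      apply is_lim_seq_scal_l, power_lim, Hs.
Qed.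

Lemma lap_one (s : C) : 0 < fst s -> lap (fun _ => 1) s = (/ s)%C.
Proof.
  intros Hs.
  assert (N0 : s <> 0%C) by (intros ->; simpl in Hs; lra).
  assert (H := lap_limC (fun _ => 1) 1 0 s (fun n => ln (INR (S n))) (cont_const 1)
    ltac:(intros t _; rewrite Rmult_0_l, Ropp_0, exp_0, Rabs_R1; lra) ltac:(lra) ln_INR_lim).
  assert (H2 : limC (fun n => RIntC (fun t => RtoC 1 * Cexp (- s * RtoC t))%C 0 (ln (INR (S n)))) (/ s)%C).
  { apply (limC_ext (fun n => / s + - / s * Cexp (- s * RtoC (ln (INR (S n)))))%C).
    - intros n; rewrite (RIntC_derive (fun t => - / s * Cexp (- s * RtoC t))%C).
      + replace (- s * RtoC 0)%C with (RtoC 0) by ring; rewrite Cexp_R, exp_0; ring.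
      + intros t; pose proof (derivC_scal _ (- / s)%C t _ (derivC_Cexp (- s) t)) as D.
        replace (1 * Cexp (- s * RtoC t))%C with (- / s * (- s * Cexp (- s * RtoC t)))%C by (field; exact N0).
        exact D.
      + apply contC_mult; [apply contC_const|apply contC_Cexp].
    - replace (/ s)%C with (/ s + - / s * 0)%C at 1 by ring.
      apply limC_plus; [apply limC_const|apply limC_scal].
      apply (limC_zero _ (fun n => exp (- fst s * ln (INR (S n))))).
      + intros n; rewrite Cmod_Cexp_line; simpl; lra.
      + apply power_lim, Hs. }
  destruct H as [A B], H2 as [A' B']; apply is_lim_seq_unique in A, A', B, B'.
  apply C_eq; [rewrite A in A'; injection A'|rewrite B in B'; injection B']; auto.
Qed.

Definition zeta_em (s : C) : C := (zeta_reg s + / (s - 1))%C.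

Lemma zeta_em_series (s : C) : 1 < fst s ->
  is_Cseries (fun n => Cexp (- s * RtoC (ln (INR (S n))))) (zeta_em s).
Proof.
  intros Hs; apply is_Cseries_limC.
  pose proof (limC_plus _ _ _ _ (zeta_reg_limit s ltac:(lra))
    (lap_limC (fun _ => 1) 1 0 (s - 1) (fun n => ln (INR (S n))) (cont_const 1)
      ltac:(intros t _; rewrite Rmult_0_l, Ropp_0, exp_0, Rabs_R1; lra) ltac:(simpl; lra) ln_INR_lim)) as H.
  rewrite lap_one in H by (simpl; lra).
  eapply limC_ext; [|exact H]; intros n; cbv beta.
  rewrite (RIntC_ext (fun t => RtoC 1 * Cexp (- (s - 1) * RtoC t))%C (fun t => Cexp ((1 - s) * RtoC t))).
  - ring.
  - rewrite <- ln_1; apply ln_le; [lra|]; rewrite S_INR; pose proof (pos_INR n); lra.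
  - intros t _; rewrite Cmult_1_l; f_equal; ring.
Qed.

Lemma zeta_reg_analytic (s : C) : - 2 < fst s -> analytic_at zeta_reg s.
Proof.
  intros Hs.
  apply (analytic_ext (fun z => (/ 2 + / 12 * (z * 1)) +
    - / 6 * (z * (z * (z * lap bernoulli (z + 2)) + (3 * (z * lap bernoulli (z + 2)) + 2 * lap bernoulli (z + 2)))))%C).
  - intros z; unfold zeta_reg, em_coeff; field.
  - assert (L : analytic_at (fun z => lap bernoulli (z + 2)) s).
    { apply (analytic_shift (lap bernoulli)), (lap_analytic bernoulli 1 0);
        [apply bernoulli_cont|apply bernoulli_bound|simpl; lra]. }
    apply analytic_plus.
    + apply analytic_plus; [apply analytic_const|apply analytic_scal, analytic_mul_X, analytic_const].
    + apply analytic_scal, analytic_mul_X, analytic_plus; [apply analytic_mul_X, analytic_mul_X, L|].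
      apply analytic_plus; apply analytic_scal; [apply analytic_mul_X|]; exact L.
Qed.

Lemma zeta_em_continuation : is_zeta_continuation (- 2) zeta_em.
Proof.
  split.
  - intros s Hs N; apply analytic_plus; [apply zeta_reg_analytic, Hs|apply analytic_inv, N].
  - intros s Hs; apply zeta_em_series, Hs.
Qed.

(** At s = 1 the integral subtracted in [zeta_reg_limit] is the logarithm itself, so the constant
    term of zeta at its pole is the Euler constant. *)
Lemma harmonic_lim : is_lim_seq (fun n => sum_n_m (fun k => / INR k) 1 n - ln (INR n)) (fst (zeta_reg 1)).
Proof.
  destruct (zeta_reg_limit 1 ltac:(simpl; lra)) as [H _].
  apply (is_lim_seq_incr_1 (fun n => sum_n_m (fun k => / INR k) 1 n - ln (INR n))).
  eapply is_lim_seq_ext; [|exact H].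
  intros n; cbv beta.
  assert (HN : forall k, 0 < INR (S k)) by (intros; apply lt_0_INR; lia).
  assert (E1 : RIntC (fun t => Cexp ((1 - 1) * RtoC t)) 0 (ln (INR (S n))) = RtoC (ln (INR (S n)))).
  { rewrite (RIntC_derive (fun t => RtoC t)).
    - apply C_eq; simpl; ring.
    - intros t; replace ((1 - 1) * RtoC t)%C with (RtoC 0) by ring; rewrite Cexp_R, exp_0.
      split; simpl; [apply @is_derive_id|apply @is_derive_const].
    - apply contC_Cexp. }
  rewrite E1, sum_n_C.
  match goal with |- fst ((?x, ?y) - RtoC ?z)%C = _ => change (x - z = sum_n_m (fun k => / INR k) 1 (S n) - z) end.
  f_equal.
  rewrite <- sum_n_m_S; unfold sum_n; apply sum_n_m_ext; intros k; cbv beta.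
  replace (- (1) * RtoC (ln (INR (S k))))%C with (RtoC (- ln (INR (S k)))) by (rewrite RtoC_opp; ring).
  rewrite Cexp_R, exp_Ropp, exp_ln by apply HN; reflexivity.
Qed.

Lemma zeta_reg_1 : fst (zeta_reg 1) = euler_gamma.
Proof. unfold euler_gamma; rewrite (is_lim_seq_unique _ _ harmonic_lim); reflexivity. Qed.

(** * Identity theorem along horizontal lines *)

Definition ranalytic (u : R -> R) (t0 : R) := exists (a : nat -> R) (r : R), 0 < r /\
  forall t, Rabs (t - t0) < r -> is_pseries a (t - t0) (u t).

Lemma pseries_radius (a : nat -> R) (r x : R) :
  (forall y, Rabs y < r -> ex_pseries a y) -> Rabs x < r -> Rbar_lt (Rabs x) (CV_radius a).
Proof.
  intros H Hx; set (y := (Rabs x + r) / 2).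
  pose proof (Rabs_pos x) as P.
  assert (Hy : Rabs y < r) by (unfold y; rewrite Rabs_pos_eq; lra).
  apply Rbar_lt_le_trans with (Finite (Rabs y)); [simpl; unfold y; rewrite (Rabs_pos_eq ((_ + _) / 2)); lra|].
  apply Rbar_not_lt_le; intros L.
  apply (CV_disk_outside a y L).
  specialize (H y Hy); apply ex_pseries_R in H.
  apply ex_series_lim_0 in H; exact H.
Qed.

(** The coefficients vanish one after the other: the constant term by continuity at 0, the next one
    after division by x. *)
Lemma pseries_zero_right (n : nat) (a : nat -> R) (e : R) : 0 < e ->
  Rbar_lt 0 (CV_radius a) -> (forall x, 0 < x < e -> PSeries a x = 0) -> a n = 0.
Proof.
  assert (First : forall a e, 0 < e -> Rbar_lt 0 (CV_radius a) ->
    (forall x, 0 < x < e -> PSeries a x = 0) -> a 0%nat = 0).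
  { clear; intros a e He Hr H.
    assert (C : continuity_pt (PSeries a) 0) by (apply PSeries_continuity; rewrite Rabs_R0; exact Hr).
    rewrite <- (PSeries_0 a).
    destruct (Req_dec (PSeries a 0) 0) as [|N]; [assumption|exfalso].
    destruct (C (Rabs (PSeries a 0)) (Rabs_pos_lt _ N)) as (d & Hd & HC).
    set (x := Rmin e d / 2).
    assert (Hm : 0 < Rmin e d) by (apply Rmin_pos; assumption).
    pose proof (Rmin_l e d); pose proof (Rmin_r e d).
    specialize (HC x); rewrite (H x) in HC by (unfold x; lra).
    simpl in HC; unfold Rdist in HC; rewrite Rminus_0_l, Rabs_Ropp in HC.
    apply (Rlt_irrefl (Rabs (PSeries a 0))), HC; split.
    - split; [exact I|]; unfold x; lra.
    - unfold x; rewrite Rminus_0_r, Rabs_pos_eq; lra. }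
  revert a e; induction n as [|n IH]; intros a e He Hr H; [eapply First; eassumption|].
  pose proof (First a e He Hr H) as A0.
  assert (Hx : exists r, 0 < r <= e /\ Rbar_le r (CV_radius a)).
  { destruct (CV_radius a) as [c| |]; simpl in Hr.
    - exists (Rmin e c); split; [split; [apply Rmin_pos; assumption|apply Rmin_l]|simpl; apply Rmin_r].
    - exists e; simpl; split; [lra|exact I].
    - contradiction. }
  destruct Hx as (r & Hr0 & Hrc).
  apply (IH (PS_decr_1 a) r); [lra|rewrite CV_radius_decr_1; exact Hr|].
  intros x Hx.
  assert (Ex : ex_pseries a x).
  { apply CV_radius_inside, Rbar_lt_le_trans with (Finite r); [|exact Hrc].
    simpl; rewrite Rabs_pos_eq; lra. }
  pose proof (H x ltac:(lra)) as E; rewrite (PSeries_decr_1 a x Ex), A0, Rplus_0_l in E.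
  apply Rmult_integral in E; destruct E; lra.
Qed.

Lemma ranalytic_zero_right (u : R -> R) (t0 e : R) : ranalytic u t0 -> 0 < e ->
  (forall t, t0 < t < t0 + e -> u t = 0) ->
  exists d, 0 < d /\ forall t, Rabs (t - t0) < d -> u t = 0.
Proof.
  intros (a & r & Hr & H) He Hz; exists r; split; [exact Hr|]; intros t Ht.
  assert (R0 : Rbar_lt 0 (CV_radius a)).
  { rewrite <- Rabs_R0; apply (pseries_radius a r); [|rewrite Rabs_R0; exact Hr].
    intros y Hy; exists (u (t0 + y)).
    pose proof (H (t0 + y)) as Q; replace (t0 + y - t0) with y in Q by ring; exact (Q Hy). }
  assert (A0 : forall n, a n = 0).
  { intros n; apply (pseries_zero_right n a (Rmin e r)); [apply Rmin_pos; assumption|exact R0|].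
    intros x Hx; pose proof (Rmin_l e r); pose proof (Rmin_r e r).
    rewrite <- (Hz (t0 + x)) by lra; apply is_pseries_unique.
    pose proof (H (t0 + x)) as Q; replace (t0 + x - t0) with x in Q by ring; apply Q.
    rewrite Rabs_pos_eq; lra. }
  rewrite <- (is_pseries_unique _ _ _ (H t Ht)), (PSeries_ext a (fun _ => 0) _ A0).
  apply PSeries_const_0.
Qed.

(** Let g be the infimum of the points to the right of which u vanishes. The power series at g is 0,
    so u vanishes on both sides of g, and g cannot lie strictly to the right of t0. *)
Lemma real_identity (u : R -> R) (t0 t2 T : R) : t0 < T -> t2 < T ->
  (forall t, t0 <= t < T -> ranalytic u t) -> (forall t, t2 < t < T -> u t = 0) -> u t0 = 0.
Proof.
  intros H0 H2 Ha Hz.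
  (* Arguments are negated because completeness supplies least upper bounds, while an infimum is
     wanted. *)
  set (E := fun x => t0 <= - x < T /\ forall t, - x < t < T -> u t = 0).
  destruct (completeness E) as (m & Hub & Hlub).
  - exists (- t0); intros x [Hx _]; lra.
  - exists (- Rmax t0 t2); split.
    + rewrite Ropp_involutive; split; [apply Rmax_l|apply Rmax_lub_lt; assumption].
    + intros t Ht; rewrite Ropp_involutive in Ht; apply Hz; pose proof (Rmax_r t0 t2); lra.
  - set (g := - m).
    assert (Gz : forall t, g < t < T -> u t = 0).
    { intros t Ht.
      destruct (classic (exists x, E x /\ - x < t)) as [(x & [_ Hx] & L)|N]; [apply Hx; lra|].
      exfalso; assert (m <= - t); [|unfold g in Ht; lra].
      apply Hlub; intros x Hx; apply Rnot_lt_le; intros L; apply N; exists x; split; [exact Hx|lra]. }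
    assert (G1 : t0 <= g).
    { assert (m <= - t0) by (apply Hlub; intros x [Hx _]; lra); unfold g; lra. }
    assert (G2 : g < T).
    { assert (- Rmax t0 t2 <= m).
      { apply Hub; split.
        - rewrite Ropp_involutive; split; [apply Rmax_l|apply Rmax_lub_lt; assumption].
        - intros t Ht; rewrite Ropp_involutive in Ht; apply Hz; pose proof (Rmax_r t0 t2); lra. }
      assert (Rmax t0 t2 < T) by (apply Rmax_lub_lt; assumption); unfold g; lra. }
    destruct (ranalytic_zero_right u g (T - g) (Ha g (conj G1 G2)) ltac:(lra)) as (d & Hd & Hzd).
    { intros t Ht; apply Gz; lra. }
    destruct (Req_dec g t0) as [Eg|N].
    + apply Hzd; rewrite Eg, Rminus_diag, Rabs_R0; exact Hd.
    + exfalso; set (s := Rmax t0 (g - d / 2)).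
      assert (S1 : t0 <= s /\ s < g /\ g - d / 2 <= s).
      { unfold s; split; [apply Rmax_l|split; [apply Rmax_lub_lt; lra|apply Rmax_r]]. }
      assert (- s <= m); [|unfold g in *; lra].
      apply Hub; rewrite <- (Ropp_involutive s) in S1; split; [lra|].
      intros t Ht; destruct (Rlt_le_dec t (g + d / 2)).
      * apply Hzd; apply Rabs_def1; lra.
      * apply Gz; lra.
Qed.

(** Analyticity along a horizontal line, coordinate by coordinate, which is the form that
    [real_identity] takes as input. *)
Definition LA (f : R -> C) (t : R) := ranalytic (fun t => fst (f t)) t /\ ranalytic (fun t => snd (f t)) t.

Lemma ranalytic_plus (u v : R -> R) (t : R) : ranalytic u t -> ranalytic v t -> ranalytic (fun t => u t + v t) t.
Proof.
  intros (a & r & Hr & H) (b & r' & Hr' & H'); exists (PS_plus a b), (Rmin r r').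
  split; [apply Rmin_pos; assumption|]; intros s Hs.
  apply (is_pseries_plus (K := R_AbsRing) (V := R_NormedModule)); [apply H|apply H'];
    eapply Rlt_le_trans; eauto; [apply Rmin_l|apply Rmin_r].
Qed.

Lemma ranalytic_opp (u : R -> R) (t : R) : ranalytic u t -> ranalytic (fun t => - u t) t.
Proof.
  intros (a & r & Hr & H); exists (PS_opp a), r; split; [exact Hr|]; intros s Hs.
  apply (is_pseries_opp (K := R_AbsRing) (V := R_NormedModule)), H, Hs.
Qed.

Lemma ranalytic_mult (u v : R -> R) (t : R) : ranalytic u t -> ranalytic v t -> ranalytic (fun t => u t * v t) t.
Proof.
  intros (a & r & Hr & H) (b & r' & Hr' & H'); exists (PS_mult a b), (Rmin r r').
  split; [apply Rmin_pos; assumption|]; intros s Hs.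
  pose proof (Rmin_l r r'); pose proof (Rmin_r r r').
  apply is_pseries_mult; [apply H; lra|apply H'; lra| |].
  - apply (pseries_radius a r); [|lra]; intros y Hy; exists (u (t + y)).
    pose proof (H (t + y)) as Q; replace (t + y - t) with y in Q by ring; exact (Q Hy).
  - apply (pseries_radius b r'); [|lra]; intros y Hy; exists (v (t + y)).
    pose proof (H' (t + y)) as Q; replace (t + y - t) with y in Q by ring; exact (Q Hy).
Qed.

Lemma LA_plus (f g : R -> C) (t : R) : LA f t -> LA g t -> LA (fun t => f t + g t)%C t.
Proof. intros [A B] [A' B']; split; simpl; apply ranalytic_plus; assumption. Qed.

Lemma LA_minus (f g : R -> C) (t : R) : LA f t -> LA g t -> LA (fun t => f t - g t)%C t.
Proof. intros [A B] [A' B']; split; simpl; (apply ranalytic_plus; [|apply ranalytic_opp]); assumption. Qed.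

Lemma LA_mult (f g : R -> C) (t : R) : LA f t -> LA g t -> LA (fun t => f t * g t)%C t.
Proof.
  intros [A B] [A' B']; split; simpl.
  - apply ranalytic_plus; [|apply ranalytic_opp]; apply ranalytic_mult; assumption.
  - apply ranalytic_plus; apply ranalytic_mult; assumption.
Qed.

Lemma LA_comp (f : C -> C) (k : R) (b : C) (t : R) : k <> 0 ->
  analytic_at f (RtoC k * RtoC t + b) -> LA (fun t => f (RtoC k * RtoC t + b)%C) t.
Proof.
  intros Hk (a & r & Hr & H).
  assert (Hk' : 0 < Rabs k) by (apply Rabs_pos_lt, Hk).
  assert (Q : forall s, Rabs (s - t) < r / Rabs k ->
    is_Cseries (fun n => (RtoC ((s - t) ^ n) * (RtoC (k ^ n) * a n))%C) (f (RtoC k * RtoC s + b)%C)).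
  { intros s Hs; eapply is_series_ext; [|apply (H (RtoC k * RtoC s + b)%C)].
    - intros n; unfold scal; simpl; unfold mult; simpl.
      replace (RtoC k * RtoC s + b - (RtoC k * RtoC t + b))%C with (RtoC (k * (s - t))).
      + change (pow_n (K := C_AbsRing) (RtoC (k * (s - t))) n) with (Cpow (RtoC (k * (s - t))) n).
        rewrite <- RtoC_pow, Rpow_mult_distr, RtoC_mult; ring.
      + rewrite RtoC_mult, RtoC_minus; ring.
    - replace (RtoC k * RtoC s + b - (RtoC k * RtoC t + b))%C with (RtoC (k * (s - t)))
        by (rewrite RtoC_mult, RtoC_minus; ring).
      rewrite Cmod_R, Rabs_mult.
      apply (Rmult_lt_compat_l (Rabs k)) in Hs; [|exact Hk'].
      replace (Rabs k * (r / Rabs k)) with r in Hs by (field; lra); exact Hs. }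
  assert (Hr' : 0 < r / Rabs k) by (apply Rdiv_lt_0_compat; assumption).
  split.
  - exists (fun n => k ^ n * fst (a n)), (r / Rabs k); split; [exact Hr'|]; intros s Hs.
    apply is_pseries_R; destruct (proj1 (is_Cseries_parts _ _) (Q s Hs)) as [A _].
    eapply is_series_ext; [|exact A]; intros n; as_R; simpl; ring.
  - exists (fun n => k ^ n * snd (a n)), (r / Rabs k); split; [exact Hr'|]; intros s Hs.
    apply is_pseries_R; destruct (proj1 (is_Cseries_parts _ _) (Q s Hs)) as [_ A].
    eapply is_series_ext; [|exact A]; intros n; as_R; simpl; ring.
Qed.

Lemma complex_identity (f : R -> C) (t0 t2 T : R) : t0 < T -> t2 < T ->
  (forall t, t0 <= t < T -> LA f t) -> (forall t, t2 < t < T -> f t = 0%C) -> f t0 = 0%C.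
Proof.
  intros H0 H2 Ha Hz; apply C_eq; simpl.
  - apply (real_identity (fun t => fst (f t)) t0 t2 T H0 H2).
    + intros t Ht; apply Ha, Ht.
    + intros t Ht; rewrite Hz by exact Ht; reflexivity.
  - apply (real_identity (fun t => snd (f t)) t0 t2 T H0 H2).
    + intros t Ht; apply Ha, Ht.
    + intros t Ht; rewrite Hz by exact Ht; reflexivity.
Qed.

Lemma is_Cseries_unique (a : nat -> C) (l m : C) : is_Cseries a l -> is_Cseries a m -> l = m.
Proof.
  intros H H'; apply is_Cseries_parts in H, H'.
  apply C_eq; [rewrite <- (is_series_unique _ _ (proj1 H)); apply is_series_unique, H'
              |rewrite <- (is_series_unique _ _ (proj2 H)); apply is_series_unique, H'].
Qed.

(** Whatever continuation [epsilon] selects, it agrees with [zeta_em] where both are the Dirichlet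
    series. The horizontal line through s carries this equality back to s, and it avoids the pole
    because the imaginary part is not 0. *)
Lemma CZeta_em (s : C) : - 2 < fst s -> snd s <> 0 -> CZeta s = zeta_em s.
Proof.
  intros Hs Him; unfold CZeta.
  match goal with |- epsilon ?i ?P = _ => pose proof (epsilon_spec i P) as E; set (v := epsilon i P) in * end.
  destruct E as (a & f & Ha & [Hf1 Hf2] & Hv).
  { exists (zeta_em s), (-2), zeta_em; split; [exact Hs|split; [apply zeta_em_continuation|reflexivity]]. }
  destruct zeta_em_continuation as [Hz1 Hz2].
  rewrite <- Hv; clear v Hv.
  set (b := (0, snd s) : C).
  assert (Eb : forall t, (RtoC 1 * RtoC t + b)%C = (t, snd s)) by (intros; apply C_eq; simpl; ring).
  assert (N1 : forall t, (t, snd s) <> RtoC 1) by (intros t H; injection H; intros; lra).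
  set (T := Rmax (fst s) 1 + 1).
  assert (HT : fst s < T /\ 1 < T) by (unfold T; pose proof (Rmax_l (fst s) 1); pose proof (Rmax_r (fst s) 1); lra).
  assert (Z : (f (RtoC 1 * RtoC (fst s) + b) - zeta_em (RtoC 1 * RtoC (fst s) + b))%C = 0%C).
  { apply (complex_identity (fun t => f (RtoC 1 * RtoC t + b) - zeta_em (RtoC 1 * RtoC t + b))%C (fst s) 1 T);
      try apply HT.
    - intros t Ht; apply LA_minus; (apply LA_comp; [apply R1_neq_R0|]); rewrite Eb.
      + apply Hf1; [unfold Re in *; simpl; lra|apply N1].
      + apply Hz1; [unfold Re in *; simpl; lra|apply N1].
    - intros t Ht; rewrite Eb.
      rewrite (is_Cseries_unique _ _ _ (Hf2 (t, snd s) ltac:(simpl; lra)) (Hz2 (t, snd s) ltac:(simpl; lra))).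
      ring. }
  rewrite Eb, <- surjective_pairing in Z.
  transitivity (f s - zeta_em s + zeta_em s)%C; [ring|rewrite Z; ring].
Qed.

(** * Mellin transform of the kernel *)

Definition gam1 (t : R) : R := exp (- exp (- t)).
Definition gam2 (t : R) : R := exp (- exp t).

(* Euler's integral after the substitution [exp], split at 0. *)
Definition gamL (s : C) : C := (lap gam1 s + lap gam2 (- s))%C.

Lemma gam1_cont : cont gam1.
Proof. intros t; apply @ex_derive_continuous; unfold gam1; auto_derive; exact I. Qed.

Lemma gam2_cont : cont gam2.
Proof. intros t; apply @ex_derive_continuous; unfold gam2; auto_derive; exact I. Qed.

Lemma gam1_bound : ebound 1 0 gam1.
Proof.
  intros t _; unfold gam1; rewrite Rmult_0_l, Ropp_0, exp_0, Rabs_pos_eq by (left; apply exp_pos).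
  apply Rle_trans with (exp 0); [apply exp_le; pose proof (exp_pos (- t)); lra|rewrite exp_0; lra].
Qed.

Lemma gam2_bound (k : nat) : ebound (INR k ^ k) (INR k) gam2.
Proof.
  intros t _; unfold gam2; rewrite Rabs_pos_eq by (left; apply exp_pos).
  pose proof (pow_exp_le k (exp t) (Rlt_le _ _ (exp_pos t))) as H.
  apply (Rmult_le_reg_l (exp t ^ k)); [apply pow_lt, exp_pos|].
  replace (exp t ^ k * (INR k ^ k * exp (- (INR k * t)))) with (INR k ^ k); [exact H|].
  rewrite <- exp_INR; transitivity (INR k ^ k * (exp (INR k * t) * exp (- (INR k * t)))); [|ring].
  rewrite <- exp_plus, Rplus_opp_r, exp_0; ring.
Qed.

(** [gam2] decays faster than any exponential, so the bound 20 is a convenient choice; the Mellin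
    identity uses real parts up to 11/2. *)
Lemma gamL_analytic (s : C) : 0 < fst s < 20 -> analytic_at (lap gam1) s /\ analytic_at (lap gam2) (- s).
Proof.
  intros Hs; split.
  - apply (lap_analytic gam1 1 0); [apply gam1_cont|apply gam1_bound|lra].
  - apply (lap_analytic gam2 (INR 20 ^ 20) (INR 20)); [apply gam2_cont|apply gam2_bound|].
    simpl fst; simpl INR; lra.
Qed.

Definition J2C (f : R -> C) : C := (JC f + JC (fun t => f (- t)%R))%C.

Lemma J2C_scal (f : R -> C) (z : C) (M c : R) : contC f -> contC (fun t => f (- t)) ->
  domC M c f -> domC M c (fun t => f (- t)) -> J2C (fun t => z * f t)%C = (z * J2C f)%C.
Proof.
  intros C1 C2 D1 D2; unfold J2C.
  rewrite (JC_scal f z M c C1 D1), (JC_scal (fun t => f (- t)) z M c C2 D2); ring.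
Qed.

Lemma contC_opp (f : R -> C) : contC f -> contC (fun t => f (- t)).
Proof.
  intros [A B]; split; intros t.
  - apply (continuous_comp Ropp (fun t => fst (f t))); [|apply A].
    apply @ex_derive_continuous; auto_derive; exact I.
  - apply (continuous_comp Ropp (fun t => snd (f t))); [|apply B].
    apply @ex_derive_continuous; auto_derive; exact I.
Qed.

Lemma J2C_reflect_shift (f : R -> C) (h M c : R) : contC f ->
  domC M c f -> domC M c (fun t => f (- t)) -> J2C (fun t => f (h - t)) = J2C f.
Proof.
  intros Cf D1 D2.
  assert (Q : forall g : R -> R, cont g -> dom M c g -> dom M c (fun t => g (- t)) ->
    cont (fun t => g (- t)) -> J (fun t => g (h - t)) + J (fun t => g (h - - t)) = J g + J (fun t => g (- t))).
  { intros g Cg Dg Dg' Cg'.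
    pose proof (is_J2_affine g 1 h _ _ ltac:(lra) Cg (J_correct _ _ _ Cg Dg) (J_correct _ _ _ Cg' Dg')) as H.
    rewrite Rdiv_1_r in H; rewrite <- H; unfold J2; rewrite Rplus_comm.
    f_equal; f_equal; apply functional_extensionality; intros t; f_equal; ring. }
  destruct (domC_parts _ _ _ D1) as [A1 A2], (domC_parts _ _ _ D2) as [B1 B2].
  destruct Cf as [C1 C2], (contC_opp f (conj C1 C2)) as [C3 C4].
  apply C_eq; simpl; [apply (Q (fun t => fst (f t)))|apply (Q (fun t => snd (f t)))]; assumption.
Qed.

Definition gam_integrand (s : C) (t : R) : C := (RtoC (gam2 t) * Cexp (s * RtoC t))%C.

Lemma gam_integrand_dom (s : C) (k : nat) : 0 < fst s < INR k -> exists M c,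
  domC M c (gam_integrand s) /\ domC M c (fun t => gam_integrand s (- t)).
Proof.
  intros Hs.
  pose proof (lap_dom gam1 1 0 s gam1_bound ltac:(lra)) as D1.
  pose proof (lap_dom gam2 _ _ (- s) (gam2_bound k) ltac:(simpl; lra)) as D2.
  set (M := INR k ^ k) in *.
  assert (M0 : 0 <= M) by (apply pow_le, pos_INR).
  set (c := Rmin (0 + fst s) (INR k + fst (- s)%C)) in *.
  assert (Hc : 0 < c) by (apply Rmin_pos; [lra|simpl; lra]).
  assert (W : forall (N d : R) (f : R -> C), c <= d -> N <= 1 + M -> domC N d f -> domC (1 + M) c f).
  { intros N d f Hd HN [_ Hf]; split; [exact Hc|]; intros t Ht; eapply Rle_trans; [apply Hf, Ht|].
    apply Rle_trans with ((1 + M) * exp (- (d * t))).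
    - apply Rmult_le_compat_r; [left; apply exp_pos|exact HN].
    - apply Rmult_le_compat_l; [lra|]; apply exp_le; nra. }
  exists (1 + M), c; split.
  - apply (W M (INR k + fst (- s)%C)); [apply Rmin_r|lra|].
    destruct D2 as [E1 E2]; split; [exact E1|]; intros t Ht; unfold gam_integrand.
    replace s with (- - s)%C at 1 by ring; apply E2, Ht.
  - apply (W 1 (0 + fst s)); [apply Rmin_l|lra|].
    destruct D1 as [E1 E2]; split; [exact E1|]; intros t Ht; unfold gam_integrand.
    replace (s * RtoC (- t))%C with (- s * RtoC t)%C by (rewrite RtoC_opp; ring).
    apply E2, Ht.
Qed.

Lemma gam_integrand_cont (s : C) : contC (gam_integrand s).
Proof. apply contC_mult; [apply contC_R, gam2_cont|apply contC_Cexp]. Qed.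

Lemma gamL_J2C (s : C) : J2C (gam_integrand s) = gamL s.
Proof.
  unfold J2C, gamL; rewrite Cplus_comm; f_equal.
  - apply JC_ext; intros t; unfold gam_integrand, gam2, gam1; do 2 f_equal; rewrite RtoC_opp; ring.
  - apply JC_ext; intros t; unfold gam_integrand; do 2 f_equal; ring.
Qed.

Definition tker (n : nat) (t : R) : R :=
  4 / (3 * sqrt PI) * (2 * exp (t / 2) * sterm 2 n t + exp (- (t / 2)) * sterm 1 n t).

Lemma tker_cont (n : nat) : cont (tker n).
Proof.
  intros t; apply @ex_derive_continuous; unfold tker, sterm, yval.
  generalize (INR (S n)); intros N; auto_derive; exact I.
Qed.

Lemma tker_series (t : R) : is_series (fun n => tker n t) (kern t).
Proof.
  apply series_scal, series_plus; apply series_scal; apply Series_correct, sterm_summable.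
Qed.

Lemma Cseries_mulR (a : nat -> R) (l : R) (z : C) :
  is_series a l -> is_Cseries (fun n => RtoC (a n) * z)%C (RtoC l * z)%C.
Proof.
  intros H; apply is_Cseries_parts; split; simpl.
  - replace (l * fst z - 0 * snd z) with (fst z * l) by ring.
    eapply is_series_ext; [|apply series_scal, H]; intros n; simpl; as_R; ring.
  - replace (l * snd z + 0 * fst z) with (snd z * l) by ring.
    eapply is_series_ext; [|apply series_scal, H]; intros n; simpl; as_R; ring.
Qed.

(** The growth rate 3/2 comes from [sterm_bound] with q = 1 and the decay rate 11/2 from q = 6. Both
    bounds are summable in n, which permits termwise integration in the strip of [mellin_far]. *)
Lemma tker_bound : exists C, forall n t, 0 <= t ->
  Rabs (tker n t) <= C * exp (3 / 2 * t) * / INR (S n) ^ 2 /\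
  Rabs (tker n (- t)) <= C * exp (- (11 / 2 * t)) * / INR (S n) ^ 2.
Proof.
  assert (P : 0 < 4 / (3 * sqrt PI)).
  { apply Rdiv_lt_0_compat; [lra|]; pose proof (sqrt_lt_R0 _ PI_RGT_0); lra. }
  set (c := 4 / (3 * sqrt PI)) in *.
  assert (S0 : forall p k, 0 <= sconst p k) by (intros; apply pow_le; pose proof (pos_INR (p + k)); lra).
  set (A := (2 * sconst 2 1 + sconst 1 1 + (2 * sconst 2 6 + sconst 1 6))%R).
  assert (HA : 0 <= 2 * sconst 2 1 + sconst 1 1 <= A /\ 0 <= 2 * sconst 2 6 + sconst 1 6 <= A).
  { unfold A; pose proof (S0 2 1)%nat; pose proof (S0 1 1)%nat; pose proof (S0 2 6)%nat;
      pose proof (S0 1 6)%nat; lra. }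
  assert (Q : forall (q n : nat) t e, (1 <= q)%nat -> exp (t / 2) * exp (INR q * t) <= e ->
    exp (- (t / 2)) * exp (INR q * t) <= e ->
    Rabs (tker n t) <= c * ((2 * sconst 2 q + sconst 1 q) * e * / INR (S n) ^ 2)).
  { intros q n t e Hq H1 H2; unfold tker; fold c.
    set (i := / INR (S n) ^ 2); assert (Hi : 0 < i) by (apply Rinv_0_lt_compat, pow_lt, lt_0_INR; lia).
    assert (B : forall p, 0 <= sterm p n t <= sconst p q * (exp (INR q * t) * i)).
    { intros p; destruct (sterm_bound p q n t Hq) as [L U]; fold i in U; split; [exact L|].
      eapply Rle_trans; [exact U|].
      pose proof (S0 p q); pose proof (exp_pos (INR q * t)).
      replace (sconst p q * exp (INR q * t) * exp (- (exp (- t) / 2)) * i) with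
        (sconst p q * (exp (INR q * t) * i) * exp (- (exp (- t) / 2))) by ring.
      rewrite <- (Rmult_1_r (sconst p q * (exp (INR q * t) * i))) at 2.
      apply Rmult_le_compat_l; [apply Rmult_le_pos; [lra|apply Rmult_le_pos; lra]|].
      rewrite <- exp_0; apply exp_le; pose proof (exp_pos (- t)); lra. }
    pose proof (B 2%nat) as B2; pose proof (B 1%nat) as B1.
    pose proof (exp_pos (t / 2)) as E1; pose proof (exp_pos (- (t / 2))) as E2.
    rewrite Rabs_mult, (Rabs_pos_eq c) by lra; apply Rmult_le_compat_l; [lra|].
    assert (X2 : 0 <= exp (t / 2) * sterm 2 n t <= sconst 2 q * (e * i)).
    { split; [apply Rmult_le_pos; lra|].
      apply Rle_trans with (exp (t / 2) * (sconst 2 q * (exp (INR q * t) * i))); [apply Rmult_le_compat_l; lra|].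
      replace (exp (t / 2) * (sconst 2 q * (exp (INR q * t) * i))) with
        (sconst 2 q * (exp (t / 2) * exp (INR q * t) * i)) by ring.
      apply Rmult_le_compat_l; [apply S0|apply Rmult_le_compat_r; lra]. }
    assert (X1 : 0 <= exp (- (t / 2)) * sterm 1 n t <= sconst 1 q * (e * i)).
    { split; [apply Rmult_le_pos; lra|].
      apply Rle_trans with (exp (- (t / 2)) * (sconst 1 q * (exp (INR q * t) * i))); [apply Rmult_le_compat_l; lra|].
      replace (exp (- (t / 2)) * (sconst 1 q * (exp (INR q * t) * i))) with
        (sconst 1 q * (exp (- (t / 2)) * exp (INR q * t) * i)) by ring.
      apply Rmult_le_compat_l; [apply S0|apply Rmult_le_compat_r; lra]. }
    replace (2 * exp (t / 2) * sterm 2 n t) with (2 * (exp (t / 2) * sterm 2 n t)) by ring.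
    rewrite Rabs_pos_eq by lra.
    replace ((2 * sconst 2 q + sconst 1 q) * e * i) with (2 * (sconst 2 q * (e * i)) + sconst 1 q * (e * i)) by ring.
    lra. }
  exists (c * A); intros n t Ht.
  set (i := / INR (S n) ^ 2) in *; assert (Hi : 0 < i) by (apply Rinv_0_lt_compat, pow_lt, lt_0_INR; lia).
  split.
  - eapply Rle_trans; [apply (Q 1%nat n t (exp (3 / 2 * t)) (le_n _)); rewrite <- exp_plus; apply exp_le; simpl; lra|].
    fold i; rewrite !Rmult_assoc; apply Rmult_le_compat_l; [lra|].
    apply Rmult_le_compat_r; [|lra]; apply Rmult_le_pos; [left; apply exp_pos|lra].
  - eapply Rle_trans; [apply (Q 6%nat n (- t) (exp (- (11 / 2 * t))) ltac:(lia)); rewrite <- exp_plus; apply exp_le; simpl; lra|].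
    fold i; rewrite !Rmult_assoc; apply Rmult_le_compat_l; [lra|].
    apply Rmult_le_compat_r; [|lra]; apply Rmult_le_pos; [left; apply exp_pos|lra].
Qed.

Definition kopp (t : R) : R := kern (- t).

Lemma kern_cont : cont kern.
Proof. apply (is_derive_cont _ _ kern_derive). Qed.

Lemma kopp_cont : cont kopp.
Proof.
  intros t; apply (continuous_comp Ropp kern); [|apply kern_cont].
  apply @ex_derive_continuous; auto_derive; exact I.
Qed.

Lemma psi_cont : cont psi.
Proof. apply (is_derive_cont _ _ psi_derive). Qed.

Lemma kopp_bound : exists C, ebound C (11 / 2) kopp.
Proof.
  destruct (kern_bound 6 ltac:(lia)) as (C & HC & H); exists C; intros t _; unfold kopp.
  destruct (H (- t)) as [[A B] _]; rewrite Rabs_pos_eq by exact A.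
  eapply Rle_trans; [exact B|].
  replace ((INR 6 - / 2) * - t) with (- (11 / 2 * t)) by (simpl; field).
  rewrite <- (Rmult_1_r (C * exp (- (11 / 2 * t)))) at 2.
  apply Rmult_le_compat_l; [apply Rmult_le_pos; [lra|left; apply exp_pos]|].
  rewrite <- exp_0; apply exp_le; pose proof (exp_pos (- - t)); lra.
Qed.

Lemma psi_ebound : exists C, ebound C 1 psi.
Proof.
  destruct psi_bound as (C & HC & H); exists C; intros t _; rewrite Rmult_1_l; apply H.
Qed.

(** With N = n + 1, the quantity y equals exp (2 ln N - t), so every term is a reflected translate
    of the same gamma integrand. The translation leaves behind N^(1 - 2 w) and N^(- 1 - 2 w), the
    terms of the two zeta series. *)
Lemma tker_gam (n : nat) (w : C) (t : R) :
  (RtoC (tker n t) * Cexp (- w * RtoC t))%C =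
  (RtoC (4 / (3 * sqrt PI)) * (2 * Cexp (- (2 * w - 1) * RtoC (ln (INR (S n)))) + Cexp (- (2 * w + 1) * RtoC (ln (INR (S n)))))
    * gam_integrand (w + 3 / 2) (2 * ln (INR (S n)) - t))%C.
Proof.
  set (N := INR (S n)); assert (HN : 0 < N) by (apply lt_0_INR; lia).
  set (L := ln N).
  assert (Y : yval n t = exp (2 * L - t)).
  { unfold yval; fold N; unfold Rminus; rewrite exp_plus; f_equal.
    unfold L; replace (2 * ln N) with (INR 2 * ln N) by reflexivity.
    rewrite exp_INR, exp_ln by exact HN; reflexivity. }
  unfold tker, sterm, gam_integrand, gam2; rewrite Y.
  set (e := exp (- exp (2 * L - t))).
  rewrite <- !exp_INR.
  transitivity (RtoC (4 / (3 * sqrt PI)) * RtoC e *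
    (2 * (Cexp (RtoC (t / 2)) * Cexp (RtoC (INR 2 * (2 * L - t))) * Cexp (- w * RtoC t)) +
     Cexp (RtoC (- (t / 2))) * Cexp (RtoC (INR 1 * (2 * L - t))) * Cexp (- w * RtoC t)))%C.
  - rewrite !Cexp_R, !RtoC_mult, RtoC_plus, !RtoC_mult; ring.
  - rewrite <- !Cexp_plus.
    replace (RtoC (t / 2) + RtoC (INR 2 * (2 * L - t)) + - w * RtoC t)%C with
      (- (2 * w - 1) * RtoC L + (w + 3 / 2) * RtoC (2 * L - t))%C by (apply C_eq; simpl; field).
    replace (RtoC (- (t / 2)) + RtoC (INR 1 * (2 * L - t)) + - w * RtoC t)%C with
      (- (2 * w + 1) * RtoC L + (w + 3 / 2) * RtoC (2 * L - t))%C by (apply C_eq; simpl; field).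
    rewrite !Cexp_plus; ring.
Qed.

Lemma lap_lin (f g : R -> R) (a M c N d : R) (s : C) : cont f -> cont g -> ebound M c f -> ebound N d g ->
  - c < fst s -> - d < fst s ->
  lap (fun t => a * f t + g t) s = (RtoC a * lap f s + lap g s)%C.
Proof.
  intros Cf Cg Bf Bg Hc Hd; unfold lap.
  rewrite <- (JC_lin _ _ (RtoC a) _ _ _ _ (lap_cont f s Cf) (lap_cont g s Cg) (lap_dom f M c s Bf Hc) (lap_dom g N d s Bg Hd)).
  apply JC_ext; intros t; rewrite RtoC_plus, RtoC_mult; ring.
Qed.

Lemma lap_exp (s : C) : 1 < fst s -> lap exp s = (/ (s - 1))%C.
Proof.
  intros Hs; rewrite <- lap_one by (simpl; lra); unfold lap; apply JC_ext; intros t.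
  rewrite <- !Cexp_R, <- Cexp_plus, Cmult_1_l; f_equal; ring.
Qed.

(** In this strip both zeta series converge and [kern] may be integrated term by term, each term
    being a gamma integral after reflection and translation. On the left, the half-line t > 0 is
    rewritten by [kern_psi], whose elementary part has the transform 1 / (w - 1) + 1 / (3 w). *)
Lemma mellin_far (w : C) : 3 < fst w < 4 ->
  (lap psi w + lap kopp (- w) + / (w - 1) + / (3 * w))%C =
  (RtoC (4 / (3 * sqrt PI)) * gamL (w + 3 / 2) * (2 * zeta_em (2 * w - 1) + zeta_em (2 * w + 1)))%C.
Proof.
  intros Hw; destruct tker_bound as [C HC].
  set (c0 := RtoC (4 / (3 * sqrt PI))).
  assert (C0 : 0 <= C).
  { destruct (HC 0%nat 0 (Rle_refl 0)) as [A _]; rewrite Rmult_0_r, exp_0 in A; simpl in A.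
    pose proof (Rabs_pos (tker 0 0)); lra. }
  set (M := fun n => C * / INR (S n) ^ 2).
  assert (HM : ex_series M) by apply inv_sq_scal.
  assert (S1 : is_Cseries (fun n => JC (fun t => RtoC (tker n t) * Cexp (- w * RtoC t))%C) (lap kern w)).
  { apply (JC_series _ _ M 1); [| |lra| |exact HM|].
    - intros n; apply lap_cont, tker_cont.
    - apply lap_cont, kern_cont.
    - intros n t Ht; rewrite Cmod_mult, Cmod_R, Cmod_Cexp_line.
      destruct (HC n t Ht) as [A _].
      apply Rle_trans with (C * exp (3 / 2 * t) * / INR (S n) ^ 2 * exp (fst (- w)%C * t));
        [apply Rmult_le_compat_r; [left; apply exp_pos|exact A]|].
      unfold M; replace (C * exp (3 / 2 * t) * / INR (S n) ^ 2 * exp (fst (- w)%C * t)) with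
        (C * / INR (S n) ^ 2 * (exp (3 / 2 * t) * exp (fst (- w)%C * t))) by ring.
      apply Rmult_le_compat_l.
      + apply Rmult_le_pos; [exact C0|left; apply Rinv_0_lt_compat, pow_lt, lt_0_INR; lia].
      + rewrite <- exp_plus; apply exp_le; simpl; nra.
    - intros t _; apply Cseries_mulR, tker_series. }
  assert (S2 : is_Cseries (fun n => JC (fun t => RtoC (tker n (- t)) * Cexp (- - w * RtoC t))%C) (lap kopp (- w))).
  { apply (JC_series _ _ M 1); [| |lra| |exact HM|].
    - intros n; apply lap_cont; intros t; apply (continuous_comp Ropp (tker n)); [|apply tker_cont].
      apply @ex_derive_continuous; auto_derive; exact I.
    - apply lap_cont, kopp_cont.
    - intros n t Ht; rewrite Cmod_mult, Cmod_R, Cmod_Cexp_line.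
      destruct (HC n t Ht) as [_ A].
      apply Rle_trans with (C * exp (- (11 / 2 * t)) * / INR (S n) ^ 2 * exp (fst (- - w)%C * t));
        [apply Rmult_le_compat_r; [left; apply exp_pos|exact A]|].
      unfold M; replace (C * exp (- (11 / 2 * t)) * / INR (S n) ^ 2 * exp (fst (- - w)%C * t)) with
        (C * / INR (S n) ^ 2 * (exp (- (11 / 2 * t)) * exp (fst (- - w)%C * t))) by ring.
      apply Rmult_le_compat_l.
      + apply Rmult_le_pos; [exact C0|left; apply Rinv_0_lt_compat, pow_lt, lt_0_INR; lia].
      + rewrite <- exp_plus; apply exp_le; simpl; nra.
    - intros t _; apply Cseries_mulR, tker_series. }
  destruct (gam_integrand_dom (w + 3 / 2) 20) as (Mg & cg & Dg1 & Dg2).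
  { simpl; lra. }
  pose proof (gam_integrand_cont (w + 3 / 2)) as Cg.
  assert (T : forall n, (JC (fun t => RtoC (tker n t) * Cexp (- w * RtoC t))%C +
     JC (fun t => RtoC (tker n (- t)) * Cexp (- - w * RtoC t))%C)%C =
     (c0 * gamL (w + 3 / 2) * (2 * Cexp (- (2 * w - 1) * RtoC (ln (INR (S n)))) +
        Cexp (- (2 * w + 1) * RtoC (ln (INR (S n))))))%C).
  { intros n.
    set (k := (2 * Cexp (- (2 * w - 1) * RtoC (ln (INR (S n)))) + Cexp (- (2 * w + 1) * RtoC (ln (INR (S n)))))%C).
    set (h := 2 * ln (INR (S n))).
    transitivity (J2C (fun t => c0 * k * gam_integrand (w + 3 / 2) (h - t))%C).
    - unfold J2C; f_equal; apply JC_ext; intros t.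
      + apply tker_gam.
      + transitivity (RtoC (tker n (- t)) * Cexp (- w * RtoC (- t)))%C; [|apply tker_gam].
        do 2 f_equal; rewrite RtoC_opp; ring.
    - transitivity (J2C (fun t => (fun u => c0 * k * gam_integrand (w + 3 / 2) u)%C (h - t))); [reflexivity|].
      assert (Ck : contC (fun u => (c0 * k * gam_integrand (w + 3 / 2) u)%C)) by (apply contC_mult; [apply contC_const|exact Cg]).
      rewrite (J2C_reflect_shift _ h (Cmod (c0 * k) * Mg) cg Ck).
      + rewrite (J2C_scal _ _ Mg cg Cg (contC_opp _ Cg) Dg1 Dg2), gamL_J2C; ring.
      + split; [apply Dg1|]; intros t Ht; rewrite Cmod_mult, Rmult_assoc.
        apply Rmult_le_compat_l; [apply Cmod_ge_0|apply Dg1, Ht].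
      + split; [apply Dg1|]; intros t Ht; rewrite Cmod_mult, Rmult_assoc.
        apply Rmult_le_compat_l; [apply Cmod_ge_0|apply Dg2, Ht]. }
  pose proof (is_series_plus (K := C_AbsRing) (V := C_NormedModule) _ _ _ _ S1 S2) as S12.
  pose proof (is_series_scal (K := C_AbsRing) (V := C_NormedModule) (c0 * gamL (w + 3 / 2))%C _ _
    (is_series_plus (K := C_AbsRing) (V := C_NormedModule) _ _ _ _
      (is_series_scal (K := C_AbsRing) (V := C_NormedModule) (RtoC 2) _ _ (zeta_em_series (2 * w - 1) ltac:(simpl; lra)))
      (zeta_em_series (2 * w + 1) ltac:(simpl; lra)))) as S3.
  assert (E : (lap kern w + lap kopp (- w))%C =
    (c0 * gamL (w + 3 / 2) * (2 * zeta_em (2 * w - 1) + zeta_em (2 * w + 1)))%C).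
  { eapply is_Cseries_unique; [exact S12|].
    eapply is_series_ext; [|exact S3]; intros n; symmetry; apply T. }
  rewrite <- E.
  assert (EL : lap kern w = (lap psi w + / (w - 1) + / (3 * w))%C).
  { destruct psi_ebound as [Cp HCp].
    assert (B1 : ebound 1 0 (fun _ => 1)) by (intros t _; rewrite Rmult_0_l, Ropp_0, exp_0, Rabs_R1; lra).
    assert (Be : ebound 1 (-1) exp).
    { intros t _; rewrite Rabs_pos_eq by (left; apply exp_pos); right; rewrite Rmult_1_l; f_equal; ring. }
    assert (Ce : cont exp) by (apply (is_derive_cont exp exp), is_derive_exp).
    assert (N0 : w <> 0%C) by (intros H; rewrite H in Hw; simpl in Hw; lra).
    assert (B2 : ebound 2 (-1) (fun t => / 3 * 1 + exp t)).
    { intros t Ht; pose proof (exp_le 0 t Ht); rewrite exp_0 in *.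
      replace (- (-1 * t)) with t by ring; rewrite Rabs_pos_eq; lra. }
    assert (N1 : (w - 1)%C <> 0%C).
    { intros H; apply (f_equal fst) in H; simpl in H; lra. }
    replace kern with (fun t => 1 * psi t + (/ 3 * 1 + exp t)).
    - rewrite (lap_lin psi (fun t => / 3 * 1 + exp t) 1 Cp 1 2 (-1) w), (lap_lin (fun _ => 1) exp (/ 3) 1 0 1 (-1) w);
        auto using psi_cont, cont_const; try lra.
      + rewrite lap_one, lap_exp, RtoC_inv by lra; field; split; assumption.
      + apply cont_plus; [apply cont_const|exact Ce].
    - apply functional_extensionality; intros t; rewrite kern_psi; field. }
  rewrite EL; ring.
Qed.

Definition mel_left (w : C) : C := (w * (w - 1) * (lap psi w + lap kopp (- w)) + w + (w - 1) / 3)%C.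
Definition mel_right (w : C) : C :=
  (RtoC (4 / (3 * sqrt PI)) * (gamL (w + 3 / 2) *
    (2 * w * (w - 1) * zeta_reg (2 * w - 1) + w + w * (w - 1) * zeta_reg (2 * w + 1) + (w - 1) / 2)))%C.

(* Multiplying by w (w - 1) clears the poles of both zeta factors. *)
Lemma mellin (w : C) : - / 2 < fst w < 4 -> mel_left w = mel_right w.
Proof.
  intros Hw; set (b := (0, snd w) : C).
  set (W := fun t : R => (RtoC 1 * RtoC t + b)%C).
  assert (EW : forall t, W t = (t, snd w)) by (intros; apply C_eq; unfold W, b; simpl; ring).
  assert (N1 : -1 <> 0) by lra.
  assert (N2 : 2 <> 0) by lra.
  set (F := fun t => (mel_left (W t) - mel_right (W t))%C).
  assert (Z : F (fst w) = 0%C).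
  { apply (complex_identity F (fst w) 3 4); try lra.
    - intros t Ht.
      assert (LW : LA W t).
      { apply (LA_comp (fun z => z)); [apply R1_neq_R0|].
        apply (analytic_ext (fun z => z * 1)%C); [intros; ring|apply analytic_mul_X, analytic_const]. }
      assert (Lc : forall c : C, LA (fun _ => c) t).
      { intros c; apply (LA_comp (fun _ => c) 1 b); [apply R1_neq_R0|apply analytic_const]. }
      assert (Lpsi : LA (fun t => lap psi (W t)) t).
      { apply LA_comp; [apply R1_neq_R0|].
        destruct psi_ebound as [C HC]; apply (lap_analytic psi C 1); [apply psi_cont|exact HC|].
        fold (W t); rewrite EW; simpl; lra. }
      assert (Lk : LA (fun t => lap kopp (- W t)) t).
      { replace (fun t => lap kopp (- W t)) with (fun t => lap kopp (RtoC (-1) * RtoC t + - b)).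
        - apply LA_comp; [exact N1|].
          destruct kopp_bound as [C HC]; apply (lap_analytic kopp C (11 / 2)); [apply kopp_cont|exact HC|].
          simpl; lra.
        - apply functional_extensionality; intros s; f_equal; unfold W; apply C_eq; simpl; ring. }
      assert (Lg : LA (fun t => gamL (W t + 3 / 2)) t).
      { unfold gamL; apply LA_plus.
        - replace (fun t => lap gam1 (W t + 3 / 2)) with (fun t => lap gam1 (RtoC 1 * RtoC t + (b + 3 / 2))).
          + apply LA_comp; [apply R1_neq_R0|]; apply gamL_analytic; simpl; lra.
          + apply functional_extensionality; intros s; f_equal; unfold W; ring.
        - replace (fun t => lap gam2 (- (W t + 3 / 2))) with (fun t => lap gam2 (RtoC (-1) * RtoC t + - (b + 3 / 2))).
          + apply LA_comp; [exact N1|].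
            replace (RtoC (-1) * RtoC t + - (b + 3 / 2))%C with (- (RtoC t + (b + 3 / 2)))%C
              by (apply C_eq; simpl; ring).
            apply gamL_analytic; simpl; lra.
          + apply functional_extensionality; intros s; f_equal; unfold W; apply C_eq; simpl; ring. }
      (* The lower end of the strip comes from here: Re w > - 1/2 puts 2 w - 1 into Re s > - 2,
         where [zeta_reg] is analytic. *)
      assert (Lz : forall d : C, - 1 <= fst d -> LA (fun t => zeta_reg (2 * W t + d)) t).
      { intros d Hd.
        replace (fun t => zeta_reg (2 * W t + d)) with (fun t => zeta_reg (RtoC 2 * RtoC t + (2 * b + d))).
        - apply LA_comp; [exact N2|]; apply zeta_reg_analytic; simpl; lra.
        - apply functional_extensionality; intros s; f_equal; unfold W; ring. }
      assert (Lz1 : LA (fun t => zeta_reg (2 * W t - 1)) t) by (apply (Lz (- (1))%C); simpl; lra); pose proof (Lz 1%C ltac:(simpl; lra)) as Lz2.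
      assert (LW1 : LA (fun t => W t - 1)%C t) by (apply LA_minus; [exact LW|apply Lc]).
      unfold F, mel_left, mel_right, Cdiv.
      repeat lazymatch goal with
        | |- LA (fun s => Cminus (@?f s) (@?g s)) _ => apply (LA_minus f g)
        | |- LA (fun s => Cplus (@?f s) (@?g s)) _ => apply (LA_plus f g)
        | |- LA (fun s => Cmult (@?f s) (@?g s)) _ => apply (LA_mult f g)
        end; first [assumption | apply Lc].
    - intros t Ht; unfold F; rewrite EW.
      set (v := (t, snd w) : C); assert (Hv : 3 < fst v < 4) by exact Ht.
      assert (V0 : v <> 0%C) by (intros H; rewrite H in Hv; simpl in Hv; lra).
      assert (V1 : (v - 1)%C <> 0%C) by (intros H; apply (f_equal fst) in H; simpl in H, Hv; lra).
      pose proof (mellin_far v Hv) as E.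
      assert (E1 : mel_left v = (v * (v - 1) * (lap psi v + lap kopp (- v) + / (v - 1) + / (3 * v)))%C)
        by (unfold mel_left; field; split; assumption).
      rewrite E1, E; unfold mel_right, zeta_em; field.
      repeat split; try assumption; intros H; apply (f_equal fst) in H; simpl in H, Hv; lra. }
  unfold F in Z; rewrite EW, <- surjective_pairing in Z.
  transitivity (mel_left w - mel_right w + mel_right w)%C; [ring|rewrite Z; ring].
Qed.

(** * The gamma function *)

Lemma gamma_subst (s : C) (a b : R) : 0 < a -> a < b ->
  is_RInt (V := C_R_CompleteNormedModule) (fun t : R => (cpow t (s - 1) * RtoC (exp (- t)))%C) a b
    (RIntC (gam_integrand s) (ln a) (ln b)).
Proof.
  intros Ha Hab.
  destruct (gam_integrand_cont s) as [C1 C2].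
  assert (E : forall t, 0 < t -> (cpow t (s - 1) * RtoC (exp (- t)))%C = (RtoC (/ t) * gam_integrand s (ln t))%C).
  { intros t Ht; unfold cpow, gam_integrand, gam2; rewrite exp_ln by exact Ht.
    replace ((s - 1) * RtoC (ln t))%C with (s * RtoC (ln t) + RtoC (- ln t))%C by (rewrite RtoC_opp; ring).
    rewrite Cexp_plus, Cexp_R, exp_Ropp, exp_ln by exact Ht; ring. }
  assert (Q : forall g : R -> R, cont g -> is_RInt (fun t => / t * g (ln t)) a b (RInt g (ln a) (ln b))).
  { intros g Cg; apply (is_RInt_comp g ln Rinv a b).
    - intros; apply Cg.
    - intros x; rewrite Rmin_left, Rmax_right by lra; intros Hx; split.
      + auto_derive; [lra|field; lra].
      + apply @ex_derive_continuous; auto_derive; lra. }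
  apply (is_RInt_fct_extend_pair (U := R_NormedModule) (V := R_NormedModule)).
  - eapply is_RInt_ext; [|apply (Q _ C1)]; rewrite Rmin_left, Rmax_right by lra; intros t Ht.
    rewrite E by lra; simpl; as_R; ring.
  - eapply is_RInt_ext; [|apply (Q _ C2)]; rewrite Rmin_left, Rmax_right by lra; intros t Ht.
    rewrite E by lra; simpl; as_R; ring.
Qed.

Lemma RInt_opp_arg (g : R -> R) (c : R) : cont g -> RInt (fun t => g (- t)) 0 c = RInt g (- c) 0 :> R.
Proof.
  intros Cg.
  pose proof (RInt_comp_affine g (-1) 0 0 c Cg) as E.
  replace (-1 * 0 + 0) with 0 in E by ring; replace (-1 * c + 0) with (- c) in E by ring.
  rewrite <- (opp_RInt_swap g 0 (- c)) by (apply cont_ex_RInt, Cg).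
  rewrite <- E.
  rewrite (RInt_ext (fun t => g (-1 * t + 0)) (fun t => g (- t))).
  - generalize (RInt (fun t => g (- t)) 0 c : R); intros i; change (i = - (-1 * i)); ring.
  - intros t _; f_equal; ring.
Qed.

(** The substitution t = exp u turns an integral over [a, b] into one over [ln a, ln b]. The two
    ends tend to infinity independently, so the limits on both half-lines are combined with one
    common threshold m. *)
Lemma CGamma_gamL (s : C) : 0 < fst s < 20 -> CGamma s = gamL s.
Proof.
  intros Hs; unfold CGamma; apply (@is_RInt_gen_unique C_R_CompleteNormedModule (at_right 0) (Rbar_locally p_infty) _ _).
  rewrite <- gamL_J2C.
  destruct (gam_integrand_dom s 20 ltac:(simpl; lra)) as (M & c & D1 & D2).
  pose proof (gam_integrand_cont s) as [C1 C2].
  pose proof (contC_opp _ (conj C1 C2)) as [C3 C4].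
  destruct (domC_parts _ _ _ D1) as [A1 A2], (domC_parts _ _ _ D2) as [A3 A4].
  assert (Q : forall g : R -> R, cont g -> cont (fun t => g (- t)) -> dom M c g -> dom M c (fun t => g (- t)) ->
    forall eps : posreal, exists m, 0 < m /\ forall u v, m < u -> m < v ->
      Rabs (RInt g (- u) v - (J g + J (fun t => g (- t)))) < eps).
  { intros g Cg Cg' Dg Dg' eps.
    pose proof (J_correct _ _ _ Cg Dg) as L1; pose proof (J_correct _ _ _ Cg' Dg') as L2.
    apply is_lim_spec in L1; apply is_lim_spec in L2.
    destruct (L1 (pos_div_2 eps)) as [m1 H1], (L2 (pos_div_2 eps)) as [m2 H2].
    exists (Rmax 1 (Rmax m1 m2)); split; [pose proof (Rmax_l 1 (Rmax m1 m2)); lra|].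
    intros u v Hu Hv.
    pose proof (Rmax_r 1 (Rmax m1 m2)); pose proof (Rmax_l m1 m2); pose proof (Rmax_r m1 m2).
    specialize (H1 v ltac:(lra)); specialize (H2 u ltac:(lra)); simpl in H1, H2.
    rewrite RInt_opp_arg in H2 by exact Cg.
    rewrite <- (RInt_Chasles_cont g (- u) 0 v Cg).
    match goal with |- Rabs (?x + ?y - (?p + ?q)) < _ => change (Rabs ((x + y - (p + q)) : R) < eps) end.
    apply Rabs_def2 in H1; apply Rabs_def2 in H2; apply Rabs_def1; simpl in *; lra. }
  intros P HP.
  assert (HP' : locally (T := prod_UniformSpace R_UniformSpace R_UniformSpace) (J2C (gam_integrand s)) P) by exact HP.
  destruct HP' as [eps Heps].
  destruct (Q (fun t => fst (gam_integrand s t)) C1 C3 A1 A3 eps) as (m1 & M1 & Q1).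
  destruct (Q (fun t => snd (gam_integrand s t)) C2 C4 A2 A4 eps) as (m2 & M2 & Q2).
  set (m := Rmax m1 m2); pose proof (Rmax_l m1 m2); pose proof (Rmax_r m1 m2).
  apply (Filter_prod _ _ _ (fun a => 0 < a < exp (- m)) (fun b => exp m < b)).
  - exists (mkposreal _ (exp_pos (- m))); intros y Hy Hy0; split; [exact Hy0|].
    unfold ball in Hy; simpl in Hy; unfold AbsRing_ball, abs, minus, plus, opp in Hy; simpl in Hy.
    apply Rabs_def2 in Hy; lra.
  - exists (exp m); auto.
  - intros x y [Hx0 Hx] Hy; simpl.
    assert (Hlx : ln x < - m) by (rewrite <- (ln_exp (- m)); apply ln_increasing; assumption).
    assert (Hly : m < ln y) by (rewrite <- (ln_exp m); apply ln_increasing; [apply exp_pos|assumption]).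
    exists (RIntC (gam_integrand s) (ln x) (ln y)); split.
    + apply gamma_subst; [exact Hx0|].
      apply Rlt_trans with (exp (- m)); [exact Hx|]; apply Rlt_trans with (exp m); [|exact Hy].
      apply exp_increasing; unfold m; lra.
    + apply Heps; split; unfold ball; simpl; unfold AbsRing_ball, abs, minus, plus, opp; simpl.
      * pose proof (Q1 (- ln x) (ln y) ltac:(unfold m in *; lra) ltac:(unfold m in *; lra)) as Z.
        rewrite Ropp_involutive in Z; exact Z.
      * pose proof (Q2 (- ln x) (ln y) ltac:(unfold m in *; lra) ltac:(unfold m in *; lra)) as Z.
        rewrite Ropp_involutive in Z; exact Z.
Qed.

(** * The logarithmic derivative of the gamma function at 3/2 *)

Definition gint (x t : R) : R := gam2 t * exp (x * t).
Definition Rgam (x : R) : R := J2 (gint x).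

Lemma gam_integrand_R (x t : R) : gam_integrand (RtoC x) t = RtoC (gint x t).
Proof.
  unfold gam_integrand, gint; rewrite <- RtoC_mult, Cexp_R, RtoC_mult; reflexivity.
Qed.

Lemma gint_cont (x : R) : cont (gint x).
Proof. intros t; apply @ex_derive_continuous; unfold gint, gam2; auto_derive; exact I. Qed.

Lemma cont_reflect (f : R -> R) : cont f -> cont (fun t => f (- t)).
Proof.
  intros H t; apply (continuous_comp Ropp f); [|apply H].
  apply @ex_derive_continuous; auto_derive; exact I.
Qed.

Lemma gint_dom (x : R) : 0 < x -> exists M c, dom M c (gint x) /\ dom M c (fun t => gint x (- t)).
Proof.
  intros Hx; destruct (gam_integrand_dom (RtoC x) (S (Z.to_nat (up x)))) as (M & c & D1 & D2).
  - split; [exact Hx|]; rewrite S_INR, INR_IZR_INZ, Z2Nat.id.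
    + simpl; destruct (archimed x); lra.
    + apply le_IZR; destruct (archimed x); lra.
  - exists M, c; split.
    + destruct (domC_parts _ _ _ D1) as [[Hc A] _]; split; [exact Hc|]; intros t Ht.
      specialize (A t Ht); rewrite gam_integrand_R in A; exact A.
    + destruct (domC_parts _ _ _ D2) as [[Hc A] _]; split; [exact Hc|]; intros t Ht.
      specialize (A t Ht); rewrite gam_integrand_R in A; exact A.
Qed.

Lemma Rgam_gamL (x : R) : fst (gamL (RtoC x)) = Rgam x.
Proof.
  rewrite <- gamL_J2C; unfold Rgam, J2.
  change (fst (J2C (gam_integrand (RtoC x)))) with
    (J (fun t => fst (gam_integrand (RtoC x) t)) + J (fun t => fst (gam_integrand (RtoC x) (- t)))).
  f_equal; f_equal; apply functional_extensionality; intros t; rewrite gam_integrand_R; reflexivity.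
Qed.

Lemma dom_lim (C c : R) (f : R -> R) : dom C c f -> is_lim f p_infty 0.
Proof.
  intros [Hc H].
  assert (L : is_lim (fun t => C * exp (- (c * t))) p_infty 0).
  { replace (Finite 0) with (Rbar_mult C 0) by (simpl; f_equal; ring).
    apply is_lim_scal_l, exp_neg_lim, Hc. }
  apply (is_lim_le_le_loc (fun t => - (C * exp (- (c * t)))) (fun t => C * exp (- (c * t)))).
  - exists 0; intros t Ht; specialize (H t ltac:(lra)); apply Rabs_le_between in H; lra.
  - replace (Finite 0) with (Rbar_opp 0) by (simpl; f_equal; ring); apply is_lim_opp, L.
  - exact L.
Qed.

Lemma J_le (f g : R -> R) (C c D d : R) : cont f -> cont g -> dom C c f -> dom D d g ->
  (forall t, f t <= g t) -> J f <= J g.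
Proof.
  intros Cf Cg Df Dg H.
  pose proof (J_correct _ _ _ Cf Df) as L1; pose proof (J_correct _ _ _ Cg Dg) as L2.
  refine (is_lim_le_loc _ _ _ (Finite (J f)) (Finite (J g)) _ L1 L2).
  exists 0; intros b Hb; apply RInt_le; try apply cont_ex_RInt; try assumption; [lra|].
  intros; apply H.
Qed.

Lemma Rgam_succ (x : R) : 0 < x -> Rgam (x + 1) = x * Rgam x.
Proof.
  intros Hx.
  destruct (gint_dom x Hx) as (M & c & D1 & D2).
  destruct (gint_dom (x + 1) ltac:(lra)) as (N & d & E1 & E2).
  pose proof (gint_cont x) as C1; pose proof (gint_cont (x + 1)) as C2.
  pose proof (cont_reflect _ C1) as C3; pose proof (cont_reflect _ C2) as C4.
  assert (D : forall t, is_derive (gint x) t (- (1) * gint (x + 1) t + x * gint x t)).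
  { intros t; unfold gint, gam2; auto_derive; [exact I|].
    replace ((x + 1) * t) with (x * t + t) by ring; rewrite exp_plus; ring. }
  assert (D' : forall t, is_derive (fun t => gint x (- t)) t (1 * gint (x + 1) (- t) + - x * gint x (- t))).
  { intros t; unfold gint, gam2; auto_derive; [exact I|].
    replace ((x + 1) * - t) with (x * - t + - t) by ring; rewrite exp_plus; ring. }
  pose proof (is_J_unique _ _ (is_J_derive _ _ 0 D ltac:(solve_cont) (dom_lim _ _ _ D1))) as A.
  pose proof (is_J_unique _ _ (is_J_derive _ _ 0 D' ltac:(solve_cont) (dom_lim _ _ _ D2))) as B.
  cbv beta in B.
  rewrite (J_lin2 (gint (x + 1)) (gint x) _ _ N d M c) in A by assumption.
  rewrite (J_lin2 (fun t => gint (x + 1) (- t)) (fun t => gint x (- t)) _ _ N d M c) in B by assumption.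
  unfold Rgam, J2; rewrite Ropp_0 in B; lra.
Qed.

(** The tangent of the exponential at w u lies below its graph; its values at 0 and at u are
    averaged with weights 1 - w and w. *)
Lemma exp_convex (w u : R) : 0 <= w <= 1 -> exp (w * u) <= 1 - w + w * exp u.
Proof.
  intros Hw.
  pose proof (exp_ge_1p (- (w * u))) as A; pose proof (exp_ge_1p ((1 - w) * u)) as B.
  assert (E0 : 1 = exp (w * u) * exp (- (w * u))) by (rewrite <- exp_plus, Rplus_opp_r, exp_0; reflexivity).
  assert (E1 : exp u = exp (w * u) * exp ((1 - w) * u)) by (rewrite <- exp_plus; f_equal; ring).
  pose proof (exp_pos (w * u)) as P.
  rewrite E1; replace (1 - w) with ((1 - w) * (exp (w * u) * exp (- (w * u)))) at 1 by (rewrite <- E0; ring).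
  assert (1 <= (1 - w) * exp (- (w * u)) + w * exp ((1 - w) * u)) by nra.
  nra.
Qed.

(* Log-convexity in the form given by weighting the integrand with [exp_convex]. *)
Lemma Rgam_weight (x w : R) : 0 < x -> 0 <= w <= 1 -> Rgam (x + w) <= exp (w * ln x) * Rgam x.
Proof.
  intros Hx Hw.
  destruct (gint_dom x Hx) as (M & c & D1 & D2).
  destruct (gint_dom (x + 1) ltac:(lra)) as (N & d & E1 & E2).
  destruct (gint_dom (x + w) ltac:(lra)) as (K & e & F1 & F2).
  set (p := exp (w * ln x)).
  assert (P : 0 < p) by apply exp_pos.
  assert (H : forall t, gint (x + w) t <= p * (1 - w) * gint x t + p * w / x * gint (x + 1) t).
  { intros t; unfold gint.
    replace ((x + w) * t) with (w * (t - ln x) + (w * ln x + x * t)) by ring.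
    replace ((x + 1) * t) with (ln x + (t - ln x) + x * t) by ring.
    rewrite !exp_plus, exp_ln by exact Hx; fold p.
    pose proof (exp_convex w (t - ln x) Hw) as Q.
    assert (0 < gam2 t) by apply exp_pos; pose proof (exp_pos (x * t)).
    replace (p * (1 - w) * (gam2 t * exp (x * t)) + p * w / x * (gam2 t * (x * exp (t - ln x) * exp (x * t))))
      with (gam2 t * p * exp (x * t) * (1 - w + w * exp (t - ln x))) by (field; lra).
    replace (gam2 t * (exp (w * (t - ln x)) * (p * exp (x * t))))
      with (gam2 t * p * exp (x * t) * exp (w * (t - ln x))) by ring.
    apply Rmult_le_compat_l; [|exact Q]; left; repeat apply Rmult_lt_0_compat; assumption. }
  assert (E : Rgam (x + w) <= p * (1 - w) * Rgam x + p * w / x * Rgam (x + 1)).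
  { pose proof (gint_cont x) as C1; pose proof (gint_cont (x + 1)) as C2; pose proof (gint_cont (x + w)) as C5.
    pose proof (cont_reflect _ C1) as C3; pose proof (cont_reflect _ C2) as C4; pose proof (cont_reflect _ C5) as C6.
    assert (Q : forall f g h : R -> R, cont f -> cont g -> cont h -> dom M c f -> dom N d g -> dom K e h ->
      (forall t, h t <= p * (1 - w) * f t + p * w / x * g t) -> J h <= p * (1 - w) * J f + p * w / x * J g).
    { intros f g h Cf Cg Ch Df Dg Dh Hh.
      rewrite <- (J_lin2 f g _ _ M c N d) by assumption.
      destruct Df as [Hc Df], Dg as [Hd Dg].
      apply (J_le _ _ K e (Rabs (p * (1 - w)) * Rabs M + Rabs (p * w / x) * Rabs N) (Rmin c d)); auto; [solve_cont|].
      split; [apply Rmin_pos; assumption|]; intros t Ht.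
      assert (G : forall a m k v, Rmin c d <= k -> Rabs v <= m * exp (- (k * t)) ->
        Rabs (a * v) <= Rabs a * Rabs m * exp (- (Rmin c d * t))).
      { intros a m k v Hk Hv; rewrite Rabs_mult, Rmult_assoc; apply Rmult_le_compat_l; [apply Rabs_pos|].
        eapply Rle_trans; [exact Hv|].
        apply Rle_trans with (Rabs m * exp (- (k * t))).
        - apply Rmult_le_compat_r; [left; apply exp_pos|apply Rle_abs].
        - apply Rmult_le_compat_l; [apply Rabs_pos|]; apply exp_le; nra. }
      eapply Rle_trans; [apply Rabs_triang|]; rewrite Rmult_plus_distr_r; apply Rplus_le_compat.
      - apply (G _ _ c); [apply Rmin_l|apply Df, Ht].
      - apply (G _ _ d); [apply Rmin_r|apply Dg, Ht]. }
    unfold Rgam, J2.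
    pose proof (Q _ _ _ C1 C2 C5 D1 E1 F1 H); pose proof (Q _ _ _ C3 C4 C6 D2 E2 F2 (fun t => H (- t))); lra. }
  rewrite (Rgam_succ x Hx) in E; eapply Rle_trans; [exact E|]; right; field; lra.
Qed.

Lemma lap_real (f : R -> R) (x : R) : lap f (RtoC x) = RtoC (fst (lap f (RtoC x))).
Proof.
  apply C_eq; [reflexivity|].
  change (J (fun t => snd (RtoC (f t) * Cexp (- RtoC x * RtoC t))%C) = 0).
  apply is_J_unique; apply (is_J_ext (fun _ => 0)).
  - intros t _; rewrite <- RtoC_opp, <- RtoC_mult, Cexp_R; simpl; ring.
  - unfold is_J; apply (is_lim_ext (fun _ => 0)); [|apply is_lim_const].
    intros b; rewrite RInt_const; unfold scal; simpl; unfold mult; simpl; as_R; ring.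
Qed.

Lemma gamL_real (x : R) : gamL (RtoC x) = RtoC (Rgam x).
Proof.
  rewrite <- Rgam_gamL; unfold gamL; rewrite <- RtoC_opp, (lap_real gam1), (lap_real gam2), <- RtoC_plus; reflexivity.
Qed.

Lemma zeta_reg_real (x : R) : zeta_reg (RtoC x) = RtoC (fst (zeta_reg (RtoC x))).
Proof.
  apply C_eq; [reflexivity|]; unfold zeta_reg, em_coeff.
  replace (RtoC x + 2)%C with (RtoC (x + 2)) by (rewrite RtoC_plus; reflexivity).
  rewrite (lap_real bernoulli).
  generalize (fst (lap bernoulli (RtoC (x + 2)))); intros v; simpl; field.
Qed.

Fixpoint rising (x : R) (n : nat) : R :=
  match n with O => 1 | S m => rising x m * (x + INR m) end.

Lemma rising_pos (x : R) (n : nat) : 0 < x -> 0 < rising x n.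
Proof.
  intros Hx; induction n; simpl; [lra|]; apply Rmult_lt_0_compat; [exact IHn|].
  pose proof (pos_INR n); lra.
Qed.

Lemma Rgam_rising (x : R) (n : nat) : 0 < x -> Rgam (x + INR n) = rising x n * Rgam x.
Proof.
  intros Hx; induction n; [simpl; rewrite Rplus_0_r; ring|].
  rewrite S_INR, <- Rplus_assoc, Rgam_succ by (pose proof (pos_INR n); lra).
  rewrite IHn; cbn [rising]; ring.
Qed.

Lemma rising_derive (x : R) (n : nat) : 0 < x ->
  is_derive (fun w => rising (x + w) n) 0 (rising x n * rsum n (fun j => / (x + INR j))).
Proof.
  intros Hx; induction n.
  - simpl; rewrite Rmult_0_r; apply @is_derive_const.
  - pose proof (pos_INR n) as P; cbn [rising rsum].
    replace (rising x n * (x + INR n) * (rsum n (fun j => / (x + INR j)) + / (x + INR n))) with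
      (rising x n * rsum n (fun j => / (x + INR j)) * (x + 0 + INR n) + rising (x + 0) n * 1)
      by (rewrite !Rplus_0_r; field; lra).
    apply (derive_mult (fun w => rising (x + w) n) (fun w => x + w + INR n)); [exact IHn|].
    generalize (INR n); intros N; auto_derive; [exact I|ring].
Qed.

Lemma derive_le_0_right (h : R -> R) (d : R) : is_derive h 0 d -> h 0 = 0 ->
  (forall w, 0 <= w <= 1 -> h w <= 0) -> d <= 0.
Proof.
  intros D H0 H; destruct (Rle_or_lt d 0) as [|Hd]; [assumption|exfalso].
  apply is_derive_Reals in D.
  destruct (D (d / 2) ltac:(lra)) as [e He].
  set (w := Rmin 1 (e / 2)).
  pose proof (cond_pos e) as Pe.
  assert (W : 0 < w <= 1) by (split; [apply Rmin_pos; lra|apply Rmin_l]).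
  assert (W2 : w <= e / 2) by apply Rmin_r.
  specialize (He w ltac:(lra) ltac:(rewrite Rabs_pos_eq; lra)).
  rewrite Rplus_0_l, H0, Rminus_0_r in He; specialize (H w ltac:(lra)).
  apply Rabs_def2 in He.
  assert (h w / w <= 0) by (apply Rmult_le_reg_r with w; [lra|]; field_simplify; lra).
  lra.
Qed.

(** Two functions of w that agree at w = 0 and are ordered for 0 <= w <= 1 have ordered derivatives
    at 0. With X = x + n, [Rgam_weight] gives Rgam (X + w) <= X^w Rgam X for the upper bound and
    Rgam (X + 1) <= (X + w)^(1 - w) Rgam (X + w) for the lower one. The shift by n, undone by
    [rising], makes the gap 1 / X tend to 0. *)
Lemma log_derivative_bounds (x G' : R) (n : nat) : 0 < x -> 0 < Rgam x -> is_derive Rgam x G' ->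
  let X := x + INR n in let S := rsum n (fun j => / (x + INR j)) in
  (ln X - / X - S) * Rgam x <= G' <= (ln X - S) * Rgam x.
Proof.
  intros Hx HG D X S.
  pose proof (pos_INR n) as Pn.
  assert (HX : 0 < X) by (unfold X; lra).
  pose proof (rising_pos x n Hx) as Hr; set (r := rising x n) in *; set (G := Rgam x) in *.
  assert (Dg : is_derive (fun w => Rgam (x + w)) 0 G').
  { replace G' with (1 * G') by ring.
    apply (is_derive_comp Rgam (fun w => x + w)); [rewrite Rplus_0_r; exact D|auto_derive; [exact I|ring]]. }
  pose proof (rising_derive x n Hx) as Dr; fold r S in Dr.
  pose proof (derive_mult _ _ _ _ _ Dr Dg) as Dp; cbv beta in Dp; rewrite !Rplus_0_r in Dp; fold r G in Dp.
  assert (EG : forall w, 0 <= w -> rising (x + w) n * Rgam (x + w) = Rgam (X + w)).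
  { intros w Hw; rewrite <- Rgam_rising by lra; f_equal; unfold X; ring. }
  assert (EX : Rgam X = r * G) by (unfold X; apply Rgam_rising, Hx).
  split.
  - assert (A : - ((- ln X + / X) * X * (r * G) + X * (r * S * G + r * G')) <= 0).
    { apply (derive_le_0_right (fun w => X * (r * G) - exp ((1 - w) * ln (X + w)) * (rising (x + w) n * Rgam (x + w)))).
      - assert (De : is_derive (fun w => exp ((1 - w) * ln (X + w))) 0 ((- ln X + / X) * X)).
        { auto_derive; [lra|]; rewrite !Rplus_0_r, Ropp_0, Rplus_0_r, !Rmult_1_l, exp_ln by exact HX; field; lra. }
        pose proof (derive_mult _ _ _ _ _ De Dp) as Dq; cbv beta in Dq.
        rewrite Rminus_0_r, !Rplus_0_r, Rmult_1_l, exp_ln in Dq by exact HX; fold r G in Dq.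
        pose proof (is_derive_minus (fun _ => X * (r * G)) _ 0 0 _ (is_derive_const (V := R_NormedModule) _ _) Dq) as Q.
        unfold minus, plus, opp in Q; simpl in Q.
        match type of Q with is_derive _ _ ?v => match goal with |- is_derive _ _ ?v' =>
          replace v' with v by ring end end.
        exact Q.
      - rewrite Rminus_0_r, !Rplus_0_r, Rmult_1_l, exp_ln by exact HX; fold r G; ring.
      - intros w Hw; rewrite EG by lra; rewrite <- EX, <- Rgam_succ by exact HX.
        pose proof (Rgam_weight (X + w) (1 - w) ltac:(lra) ltac:(lra)) as Q.
        replace (X + w + (1 - w)) with (X + 1) in Q by ring; lra. }
    apply (Rmult_le_reg_l (X * r)); [apply Rmult_lt_0_compat; assumption|].
    replace (X * r * ((ln X - / X - S) * G)) with (X * r * G' - ((- ln X + / X) * X * (r * G) + X * (r * S * G + r * G'))) by ring.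
    lra.
  - assert (A : r * S * G + r * G' - ln X * (r * G) <= 0).
    { apply (derive_le_0_right (fun w => rising (x + w) n * Rgam (x + w) - exp (w * ln X) * (r * G))).
      - assert (De : is_derive (fun w => exp (w * ln X) * (r * G)) 0 (ln X * (r * G))).
        { auto_derive; [exact I|]; rewrite Rmult_0_l, exp_0; ring. }
        exact (is_derive_minus _ _ 0 _ _ Dp De).
      - rewrite !Rplus_0_r, Rmult_0_l, exp_0; fold r G; ring.
      - intros w Hw; rewrite EG by lra; rewrite <- EX.
        pose proof (Rgam_weight X w HX ltac:(lra)); lra. }
    apply (Rmult_le_reg_l r); [exact Hr|]; lra.
Qed.

(** The terms are twice the reciprocals of the odd numbers from 3 on: all reciprocals up to 2 n + 1,
    without 1 and without the even ones. *)
Lemma odd_harmonic (n : nat) :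
  let H n := sum_n_m (fun k => / INR k) 1 n in
  rsum n (fun j => / (3 / 2 + INR j)) = 2 * H (2 * n + 1)%nat - 2 - H n.
Proof.
  intros H.
  assert (HS : forall k, H (S k) = H k + / INR (S k)) by (intros k; unfold H; rewrite sum_n_Sm by lia; reflexivity).
  assert (H0 : H 0%nat = 0) by (unfold H; rewrite sum_n_m_zero by lia; reflexivity).
  induction n.
  - change (2 * 0 + 1)%nat with 1%nat; rewrite HS, H0; simpl; lra.
  - replace (2 * S n + 1)%nat with (S (S (2 * n + 1))) by lia.
    cbn [rsum]; rewrite IHn, !HS; pose proof (pos_INR n) as P.
    rewrite !S_INR, !plus_INR, !mult_INR; simpl; field; lra.
Qed.

Lemma digamma_sum_lim : is_lim_seq (fun n => ln (3 / 2 + INR n) - rsum n (fun j => / (3 / 2 + INR j)))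
  (2 - euler_gamma - 2 * ln 2).
Proof.
  set (H := fun n => sum_n_m (fun k => / INR k) 1 n).
  pose proof harmonic_lim as L; rewrite zeta_reg_1 in L; fold (H) in L.
  assert (L2 : is_lim_seq (fun n => H (2 * n + 1)%nat - ln (INR (2 * n + 1))) euler_gamma).
  { apply (is_lim_seq_subseq (fun n => H n - ln (INR n)) _ (fun n => (2 * n + 1)%nat)); [|exact L].
    apply eventually_subseq; intros n; lia. }
  assert (I : forall c, is_lim_seq (fun n => c * / INR n) 0).
  { intros c; replace (Finite 0) with (Rbar_mult c (Rbar_inv p_infty)) by (simpl; f_equal; ring).
    apply is_lim_seq_scal_l, is_lim_seq_inv; [apply is_lim_seq_INR|discriminate]. }
  assert (Ll : forall a c, 0 < a -> is_lim_seq (fun n => ln (a + c * / INR n)) (ln a)).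
  { intros a c Ha.
    apply (is_lim_seq_continuous ln (fun n => a + c * / INR n)).
    - apply derivable_continuous_pt; exists (/ a); apply derivable_pt_lim_ln, Ha.
    - replace (Finite a) with (Finite (a + 0)) by (f_equal; ring).
      apply is_lim_seq_plus'; [apply is_lim_seq_const|apply I]. }
  assert (Lb : is_lim_seq (fun n => ln (1 + 3 / 2 * / INR n) - 2 * ln (2 + 1 * / INR n)) (ln 1 - 2 * ln 2)).
  { apply is_lim_seq_minus'; [apply Ll; lra|].
    apply (is_lim_seq_scal_l _ 2 (ln 2)), Ll; lra. }
  rewrite ln_1 in Lb.
  replace (2 - euler_gamma - 2 * ln 2) with (2 + (euler_gamma - 2 * euler_gamma + (0 - 2 * ln 2))) by ring.
  apply (is_lim_seq_ext_loc (fun n => 2 + ((H n - ln (INR n) - 2 * (H (2 * n + 1)%nat - ln (INR (2 * n + 1))))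
    + (ln (1 + 3 / 2 * / INR n) - 2 * ln (2 + 1 * / INR n))))).
  - exists 1%nat; intros n Hn.
    assert (Pn : 0 < INR n) by (apply lt_0_INR; lia).
    pose proof (Rinv_0_lt_compat _ Pn).
    rewrite odd_harmonic; fold (H (2 * n + 1)%nat) (H n).
    replace (3 / 2 + INR n) with (INR n * (1 + 3 / 2 * / INR n)) by (field; lra).
    replace (INR (2 * n + 1)) with (INR n * (2 + 1 * / INR n)) by (rewrite plus_INR, mult_INR; simpl; field; lra).
    rewrite !ln_mult by lra; ring.
  - apply is_lim_seq_plus'; [apply is_lim_seq_const|].
    apply is_lim_seq_plus'; [|exact Lb].
    apply is_lim_seq_minus'; [exact L|].
    apply (is_lim_seq_scal_l _ 2 euler_gamma), L2.
Qed.

Lemma Rgam_derive_3_2 (G' : R) : 0 < Rgam (3 / 2) -> is_derive Rgam (3 / 2) G' ->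
  G' = (2 - euler_gamma - 2 * ln 2) * Rgam (3 / 2).
Proof.
  intros HG D.
  pose proof (fun n => log_derivative_bounds (3 / 2) G' n ltac:(lra) HG D) as B; cbv zeta in B.
  pose proof digamma_sum_lim as L.
  assert (I : is_lim_seq (fun n => / (3 / 2 + INR n)) 0).
  { replace (Finite 0) with (Rbar_inv p_infty) by reflexivity.
    apply is_lim_seq_inv; [|discriminate].
    apply (is_lim_seq_plus _ _ (3 / 2) p_infty); [apply is_lim_seq_const|apply is_lim_seq_INR|reflexivity]. }
  apply Rle_antisym.
  - refine (is_lim_seq_le (fun _ => G') _ (Finite G') (Finite _) (fun n => proj2 (B n)) (is_lim_seq_const _) _).
    apply (is_lim_seq_scal_r _ (Rgam (3 / 2)) (2 - euler_gamma - 2 * ln 2)), L.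
  - refine (is_lim_seq_le _ (fun _ => G') (Finite _) (Finite G') (fun n => proj1 (B n)) _ (is_lim_seq_const _)).
    apply (is_lim_seq_scal_r _ (Rgam (3 / 2)) (2 - euler_gamma - 2 * ln 2)).
    replace (2 - euler_gamma - 2 * ln 2) with (2 - euler_gamma - 2 * ln 2 - 0) by ring.
    eapply is_lim_seq_ext; [|apply (is_lim_seq_minus' _ _ _ _ L I)]; intros n; cbv beta; ring.
Qed.

Lemma LA_ex_derive (f : R -> C) (t : R) : LA f t -> ex_derive (fun t => fst (f t)) t.
Proof.
  intros [(a & r & Hr & H) _].
  exists (PSeries (PS_derive a) 0).
  apply (is_derive_ext_loc (fun s => PSeries a (s - t))).
  - exists (mkposreal _ Hr); intros s Hs; apply is_pseries_unique, H, Hs.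
  - replace (PSeries (PS_derive a) 0) with (1 * PSeries (PS_derive a) (t - t)) by (rewrite Rminus_diag_eq by reflexivity; ring).
    apply (is_derive_comp (PSeries a) (fun s => s - t)); [|auto_derive; [exact I|ring]].
    apply is_derive_PSeries; rewrite Rminus_diag_eq by reflexivity.
    apply (pseries_radius a r); [|rewrite Rabs_R0; exact Hr].
    intros y Hy; exists (fst (f (t + y))).
    pose proof (H (t + y)) as Q; replace (t + y - t) with y in Q by ring; exact (Q Hy).
Qed.

(** The factor w (w - 1) hides the transforms at w = 0: the Mellin identity there only says that c
    times the gamma value at 3/2 is 2/3. Differentiating both sides at 0 brings out - L 0 + 4/3 on
    the left. On the right appear the logarithmic derivative of gamma at 3/2 and the values of
    [zeta_reg] at - 1 and 1. *)
Lemma lap_mean : fst (lap psi 0 + lap kopp 0)%C = 14 / 9 + euler_gamma / 3 - 2 / 3 * ln 2.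
Proof.
  set (L := fun w : R => fst (lap psi (RtoC w) + lap kopp (- RtoC w))%C).
  set (A := fun w : R => fst (zeta_reg (RtoC (2 * w - 1)))).
  set (B := fun w : R => fst (zeta_reg (RtoC (2 * w + 1)))).
  set (c := 4 / (3 * sqrt PI)).
  assert (M : forall w, - / 2 < w < 4 -> w * (w - 1) * L w + w + (w - 1) / 3 =
    c * (Rgam (w + 3 / 2) * (2 * w * (w - 1) * A w + w + w * (w - 1) * B w + (w - 1) / 2))).
  { intros w Hw; pose proof (mellin (RtoC w) Hw) as E; unfold mel_left, mel_right in E; fold c in E.
    replace (RtoC w + 3 / 2)%C with (RtoC (w + 3 / 2)) in E by (apply C_eq; simpl; field).
    replace (2 * RtoC w - 1)%C with (RtoC (2 * w - 1)) in E by (apply C_eq; simpl; ring).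
    replace (2 * RtoC w + 1)%C with (RtoC (2 * w + 1)) in E by (apply C_eq; simpl; ring).
    rewrite gamL_real, (zeta_reg_real (2 * w - 1)), (zeta_reg_real (2 * w + 1)) in E; fold (A w) (B w) in E.
    rewrite <- RtoC_opp, (lap_real psi), (lap_real kopp), <- RtoC_plus in E.
    assert (EL : L w = fst (lap psi (RtoC w)) + fst (lap kopp (RtoC (- w)))) by (unfold L; rewrite <- RtoC_opp; reflexivity).
    rewrite <- EL in E; apply (f_equal fst) in E.
    revert E; generalize (L w) (A w) (B w) (Rgam (w + 3 / 2)); intros l a b g E; simpl in E.
    match type of E with ?x = _ => transitivity x; [field|rewrite E; field] end. }
  assert (Dz : forall d, -1 <= d -> ex_derive (fun w : R => fst (zeta_reg (RtoC (2 * w + d)))) 0).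
  { intros d Hd; apply (ex_derive_ext (fun w => fst (zeta_reg (RtoC 2 * RtoC w + RtoC d)))).
    - intros t; do 2 f_equal; apply C_eq; simpl; ring.
    - apply LA_ex_derive, LA_comp; [lra|]; apply zeta_reg_analytic; simpl; lra. }
  assert (DL : ex_derive L 0).
  { destruct psi_ebound as [C1 H1], kopp_bound as [C2 H2].
    apply LA_ex_derive, LA_plus.
    - pose proof (LA_comp (lap psi) 1 0 0 R1_neq_R0) as Q.
      replace (fun t => lap psi (1 * RtoC t + 0)) with (fun t => lap psi (RtoC t)) in Q
        by (apply functional_extensionality; intros t; f_equal; ring).
      apply Q, (lap_analytic psi C1 1); [apply psi_cont|exact H1|simpl; lra].
    - pose proof (LA_comp (lap kopp) (-1) 0 0 ltac:(lra)) as Q.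
      replace (fun t => lap kopp (RtoC (-1) * RtoC t + 0)) with (fun t => lap kopp (- RtoC t)) in Q
        by (apply functional_extensionality; intros t; f_equal; apply C_eq; simpl; ring).
      apply Q, (lap_analytic kopp C2 (11 / 2)); [apply kopp_cont|exact H2|simpl; lra]. }
  assert (DA : ex_derive A 0) by (exact (Dz (-1) ltac:(lra))).
  assert (DB : ex_derive B 0) by (exact (Dz 1 ltac:(lra))).
  assert (DG : ex_derive (fun w => Rgam (w + 3 / 2)) 0).
  { apply (ex_derive_ext (fun w => fst (gamL (RtoC w + 3 / 2)))).
    - intros t; rewrite <- Rgam_gamL; do 2 f_equal; apply C_eq; simpl; field.
    - apply LA_ex_derive; unfold gamL; apply LA_plus.
      + pose proof (LA_comp (lap gam1) 1 (3 / 2) 0 R1_neq_R0) as Q.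
        replace (fun t => lap gam1 (1 * RtoC t + 3 / 2)) with (fun t => lap gam1 (RtoC t + 3 / 2)) in Q
          by (apply functional_extensionality; intros t; f_equal; ring).
        apply Q; apply gamL_analytic; simpl; lra.
      + pose proof (LA_comp (lap gam2) (-1) (- (3 / 2)) 0 ltac:(lra)) as Q.
        replace (fun t => lap gam2 (RtoC (-1) * RtoC t + - (3 / 2))) with (fun t => lap gam2 (- (RtoC t + 3 / 2))) in Q
          by (apply functional_extensionality; intros t; f_equal; apply C_eq; simpl; field).
        apply Q; replace (RtoC (-1) * RtoC 0 + - (3 / 2))%C with (- (3 / 2))%C by (apply C_eq; simpl; ring).
        apply gamL_analytic; simpl; lra. }
  pose proof (M 0 ltac:(lra)) as M0.
  assert (Hc : 0 < c) by (apply Rdiv_lt_0_compat; [lra|]; apply Rmult_lt_0_compat; [lra|apply sqrt_lt_R0, PI_RGT_0]).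
  rewrite Rplus_0_l in M0.
  assert (Hg : c * Rgam (3 / 2) = 2 / 3) by lra.
  assert (Pg : 0 < Rgam (3 / 2)) by (apply (Rmult_lt_reg_l c); lra).
  set (g' := Derive (fun w => Rgam (w + 3 / 2)) 0).
  assert (Dg : is_derive Rgam (3 / 2) g').
  { apply (is_derive_ext (fun s => (fun w => Rgam (w + 3 / 2)) (s - 3 / 2))); [intros; f_equal; lra|].
    replace g' with (1 * g') by ring.
    apply (is_derive_comp (fun w => Rgam (w + 3 / 2)) (fun s => s - 3 / 2)); [|auto_derive; [exact I|ring]].
    replace (3 / 2 - 3 / 2) with 0 by ring; apply Derive_correct, DG. }
  apply Rgam_derive_3_2 in Dg; [|exact Pg].
  assert (EL : Derive (fun w => w * (w - 1) * L w + w + (w - 1) / 3) 0 = - L 0 + 4 / 3).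
  { apply is_derive_unique; auto_derive; [exact DL|]; field. }
  set (g := fun w => Rgam (w + 3 / 2)) in *.
  assert (ER : Derive (fun w => c * (g w * (2 * w * (w - 1) * A w + w + w * (w - 1) * B w + (w - 1) / 2))) 0 =
    c * (- g' / 2 + g 0 * (- 2 * A 0 + 3 / 2 - B 0))).
  { apply is_derive_unique; auto_derive; [repeat split; assumption|]; change g' with (Derive (fun w => g w) 0).
    generalize (Derive (fun w => g w) 0) (Derive (fun w => A w) 0) (Derive (fun w => B w) 0) (g 0) (A 0) (B 0).
    intros; field. }
  assert (E : Derive (fun w => w * (w - 1) * L w + w + (w - 1) / 3) 0 =
    Derive (fun w => c * (g w * (2 * w * (w - 1) * A w + w + w * (w - 1) * B w + (w - 1) / 2))) 0).
  { apply Derive_ext_loc; exists (mkposreal (/ 2) ltac:(lra)); intros w Hw; apply M.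
    unfold ball in Hw; simpl in Hw; unfold AbsRing_ball, abs, minus, plus, opp in Hw; simpl in Hw.
    apply Rabs_def2 in Hw; lra. }
  (* [em_coeff] vanishes at - 1, so the Laplace integral drops out and 1/2 - 1/12 remains. *)
  assert (EA : A 0 = 5 / 12).
  { unfold A; replace (2 * 0 - 1) with (-1) by ring; unfold zeta_reg, em_coeff.
    generalize (lap bernoulli (RtoC (-1) + 2)); intros v; simpl; field. }
  assert (EB : B 0 = euler_gamma) by (rewrite <- zeta_reg_1; unfold B; replace (2 * 0 + 1) with 1 by ring; reflexivity).
  assert (Eg : g 0 = Rgam (3 / 2)) by (unfold g; f_equal; ring).
  assert (E0 : L 0 = fst (lap psi 0 + lap kopp 0)%C) by (unfold L; do 3 f_equal; apply C_eq; simpl; ring).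
  rewrite EL, ER, EA, EB, Eg, Dg in E; rewrite <- E0.
  replace (c * (- ((2 - euler_gamma - 2 * ln 2) * Rgam (3 / 2)) / 2 + Rgam (3 / 2) * (-2 * (5 / 12) + 3 / 2 - euler_gamma)))
    with (c * Rgam (3 / 2) * (- (2 - euler_gamma - 2 * ln 2) / 2 + (-2 * (5 / 12) + 3 / 2 - euler_gamma))) in E by field.
  rewrite Hg in E; lra.
Qed.

(** * The periodic fluctuation *)

Lemma ln4_pos : 0 < ln 4.
Proof. rewrite <- ln_1; apply ln_increasing; lra. Qed.

Lemma ln4_ln2 : ln 4 = 2 * ln 2.
Proof. replace 4 with (2 * 2) by ring; rewrite ln_mult by lra; ring. Qed.

Lemma exp_ln4 (r : nat) : exp (INR r * ln 4) = 4 ^ r.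
Proof. rewrite exp_INR, exp_ln by lra; reflexivity. Qed.

Lemma exp_mln4 (r : nat) : exp (- (INR r * ln 4)) = / 4 ^ r.
Proof. rewrite exp_Ropp, exp_ln4; reflexivity. Qed.

Lemma ex_series_scal_geom4 (c : R) : ex_series (fun r => c * / 4 ^ r).
Proof. eexists; apply series_scal, ex_series_geom4. Qed.

Definition psi_sum (t : R) : R := Series (fun r => psi (t + INR r * ln 4)).
Definition kern_sum (t : R) : R := Series (fun r => kern (t - INR (S r) * ln 4)).
(** - 1/9 is 1/3 - 4/9: the constant in the expansion of [kern] at r = 0, and the sum of the
    corrections - 1 / (3 * 4^r). The rest is the constant of the theorem with opposite sign. *)
Definition fluct_const : R := - (1 / 9) - (5 + 3 * euler_gamma - 11 * ln 2) / (18 * ln 2).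
(** Solves elem (t + ln 4) - elem t = - exp t - 1/3. A shift by ln 4 moves one term from [psi_sum]
    to [kern_sum], and this compensates the difference of [kern] and [psi]. *)
Definition elem (t : R) : R := - (exp t / 3) - t / (3 * ln 4) + fluct_const.
(* [fluct t] is the sum of [kern - exp - 1/3] over the shifts by nonnegative multiples of
   [ln 4] and of [kern] over those by negative ones, with the secular part removed. *)
Definition fluct (t : R) : R := psi_sum t + kern_sum t + elem t.

Lemma psi_shift_bound : exists C, 0 < C /\ forall t r,
  Rabs (psi (t + INR r * ln 4)) <= C * exp (- t) * / 4 ^ r /\ Rabs (dpsi (t + INR r * ln 4)) <= C * exp (- t) * / 4 ^ r.
Proof.
  destruct psi_bound as (C & HC & H); exists C; split; [exact HC|]; intros t r.
  specialize (H (t + INR r * ln 4)).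
  replace (- (t + INR r * ln 4)) with (- t + - (INR r * ln 4)) in H by ring.
  rewrite exp_plus, exp_mln4, <- Rmult_assoc in H; exact H.
Qed.

Lemma kern_shift_bound : exists C, 0 < C /\ forall t r,
  Rabs (kern (t - INR r * ln 4)) <= C * exp (3 / 2 * t) * / 4 ^ r /\
  Rabs (dkern (t - INR r * ln 4)) <= C * exp (3 / 2 * t) * / 4 ^ r.
Proof.
  destruct (kern_bound 2 (le_n 2)) as (C & HC & H); exists C; split; [exact HC|]; intros t r.
  specialize (H (t - INR r * ln 4)).
  assert (E : exp ((INR 2 - / 2) * (t - INR r * ln 4)) <= exp (3 / 2 * t) * / 4 ^ r).
  { rewrite <- exp_mln4, <- exp_plus; apply exp_le; simpl.
    pose proof (Rmult_le_pos _ _ (pos_INR r) (Rlt_le _ _ ln4_pos)); lra. }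
  assert (E1 : exp (- (exp (- (t - INR r * ln 4)) / 2)) <= 1).
  { rewrite <- exp_0; apply exp_le; pose proof (exp_pos (- (t - INR r * ln 4))); lra. }
  pose proof (exp_pos ((INR 2 - / 2) * (t - INR r * ln 4))) as P.
  destruct H as [[H0 H1] H2]; rewrite Rabs_pos_eq by exact H0; split.
  - eapply Rle_trans; [exact H1|].
    rewrite (Rmult_assoc C), (Rmult_assoc C); apply Rmult_le_compat_l; [lra|].
    pose proof (exp_pos (- (exp (- (t - INR r * ln 4)) / 2))); nra.
  - eapply Rle_trans; [exact H2|]; rewrite (Rmult_assoc C); apply Rmult_le_compat_l; lra.
Qed.

Lemma psi_sum_correct (t : R) : is_series (fun r => psi (t + INR r * ln 4)) (psi_sum t).
Proof.
  destruct psi_shift_bound as (C & HC & H); apply Series_correct.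
  apply (ex_series_le (K := R_AbsRing) (V := R_CompleteNormedModule) _ (fun r => C * exp (- t) * / 4 ^ r));
    [intros r; apply H|apply ex_series_scal_geom4].
Qed.

Lemma kern_sum_correct (t : R) : is_series (fun r => kern (t - INR (S r) * ln 4)) (kern_sum t).
Proof.
  destruct kern_shift_bound as (C & HC & H); apply Series_correct.
  apply (ex_series_le (K := R_AbsRing) (V := R_CompleteNormedModule) _ (fun r => C * exp (3 / 2 * t) * / 4 ^ S r));
    [intros r; apply (H t (S r))|].
  apply ex_series_incr_1 with (a := fun r => C * exp (3 / 2 * t) * / 4 ^ r), ex_series_scal_geom4.
Qed.

Lemma psi_sum_derive (t : R) : ex_derive psi_sum t.
Proof.
  destruct psi_shift_bound as (C & HC & H).
  eexists; apply (is_derive_Series (fun r t => psi (t + INR r * ln 4)) (fun r t => dpsi (t + INR r * ln 4))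
    (fun r => C * exp (- t + 1) * / 4 ^ r)).
  - intros r y Hy; split.
    + replace (dpsi (y + INR r * ln 4)) with (1 * dpsi (y + INR r * ln 4)) by ring.
      apply (is_derive_comp psi (fun t => t + INR r * ln 4)); [apply psi_derive|].
      generalize (INR r * ln 4); intros c; auto_derive; [exact I|ring].
    + eapply Rle_trans; [apply H|]; apply Rmult_le_compat_r.
      * left; apply Rinv_0_lt_compat, pow_lt; lra.
      * apply Rmult_le_compat_l; [lra|]; apply exp_le; apply Rabs_def2 in Hy; lra.
  - apply ex_series_scal_geom4.
  - intros y _; eexists; apply psi_sum_correct.
Qed.

Lemma kern_sum_derive (t : R) : ex_derive kern_sum t.
Proof.
  destruct kern_shift_bound as (C & HC & H).
  eexists; apply (is_derive_Series (fun r t => kern (t - INR (S r) * ln 4)) (fun r t => dkern (t - INR (S r) * ln 4))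
    (fun r => C * exp (3 / 2 * (t + 1)) * / 4 ^ S r)).
  - intros r y Hy; split.
    + replace (dkern (y - INR (S r) * ln 4)) with (1 * dkern (y - INR (S r) * ln 4)) by ring.
      apply (is_derive_comp kern (fun t => t - INR (S r) * ln 4)); [apply kern_derive|].
      generalize (INR (S r) * ln 4); intros c; auto_derive; [exact I|ring].
    + eapply Rle_trans; [apply H|]; apply Rmult_le_compat_r.
      * left; apply Rinv_0_lt_compat, pow_lt; lra.
      * apply Rmult_le_compat_l; [lra|]; apply exp_le; apply Rabs_def2 in Hy; lra.
  - apply ex_series_incr_1 with (a := fun r => C * exp (3 / 2 * (t + 1)) * / 4 ^ r), ex_series_scal_geom4.
  - intros y _; eexists; apply kern_sum_correct.
Qed.

Lemma elem_derive (t : R) : ex_derive elem t.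
Proof. unfold elem; pose proof ln4_pos; auto_derive; exact I. Qed.

Lemma fluct_derive (t : R) : ex_derive fluct t.
Proof.
  unfold fluct; apply (ex_derive_plus (fun t => psi_sum t + kern_sum t) elem); [|apply elem_derive].
  apply (ex_derive_plus psi_sum kern_sum); [apply psi_sum_derive|apply kern_sum_derive].
Qed.

Lemma ex_derive_cont (f : R -> R) : (forall t, ex_derive f t) -> cont f.
Proof. intros H t; apply @ex_derive_continuous, H. Qed.

Lemma fluct_period (t : R) : fluct (t + ln 4) = fluct t.
Proof.
  pose proof ln4_pos as L.
  assert (A : psi_sum t = psi t + psi_sum (t + ln 4)).
  { unfold psi_sum at 1; rewrite Series_incr_1 by (eexists; apply psi_sum_correct).
    rewrite Rmult_0_l, Rplus_0_r; f_equal.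
    apply Series_ext; intros r; f_equal; rewrite S_INR; ring. }
  assert (B : kern_sum (t + ln 4) = kern t + kern_sum t).
  { unfold kern_sum at 1; rewrite Series_incr_1 by (eexists; apply kern_sum_correct).
    f_equal; [f_equal; simpl; ring|].
    apply Series_ext; intros r; f_equal; rewrite !S_INR; ring. }
  unfold fluct, elem; rewrite A, B, kern_psi, exp_plus, exp_ln by lra; field; lra.
Qed.

(** The half-line is cut into periods, whose integrals are summed under the integral sign. In this
    way Fourier coefficients of a sum over shifts become Laplace transforms. *)
Lemma periodize_R (f F : R -> R) (M c l : R) : 0 < l -> cont f -> dom M c f -> cont F ->
  (forall t, 0 <= t <= l -> is_series (fun r => f (t + INR r * l)) (F t)) ->
  J f = RInt F 0 l.
Proof.
  intros Hl Cf Df CF HF.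
  assert (S1 : is_series (fun r => RInt (fun t => f (t + INR r * l)) 0 l) (RInt F 0 l)).
  { assert (H1 : 0 < exp (- (c * l)) < 1).
    { split; [apply exp_pos|]; rewrite <- exp_0; apply exp_increasing; destruct Df; nra. }
    apply (RInt_series (fun r t => f (t + INR r * l)) F (fun r => Rabs M * exp (- (c * l)) ^ r)); try assumption; [lra| | |].
    - intros n; apply cont_shift, Cf.
    - intros n t Ht; destruct Df as [Hc Df].
      pose proof (Rmult_le_pos _ _ (pos_INR n) (Rlt_le _ _ Hl)) as P.
      eapply Rle_trans; [apply Df; lra|].
      rewrite <- exp_INR.
      apply Rle_trans with (Rabs M * exp (- (c * (t + INR n * l)))).
      + apply Rmult_le_compat_r; [left; apply exp_pos|apply Rle_abs].
      + apply Rmult_le_compat_l; [apply Rabs_pos|]; apply exp_le; nra.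
    - eexists; apply series_scal, is_series_geom; rewrite Rabs_pos_eq; lra. }
  apply is_series_rsum in S1.
  pose proof (J_correct _ _ _ Cf Df) as L.
  assert (L2 : is_lim_seq (fun n => RInt f 0 (INR n * l)) (J f)).
  { apply (is_lim_comp_seq (fun b => RInt f 0 b) (fun n => INR n * l) p_infty); [exact L|exists 0%nat; intros; discriminate|].
    replace p_infty with (Rbar_mult p_infty l); [apply is_lim_seq_scal_r, is_lim_seq_INR|].
    apply is_Rbar_mult_unique, is_Rbar_mult_p_infty_pos, Hl. }
  assert (E : forall n, rsum n (fun r => RInt (fun t => f (t + INR r * l)) 0 l) = RInt f 0 (INR n * l)).
  { induction n; cbn [rsum].
    - simpl; rewrite Rmult_0_l, RInt_point; reflexivity.
    - rewrite IHn, RInt_shift by exact Cf.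
      replace (0 + INR n * l) with (INR n * l) by ring.
      replace (l + INR n * l) with (INR (S n) * l) by (rewrite S_INR; ring).
      apply RInt_Chasles_cont, Cf. }
  apply (is_lim_seq_ext _ _ _ E) in S1.
  apply is_lim_seq_unique in S1; apply is_lim_seq_unique in L2.
  rewrite S1 in L2; injection L2; auto.
Qed.

Lemma periodize (f F : R -> C) (M c l : R) : 0 < l -> contC f -> domC M c f -> contC F ->
  (forall t, 0 <= t <= l -> is_Cseries (fun r => f (t + INR r * l)%R) (F t)) ->
  JC f = RIntC F 0 l.
Proof.
  intros Hl [C1 C2] D [C3 C4] HF; destruct (domC_parts _ _ _ D) as [D1 D2].
  apply C_eq; simpl.
  - apply (periodize_R (fun t => fst (f t)) (fun t => fst (F t)) M c); auto.
    intros t Ht; apply (is_Cseries_parts _ _), HF, Ht.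
  - apply (periodize_R (fun t => snd (f t)) (fun t => snd (F t)) M c); auto.
    intros t Ht; apply (is_Cseries_parts _ _), HF, Ht.
Qed.

(** Half of [chi k]: in the variable t = log n the fluctuation has period ln 4 = 2 ln 2. *)
Definition freq (k : Z) : C := (RtoC (2 * PI * IZR k / ln 4) * Ci)%C.

Lemma trig_2PI_Z (k : Z) : cos (2 * PI * IZR k) = 1 /\ sin (2 * PI * IZR k) = 0.
Proof.
  assert (S0 : sin (IZR k * PI) = 0) by (apply sin_eq_0_1; exists k; reflexivity).
  replace (2 * PI * IZR k) with (2 * (IZR k * PI)) by ring; split.
  - rewrite cos_2a_sin, S0; ring.
  - rewrite sin_2a, S0; ring.
Qed.

Lemma freq_mode (k : Z) (t : R) :
  Cexp (freq k * RtoC t) = (cos (2 * PI * IZR k / ln 4 * t), sin (2 * PI * IZR k / ln 4 * t)).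
Proof.
  rewrite Cexp_eq; apply C_eq; simpl.
  - replace ((_ - _) * t - _) with 0 by ring; rewrite exp_0, Rmult_1_l; f_equal; ring.
  - replace ((_ - _) * t - _) with 0 by ring; rewrite exp_0, Rmult_1_l; f_equal; ring.
Qed.

Lemma freq_opp (k : Z) : (- freq k)%C = freq (- k).
Proof. unfold freq; rewrite opp_IZR; pose proof ln4_pos; apply C_eq; simpl; field; lra. Qed.

Lemma freq_period (k : Z) (r : nat) (t : R) : Cexp (freq k * RtoC (t + INR r * ln 4)) = Cexp (freq k * RtoC t).
Proof.
  replace (freq k * RtoC (t + INR r * ln 4))%C with (freq k * RtoC t + freq k * RtoC (INR r * ln 4))%C
    by (rewrite RtoC_plus; ring).
  rewrite Cexp_plus, (freq_mode k (INR r * ln 4)).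
  pose proof ln4_pos.
  replace (2 * PI * IZR k / ln 4 * (INR r * ln 4)) with (2 * PI * IZR (k * Z.of_nat r))
    by (rewrite mult_IZR, <- INR_IZR_INZ; field; lra).
  destruct (trig_2PI_Z (k * Z.of_nat r)) as [-> ->]; apply C_eq; simpl; ring.
Qed.

Lemma freq_re (k : Z) : fst (freq k) = 0.
Proof. simpl; ring. Qed.

Lemma RIntC_reflect (f : R -> C) (l : R) : contC f -> RIntC (fun t => f (l - t)%R) 0 l = RIntC f 0 l.
Proof.
  assert (Q : forall g : R -> R, cont g -> RInt (fun t => g (l - t)) 0 l = RInt g 0 l).
  { intros g Cg; pose proof (RInt_comp_affine g (-1) l 0 l Cg) as E.
    replace (-1 * 0 + l) with l in E by ring; replace (-1 * l + l) with 0 in E by ring.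
    rewrite <- (opp_RInt_swap g 0 l) in E by apply cont_ex_RInt, Cg.
    rewrite (RInt_ext (fun t => g (-1 * t + l)) (fun t => g (l - t))) in E by (intros; f_equal; ring).
    revert E; generalize (RInt (fun t => g (l - t)) 0 l : R) (RInt g 0 l : R); intros i j E.
    change (-1 * i = - j) in E; lra. }
  intros [C1 C2]; apply C_eq; simpl; [apply (Q (fun t => fst (f t)) C1)|apply (Q (fun t => snd (f t)) C2)].
Qed.

Lemma psi_sum_fourier (k : Z) :
  RIntC (fun t => RtoC (psi_sum t) * Cexp (- freq k * RtoC t))%C 0 (ln 4) = lap psi (freq k).
Proof.
  destruct psi_ebound as [C HC]; symmetry; unfold lap.
  apply (periodize _ _ C (1 + fst (freq k))).
  - apply ln4_pos.
  - apply lap_cont, psi_cont.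
  - apply lap_dom; [exact HC|rewrite freq_re; lra].
  - apply lap_cont, ex_derive_cont, psi_sum_derive.
  - intros t _; rewrite freq_opp.
    apply (is_series_ext (fun r => RtoC (psi (t + INR r * ln 4)) * Cexp (freq (- k) * RtoC t))%C).
    + intros r; rewrite freq_period; reflexivity.
    + apply Cseries_mulR, psi_sum_correct.
Qed.

(** Over one period the shifts in [kern_sum] cover the negative half-line; the reflection t -> ln 4
    - t brings them into the form that [periodize] expects. *)
Lemma kern_sum_fourier (k : Z) :
  RIntC (fun t => RtoC (kern_sum t) * Cexp (- freq k * RtoC t))%C 0 (ln 4) = lap kopp (- freq k).
Proof.
  destruct kopp_bound as [C HC]; symmetry.
  rewrite <- RIntC_reflect by (apply lap_cont, ex_derive_cont, kern_sum_derive).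
  unfold lap; apply (periodize _ _ C (11 / 2 + fst (- freq k)%C)).
  - apply ln4_pos.
  - apply lap_cont, kopp_cont.
  - apply lap_dom; [exact HC|rewrite freq_opp, freq_re; lra].
  - apply (contC_mult (fun t => RtoC (kern_sum (ln 4 - t))) (fun t => Cexp (- freq k * RtoC (ln 4 - t)))).
    + apply contC_R; intros t; apply (continuous_comp (fun t => ln 4 - t) kern_sum).
      * apply @ex_derive_continuous; auto_derive; exact I.
      * apply ex_derive_cont, kern_sum_derive.
    + replace (fun t => Cexp (- freq k * RtoC (ln 4 - t))) with (fun t => Cexp (freq k * RtoC t)); [apply contC_Cexp|].
      apply functional_extensionality; intros t.
      rewrite freq_opp; replace (ln 4 - t) with (- t + INR 1 * ln 4) by (simpl; ring).
      rewrite freq_period; f_equal; rewrite <- freq_opp, RtoC_opp; ring.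
  - intros t _.
    apply (is_series_ext (fun r => RtoC (kern (ln 4 - t - INR (S r) * ln 4)) * Cexp (- freq k * RtoC (ln 4 - t)))%C).
    + intros r; f_equal.
      * unfold kopp; do 2 f_equal; rewrite S_INR; ring.
      * replace (- - freq k)%C with (freq k) by ring; rewrite freq_period.
        rewrite freq_opp; replace (ln 4 - t) with (- t + INR 1 * ln 4) by (simpl; ring).
        rewrite freq_period; f_equal; rewrite <- freq_opp, RtoC_opp; ring.
    + apply Cseries_mulR, kern_sum_correct.
Qed.

Lemma RIntC_plus (f g : R -> C) (a b : R) : contC f -> contC g ->
  RIntC (fun t => f t + g t)%C a b = (RIntC f a b + RIntC g a b)%C.
Proof. intros [C1 C2] [C3 C4]; apply C_eq; simpl; apply RInt_plus_cont; assumption. Qed.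

Lemma freq_neq_0 (k : Z) : k <> 0%Z -> freq k <> 0%C.
Proof.
  intros Hk H; apply (f_equal snd) in H; revert H; unfold freq; simpl.
  pose proof PI_RGT_0; pose proof ln4_pos; apply not_0_IZR in Hk.
  replace (2 * PI * IZR k / ln 4 * 1 + 0 * 0) with (2 * PI / ln 4 * IZR k) by (field; lra).
  intros E; apply Rmult_integral in E; destruct E as [E|E]; [|contradiction].
  assert (0 < 2 * PI / ln 4) by (apply Rdiv_lt_0_compat; lra); lra.
Qed.

Lemma freq_neq_1 (k : Z) : (freq k - 1)%C <> 0%C.
Proof. intros H; apply (f_equal fst) in H; simpl in H; lra. Qed.

(** The secular part contributes exactly the two polar terms of [mellin_far], so that the
    coefficients of [fluct] are the full left-hand side of the Mellin identity. *)
Lemma elem_fourier (k : Z) : k <> 0%Z ->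
  RIntC (fun t => RtoC (elem t) * Cexp (- freq k * RtoC t))%C 0 (ln 4) = (/ (freq k - 1) + / (3 * freq k))%C.
Proof.
  intros Hk; pose proof ln4_pos as L; pose proof (freq_neq_0 k Hk) as W0; pose proof (freq_neq_1 k) as W1.
  set (w := freq k) in *; set (l := ln 4) in *.
  assert (L0 : RtoC l <> 0%C) by (intros H; apply RtoC_inj in H; lra).
  assert (W2 : (1 - w)%C <> 0%C).
  { intros H; apply W1; replace (w - 1)%C with (- (1 - w))%C by ring; rewrite H; ring. }
  assert (N3 : RtoC 3 <> 0%C) by (intros H; apply RtoC_inj in H; lra).
  set (E := fun t : R => Cexp (- w * RtoC t)).
  rewrite (RIntC_derive (fun t => (- / (3 * (1 - w)) * Cexp ((1 - w) * RtoC t)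
    + (/ (3 * RtoC l * w) * (E t * RtoC t) + (/ (3 * RtoC l * w * w) - RtoC fluct_const / w) * E t)))%C).
  - assert (E1 : E l = 1%C).
    { unfold E, w; rewrite freq_opp; replace l with (0 + INR 1 * ln 4) by (unfold l; simpl; ring).
      rewrite freq_period, Cmult_0_r, Cexp_R, exp_0; reflexivity. }
    assert (E0 : E 0 = 1%C) by (unfold E; rewrite Cmult_0_r, Cexp_R, exp_0; reflexivity).
    assert (E4 : Cexp ((1 - w) * RtoC l) = 4%C).
    { replace ((1 - w) * RtoC l)%C with (RtoC l + - w * RtoC l)%C by ring.
      rewrite Cexp_plus; fold (E l); rewrite E1, Cexp_R; unfold l; rewrite exp_ln by lra; ring. }
    rewrite E1, E0, E4, Cmult_0_r, Cexp_R, exp_0; field; repeat split; assumption.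
  - intros t.
    replace (RtoC (elem t) * Cexp (- w * RtoC t))%C with
      (- / (3 * (1 - w)) * ((1 - w) * Cexp ((1 - w) * RtoC t)) +
        (/ (3 * RtoC l * w) * (- w * E t * RtoC t + E t * 1)
          + (/ (3 * RtoC l * w * w) - RtoC fluct_const / w) * (- w * E t)))%C.
    + apply derivC_plus; [apply derivC_scal, derivC_Cexp|].
      apply derivC_plus; apply derivC_scal; [|apply derivC_Cexp].
      apply derivC_mulR; [apply derivC_Cexp|apply @is_derive_id].
    + replace ((1 - w) * RtoC t)%C with (RtoC t + - w * RtoC t)%C by ring.
      rewrite Cexp_plus, Cexp_R; unfold E, elem; fold l.
      rewrite RtoC_plus, RtoC_minus, RtoC_opp, !RtoC_div, RtoC_mult by lra; field; repeat split; assumption.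
  - apply lap_cont, ex_derive_cont, elem_derive.
Qed.

Lemma fluct_fourier (k : Z) : k <> 0%Z ->
  RIntC (fun t => RtoC (fluct t) * Cexp (- freq k * RtoC t))%C 0 (ln 4) =
  (lap psi (freq k) + lap kopp (- freq k) + / (freq k - 1) + / (3 * freq k))%C.
Proof.
  intros Hk; rewrite <- psi_sum_fourier, <- kern_sum_fourier.
  rewrite <- Cplus_assoc, <- (elem_fourier k Hk).
  rewrite <- !RIntC_plus.
  - apply RIntC_ext; [left; apply ln4_pos|]; intros t _; unfold fluct; rewrite !RtoC_plus; ring.
  - apply contC_plus; apply lap_cont, ex_derive_cont; [apply psi_sum_derive|apply kern_sum_derive].
  - apply lap_cont, ex_derive_cont, elem_derive.
  - apply lap_cont, ex_derive_cont, psi_sum_derive.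
  - apply lap_cont, ex_derive_cont, kern_sum_derive.
Qed.

(** The coefficient of index 0 is [lap_mean] plus an elementary integral; the constant of the
    theorem is the one for which they cancel. *)
Lemma fluct_mean : RInt fluct 0 (ln 4) = 0.
Proof.
  pose proof ln4_pos as L.
  assert (F0 : freq 0 = 0%C) by (unfold freq; apply C_eq; simpl; field; lra).
  pose proof (psi_sum_fourier 0) as A; pose proof (kern_sum_fourier 0) as B; rewrite F0 in A, B.
  replace (- RtoC 0)%C with (RtoC 0) in A, B by ring.
  apply (f_equal fst) in A, B; unfold RIntC in A, B; cbn [fst] in A, B.
  assert (Q : forall f : R -> R, (fun t => fst (RtoC (f t) * Cexp (0 * RtoC t))%C) = f).
  { intros f; apply functional_extensionality; intros t; rewrite Cmult_0_l, Cexp_R, exp_0; simpl; ring. }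
  rewrite Q in A, B.
  pose proof lap_mean as M; change (fst (lap psi 0) + fst (lap kopp 0) = 14 / 9 + euler_gamma / 3 - 2 / 3 * ln 2) in M.
  rewrite <- A, <- B in M.
  assert (E : RInt elem 0 (ln 4) = - 1 - ln 4 / 6 + fluct_const * ln 4).
  { apply is_RInt_unique.
    replace (- 1 - ln 4 / 6 + fluct_const * ln 4) with
      ((- (exp (ln 4) / 3) - ln 4 ^ 2 / (6 * ln 4) + fluct_const * ln 4) - (- (exp 0 / 3) - 0 ^ 2 / (6 * ln 4) + fluct_const * 0))
      by (rewrite exp_ln, exp_0 by lra; field; lra).
    apply (is_RInt_derive (fun t => - (exp t / 3) - t ^ 2 / (6 * ln 4) + fluct_const * t) elem).
    - intros t _; unfold elem; auto_derive; [exact I|field; lra].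
    - intros t _; apply ex_derive_cont, elem_derive. }
  unfold fluct.
  rewrite (RInt_plus_cont (fun t => psi_sum t + kern_sum t) elem), (RInt_plus_cont psi_sum kern_sum), M, E.
  - unfold fluct_const; rewrite ln4_ln2; pose proof (ln_lt_2); as_R; field; lra.
  - apply ex_derive_cont, psi_sum_derive.
  - apply ex_derive_cont, kern_sum_derive.
  - apply cont_plus; apply ex_derive_cont; [apply psi_sum_derive|apply kern_sum_derive].
  - apply ex_derive_cont, elem_derive.
Qed.

(** On the imaginary axis away from 0 the factor w (w - 1) can be divided out, and both zeta
    arguments have nonzero imaginary part, as [CZeta_em] requires. *)
Lemma delta_coeff_mellin (k : Z) : k <> 0%Z ->
  (RtoC (/ ln 4) * (lap psi (freq k) + lap kopp (- freq k) + / (freq k - 1) + / (3 * freq k)))%C = delta_coeff k.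
Proof.
  intros Hk; pose proof ln4_pos as L; pose proof (freq_neq_0 k Hk) as W0; pose proof (freq_neq_1 k) as W1.
  assert (Im : snd (freq k) <> 0) by (intros H; apply W0, C_eq; [apply freq_re|exact H]).
  assert (Echi : chi k = (2 * freq k)%C).
  { unfold chi, freq; rewrite ln4_ln2 in *; apply C_eq; simpl; field; lra. }
  unfold delta_coeff; rewrite Echi.
  pose proof (freq_re k) as Re.
  set (w := freq k) in *; clearbody w.
  replace ((RtoC 3 + 2 * w) / RtoC 2)%C with (w + 3 / 2)%C by (field; intros H; apply RtoC_inj in H; lra).
  rewrite CGamma_gamL by (simpl; rewrite Re; lra).
  rewrite (CZeta_em (2 * w - 1)) by (simpl; rewrite ?Re; lra).
  rewrite (CZeta_em (2 * w + 1)) by (simpl; rewrite ?Re; lra).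
  pose proof (mellin w ltac:(rewrite Re; lra)) as M; unfold mel_left, mel_right in M.
  assert (N2 : RtoC 2 <> 0%C) by (intros H; apply RtoC_inj in H; lra).
  assert (N3 : RtoC 3 <> 0%C) by (intros H; apply RtoC_inj in H; lra).
  transitivity (RtoC (/ ln 4) * (/ (w * (w - 1)) * (w * (w - 1) * (lap psi w + lap kopp (- w)) + w + (w - 1) / 3)))%C.
  - generalize (lap psi w) (lap kopp (- w)); intros; field; repeat split; assumption.
  - rewrite M.
    replace (2 / (3 * sqrt PI * ln 2)) with (/ ln 4 * (4 / (3 * sqrt PI))).
    + rewrite RtoC_mult; unfold zeta_em.
      assert (N4 : (2 * w - 1 - 1)%C <> 0%C).
      { intros H; apply W1; replace (w - 1)%C with (/ 2 * (2 * w - 1 - 1))%C by (field; exact N2); rewrite H; ring. }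
      assert (N5 : (2 * w + 1 - 1)%C <> 0%C).
      { intros H; apply W0; replace w with (/ 2 * (2 * w + 1 - 1))%C by (field; exact N2); rewrite H; ring. }
      generalize (gamL (w + 3 / 2)) (zeta_reg (2 * w - 1)) (zeta_reg (2 * w + 1)); intros.
      field; repeat split; assumption.
    + rewrite ln4_ln2 in *; field.
      split; first [lra | apply Rgt_not_eq, sqrt_lt_R0, PI_RGT_0].
Qed.

(** * The Fourier series *)

Definition delta (t : R) : R := fluct (ln 4 * t).

Lemma delta_derive (t : R) : ex_derive delta t.
Proof.
  apply (ex_derive_comp fluct (fun t => ln 4 * t)); [apply fluct_derive|auto_derive; exact I].
Qed.

Lemma delta_cont : cont delta.
Proof. apply ex_derive_cont, delta_derive. Qed.

Lemma delta_period (t : R) : delta (t + 1) = delta t.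
Proof. unfold delta; rewrite Rmult_plus_distr_l, Rmult_1_r; apply fluct_period. Qed.

Lemma RInt_scale_unit (g : R -> R) (l : R) : 0 < l -> cont g ->
  RInt (fun t => g (l * t)) 0 1 = / l * RInt g 0 l.
Proof.
  intros Hl Cg; pose proof (RInt_comp_affine g l 0 0 1 Cg) as E.
  replace (l * 0 + 0) with 0 in E by ring; replace (l * 1 + 0) with l in E by ring.
  rewrite <- E, (RInt_ext (fun t => g (l * t + 0)) (fun t => g (l * t))) by (intros; f_equal; ring).
  generalize (RInt (fun t => g (l * t)) 0 1 : R); intros i; as_R; field; lra.
Qed.

Lemma delta_mean : RInt delta 0 1 = 0.
Proof.
  unfold delta; rewrite RInt_scale_unit, fluct_mean by (apply ln4_pos || apply ex_derive_cont, fluct_derive); as_R; ring.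
Qed.

Lemma fourier_mode_eq (k : Z) (x : R) :
  fourier_mode k x = (cos (2 * PI * IZR k * x), sin (2 * PI * IZR k * x)).
Proof.
  unfold fourier_mode; rewrite Cexp_eq; apply C_eq; simpl.
  - replace (_ * 0 - 0 * 1) with 0 by ring; rewrite exp_0, Rmult_1_l; f_equal; ring.
  - replace (_ * 0 - 0 * 1) with 0 by ring; rewrite exp_0, Rmult_1_l; f_equal; ring.
Qed.

Lemma cont_osc (f : R -> R) (b x : R) : cont f ->
  cont (fun t => f t * cos (b * (t - x))) /\ cont (fun t => f t * sin (b * (t - x))).
Proof.
  intros Cf; split; (apply cont_mult; [exact Cf|]);
    intros t; apply @ex_derive_continuous; auto_derive; exact I.
Qed.

Lemma cont_osc_0 (f : R -> R) (b : R) : cont f ->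
  cont (fun t => f t * cos (b * t)) /\ cont (fun t => f t * sin (b * t)).
Proof.
  intros Cf; split; (apply cont_mult; [exact Cf|]);
    intros t; apply @ex_derive_continuous; auto_derive; exact I.
Qed.

Ltac solve_osc := lazymatch goal with
  | |- cont (fun t => ?f t * cos (?b * (t - ?x))) => apply (proj1 (cont_osc f b x ltac:(assumption)))
  | |- cont (fun t => ?f t * sin (?b * (t - ?x))) => apply (proj2 (cont_osc f b x ltac:(assumption)))
  | |- cont (fun t => ?f t * cos (?b * t)) => apply (proj1 (cont_osc_0 f b ltac:(assumption)))
  | |- cont (fun t => ?f t * sin (?b * t)) => apply (proj2 (cont_osc_0 f b ltac:(assumption)))
  | |- cont (fun t => ?c * @?g t) => apply (cont_mult (fun _ => c) g (cont_const c)); solve_osc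
  end.

Lemma delta_coeff_eq (k : Z) : k <> 0%Z -> delta_coeff k =
  (RInt (fun t => delta t * cos (2 * PI * IZR k * t)) 0 1, - RInt (fun t => delta t * sin (2 * PI * IZR k * t)) 0 1).
Proof.
  intros Hk; pose proof ln4_pos as L.
  rewrite <- delta_coeff_mellin, <- fluct_fourier by exact Hk.
  set (a := 2 * PI * IZR k / ln 4).
  assert (E : forall t, (RtoC (fluct t) * Cexp (- freq k * RtoC t))%C = (fluct t * cos (a * t), - (fluct t * sin (a * t)))).
  { intros t; rewrite freq_opp, freq_mode, opp_IZR.
    replace (2 * PI * - IZR k / ln 4 * t) with (- (a * t)) by (unfold a; field; lra).
    rewrite cos_neg, sin_neg; apply C_eq; simpl; ring. }
  assert (Cf : cont fluct) by (apply ex_derive_cont, fluct_derive).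
  assert (C1 : cont (fun t => fluct t * cos (a * t))) by solve_osc.
  assert (C2 : cont (fun t => fluct t * sin (a * t))) by solve_osc.
  pose proof (RInt_scale_unit _ _ L C1) as I1; pose proof (RInt_scale_unit _ _ L C2) as I2.
  assert (E1 : forall t, a * (ln 4 * t) = 2 * PI * IZR k * t) by (intros; unfold a; field; lra).
  rewrite (functional_extensionality _ _ E).
  apply C_eq; unfold RIntC, delta; cbn [fst snd Cmult RtoC].
  - rewrite (RInt_ext_le (fun t => fluct (ln 4 * t) * cos (2 * PI * IZR k * t)) (fun t => fluct (ln 4 * t) * cos (a * (ln 4 * t))))
      by (lra || intros; rewrite E1; reflexivity).
    rewrite I1, Rmult_0_l, Rminus_0_r; reflexivity.
  - rewrite (RInt_ext_le (fun t => fluct (ln 4 * t) * sin (2 * PI * IZR k * t)) (fun t => fluct (ln 4 * t) * sin (a * (ln 4 * t))))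
      by (lra || intros; rewrite E1; reflexivity).
    rewrite I2, Rmult_0_l, Rplus_0_r, Ropp_mult_distr_r; f_equal.
    rewrite <- (Rmult_1_l (RInt (fun t => fluct t * sin (a * t)) 0 (ln 4))), Ropp_mult_distr_l, <- RInt_scal_cont by exact C2.
    apply RInt_ext_le; [lra|]; intros t _; ring.
Qed.

Lemma delta_fourier (k : Z) : k <> 0%Z ->
  is_RInt (V := C_R_NormedModule) (fun x : R => (RtoC (delta x) * fourier_mode (- k) x)%C) 0 1 (delta_coeff k).
Proof.
  intros Hk; rewrite delta_coeff_eq by exact Hk; pose proof delta_cont.
  assert (E : forall t, (RtoC (delta t) * fourier_mode (- k) t)%C =
    (delta t * cos (2 * PI * IZR k * t), - (1) * (delta t * sin (2 * PI * IZR k * t)))).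
  { intros t; rewrite fourier_mode_eq, opp_IZR.
    replace (2 * PI * - IZR k * t) with (- (2 * PI * IZR k * t)) by ring.
    rewrite cos_neg, sin_neg; apply C_eq; simpl; ring. }
  apply (is_RInt_fct_extend_pair (U := R_NormedModule) (V := R_NormedModule)); cbn [fst snd].
  - apply (is_RInt_ext (fun t => delta t * cos (2 * PI * IZR k * t))); [intros t _; rewrite E; reflexivity|].
    apply (@RInt_correct R_CompleteNormedModule), cont_ex_RInt; solve_osc.
  - apply (is_RInt_ext (fun t => - (1) * (delta t * sin (2 * PI * IZR k * t)))); [intros t _; rewrite E; reflexivity|].
    replace (- RInt (fun t => delta t * sin (2 * PI * IZR k * t)) 0 1)
      with (RInt (fun t => - (1) * (delta t * sin (2 * PI * IZR k * t))) 0 1)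
      by (rewrite RInt_scal_cont by solve_osc; as_R; ring).
    apply (@RInt_correct R_CompleteNormedModule), cont_ex_RInt; solve_osc.
Qed.

Lemma RInt_period (g : R -> R) (a : R) : cont g -> (forall t, g (t + 1) = g t) ->
  RInt g a (a + 1) = RInt g 0 1.
Proof.
  intros Cg P.
  rewrite <- (RInt_Chasles_cont g a 0 (a + 1) Cg), <- (RInt_Chasles_cont g 0 1 (a + 1) Cg).
  replace (RInt g 1 (a + 1)) with (RInt g 0 a).
  - rewrite <- (RInt_Chasles_cont g 0 a 1 Cg), <- (RInt_Chasles_cont g a 0 1 Cg).
    pose proof (RInt_Chasles_cont g a 0 a Cg) as E; rewrite RInt_point in E.
    revert E; generalize (RInt g a 0 : R) (RInt g 0 a : R) (RInt g 0 1 : R); intros x y z E.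
    change (x + y = 0) in E; as_R; lra.
  - replace 1 with (0 + 1) at 1 by ring; rewrite <- (RInt_shift g 1 0 a Cg).
    apply RInt_ext; intros t _; symmetry; apply P.
Qed.

(** [fourier_pointwise] is applied at 0 to the translate of [delta] by x. The cosine parts give half
    of the value to each of the two sums over positive and negative k. The sine series need only
    converge, since their limits are opposite and cancel. *)
Lemma delta_sum (x : R) :
  is_sum_nonzero (fun k : Z => (delta_coeff k * fourier_mode k x)%C) (RtoC (delta x)).
Proof.
  pose proof delta_cont as Cd.
  set (f := fun t => delta (t + x)).
  assert (Cf : cont f) by (apply cont_shift, Cd).
  assert (Df : exists d, is_derive f 0 d).
  { apply (ex_derive_comp delta (fun t => t + x)); [apply delta_derive|auto_derive; exact I]. }
  destruct Df as [d Df].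
  destruct (fourier_pointwise f d Cf Df) as [Sc [ls Ss]].
  set (c := fun j => RInt (fun t => f t * cos (2 * PI * INR (S j) * t)) (- / 2) (/ 2)) in *.
  set (s := fun j => RInt (fun t => f t * sin (2 * PI * INR (S j) * t)) (- / 2) (/ 2)) in *.
  assert (Sh : forall g : R -> R, cont g -> (forall t, g (t + 1) = g t) ->
    RInt (fun t => g (t + x)) (- / 2) (/ 2) = RInt g 0 1).
  { intros g Cg P; rewrite RInt_shift by exact Cg.
    replace (/ 2 + x) with (- / 2 + x + 1) by field; apply RInt_period; assumption. }
  assert (M : RInt f (- / 2) (/ 2) = 0) by (unfold f; rewrite (Sh delta Cd delta_period); apply delta_mean).
  rewrite M, Rminus_0_r in Sc; unfold f in Sc at 1; rewrite Rplus_0_l in Sc.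
  assert (Tr : forall k : Z, k <> 0%Z -> (delta_coeff k * fourier_mode k x)%C =
    (RInt (fun t => f t * cos (2 * PI * IZR k * t)) (- / 2) (/ 2), - RInt (fun t => f t * sin (2 * PI * IZR k * t)) (- / 2) (/ 2))).
  { intros k Hk; rewrite delta_coeff_eq, fourier_mode_eq by exact Hk.
    set (b := 2 * PI * IZR k).
    assert (Pb : forall t, b * (t + 1 - x) = b * (t - x) + 2 * PI * IZR k) by (intros; unfold b; ring).
    destruct (trig_2PI_Z k) as [T1 T2].
    apply C_eq; cbn [fst snd Cmult].
    - transitivity (RInt (fun t => delta t * cos (b * (t - x))) 0 1).
      + rewrite (RInt_ext_le (fun t => delta t * cos (b * (t - x)))
          (fun t => cos (b * x) * (delta t * cos (b * t)) + sin (b * x) * (delta t * sin (b * t)))).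
        * rewrite RInt_plus_cont, !RInt_scal_cont by solve_osc; ring.
        * lra.
        * intros t _; replace (b * (t - x)) with (b * t - b * x) by ring; rewrite cos_minus; ring.
      + rewrite <- (Sh (fun t => delta t * cos (b * (t - x)))).
        * apply RInt_ext_le; [lra|]; intros t _; unfold f; do 2 f_equal; ring.
        * solve_osc.
        * intros t; rewrite delta_period, Pb, cos_plus, T1, T2; ring.
    - transitivity (- RInt (fun t => delta t * sin (b * (t - x))) 0 1).
      + rewrite (RInt_ext_le (fun t => delta t * sin (b * (t - x)))
          (fun t => cos (b * x) * (delta t * sin (b * t)) + - sin (b * x) * (delta t * cos (b * t)))).
        * rewrite RInt_plus_cont, !RInt_scal_cont by solve_osc; ring.
        * lra.
        * intros t _; replace (b * (t - x)) with (b * t - b * x) by ring; rewrite sin_minus; ring.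
      + f_equal; rewrite <- (Sh (fun t => delta t * sin (b * (t - x)))).
        * apply RInt_ext_le; [lra|]; intros t _; unfold f; do 2 f_equal; ring.
        * solve_osc.
        * intros t; rewrite delta_period, Pb, sin_plus, T1, T2; ring. }
  exists (delta x / 2, - (1) * ls), (delta x / 2, ls); repeat split.
  - apply is_Cseries_parts; split.
    + eapply is_series_ext; [|exact Sc]; intros j; rewrite Tr by lia.
      cbn [fst]; unfold c; rewrite INR_IZR_INZ; reflexivity.
    + eapply is_series_ext; [|apply (series_scal (- (1)) _ _ Ss)]; intros j; rewrite Tr by lia.
      cbn [snd]; unfold s; rewrite INR_IZR_INZ; as_R; ring.
  - apply is_Cseries_parts; split.
    + eapply is_series_ext; [|exact Sc]; intros j; rewrite Tr by lia.
      cbn [fst]; unfold c; apply RInt_ext_le; [lra|]; intros t _.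
      rewrite opp_IZR, <- INR_IZR_INZ; f_equal; rewrite <- cos_neg; f_equal; ring.
    + eapply is_series_ext; [|exact Ss]; intros j; rewrite Tr by lia.
      cbn [snd]; unfold s.
      rewrite (RInt_ext_le (fun t => f t * sin (2 * PI * IZR (- Z.of_nat (S j)) * t))
        (fun t => - (1) * (f t * sin (2 * PI * INR (S j) * t)))).
      * rewrite RInt_scal_cont by solve_osc; symmetry; match goal with |- - (- (1) * ?i) = _ => generalize (i : R) end; intros i; change (- (- (1) * i) = i); ring.
      * lra.
      * intros t _; rewrite opp_IZR, <- INR_IZR_INZ.
        replace (2 * PI * - INR (S j) * t) with (- (2 * PI * INR (S j) * t)) by ring; rewrite sin_neg; ring.
  - apply C_eq; simpl; field.
Qed.

(** * The asymptotic expansion *)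

Lemma exp_le_inv (x y : R) : exp x <= exp y -> x <= y.
Proof.
  intros H; destruct (Rle_or_lt x y) as [|H']; [assumption|]; apply exp_increasing in H'; lra.
Qed.

Definition fringe_error (n r : nat) : R := mean_fringe r n - kern (ln (INR n) - INR r * ln 4) + 1 / 3 * / 4 ^ r.

Lemma exp_shift (n r : nat) : (1 <= n)%nat -> exp (ln (INR n) - INR r * ln 4) = INR n / 4 ^ r.
Proof.
  intros Hn; assert (0 < INR n) by (apply lt_0_INR; lia).
  unfold Rminus; rewrite exp_plus, exp_mln4, exp_ln by assumption; reflexivity.
Qed.

Lemma pow4_pos (r : nat) : 0 < 4 ^ r.
Proof. apply pow_lt; lra. Qed.

Lemma fringe_error_head : exists c, 0 < c /\ forall r n, (6 <= n)%nat ->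
  Rabs (fringe_error n r) <= c / INR n * (1 + 4 ^ r / INR n).
Proof.
  destruct mean_fringe_gauss as (c & Hc & H); exists c; split; [exact Hc|]; intros r n Hn.
  destruct (H r n Hn) as [_ B]; eapply Rle_trans; [|exact B]; right; f_equal.
  unfold fringe_error; rewrite kern_psi, psi_gterm, exp_shift by lia.
  pose proof (pow4_pos r); field; lra.
Qed.

(** The threshold makes y = 4^r / (4 n) at least 8 ln n. Half of exp (- y) then beats n^4, and the
    other half is at most 2 / y. For [kern] the doubly exponential factor of [kern_bound] does the
    same. *)
Lemma fringe_error_tail : exists c, 0 < c /\ forall r n, (3 <= n)%nat -> 32 * INR n * ln (INR n) <= 4 ^ r ->
  Rabs (fringe_error n r) <= c * / 4 ^ r.
Proof.
  destruct (kern_bound 2 (le_n 2)) as (C & HC & HK).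
  (* 8 times the constant of [mean_fringe_tail], then the constant for [kern] and the one for the
     correction term. *)
  exists (800000 + C + 1 / 3); split; [lra|]; intros r n Hn Hr.
  assert (N3 : 3 <= INR n) by (replace 3 with (INR 3) by (simpl; ring); apply le_INR, Hn).
  set (L := ln (INR n)) in *.
  assert (EL : exp L = INR n) by (unfold L; apply exp_ln; lra).
  assert (L1 : 1 <= L).
  { apply exp_le_inv; rewrite EL; pose proof exp_le_3; lra. }
  pose proof (pow4_pos r) as P4.
  set (y := 4 ^ r / (4 * INR n)).
  assert (Hy : 8 * L <= y).
  { unfold y; apply (Rmult_le_reg_r (4 * INR n)); [lra|]; field_simplify; lra. }
  assert (E4 : / 4 ^ r = / (4 * INR n) * / y) by (unfold y; field; lra).
  assert (Y0 : 0 < y) by lra.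
  assert (E1 : INR n ^ 3 * exp (- y) <= 8 * / 4 ^ r).
  { replace (- y) with (- (y / 2) + - (y / 2)) by field; rewrite exp_plus.
    assert (A : exp (- (y / 2)) <= / INR n ^ 4).
    { rewrite <- EL, <- exp_INR, <- exp_Ropp; apply exp_le; simpl INR; lra. }
    assert (B : exp (- (y / 2)) <= 2 * / y).
    { rewrite exp_Ropp; replace (2 * / y) with (/ (y / 2)) by (field; lra).
      apply Rinv_le_contravar; [lra|]; pose proof (exp_ge_1p (y / 2)); lra. }
    apply Rle_trans with (INR n ^ 3 * (/ INR n ^ 4 * (2 * / y))).
    - apply Rmult_le_compat_l; [apply pow_le; lra|]; apply Rmult_le_compat; try assumption; left; apply exp_pos.
    - rewrite E4; right; field; lra. }
  assert (E2 : kern (L - INR r * ln 4) <= C * / 4 ^ r).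
  { destruct (HK (L - INR r * ln 4)) as [[_ K] _]; eapply Rle_trans; [exact K|].
    rewrite Rmult_assoc; apply Rmult_le_compat_l; [lra|].
    assert (Ex : exp (L - INR r * ln 4) = INR n / 4 ^ r) by (apply exp_shift; lia).
    assert (En : exp (- (L - INR r * ln 4)) = 4 * y) by (rewrite exp_Ropp, Ex; unfold y; field; lra).
    rewrite En.
    assert (T : L - INR r * ln 4 <= 0).
    { apply exp_le_inv; rewrite exp_0, Ex; apply (Rmult_le_reg_r (4 ^ r)); [exact P4|]; field_simplify; nra. }
    apply Rle_trans with (exp (L - INR r * ln 4) * exp (- L)).
    - apply Rmult_le_compat; try (left; apply exp_pos); apply exp_le; simpl INR; lra.
    - rewrite <- exp_plus; replace (L - INR r * ln 4 + - L) with (- (INR r * ln 4)) by ring.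
      rewrite exp_mln4; lra. }
  destruct (mean_fringe_tail r n ltac:(lia)) as [T0 T1].
  replace (- (4 ^ r / (4 * INR n))) with (- y) in T1 by reflexivity.
  assert (K0 : 0 <= kern (L - INR r * ln 4)) by apply HK.
  pose proof (Rinv_0_lt_compat _ P4).
  unfold fringe_error; fold L; apply Rabs_le; split; nra.
Qed.

Lemma pow4_floor (y : R) : 1 <= y -> exists R, 4 ^ R <= y < 4 ^ S R.
Proof.
  intros Hy.
  assert (A : forall N, y < 4 ^ N -> exists R, 4 ^ R <= y < 4 ^ S R).
  { induction N; intros H; [simpl in H; lra|].
    destruct (Rle_or_lt (4 ^ N) y) as [H1|H1]; [exists N; split; assumption|apply IHN, H1]. }
  destruct (INR_unbounded y) as [N HN]; apply (A N).
  apply Rlt_trans with (INR N); [exact HN|].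
  clear; induction N; [simpl; lra|]; rewrite S_INR; simpl; pose proof (pos_INR N); pose proof (pow_R1_Rle 4 N ltac:(lra)); lra.
Qed.

Lemma rsum_pow4_le (n : nat) : rsum (S n) (pow 4) <= 4 / 3 * 4 ^ n.
Proof. induction n; [simpl; lra|]; cbn [rsum] in *; simpl pow in *; lra. Qed.

Lemma fringe_error_summable (n : nat) : (3 <= n)%nat -> ex_series (fringe_error n).
Proof.
  intros Hn; destruct kern_shift_bound as (C & HC & HK).
  apply (ex_series_plus (fun r => mean_fringe r n - kern (ln (INR n) - INR r * ln 4)) (fun r => 1 / 3 * / 4 ^ r));
    [|apply ex_series_scal_geom4].
  apply (ex_series_minus (fun r => mean_fringe r n) (fun r => kern (ln (INR n) - INR r * ln 4))).
  - apply mean_fringe_summable; lia.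
  - apply (ex_series_le (K := R_AbsRing) (V := R_CompleteNormedModule) _ (fun r => C * exp (3 / 2 * ln (INR n)) * / 4 ^ r));
      [intros r; apply HK|apply ex_series_scal_geom4].
Qed.

Lemma fringe_error_sum : exists K, 0 < K /\ forall n, (6 <= n)%nat ->
  Rabs (Series (fringe_error n)) <= K * (ln (INR n) / INR n).
Proof.
  destruct fringe_error_head as (c & Hc & H1), fringe_error_tail as (d & Hd & H2).
  (* 50 = 7 + 43: at most 7 ln n levels in the head, and the geometric sum of 4^r / n, at most 4/3 *
     32 ln n. The tail contributes d. *)
  exists (50 * c + d); split; [lra|]; intros n Hn.
  assert (N6 : 6 <= INR n) by (replace 6 with (INR 6) by (simpl; ring); apply le_INR, Hn).
  set (L := ln (INR n)).
  assert (EL : exp L = INR n) by (unfold L; apply exp_ln; lra).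
  assert (L1 : 1 <= L) by (apply exp_le_inv; rewrite EL; pose proof exp_le_3; lra).
  assert (LN : L <= INR n) by (rewrite <- EL; pose proof (exp_ge_1p L); lra).
  destruct (pow4_floor (32 * INR n * L)) as (R & R1 & R2); [nra|].
  (* From 4^R <= 32 n ln n <= 32 n^2 <= n^6 and ln 4 >= 1, while ln n >= 1 pays for the
     successor. *)
  assert (HR : INR (S R) <= 7 * L).
  { assert (A : INR R * ln 4 <= 6 * L).
    { apply exp_le_inv; rewrite exp_ln4; eapply Rle_trans; [exact R1|].
      replace (6 * L) with (INR 6 * L) by (simpl; ring); rewrite exp_INR, EL.
      apply Rle_trans with (32 * INR n * INR n); [nra|].
      assert (36 <= INR n ^ 2) by nra; assert (INR n ^ 2 <= INR n ^ 4) by nra.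
      replace (INR n ^ 6) with (INR n ^ 2 * INR n ^ 4) by ring; nra. }
    assert (1 <= ln 4) by (rewrite ln4_ln2; pose proof ln_lt_2; lra).
    rewrite S_INR; pose proof (pos_INR R); nra. }
  rewrite (Series_incr_n _ (S R)) by (lia || apply fringe_error_summable; lia).
  rewrite <- sum_n_Reals; simpl pred; rewrite <- rsum_sum_n.
  eapply Rle_trans; [apply Rabs_triang|].
  rewrite Rmult_plus_distr_r; apply Rplus_le_compat.
  - eapply Rle_trans; [apply rsum_abs_le; intros r; apply H1, Hn|].
    rewrite rsum_scal, rsum_plus, rsum_const.
    rewrite (rsum_ext (S R) (fun r => 4 ^ r / INR n) (fun r => / INR n * 4 ^ r)) by (intros; unfold Rdiv; ring).
    rewrite rsum_scal; pose proof (rsum_pow4_le R) as B.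
    assert (B2 : / INR n * rsum (S R) (pow 4) <= 43 * L).
    { apply (Rmult_le_reg_l (INR n)); [lra|]; rewrite <- Rmult_assoc, Rinv_r, Rmult_1_l by lra; nra. }
    replace (50 * c * (L / INR n)) with (c / INR n * (50 * L)) by (field; lra).
    apply Rmult_le_compat_l; [apply Rlt_le, Rdiv_lt_0_compat; lra|]; lra.
  - eapply Rle_trans; [apply (Series_abs_le _ (fun k => d * / 4 ^ S R * / 4 ^ k))|].
    + intros k; eapply Rle_trans; [apply H2; [lia|]|].
      * fold L; rewrite pow_add; pose proof (pow_R1_Rle 4 k ltac:(lra)); pose proof (pow4_pos (S R)); nra.
      * rewrite pow_add, Rinv_mult; right; ring.
    + apply ex_series_scal_geom4.
    + rewrite (is_series_unique _ _ (series_scal (d * / 4 ^ S R) _ _ ex_series_geom4)).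
      assert (I : / 4 ^ S R <= / (32 * INR n * L)) by (apply Rinv_le_contravar; [nra|lra]).
      apply Rle_trans with (d * / (32 * INR n * L) * (4 / 3)).
      * apply Rmult_le_compat_r; [lra|]; apply Rmult_le_compat_l; lra.
      * apply Rle_trans with (d * / INR n); [|apply Rmult_le_compat_l; [lra|]].
        -- rewrite Rmult_assoc; apply Rmult_le_compat_l; [lra|].
           apply (Rmult_le_reg_r (INR n * L)); [nra|]; field_simplify; nra.
        -- unfold Rdiv; rewrite <- (Rmult_1_l (/ INR n)) at 1; apply Rmult_le_compat_r; [|exact L1].
           left; apply Rinv_0_lt_compat; lra.
Qed.

(** The expectation involves [psi] only through [kern] at r = 0, whereas [fluct] contains all
    forward shifts of [psi]. The shifts with r >= 1 are the price of periodicity and form the last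
    difference. *)
Lemma expansion_main (n : nat) : (6 <= n)%nat ->
  expected_total_fringe_size n
    - (4 / 3 * INR n + 1 / 3 * (ln (INR n) / ln 4)
       + (5 + 3 * euler_gamma - 11 * ln 2) / (18 * ln 2) + delta (ln (INR n) / ln 4))
  = Series (fringe_error n) - (psi_sum (ln (INR n)) - psi (ln (INR n))).
Proof.
  intros Hn; pose proof ln4_pos as L4.
  assert (N6 : 6 <= INR n) by (replace 6 with (INR 6) by (simpl; ring); apply le_INR, Hn).
  set (x := ln (INR n)).
  assert (Ex : exp x = INR n) by (unfold x; apply exp_ln; lra).
  assert (Hk : is_series (fun r => kern (x - INR r * ln 4)) (kern x + kern_sum x)).
  { replace (kern x) with (kern (x - INR 0 * ln 4)) by (f_equal; simpl; ring).
    apply (is_series_decr_1 (fun r => kern (x - INR r * ln 4))).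
    match goal with |- is_series _ ?v => replace v with (kern_sum x) end; [apply kern_sum_correct|].
    unfold plus, opp; simpl; as_R; ring. }
  pose proof (Series_correct _ (mean_fringe_summable n ltac:(lia))) as Hm.
  rewrite <- expected_total_fringe_size_series in Hm by lia.
  assert (He : is_series (fringe_error n) (expected_total_fringe_size n - (kern x + kern_sum x) + 1 / 3 * (4 / 3))).
  { apply (series_plus (fun r => mean_fringe r n - kern (x - INR r * ln 4))); [|apply series_scal, ex_series_geom4].
    apply (is_series_minus _ _ _ _ Hm Hk). }
  rewrite (is_series_unique _ _ He).
  unfold delta; replace (ln 4 * (x / ln 4)) with x by (field; lra).
  unfold fluct, elem, fluct_const; rewrite kern_psi, Ex, ln4_ln2 in *; field; lra.
Qed.

Lemma psi_sum_far : exists C, 0 < C /\ forall t, Rabs (psi_sum t - psi t) <= C * exp (- t).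
Proof.
  destruct psi_shift_bound as (C & HC & H); exists (C * (4 / 3)); split; [lra|]; intros t.
  unfold psi_sum; rewrite Series_incr_1 by (eexists; apply psi_sum_correct).
  change (INR 0) with 0; rewrite Rmult_0_l, Rplus_0_r, Rplus_minus_l.
  eapply Rle_trans; [apply (Series_abs_le _ (fun r => C * exp (- t) * / 4 ^ r))|].
  - intros r; eapply Rle_trans; [apply H|]; apply Rmult_le_compat_l.
    + pose proof (exp_pos (- t)); nra.
    + apply Rinv_le_contravar; [apply pow4_pos|]; simpl; pose proof (pow4_pos r); lra.
  - apply ex_series_scal_geom4.
  - rewrite (is_series_unique _ _ (series_scal (C * exp (- t)) _ _ ex_series_geom4)); lra.
Qed.

Theorem theorem3p14 :
  exists delta : R -> R,
    (forall x : R, delta (x + 1) = delta x) /\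
    is_RInt delta 0 1 0 /\
    (forall k : Z, k <> 0%Z ->
       is_RInt (V := C_R_NormedModule)
         (fun x : R => (RtoC (delta x) * fourier_mode (- k) x)%C) 0 1
         (delta_coeff k)) /\
    (forall x : R,
       is_sum_nonzero (fun k : Z => (delta_coeff k * fourier_mode k x)%C)
         (RtoC (delta x))) /\
    (exists (K : R) (N : nat), forall n : nat, (N <= n)%nat ->
       Rabs (expected_total_fringe_size n
             - (4 / 3 * INR n
                + 1 / 3 * (ln (INR n) / ln 4)
                + (5 + 3 * euler_gamma - 11 * ln 2) / (18 * ln 2)
                + delta (ln (INR n) / ln 4)))
       <= K * (ln (INR n) / INR n)).
Proof.
  exists delta; split; [apply delta_period|]; split; [|split; [apply delta_fourier|split; [apply delta_sum|]]].
  - pose proof (@RInt_correct R_CompleteNormedModule delta 0 1 (cont_ex_RInt _ _ _ delta_cont)) as H.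
    rewrite delta_mean in H; exact H.
  - destruct fringe_error_sum as (K & HK & H1), psi_sum_far as (C & HC & H2).
    (* K bounds the errors of all levels together, C the completion by forward shifts; 6 is the
       threshold of the Gaussian approximation. *)
    exists (K + C), 6%nat; intros n Hn.
    assert (N6 : 6 <= INR n) by (replace 6 with (INR 6) by (simpl; ring); apply le_INR, Hn).
    assert (EL : exp (ln (INR n)) = INR n) by (apply exp_ln; lra).
    assert (L1 : 1 <= ln (INR n)) by (apply exp_le_inv; rewrite EL; pose proof exp_le_3; lra).
    rewrite expansion_main by exact Hn.
    eapply Rle_trans; [apply Rabs_triang|]; rewrite Rabs_Ropp, Rmult_plus_distr_r.
    apply Rplus_le_compat; [apply H1, Hn|].
    eapply Rle_trans; [apply H2|]; rewrite exp_Ropp, EL; apply Rmult_le_compat_l; [lra|].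
    unfold Rdiv; rewrite <- (Rmult_1_l (/ INR n)) at 1; apply Rmult_le_compat_r; [|exact L1].
    left; apply Rinv_0_lt_compat; lra.
Qed.
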